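(* Let $p:A\to M$ be a Riemannian Lie algebroid with Levi-Civita $A$-connection $\mathcal D$. Then: 1. For any variation of $A$-paths $\alpha:[0,1]\times[0,1]\to A$ and for any transverse variation $\beta$ to $\alpha$, one has $$\frac{d}{d\epsilon}\mathbf E(\alpha)=\langle\beta(\epsilon,1),\alpha(\epsilon,1)\rangle-\langle\beta(\epsilon,0),\alpha(\epsilon,0)\rangle-\int_0^1\langle\beta,\mathcal D_t\alpha\rangle dt-\int_0^1\langle\Delta(\alpha,\beta),\alpha\rangle dt,$$ where $\mathbf E(\alpha)$ is the energy of $\alpha(\epsilon,\cdot)$. 2. Let $m,q$ be points in the same leaf of the characteristic foliation. The $h$-critical points of $\mathbf E:\Omega_{mq}\to\mathbb R$, namely the $A$-paths $\alpha_0\in\Omega_{mq}$ such that $\frac{d}{d\epsilon}\mathbf E(\alpha)_{|\epsilon=0}=0$ for any $A$-homotopy $\alpha$ in $\Omega_{mq}$ starting at $\alpha_0$, are geodesics. 3. For any variation of $A$-paths $\alpha$ such that $\alpha_0=\alpha(0,\cdot)$ is parameterized by arc length, $$\frac{d}{d\epsilon}\mathbf E(\alpha)_{|\epsilon=0}=\frac{d}{d\epsilon}\mathcal L(\alpha)_{|\epsilon=0}.$$ 4. An $A$-path $\alpha_0\in\Omega_{mq}$ is $h$-critical for $\mathcal L$, namely $\frac{d}{d\epsilon}\mathcal L(\alpha)_{|\epsilon=0}=0$ for any $A$-homotopy $\alpha$ in $\Omega_{mq}$ starting at $\alpha_0$, if and only if there exists a change of parameter $\mu$ such that the $A$-path $\widetilde\alpha_0=\mu'\,\alpha_0(\mu)$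 is a geodesic.
   Context: Everything is smooth. A Lie algebroid over $M$ is a vector bundle $p:A\to M$ with a Lie bracket $[\,,]$ on $\Gamma(A)$ and a bundle map $\#:A\to TM$ (anchor) such that $\#:\Gamma(A)\to\mathfrak X(M)$ is a Lie algebra homomorphism and $[a,fb]=f[a,b]+\#(a)(f)b$. The image of $\#$ is an integrable generalized distribution, whose leaves form the characteristic foliation. A Riemannian Lie algebroid is a Lie algebroid with a smooth fiberwise scalar product $\langle\,,\rangle$ on $A$. Its Levi-Civita $A$-connection is the operator $\mathcal D:\Gamma(A)\times\Gamma(A)\to\Gamma(A)$ defined by $2\langle\mathcal D_ab,c\rangle=\#(a).\langle b,c\rangle+\#(b).\langle a,c\rangle-\#(c).\langle a,b\rangle+\langle[c,a],b\rangle+\langle[c,b],a\rangle+\langle[a,b],c\rangle$. An $A$-path is a smooth path $\alpha:[t_0,t_1]\to A$ with $\#(\alpha(t))=\frac{d}{dt}p(\alpha(t))$; $p\circ\alpha$ is its base path. An $\alpha$-section is a smooth $s:[t_0,t_1]\to A$ with $p\circ s=p\circ\alpha$; its derivative along $\alpha$ is, in a local frame $(a_i)$, $\mathcal D^\alpha s=\sum_j\frac{ds^j}{dt}a_j+\sum_{i,j}\alpha^is^j\mathcal D_{a_i}a_j$. A geodesic is an $A$-path $\alpha$ with $\mathcal D^\alpha\alpha=0$. A variation of $A$-paths is a smooth map $\alpha:[0,1]\times[0,1]\to A$, $(\epsilon,t)\mapsto\alpha(\epsilon,t)$, such that each $\alpha(\epsilon,\cdot)$ is an $A$-path and the base variation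 $\gamma=p\circ\alpha$ lies in a fixed leaf. A transverse variation to $\alpha$ is a smooth $\beta:[0,1]\times[0,1]\to A$ with $p\circ\beta=\gamma$ and $\#(\beta)=\frac{\partial\gamma}{\partial\epsilon}$. For a section $s$ of $A$ over $\gamma$ (a smooth $s:[0,1]\times[0,1]\to A$ with $p\circ s=\gamma$), $\mathcal D_ts$ is the derivative of $t\mapsto s(\epsilon,t)$ along the $A$-path $\alpha(\epsilon,\cdot)$, and $\mathcal D_\epsilon s$ is the derivative of $\epsilon\mapsto s(\epsilon,t)$ along the $A$-path $\beta(\cdot,t)$. Set $\Delta(\alpha,\beta)=\mathcal D_t\beta-\mathcal D_\epsilon\alpha$ ($\mathcal D$ is torsion free). For given $\alpha$ and given initial data $\beta(\cdot,0)$ compatible with the definition there is a unique transverse variation with $\Delta(\alpha,\beta)=0$. An $A$-homotopy (with fixed end-points) starting at $\alpha_0$ is a variation of $A$-paths $\alpha$ with $\alpha(0,\cdot)=\alpha_0$, $p(\alpha(\epsilon,0))$ and $p(\alpha(\epsilon,1))$ independent of $\epsilon$, and such that the unique transverse variation $\beta$ with $\Delta(\alpha,\beta)=0$ and $\beta(\epsilon,0)=0$ also satisfies $\beta(\epsilon,1)=0$ for all $\epsilon$. For an $A$-path $\alpha:[0,1]\to A$: $\mathbf E(\alpha)=\frac12\int_0^1\langle\alpha(t),\alpha(t)\rangle dt$ and $\mathcal L(\alpha)=\int_0^1\sqrt{\langle\alpha(t),\alpha(t)\rangle}\,dt$; for a variation, these are applied to $\alpha(\epsilon,\cdot)$. ''Parameterized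 by arc length'' means $\langle\alpha_0,\alpha_0\rangle=1$. $\Omega_{mq}$ is the set of $A$-paths $\alpha:[0,1]\to A$ with $p(\alpha(0))=m$ and $p(\alpha(1))=q$.
   Formalization: In item 4 the A-path α₀ is assumed to vanish nowhere; without this the equivalence fails, e.g. the zero path in Tℝᵏ is a geodesic but is not h-critical for the length. *)

(* Defs.v *)
From mathcomp Require Import all_boot all_order all_algebra.
From mathcomp Require Import all_classical all_reals all_analysis.
From Stdlib Require Import Relation_Operators.

Set Implicit Arguments.
Unset Strict Implicit.
Unset Printing Implicit Defensive.

Import Order.TTheory GRing.Theory Num.Theory.
Import numFieldNormedType.Exports.

Local Open Scope classical_set_scope.
Local Open Scope ring_scope.

(* For V finite-dimensional and U open, Ck k U f says that f is of class C^k
   on U: all iterated directional derivatives up to order k exist and are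
   continuous on U. *)
Fixpoint Ck (R : realType) (V W : normedModType R) (k : nat)
    (U : set V) (f : V -> W) : Prop :=
  match k with
  | 0%N => forall x, U x -> {for x, continuous f}
  | k'.+1 => (forall x, U x -> differentiable f x) /\
             (forall v : V, Ck k' U (fun x => 'D_v f x))
  end.

Definition Cinf (R : realType) (V W : normedModType R)
    (U : set V) (f : V -> W) : Prop := forall k, Ck k U f.

(* Smoothness on a set S that need not be open (an interval, a square): a
   smooth extension exists in a neighborhood of each point. The values of f
   outside S are irrelevant. *)
Definition smooth_within (R : realType) (V W : normedModType R)
    (S : set V) (z : V) (f : V -> W) : Prop :=
  exists2 U : set V, open U /\ U z &
  exists2 h : V -> W, Cinf U h & forall w, U w -> S w -> f w = h w.

(* f'(t) = l for f restricted to I: one-sided at the end-points of an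
   interval I. *)
Definition is_deriv_in (R : realType) (W : normedModType R)
    (I : set R) (f : R -> W) (t : R) (l : W) : Prop :=
  (fun u => (u - t)^-1 *: (f u - f t)) @ within I t^' --> l.

Definition square (R : realType) : set (R * R) :=
  [set z | `[0, 1]%classic z.1 /\ `[0, 1]%classic z.2].

Section Manifold.
Variables (R : realType) (n : nat).

Record chart (M : topologicalType) := Chart {
  cdom : set M;
  cmap : M -> 'rV[R]_n;
  cinv : 'rV[R]_n -> M;
  cdom_open : open cdom;
  cimg_open : open (cmap @` cdom);
  cmapK : forall x, cdom x -> cinv (cmap x) = x;
  cmap_cont : forall x, cdom x -> {for x, continuous cmap};
  cinv_cont : forall y, (cmap @` cdom) y -> {for y, continuous cinv} }.

Record manifold := Manifold {
  mcarrier :> topologicalType;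
  atlas : set (chart mcarrier);
  mhausdorff : hausdorff_space mcarrier;
  msecond_countable : @second_countable mcarrier;
  atlas_cover : forall x, exists2 c, atlas c & cdom c x;
  atlas_compat : forall c c', atlas c -> atlas c' ->
    Cinf (cmap c @` (cdom c `&` cdom c')) (cmap c' \o cinv c) }.

Definition msmooth_on (M : manifold) (W : normedModType R)
    (U : set M) (f : M -> W) : Prop :=
  forall c, atlas c -> Cinf (cmap c @` (cdom c `&` U)) (f \o cinv c).

Definition msmooth (M : manifold) (f : M -> R) : Prop := msmooth_on setT f.

Definition smooth_map (M : manifold) (V : normedModType R)
    (S : set V) (gamma : V -> M) : Prop :=
  forall z, S z -> forall c, atlas c -> cdom c (gamma z) ->
    (\forall w \near within S (nbhs z), cdom c (gamma w)) /\
    smooth_within S z (cmap c \o gamma).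

(* Tangent vectors at x are the derivations at x of the algebra of smooth
   functions on M. The value of v on non-smooth functions is irrelevant. *)
Definition tangent_vector (M : manifold) (x : M) (v : (M -> R) -> R) : Prop :=
  (forall (k : R) f g, msmooth f -> msmooth g ->
     v (fun y => k * f y + g y) = k * v f + v g) /\
  (forall f g, msmooth f -> msmooth g ->
     v (fun y => f y * g y) = v f * g x + f x * v g).

(* d/dt gamma(t) = v in the tangent space of M at gamma t *)
Definition is_velocity (M : manifold) (I : set R) (gamma : R -> M) (t : R)
    (v : (M -> R) -> R) : Prop :=
  forall f, msmooth f -> is_deriv_in I (f \o gamma) t (v f : R).

End Manifold.

Section LieAlgebroid.
Variables (R : realType) (n : nat) (M : manifold R n) (r : nat).

Record trivialization (E : M -> lmodType R) := Trivialization {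
  tdom : set M;
  tcoord : forall x, E x -> 'rV[R]_r;
  tinv : forall x, 'rV[R]_r -> E x;
  tdom_open : open tdom;
  tcoord_linear : forall x, tdom x -> linear (@tcoord x);
  tcoordK : forall x, tdom x -> cancel (@tcoord x) (@tinv x);
  tinvK : forall x, tdom x -> cancel (@tinv x) (@tcoord x) }.

(* A rank r vector bundle, as the family of its fibers; the total space is
   the disjoint union {x : M & E x}, smooth through the trivializations. *)
Record vector_bundle := VectorBundle {
  fiber :> M -> lmodType R;
  trivs : set (trivialization fiber);
  trivs_cover : forall x, exists2 T, trivs T & tdom T x;
  trivs_compat : forall T T', trivs T -> trivs T' -> forall v : 'rV[R]_r,
    msmooth_on (tdom T `&` tdom T') (fun x => tcoord T' (tinv T x v)) }.

Definition section (A : vector_bundle) := forall x : M, A x.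

Definition smooth_section (A : vector_bundle) (a : section A) : Prop :=
  forall T, trivs T -> msmooth_on (tdom T) (fun x => tcoord T (a x)).

(* s is a smooth map from S to the total space, with base map gamma *)
Definition smooth_along (A : vector_bundle) (V : normedModType R) (S : set V)
    (gamma : V -> M) (s : forall z, A (gamma z)) : Prop :=
  smooth_map S gamma /\
  forall z, S z -> forall T, trivs T -> tdom T (gamma z) ->
    smooth_within S z (fun w => tcoord T (s w)).

(* The bracket is a total operation on set-theoretic sections; only its
   values on smooth sections are meaningful. *)
Record lie_algebroid := LieAlgebroid {
  bundle :> vector_bundle;
  anchor : forall x, bundle x -> (M -> R) -> R;
  bracket : section bundle -> section bundle -> section bundle;
  anchor_tangent : forall x (u : bundle x), tangent_vector x (anchor u);
  anchor_linear : forall x (k : R) (u v : bundle x) f, msmooth f ->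
    anchor (k *: u + v) f = k * anchor u f + anchor v f;
  anchor_smooth : forall (a : section bundle) f,
    smooth_section a -> msmooth f -> msmooth (fun x => anchor (a x) f);
  bracket_smooth : forall a b : section bundle,
    smooth_section a -> smooth_section b -> smooth_section (bracket a b);
  bracket_linear : forall (k : R) (a b c : section bundle),
    smooth_section a -> smooth_section b -> smooth_section c -> forall x,
    bracket (fun y => k *: a y + b y) c x =
    k *: bracket a c x + bracket b c x;
  bracket_antisym : forall a b : section bundle,
    smooth_section a -> smooth_section b -> forall x,
    bracket a b x = - bracket b a x;
  bracket_jacobi : forall a b c : section bundle,
    smooth_section a -> smooth_section b -> smooth_section c -> forall x,
    bracket a (bracket b c) x + bracket b (bracket c a) x +
    bracket c (bracket a b) x = 0;
  anchor_bracket : forall (a b : section bundle) f,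
    smooth_section a -> smooth_section b -> msmooth f -> forall x,
    anchor (bracket a b x) f =
    anchor (a x) (fun y => anchor (b y) f) -
    anchor (b x) (fun y => anchor (a y) f);
  bracket_leibniz : forall (a b : section bundle) f,
    smooth_section a -> smooth_section b -> msmooth f -> forall x,
    bracket a (fun y => f y *: b y) x =
    f x *: bracket a b x + anchor (a x) f *: b x }.

Record riemannian_metric (A : vector_bundle) := RiemannianMetric {
  inner :> forall x, A x -> A x -> R;
  inner_linear : forall x (k : R) (u v w : A x),
    inner (k *: u + v) w = k * inner u w + inner v w;
  inner_sym : forall x (u v : A x), inner u v = inner v u;
  inner_pos : forall x (u : A x), u != 0 -> 0 < inner u u;
  inner_smooth : forall a b : section A,
    smooth_section a -> smooth_section b ->
    msmooth (fun x => inner (a x) (b x)) }.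

Definition connection_op (A : vector_bundle) :=
  section A -> section A -> section A.

Definition levi_civita (A : lie_algebroid) (g : riemannian_metric A)
    (D : connection_op A) : Prop :=
  forall a b, smooth_section a -> smooth_section b ->
    smooth_section (D a b) /\
    forall c, smooth_section c -> forall x,
      2 * g x (D a b x) (c x) =
        anchor (a x) (fun y => g y (b y) (c y)) +
        anchor (b x) (fun y => g y (a y) (c y)) -
        anchor (c x) (fun y => g y (a y) (b y)) +
        g x (bracket c a x) (b x) + g x (bracket c b x) (a x) +
        g x (bracket a b x) (c x).

Definition lincomb (A : vector_bundle) (x : M) (c : 'rV[R]_r)
    (e : 'I_r -> section A) : A x := \sum_i c 0 i *: e i x.

(* The value at t of the derivative of s along alpha, computed in a local
   frame e near gamma t. Since D acts on global sections, the frame is given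
   by global sections that form a frame near gamma t only: multiplying by a
   bump function, any local frame agrees with such a family near gamma t. *)
Definition is_covder (A : vector_bundle) (D : connection_op A) (I : set R)
    (gamma : R -> M) (alpha s : forall t, A (gamma t)) (t : R)
    (v : A (gamma t)) : Prop :=
  exists (e : 'I_r -> section A) (ca cs : R -> 'rV[R]_r) (ds : 'rV[R]_r),
  [/\ forall i, smooth_section (e i),
      \forall x \near gamma t, bijective (fun c => lincomb x c e),
      \forall u \near within I (nbhs t),
        alpha u = lincomb (gamma u) (ca u) e /\
        s u = lincomb (gamma u) (cs u) e,
      is_deriv_in I cs t ds &
      v = \sum_j ds 0 j *: e j (gamma t) +
          \sum_i \sum_j (ca t 0 i * cs t 0 j) *: D (e i) (e j) (gamma t)].

Definition covder (A : vector_bundle) (D : connection_op A) (I : set R)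
    (gamma : R -> M) (alpha s : forall t, A (gamma t)) (t : R) : A (gamma t) :=
  xget 0 [set v | is_covder D I alpha s v].

Definition A_path (A : lie_algebroid) (t0 t1 : R) (gamma : R -> M)
    (alpha : forall t, A (gamma t)) : Prop :=
  smooth_along `[t0, t1]%classic alpha /\
  forall t, t \in `[t0, t1] ->
    is_velocity `[t0, t1]%classic gamma t (anchor (alpha t)).

Definition geodesic (A : lie_algebroid) (D : connection_op A) (t0 t1 : R)
    (gamma : R -> M) (alpha : forall t, A (gamma t)) : Prop :=
  A_path t0 t1 alpha /\
  forall t, t \in `[t0, t1] -> covder D `[t0, t1]%classic alpha alpha t = 0.

Definition Omega (A : lie_algebroid) (m q : M) (gamma : R -> M)
    (alpha : forall t, A (gamma t)) : Prop :=
  [/\ A_path 0 1 alpha, gamma 0 = m & gamma 1 = q].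

(* The leaf of x in the characteristic foliation is its accessibility class:
   the points that are joined to x by finitely many base paths of A-paths,
   traversed in either direction. *)
Definition same_leaf (A : lie_algebroid) (x y : M) : Prop :=
  clos_refl_sym_trans M
    (fun m q => exists (gamma : R -> M) (alpha : forall t, A (gamma t)),
       Omega m q alpha) x y.

(* In the family alpha eps t the first argument is the parameter of the
   variation. *)
Definition A_variation (A : lie_algebroid) (gamma : R -> R -> M)
    (alpha : forall eps t, A (gamma eps t)) : Prop :=
  [/\ @smooth_along A (R * R)%type (@square R)
        (fun z => gamma z.1 z.2) (fun z => alpha z.1 z.2),
      forall eps, eps \in `[0, 1] -> A_path 0 1 (alpha eps) &
      exists x, forall eps t, eps \in `[0, 1] -> t \in `[0, 1] ->
        same_leaf A x (gamma eps t)].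

Definition transverse (A : lie_algebroid) (gamma : R -> R -> M)
    (beta : forall eps t, A (gamma eps t)) : Prop :=
  @smooth_along A (R * R)%type (@square R)
    (fun z => gamma z.1 z.2) (fun z => beta z.1 z.2) /\
  forall eps t, eps \in `[0, 1] -> t \in `[0, 1] ->
    is_velocity `[0, 1]%classic (fun e => gamma e t) eps
      (anchor (beta eps t)).

Section Variations.
Variables (A : lie_algebroid) (D : connection_op A) (gamma : R -> R -> M).
Implicit Types alpha beta s : forall eps t, A (gamma eps t).

Definition covder_t alpha s eps t : A (gamma eps t) :=
  covder D `[0, 1]%classic (alpha eps) (s eps) t.

Definition covder_eps beta s eps t : A (gamma eps t) :=
  covder D `[0, 1]%classic (gamma := fun e => gamma e t)
    (fun e => beta e t) (fun e => s e t) eps.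

Definition Delta alpha beta eps t : A (gamma eps t) :=
  covder_t alpha beta eps t - covder_eps beta alpha eps t.

(* The equality alpha(0,.) = alpha0 is an equality in the total space. *)
Definition A_homotopy (gamma0 : R -> M) (alpha0 : forall t, A (gamma0 t))
    alpha : Prop :=
  [/\ A_variation alpha,
      forall t, t \in `[0, 1] ->
        existT (fun x => A x : Type) (gamma 0 t) (alpha 0 t) =
        existT (fun x => A x : Type) (gamma0 t) (alpha0 t),
      forall eps, eps \in `[0, 1] ->
        gamma eps 0 = gamma 0 0 /\ gamma eps 1 = gamma 0 1 &
      exists beta,
        [/\ transverse beta,
            forall eps t, eps \in `[0, 1] -> t \in `[0, 1] ->
              Delta alpha beta eps t = 0,
            forall eps, eps \in `[0, 1] -> beta eps 0 = 0 &
            forall eps, eps \in `[0, 1] -> beta eps 1 = 0]].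

End Variations.

Section Functionals.
Variables (A : lie_algebroid) (g : riemannian_metric A).

Definition A_energy (gamma : R -> M) (alpha : forall t, A (gamma t)) : R :=
  2^-1 * \int[lebesgue_measure]_(t in `[0%R, 1%R])
           g (gamma t) (alpha t) (alpha t).

Definition A_length (gamma : R -> M) (alpha : forall t, A (gamma t)) : R :=
  \int[lebesgue_measure]_(t in `[0%R, 1%R])
    Num.sqrt (g (gamma t) (alpha t) (alpha t)).

Definition h_critical (D : connection_op A)
    (F : forall gamma : R -> M, (forall t, A (gamma t)) -> R)
    (gamma0 : R -> M) (alpha0 : forall t, A (gamma0 t)) : Prop :=
  forall (gamma : R -> R -> M) (alpha : forall eps t, A (gamma eps t)),
    A_homotopy D alpha0 alpha ->
    is_deriv_in `[0, 1]%classic (fun eps => F (gamma eps) (alpha eps)) 0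
      (0 : R).

End Functionals.

End LieAlgebroid.

(* mu is a diffeomorphism from [t0, t1] onto [0, 1], with derivative dmu *)
Definition change_of_parameter (R : realType) (t0 t1 : R) (mu dmu : R -> R)
    : Prop :=
  [/\ t0 < t1,
      set_bij `[t0, t1]%classic `[0, 1]%classic mu &
      forall t, t \in `[t0, t1] ->
        [/\ smooth_within `[t0, t1]%classic t mu,
            is_deriv_in `[t0, t1]%classic mu t (dmu t) & dmu t != 0]].

(* Main.v *)
(* The first variation formula follows by differentiating <alpha, alpha> / 2
   under the integral sign and integrating by parts in t, since D is metric.
   Metric compatibility also characterizes the derivative of s along an A-path
   by the derivatives of the functions <s, c>, for c a global section, which
   makes it independent of the local frame.

   A critical path must be tested against enough A-homotopies. If e_m belongs
   to a local frame and chi >= 0 is a bump function of t, then the equation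
   Delta(alpha, chi e_m) = 0 is an ordinary differential equation in the
   variable s = eps chi(t) for the coordinates of alpha. Its solution that
   starts at alpha_0 consists of A-paths, because the defect of the A-path
   condition solves a linear equation, and along this homotopy the energy has
   derivative - int chi <e_m, D_t alpha_0>, whence D_t alpha_0 = 0.

   For the length, alpha_0 is replaced by w = alpha_0 / |alpha_0| in the last
   integral, and D_t w = 0 holds exactly when the arc length
   reparametrization of alpha_0 is a geodesic. *)
From HB Require Import structures.
Require Import Defs.
From mathcomp Require Import all_boot all_order all_algebra.
From mathcomp Require Import all_classical all_reals all_analysis.
From mathcomp Require Import ring lra.
Import Order.TTheory GRing.Theory Num.Theory.
Import numFieldNormedType.Exports.
Set Implicit Arguments.
Unset Strict Implicit.
Unset Printing Implicit Defensive.
Local Open Scope classical_set_scope.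
Local Open Scope ring_scope.

(** * Smooth functions on normed spaces *)

Section Differentiability.
Variables (R : realType) (V W : normedModType R).
Implicit Types (f g : V -> W) (x v : V) (U : set V).

(** Two obstacles shape the proof. Brackets, connections and tangent vectors accept only global
    sections and functions, so every local computation is globalized with a bump function, and
    locality and tensoriality have to be recovered before charts and frames can be used. And a
    variation must be smooth up to the boundary of a closed square, so solving the flow equation
    separately for each [t] is not enough: joint smoothness in the flow time and in [t] is required.
    The time change s = eps chi(t) keeps both under control. The flow is needed only for small s and
    for t near one interior point, inside a single chart and frame; where chi vanishes the homotopy
    is alpha_0 itself, which fixes both end-points and makes the transverse variation vanish there.
    Such tests suffice because their supports can be made arbitrarily short. Paths over different
    base maps live in different dependent types. They are compared in the total space, and
    derivatives along them are transported through their pairing with global sections, which only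
    involves numbers. *)

Lemma diff_near_eq f g x : {near x, f =1 g} -> differentiable f x ->
  differentiable g x.
Proof.
move=> fg df; apply/diff_locallyP.
have [cdf E] := (diff_locallyP x f).1 df.
have E' : g \o shift x = cst (g x) + 'd f x +o_ 0 id.
  apply/eqaddoP => e e0.
  move/eqaddoP : E => /(_ e e0) E.
  have fg' : \forall h \near (0:V), f (h + x) = g (h + x).
    have := fg; rewrite (near_shift 0) /= => H; near=> h.
    have : f (h + (x - 0)) = g (h + (x - 0)) by near: h.
    by rewrite subr0.
  near=> h.
  have E0 : `|(f \o shift x - (cst (f x) + 'd f x)) h| <= e * `|h| by near: h.
  apply: le_trans E0; rewrite le_eqVlt; apply/orP; left; apply/eqP.
  rewrite /= !fctE /= -(nbhs_singleton fg).
  by have -> : f (h + x) = g (h + x) by near: h.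
by rewrite (diff_unique cdf E').
Unshelve. all: by end_near. Qed.

Lemma near_of_open U x f g : open U -> U x -> {in U, f =1 g} -> {near x, f =1 g}.
Proof. by move=> oU Ux fg; near do (apply: fg; rewrite inE); exact: open_nbhs_nbhs.
Unshelve. all: by end_near. Qed.

End Differentiability.

(* A basis with continuous coordinates: [R], ['rV_n] and [R * R] are handled
   uniformly through it. *)
Class fdim (R : realType) (W : normedModType R) := FDim {
  fb_dim : nat;
  fb_vec : 'I_fb_dim -> W;
  fb_co : 'I_fb_dim -> {linear W -> R};
  fb_cont : forall i, continuous (fb_co i);
  fb_sum : forall w, w = \sum_i fb_co i w *: fb_vec i }.

Section CkBasics.
Variables (R : realType) (V W : normedModType R).
Implicit Types (f g : V -> W) (x v : V) (U : set V).

Lemma CkS k U f : Ck k.+1 U f =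
  ((forall x, U x -> differentiable f x) /\ (forall v, Ck k U ('D_v f))).
Proof. by []. Qed.

Lemma Ck_sub k U U' f : U' `<=` U -> Ck k U f -> Ck k U' f.
Proof.
elim: k f => [|k IH] f sU /=; first by move=> H x /sU; exact: H.
by move=> [df H]; split=> [x /sU/df//|v]; apply: IH.
Qed.

Lemma Ck_eq k U f g : open U -> (forall x, U x -> f x = g x) ->
  Ck k U f -> Ck k U g.
Proof.
move=> oU; elim: k f g => [|k IH] f g fg /=.
  move=> H x Ux.
  have fg' : {near x, f =1 g} by apply: (near_of_open oU) => // y; rewrite inE => /fg.
  rewrite /prop_for /continuous_at -(fg x Ux).
  by apply: cvg_trans (H x Ux); apply: near_eq_cvg; 
  by apply: filterS fg' => y ->.
move=> [df H]; split=> [x Ux|v].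
  by apply: diff_near_eq (df x Ux); apply: (near_of_open oU) => // y; rewrite inE => /fg.
apply: IH (H v) => x Ux; apply: near_eq_derive.
by apply: (near_of_open oU) => // y; rewrite inE => /fg.
Unshelve. all: by end_near. Qed.

Lemma CkW k U f : Ck k.+1 U f -> Ck k U f.
Proof.
elim: k f => [|k IH] f; first by move=> [df _] x /df /differentiable_continuous.
by move=> [df H]; split=> // v; apply: IH.
Qed.

Lemma Ck_cont k U f x : Ck k U f -> U x -> {for x, continuous f}.
Proof. by elim: k => [|k IH]; [exact|move=> /CkW]. Qed.

Lemma Ck_diff k U f x : Ck k.+1 U f -> U x -> differentiable f x.
Proof. by move=> [+ _]; exact. Qed.

Lemma Ck_derive k U f v : Ck k.+1 U f -> Ck k U ('D_v f).
Proof. by rewrite CkS => -[_]; apply. Qed.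

Lemma Cinf_derive U f v : Cinf U f -> Cinf U ('D_v f).
Proof. by move=> H k; apply/Ck_derive/H. Qed.

(** Induction step for regularity: [Ck k] ignores what happens off the open set [U], so the
    directional derivatives may be replaced by any formula valid on [U], to which the induction
    hypothesis applies. *)
Lemma Ck_intro k U f (G : V -> V -> W) : open U ->
  (forall x, U x -> differentiable f x) ->
  (forall x v, U x -> 'D_v f x = G v x) ->
  (forall v, Ck k U (G v)) -> Ck k.+1 U f.
Proof. by move=> oU df E H; split=> // v; apply: Ck_eq (H v) => // x /(E _ v)->. Qed.

Lemma Ck_cst k U (w : W) : open U -> Ck k U (cst w).
Proof.
move=> oU; elim: k w => [|k IH] w; first by move=> x _; exact: cvg_cst.
by apply: (@Ck_intro _ _ _ (fun _ => cst 0)) => // x v _; rewrite derive_cst.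
Qed.

Lemma Ck_add k U f g : open U -> Ck k U f -> Ck k U g -> Ck k U (fun x => f x + g x).
Proof.
move=> oU; elim: k f g => [|k IH] f g /=.
  by move=> cf cg x Ux; apply: cvgD; [exact: cf|exact: cg].
move=> [df Hf] [dg Hg].
apply: (@Ck_intro _ _ _ (fun v x => 'D_v f x + 'D_v g x)) => // [x Ux|x v Ux|v].
- by apply: differentiableD; [exact: df|exact: dg].
- rewrite (_ : (fun x => _) = f + g) ?deriveD //; apply: diff_derivable; auto.
- by apply: IH.
Qed.

Lemma Ck_sum k U (I : Type) (s : seq I) (P : pred I) (F : I -> V -> W) : open U ->
  (forall i, P i -> Ck k U (F i)) -> Ck k U (fun x => \sum_(i <- s | P i) F i x).
Proof.
move=> oU H; elim: s => [|i s IH].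
  by apply: Ck_eq (Ck_cst k 0 oU) => // x _; rewrite big_nil.
case: (boolP (P i)) => Pi; last by apply: Ck_eq IH => // x _; rewrite big_cons (negPf Pi).
by apply: Ck_eq (Ck_add oU (H i Pi) IH) => // x _; rewrite big_cons Pi.
Qed.

End CkBasics.

Section CkLinear.
Variables (R : realType) (V W X : normedModType R).
Variable (L : {linear W -> X}).
Hypothesis cL : continuous L.

Lemma derive_lin_comp (f : V -> W) x v : differentiable f x ->
  'D_v (L \o f) x = L ('D_v f x).
Proof.
move=> df; have dL := linear_differentiable (f x) cL.
rewrite deriveE; last exact: differentiable_comp.
by rewrite diff_comp //= diff_lin // deriveE.
Qed.

Lemma Ck_lin_comp k U (f : V -> W) : open U -> Ck k U f -> Ck k U (L \o f).
Proof.
move=> oU; elim: k f => [|k IH] f.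
  by move=> H x Ux; apply: continuous_comp; [exact: H|exact: cL].
rewrite CkS => -[df H]; apply: (@Ck_intro _ _ _ _ _ _ (fun v => L \o 'D_v f)) => //.
- move=> x Ux; apply: differentiable_comp; first exact: df.
  exact: (linear_differentiable _ cL).
- by move=> x v Ux; rewrite derive_lin_comp //; exact: df.
by move=> v; exact: IH.
Qed.

End CkLinear.

Section CkScale.
Variables (R : realType) (V W : normedModType R).

Lemma Ck_Zl k U (a : V -> R) (w : W) : open U -> Ck k U a -> Ck k U (fun x => a x *: w).
Proof.
move=> oU; elim: k a => [|k IH] a.
  by move=> H x Ux; apply: cvgZr_tmp; exact: H.
rewrite CkS => -[df H]; apply: (@Ck_intro _ _ _ _ _ _ (fun v x => 'D_v a x *: w)) => //.
- by move=> x Ux; apply: differentiableZl; exact: df.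
- move=> x v Ux; have dfx := df x Ux; rewrite deriveE; last exact: differentiableZl.
  by rewrite diffZl // deriveE.
by move=> v; exact: IH.
Qed.

Lemma Ck_mul k U (a b : V -> R) : open U -> Ck k U a -> Ck k U b ->
  Ck k U (fun x => a x * b x).
Proof.
move=> oU; elim: k a b => [|k IH] a b.
  by move=> Ha Hb x Ux; apply: cvgM; [exact: Ha|exact: Hb].
move=> Ha Hb.
apply: (@Ck_intro _ _ _ _ _ _ (fun v x => a x * 'D_v b x + b x * 'D_v a x)) => //.
- by move=> x Ux; apply: differentiableM; [exact: (Ck_diff Ha)|exact: (Ck_diff Hb)].
- move=> x v Ux; rewrite (_ : (fun x => _) = a * b) // deriveM //.
  + by apply: diff_derivable; exact: (Ck_diff Ha).
  + by apply: diff_derivable; exact: (Ck_diff Hb).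
by move=> v; apply: Ck_add => //; apply: IH (Ck_derive _ _) => //; exact: CkW.
Qed.

Context {fW : fdim W}.

(** Product and chain rules are first proved for scalar functions; coordinates in the basis of
    [fdim] carry them over to vector values. *)
Lemma Ck_coord k U (f : V -> W) : open U ->
  (forall i, Ck k U (fb_co i \o f)) <-> Ck k U f.
Proof.
move=> oU; split=> H; last by move=> i; apply: Ck_lin_comp => //; exact: fb_cont.
apply: (@Ck_eq _ _ _ _ _ (fun x => \sum_i fb_co i (f x) *: fb_vec i)) => //.
  by move=> x _; rewrite -fb_sum.
by apply: Ck_sum => // i _; apply: Ck_Zl; rewrite //; exact: H.
Qed.

Lemma Ck_scale k U (a : V -> R) (f : V -> W) : open U -> Ck k U a -> Ck k U f ->
  Ck k U (fun x => a x *: f x).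
Proof.
move=> oU Ha /(Ck_coord _ _ oU) Hf; apply/(Ck_coord _ _ oU) => i.
apply: Ck_eq (Ck_mul oU Ha (Hf i)) => // x _ /=.
by rewrite linearZ.
Qed.

End CkScale.

Section CkComp.
Variables (R : realType) (V W : normedModType R).
Context {fW : fdim W}.

Lemma derive_comp (X : normedModType R) (g : V -> W) (f : W -> X) x v :
  differentiable g x -> differentiable f (g x) ->
  'D_v (f \o g) x = 'D_('D_v g x) f (g x).
Proof.
move=> dg df; rewrite deriveE; last exact: differentiable_comp.
by rewrite diff_comp //= -!deriveE.
Qed.

Lemma derive_fbE (X : normedModType R) (f : W -> X) y w : differentiable f y ->
  'D_w f y = \sum_i fb_co i w *: 'D_(fb_vec i) f y.
Proof.
move=> df; rewrite deriveE // {1}[w]fb_sum linear_sum.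
by apply: eq_bigr => i _; rewrite linearZ deriveE.
Qed.

(** The direction ['D_v g x] varies with [x]. Expanding it in the basis of [W] leaves only
    derivatives of [f] in fixed directions, to which the induction hypothesis applies. *)
Lemma Ck_comp_R k U U' (g : V -> W) (f : W -> R) : open U -> 
  (forall x, U x -> U' (g x)) -> Ck k U g -> Ck k U' f -> Ck k U (f \o g).
Proof.
move=> oU sU; elim: k f => [|k IH] f Hg Hf.
  by move=> x Ux; apply: continuous_comp; [exact: Hg|exact/Hf/sU].
apply: (@Ck_intro _ _ _ _ _ _ (fun v x =>
  \sum_i fb_co i ('D_v g x) * 'D_(fb_vec i) f (g x))) => //.
- by move=> x Ux; apply: differentiable_comp; [exact: (Ck_diff Hg)|apply: (Ck_diff Hf); exact: sU].
- move=> x v Ux; have dg := Ck_diff Hg Ux; have df := Ck_diff Hf (sU _ Ux).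
  by rewrite derive_comp // derive_fbE.
move=> v; apply: Ck_sum => // i _; apply: Ck_mul => //.
  by apply: Ck_lin_comp => //; [exact: fb_cont|exact: Ck_derive].
apply: (IH ('D_(fb_vec i) f)); [exact: CkW|exact: Ck_derive].
Qed.

Lemma Ck_comp (X : normedModType R) {fX : fdim X} k U U' (g : V -> W) (f : W -> X) :
  open U -> open U' ->
  (forall x, U x -> U' (g x)) -> Ck k U g -> Ck k U' f -> Ck k U (f \o g).
Proof.
move=> oU oU' sU Hg /(Ck_coord _ _ oU') Hf; apply/(Ck_coord _ _ oU) => i.
by apply: Ck_comp_R Hg (Hf i).
Qed.

End CkComp.

Section FdimInstances.
Variable R : realType.

Lemma fb_cont_R : forall i : 'I_1, continuous ((fun=> idfun : {linear R -> R}) i).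
Proof. by move=> ? x; exact: cvg_id. Qed.
Lemma fb_sum_R (w : R) : w = \sum_(i < 1) (idfun : {linear R -> R}) w *: 1.
Proof. by rewrite big_ord1 /= [RHS]mulr1. Qed.
Definition fdim_R : fdim R := FDim fb_cont_R fb_sum_R.

Lemma coord_linear n (i : 'I_n) : linear (fun v : 'rV[R]_n => v 0 i : R).
Proof. by move=> k u v; rewrite !mxE. Qed.
Definition coord_rV n (i : 'I_n) : {linear 'rV[R]_n -> R} :=
  HB.pack (fun v : 'rV[R]_n => v 0 i : R)
    (GRing.isLinear.Build R 'rV[R]_n R _ _ (@coord_linear n i)).

Lemma fb_cont_rV n (i : 'I_n) : continuous (coord_rV i).
Proof. exact: coord_continuous. Qed.
Lemma fb_sum_rV n (w : 'rV[R]_n) : w = \sum_(i < n) coord_rV i w *: delta_mx 0 i.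
Proof. by rewrite /= -row_sum_delta. Qed.
Definition fdim_rV n : fdim 'rV[R]_n := FDim (@fb_cont_rV n) (@fb_sum_rV n).

Definition RR_co (i : 'I_2) : {linear (R * R)%type -> R} :=
  if i == 0 then (fst : {linear (R * R)%type -> R}) else (snd : {linear (R * R)%type -> R}).
Definition RR_vec (i : 'I_2) : R * R := if i == 0 then (1, 0) else (0, 1).
Lemma fb_cont_RR (i : 'I_2) : continuous (RR_co i).
Proof.
by rewrite /RR_co; case: ifP => ? x; [exact: cvg_fst|exact: cvg_snd].
Qed.
Lemma fb_sum_RR (w : R * R) : w = \sum_(i < 2) RR_co i w *: RR_vec i.
Proof.
case: w => a b; rewrite big_ord_recl big_ord1 /=; congr (_, _) => /=.
all: by rewrite /GRing.scale /= !(mulr1, mulr0, add0r, addr0).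
Qed.
Definition fdim_RR : fdim (R * R)%type := FDim fb_cont_RR fb_sum_RR.

End FdimInstances.
Global Existing Instance fdim_R.
Global Existing Instance fdim_rV.
Global Existing Instance fdim_RR.

Lemma sum_continuous (R : realType) (V : topologicalType) (W : normedModType R)
    (I : Type) (s : seq I) (F : I -> V -> W) :
  (forall i, continuous (F i)) -> continuous (fun x => \sum_(i <- s) F i x).
Proof.
move=> cF x; elim: s => [|i s IH].
  by rewrite (_ : (fun _ => _) = cst 0); [exact: cvg_cst|apply: funext => y; rewrite big_nil].
rewrite (_ : (fun _ => _) = (fun y => F i y + \sum_(i <- s) F i y)); last first.
  by apply: funext => y; rewrite big_cons.
by apply: cvgD IH; exact: cF.
Qed.

(** * Directional derivatives, mean values and partial derivatives *)

Section Directional.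
Variables (R : realType) (V W : normedModType R).

Lemma is_derive_line (f : V -> W) (z v : V) (t : R) l :
  is_derive (t *: v + z) v f l <-> is_derive t 1 (fun u : R => f (u *: v + z)) l.
Proof.
have E : (fun h : R => h^-1 *: (f (h *: v + (t *: v + z)) - f (t *: v + z))) =
  (fun h : R => h^-1 *: (f ((h *: 1 + t) *: v + z) - f (t *: v + z))).
  by apply: funext => h; rewrite scalerDl addrA [h *: 1]mulr1.
split=> -[d e]; split.
- by move: d; rewrite /derivable E.
- by rewrite -e /derive E.
- by move: d; rewrite /derivable -E.
- by rewrite -e /derive -E.
Qed.

End Directional.

Section DirectionalR.
Variables (R : realType) (V : normedModType R).

(** The sign of [a] is free, because [a] will be a coordinate of an arbitrary increment; in
    exchange, the mean value parameter is only located by its absolute value. *)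
Lemma MVT_dir (f G : V -> R) (z v : V) (a : R) :
  (forall t : R, `|t| <= `|a| -> is_derive (t *: v + z) v f (G (t *: v + z))) ->
  exists2 t : R, `|t| <= `|a| & f (a *: v + z) - f z = a * G (t *: v + z).
Proof.
move=> H.
pose p := fun u : R => f (u *: v + z).
have dp (t : R) : `|t| <= `|a| -> is_derive t 1 p (G (t *: v + z)).
  by move=> /H/is_derive_line.
have cp (t : R) : `|t| <= `|a| -> {for t, continuous p}.
  move=> /dp [dt _].
  by apply: differentiable_continuous; apply/derivable1_diffP.
have [a0|a0] := leP 0 a.
  have [||c] := @MVT_segment R p (fun t => G (t *: v + z)) 0 a a0.
  - move=> x; rewrite in_itv /= => /andP[x0 xa]; apply: dp.
    by rewrite !ger0_norm // ltW.
  - apply: continuous_in_subspaceT => x; rewrite inE /= in_itv /= => /andP[x0 xa].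
    by apply: cp; rewrite !ger0_norm.
  rewrite in_itv /= => /andP[c0 ca] E; exists c; first by rewrite !ger0_norm.
  by move: E; rewrite /p scale0r add0r subr0 => ->; rewrite mulrC.
have [||c] := @MVT_segment R p (fun t => G (t *: v + z)) a 0 (ltW a0).
- move=> x; rewrite in_itv /= => /andP[x0 xa]; apply: dp.
  by rewrite !ltr0_norm // lerN2 ltW.
- apply: continuous_in_subspaceT => x; rewrite inE /= in_itv /= => /andP[x0 xa].
  by apply: cp; rewrite (ltr0_norm a0) ler0_norm // lerN2.
rewrite in_itv /= => /andP[c0 ca] E; exists c.
  by rewrite (ltr0_norm a0) ler0_norm // lerN2.
move: E; rewrite /p scale0r add0r sub0r => E.
by rewrite -opprB E mulrN opprK mulrC.
Qed.

Context {fV : fdim V}.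

(** The increment is performed one basis direction at a time: the mean value theorem handles each
    move, and continuity of [G i] at [x] makes the error small. *)
Lemma differentiable_partials (f : V -> R) x (G : 'I_(@fb_dim _ _ fV) -> V -> R) :
  (forall i, \forall y \near x, is_derive y (fb_vec i) f (G i y)) ->
  (forall i, {for x, continuous (G i)}) -> differentiable f x.
Proof.
move=> dG cG.
pose L (s : seq 'I_(@fb_dim _ _ fV)) (h : V) := \sum_(i <- s) fb_co i h * G i x.
pose S (s : seq 'I_(@fb_dim _ _ fV)) (h : V) := \sum_(i <- s) fb_co i h *: fb_vec i.
have cL s : continuous (L s).
  apply: (@sum_continuous R V R _ s (fun i h => fb_co i h * G i x)) => i h; apply: cvgM; [exact: fb_cont|exact: cvg_cst].
have cS s : continuous (S s).
  apply: (@sum_continuous R V V _ s (fun i h => fb_co i h *: fb_vec i)) => i h; apply: cvgZr_tmp; exact: fb_cont.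
have S0 s : S s 0 = 0 by rewrite /S big1 // => i _; rewrite linear0 scale0r.
(* [S s h] is the part of the increment carried by the directions in [s], and [L s h] the matching
   part of the linear map; for the full list of indices the claim is differentiability. *)
have claim s : forall e, 0 < e -> \forall h \near 0,
    `|f (S s h + x) - f x - L s h| <= e * `|h|.
  elim: s => [|i s IH] e e0.
    by near=> h; rewrite /S /L !big_nil add0r !subrr normr0 mulr_ge0 // ltW.
  have [C C0 HC] : exists2 C, 0 < C & forall h, `|fb_co i h| <= C * `|h|.
    have [k k0 Hk] := linear_lipschitz (fb_cont (i := i)).
    by exists k.
  have e2 : 0 < e / 2 by rewrite divr_gt0.
  (* [C] bounds the coordinate [fb_co i], so a tolerance e / 2 / C on [G i] costs at most (e / 2)
     |h|. *)
  have eC : 0 < e / 2 / C by rewrite divr_gt0.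
  have /nbhs_ballP[d /= d0 Hd] : \forall y \near x,
      is_derive y (fb_vec i) f (G i y) /\ `|G i y - G i x| <= e / 2 / C.
    apply: filterI; first exact: dG.
    have /cvgrPdist_le /(_ _ eC) := cG i.
    by apply: filterS => y; rewrite distrC.
  have d2 : 0 < d / 2 by rewrite divr_gt0.
  have n1 : \forall h \near 0, `|S s h| < d / 2.
    have /cvgrPdist_lt /(_ _ d2) := cS s 0.
    by apply: filterS => h; rewrite S0 sub0r normrN.
  have n2 : \forall h \near 0, `|fb_co i h *: fb_vec i| < d / 2.
    have cZ : continuous (fun h : V => fb_co i h *: fb_vec i).
      by move=> h; apply: cvgZr_tmp; exact: fb_cont.
    have /cvgrPdist_lt /(_ _ d2) := cZ 0.
    by apply: filterS => h; rewrite linear0 scale0r sub0r normrN.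
  near=> h.
  have [|t ta E] := @MVT_dir f (G i) (S s h + x) (fb_vec i) (fb_co i h).
    move=> t ta; apply: (Hd _ _).1; rewrite -ball_normE /= addrA opprD addrCA subrr addr0 normrN.
    rewrite (le_lt_trans (ler_normD _ _)) // [ltRHS]splitr ltrD //; last by near: h.
    apply: le_lt_trans (_ : `|fb_co i h *: fb_vec i| < _); last by near: h.
    by rewrite !normrZ ler_wpM2r.
  have HG : `|G i (t *: fb_vec i + (S s h + x)) - G i x| <= e / 2 / C.
    apply: (Hd _ _).2; rewrite -ball_normE /= addrA opprD addrCA subrr addr0 normrN.
    rewrite (le_lt_trans (ler_normD _ _)) // [ltRHS]splitr ltrD //; last by near: h.
    apply: le_lt_trans (_ : `|fb_co i h *: fb_vec i| < _); last by near: h.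
    by rewrite !normrZ ler_wpM2r.
  have IHh : `|f (S s h + x) - f x - L s h| <= e / 2 * `|h| by near: h; exact: IH.
  rewrite /S /L !big_cons -/(S s h) -/(L s h) -[X in f X]addrA.
  have -> : f (fb_co i h *: fb_vec i + (S s h + x)) - f x - (fb_co i h * G i x + L s h) =
     fb_co i h * (G i (t *: fb_vec i + (S s h + x)) - G i x) + (f (S s h + x) - f x - L s h).
    by rewrite mulrBr -E; ring.
  rewrite (le_trans (ler_normD _ _)) // [e]splitr mulrDl lerD // normrM.
  apply: le_trans (ler_pM _ _ (HC h) HG) _ => //.
  by rewrite le_eqVlt; apply/orP; left; apply/eqP; field; rewrite gt_eqF.
have Llin : linear (L (enum 'I_(@fb_dim _ _ fV))).
  move=> k u v; rewrite /L scaler_sumr -big_split /=; apply: eq_bigr => i _.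
  by rewrite linearP mulrDl scalerAl.
pose LL : {linear V -> R} := HB.pack (L (enum 'I_(@fb_dim _ _ fV)))
    (GRing.isLinear.Build R V R _ _ Llin).
apply/diff_locallyP.
have E' : f \o shift x = cst (f x) + LL +o_ 0 id.
  apply/eqaddoP => e e0; have := claim (enum 'I_(@fb_dim _ _ fV)) e e0.
  apply: filterS => h; rewrite /S -[X in f (X + x)](_ : h = _).
    by rewrite /= !fctE /= opprD addrA.
  by rewrite {1}[h]fb_sum big_enum.
have cLL : continuous LL by exact: cL.
by rewrite (diff_unique cLL E').
Unshelve. all: by end_near. Qed.

(** Differentiability itself comes from continuity of the partial derivatives along the basis.
    Parameter integrals and flows obtain their smoothness in this way. *)
Lemma Ck_partials k U (f : V -> R) (G : 'I_(@fb_dim _ _ fV) -> V -> R) : open U ->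
  (forall i x, U x -> is_derive x (fb_vec i) f (G i x)) ->
  (forall i, Ck k U (G i)) -> Ck k.+1 U f.
Proof.
move=> oU dG cG.
have df x : U x -> differentiable f x.
  move=> Ux; apply: (@differentiable_partials _ _ G) => i.
    by near=> y; apply: dG; near: y; exact: open_nbhs_nbhs.
  exact: Ck_cont (cG i) Ux.
apply: (@Ck_intro _ _ _ _ _ _ (fun v x => \sum_i fb_co i v * G i x)) => //.
  move=> x v Ux; rewrite derive_fbE; last exact: df.
  by apply: eq_bigr => i _; rewrite (derive_val (is_derive := dG i x Ux)).
move=> v; apply: Ck_sum => // i _; apply: Ck_mul => //; exact: Ck_cst.
Unshelve. all: by end_near. Qed.

End DirectionalR.

Lemma Ck_local (R : realType) (V W : normedModType R) k (U : set V) (f : V -> W) :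
  (forall x, U x -> exists2 U', open U' /\ U' x & Ck k U' f) -> Ck k U f.
Proof.
elim: k f => [|k IH] f H.
  by move=> x Ux; have [U' [oU U'x] /(_ x U'x)] := H x Ux.
rewrite CkS; split=> [x Ux|v].
  by have [U' [oU U'x] [/(_ x U'x)]] := H x Ux.
apply: IH => x Ux; have [U' oU HU] := H x Ux.
by exists U' => //; exact: Ck_derive.
Qed.

(** One neighborhood serves all orders of differentiation, which makes this an open condition on [x]
    and spares compositions the tracking of domains. *)
Definition Csm (R : realType) (V W : normedModType R) (f : V -> W) (x : V) :=
  exists2 U, open U /\ U x & Cinf U f.

(** * Smoothness at a point *)

Section CsmBasics.
Variables (R : realType) (V W : normedModType R).
Implicit Types (f g : V -> W) (x v : V) (U : set V).

Lemma Csm_Cinf U f : (forall x, U x -> Csm f x) -> Cinf U f.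
Proof.
move=> H k; apply: Ck_local => x /H [U' oU HU].
by exists U' => //; exact: HU.
Qed.

Lemma Cinf_Csm U f x : open U -> U x -> Cinf U f -> Csm f x.
Proof. by exists U. Qed.

Lemma Csm_open f x : Csm f x -> \forall y \near x, Csm f y.
Proof.
move=> [U [oU Ux] HU]; near=> y; exists U => //; split=> //.
by near: y; exact: open_nbhs_nbhs.
Unshelve. all: by end_near. Qed.

Lemma Csm_near f g x : {near x, f =1 g} -> Csm f x -> Csm g x.
Proof.
move=> fg [U [oU Ux] HU].
exists (U `&` [set y | f y = g y]°).
  by split; [apply: openI => //; exact: open_interior|split=> //; exact: fg].
move=> k; apply: (@Ck_eq _ _ _ _ _ f).
- by apply: openI => //; exact: open_interior.
- by move=> y [_ /interior_subset].
- by apply: Ck_sub (HU k); exact: subIsetl.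
Qed.

Lemma Csm_eq f g x : f =1 g -> Csm f x -> Csm g x.
Proof. by move=> /funext ->. Qed.

Lemma Csm_cont f x : Csm f x -> {for x, continuous f}.
Proof. by move=> [U [_ Ux] /(_ 0%N)]; exact. Qed.

Lemma Csm_diff f x : Csm f x -> differentiable f x.
Proof. by move=> [U [_ Ux] /(_ 1%N) [+ _]]; exact. Qed.

Lemma Csm_derive f x v : Csm f x -> Csm ('D_v f) x.
Proof. by move=> [U oU /Cinf_derive]; exists U. Qed.

Lemma Csm_cst (w : W) x : Csm (fun _ => w) x.
Proof. by exists setT; [split=> //; exact: openT|move=> k; apply: Ck_cst; exact: openT]. Qed.

Lemma Csm_common f g x : Csm f x -> Csm g x ->
  exists U, [/\ open U, U x, Cinf U f & Cinf U g].
Proof.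
move=> [U [oU Ux] HU] [U' [oU' U'x] HU']; exists (U `&` U'); split=> //.
- exact: openI.
- by move=> k; apply: Ck_sub (HU k); exact: subIsetl.
- by move=> k; apply: Ck_sub (HU' k); exact: subIsetr.
Qed.

Lemma Csm_add f g x : Csm f x -> Csm g x -> Csm (fun y => f y + g y) x.
Proof.
move=> Hf Hg; have [U [oU Ux Uf Ug]] := Csm_common Hf Hg.
by exists U => // k; apply: Ck_add.
Qed.

Lemma Csm_sum (I : Type) (s : seq I) (P : pred I) (F : I -> V -> W) x :
  (forall i, P i -> Csm (F i) x) -> Csm (fun y => \sum_(i <- s | P i) F i y) x.
Proof.
move=> H; elim: s => [|i s IH].
  by apply: Csm_eq (Csm_cst 0 x) => y; rewrite big_nil.
case: (boolP (P i)) => Pi; last by apply: Csm_eq IH => y; rewrite big_cons (negPf Pi).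
by apply: Csm_eq (Csm_add (H i Pi) IH) => y; rewrite big_cons Pi.
Qed.

Lemma Csm_lin (L : {linear V -> W}) x : continuous L -> Csm L x.
Proof.
move=> cL; exists setT; first by split=> //; exact: openT.
move=> k; case: k => [|k]; first by move=> y _; exact: cL.
apply: (@Ck_intro _ _ _ _ _ _ (fun v => cst (L v))) => //.
- exact: openT.
- by move=> y _; exact: linear_differentiable.
- by move=> y v _; rewrite deriveE ?diff_lin //; exact: linear_differentiable.
by move=> v; apply: Ck_cst; exact: openT.
Qed.

End CsmBasics.

Section CsmR.
Variables (R : realType) (V : normedModType R).

Lemma Csm_id (x : V) : Csm (fun y => y) x.
Proof. by apply: (@Csm_lin _ _ _ (idfun : {linear V -> V})) => y; exact: cvg_id. Qed.

Lemma Csm_mul (a b : V -> R) x : Csm a x -> Csm b x -> Csm (fun y => a y * b y) x.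
Proof.
move=> Hf Hg; have [U [oU Ux Uf Ug]] := Csm_common Hf Hg.
by exists U => // k; apply: Ck_mul.
Qed.

Lemma Csm_opp (a : V -> R) x : Csm a x -> Csm (fun y => - a y) x.
Proof.
move=> Ha; apply: Csm_eq (Csm_mul (Csm_cst (-1 : R) x) Ha) => y.
by rewrite mulN1r.
Qed.

Lemma Csm_sub (a b : V -> R) x : Csm a x -> Csm b x -> Csm (fun y => a y - b y) x.
Proof. by move=> Ha Hb; apply: Csm_add => //; exact: Csm_opp. Qed.

Lemma Csm_prod (I : Type) (s : seq I) (P : pred I) (F : I -> V -> R) x :
  (forall i, P i -> Csm (F i) x) -> Csm (fun y => \prod_(i <- s | P i) F i y) x.
Proof.
move=> H; elim: s => [|i s IH].
  by apply: Csm_eq (Csm_cst (1 : R) x) => y; rewrite big_nil.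
case: (boolP (P i)) => Pi; last by apply: Csm_eq IH => y; rewrite big_cons (negPf Pi).
by apply: Csm_eq (Csm_mul (H i Pi) IH) => y; rewrite big_cons Pi.
Qed.

Variable (W : normedModType R).
Context {fW : fdim W}.

Lemma Csm_scale (a : V -> R) (f : V -> W) x : Csm a x -> Csm f x ->
  Csm (fun y => a y *: f y) x.
Proof.
move=> [U [oU Ux] HU] [U' [oU' U'x] HU']; exists (U `&` U').
  by split=> //; exact: openI.
move=> k; apply: Ck_scale; first exact: openI.
- by apply: Ck_sub (HU k); exact: subIsetl.
- by apply: Ck_sub (HU' k); exact: subIsetr.
Qed.

Lemma Csm_Zl (a : V -> R) (w : W) x : Csm a x -> Csm (fun y => a y *: w) x.
Proof. by move=> Ha; apply: Csm_scale => //; exact: Csm_cst. Qed.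

Lemma Csm_comp (X : normedModType R) {fX : fdim X} (g : V -> W) (f : W -> X) x :
  Csm g x -> Csm f (g x) -> Csm (f \o g) x.
Proof.
move=> [U [oU Ux] HU] [U' [oU' U'x] HU'].
have oI : open (U `&` (g @^-1` U')).
  rewrite openE => y [Uy U'y]; apply: filterI; first exact: open_nbhs_nbhs.
  by apply: (HU 0%N y Uy); exact: open_nbhs_nbhs.
exists (U `&` (g @^-1` U')) => // k.
apply: (@Ck_comp _ _ _ _ _ _ _ _ U') => //.
- by move=> y [].
- by apply: Ck_sub (HU k); exact: subIsetl.
Qed.

Lemma Csm_coord (f : V -> W) x : (forall i, Csm (fb_co i \o f) x) -> Csm f x.
Proof.
move=> H; apply: (@Csm_eq _ _ _ (fun y => \sum_i fb_co i (f y) *: fb_vec i)).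
  by move=> y; rewrite -fb_sum.
by apply: Csm_sum => i _; apply: Csm_Zl; exact: H.
Qed.

Lemma Csm_co (f : V -> W) x i : Csm f x -> Csm (fb_co i \o f) x.
Proof.
by move=> Hf; apply: Csm_comp => //; apply: Csm_lin; exact: fb_cont.
Qed.

End CsmR.

Section CsmConcrete.
Variables (R : realType) (V : normedModType R).

Lemma Csm_rV n (f : V -> 'rV[R]_n) x :
  (forall i, Csm (fun y => f y 0 i : R) x) <-> Csm f x.
Proof.
split; last by move=> + i => /(@Csm_co _ _ _ (@fdim_rV R n) f x i).
by move=> H; apply: (@Csm_coord _ _ _ (@fdim_rV R n)) => i; exact: H.
Qed.

Lemma Csm_pair (f g : V -> R) x : Csm f x -> Csm g x -> Csm (fun y => (f y, g y)) x.
Proof.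
move=> Hf Hg; apply: (@Csm_coord _ _ _ (@fdim_RR R)) => i /=.
by rewrite /RR_co; case: ifP.
Qed.

Lemma Csm_fst (f : V -> (R * R)%type) x : Csm f x -> Csm (fun y => (f y).1) x.
Proof. by move=> /(@Csm_co _ _ _ (@fdim_RR R) f x 0). Qed.

Lemma Csm_snd (f : V -> (R * R)%type) x : Csm f x -> Csm (fun y => (f y).2) x.
Proof. by move=> /(@Csm_co _ _ _ (@fdim_RR R) f x 1). Qed.

End CsmConcrete.

Section OneVariable.
Variable R : realType.

Lemma Ck_R1 k (U : set R) (f df : R -> R) : open U ->
  (forall x, U x -> is_derive x 1 f (df x)) -> Ck k U df -> Ck k.+1 U f.
Proof.
move=> oU H Hd; apply: (@Ck_partials _ _ (@fdim_R R) k U f (fun _ => df)) => //.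

Qed.

Lemma open_neq0 : open [set x : R | x != 0].
Proof. exact: open_neq. Qed.

(** Bootstrapping: the derivative is a polynomial in the function itself, so C^k regularity implies
    C^(k+1). *)
Lemma Csm_inv (x : R) : x != 0 -> Csm (fun y : R => y^-1) x.
Proof.
move=> x0; exists [set y : R | y != 0]; first by split=> //; exact: open_neq0.
elim=> [|k IH]; first by move=> y y0; exact: inv_continuous.
apply: (@Ck_R1 _ _ _ (fun y => - (y^-1 * y^-1))); first exact: open_neq0.
  move=> y y0; apply: DeriveDef; first exact: (derivableV y0).
  rewrite (_ : (fun _ => _) = (fun y => (id y)^-1)) // deriveV // derive_id.
  by rewrite /GRing.scale /= mulr1 -exprVn expr2.
apply: (Ck_eq (f := fun y : R => -1 * (y^-1 * y^-1))); first exact: open_neq0.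
  by move=> y _; rewrite mulN1r.
apply: Ck_mul; [exact: open_neq0|apply: Ck_cst; exact: open_neq0|].
by apply: Ck_mul => //; exact: open_neq0.
Qed.

Lemma open_gt0 : open [set x : R | 0 < x].
Proof. exact: open_gt. Qed.

(** The derivative is a smooth function of the square root itself, which is nonzero here, so
    regularity bootstraps again. *)
Lemma Csm_sqrt (x : R) : 0 < x -> Csm (@Num.sqrt R) x.
Proof.
move=> x0; exists [set y : R | 0 < y]; first by split=> //; exact: open_gt0.
elim=> [|k IH]; first by move=> y y0; exact: sqrt_continuous.
apply: (@Ck_R1 _ _ _ (fun y => (2 * Num.sqrt y)^-1)); first exact: open_gt0.
apply: (@Ck_comp _ _ _ (@fdim_R R) _ (@fdim_R R) k [set y : R | 0 < y] [set y : R | y != 0]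
  (fun y => 2 * Num.sqrt y) (fun y => y^-1)).
- exact: open_gt0.
- exact: open_neq0.
- by move=> y /= y0; rewrite mulf_neq0 // sqrtr_eq0 -ltNge.
- by apply: Ck_mul; [exact: open_gt0|apply: Ck_cst; exact: open_gt0|exact: IH].
have : Cinf [set y : R | y != 0] (fun y : R => y^-1).
  by apply: Csm_Cinf => y; exact: Csm_inv.
by apply.
Qed.

End OneVariable.

Section SmoothWithin.
Variables (R : realType) (V W : normedModType R).

Lemma smooth_withinP (S : set V) z (f : V -> W) : smooth_within S z f <->
  exists2 h, Csm h z & \forall w \near z, S w -> f w = h w.
Proof.
split.
  move=> [U [oU Uz] [h Hh E]]; exists h; first by exists U.
  by near=> w; apply: E; near: w; exact: open_nbhs_nbhs.
move=> [h [U [oU Uz] HU] E].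
exists (U `&` [set w | S w -> f w = h w]°).
  by split; [apply: openI => //; exact: open_interior|split=> //; exact: E].
exists h; first by move=> k; apply: Ck_sub (HU k); exact: subIsetl.
by move=> w [_ /interior_subset].
Unshelve. all: by end_near. Qed.

End SmoothWithin.

(** * One-sided derivatives and integrals over [0,1] *)

Section DerivIn.
Variables (R : realType) (W : normedModType R).
Implicit Types (I : set R) (f g : R -> W) (t : R).

(** Clearing the denominator removes the punctured neighborhood: the inequality is trivial at u = t,
    so ordinary neighborhoods suffice. *)
Lemma is_deriv_inP I f t l : is_deriv_in I f t l <->
  forall e, 0 < e -> \forall u \near t, I u ->
    `|f u - f t - (u - t) *: l| <= e * `|u - t|.
Proof.
split.
  move=> /cvgrPdist_le H e e0.
  have : \forall u \near t, u != t -> I u -> `|l - (u - t)^-1 *: (f u - f t)| <= e := H e e0.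
  apply: filterS => u + Iu.
  have [->|ut] := eqVneq u t; first by rewrite !subrr scale0r subr0 !normr0 mulr0.
  move=> /(_ isT Iu); rewrite distrC => Hu.
  have ut0 : u - t != 0 by rewrite subr_eq0.
  rewrite -ler_pdivrMr ?normr_gt0 // mulrC -normfV -normrZ.
  by rewrite scalerBr scalerA mulVf // scale1r.
move=> H; apply/cvgrPdist_le => e e0; suff : \forall u \near t, u != t -> I u -> `|l - (u - t)^-1 *: (f u - f t)| <= e by [].
apply: filterS (H e e0) => u + ut Iu.
move=> /(_ Iu) Hu; rewrite distrC.
have ut0 : u - t != 0 by rewrite subr_eq0.
have -> : (u - t)^-1 *: (f u - f t) - l = (u - t)^-1 *: (f u - f t - (u - t) *: l).
  by rewrite [RHS]scalerBr scalerA mulVf // scale1r.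
by rewrite normrZ normfV mulrC ler_pdivrMr ?normr_gt0.
Qed.

(** The equality at [t] is asked separately because [t] need not lie in [I]. *)
Lemma is_deriv_in_eq I f g t l : (\forall u \near t, I u -> f u = g u) ->
  f t = g t -> is_deriv_in I f t l -> is_deriv_in I g t l.
Proof.
move=> fg ft /is_deriv_inP H; apply/is_deriv_inP => e e0.
near=> u => Iu; rewrite -ft.
have <- : f u = g u by move: Iu; near: u.
by move: Iu; near: u; exact: H.
Unshelve. all: by end_near. Qed.

Lemma is_derive_in I f t l : is_derive t 1 f l -> is_deriv_in I f t l.
Proof.
move=> [df <-]; apply/is_deriv_inP => e e0.
have /cvgrPdist_le /(_ e e0) :
  (fun h : R => h^-1 *: (f (h *: 1 + t) - f t)) @ 0^' --> 'D_1 f t := df.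
move=> /nbhs_ballP[d /= d0 H]; apply/nbhs_ballP; exists d => //= u tu _.
have [->|ut] := eqVneq u t; first by rewrite !subrr scale0r subr0 !normr0 mulr0.
have ut0 : u - t != 0 by rewrite subr_eq0.
have {H} := H (u - t) _ ut0; rewrite -ball_normE /= sub0r normrN distrC => /(_ tu).
rewrite [_ *: 1]mulr1 subrK distrC => Hu.
rewrite -ler_pdivrMr ?normr_gt0 // mulrC -normfV -normrZ.
by rewrite scalerBr scalerA mulVf // scale1r distrC.
Qed.

Lemma is_deriv_in_derive f t l : is_deriv_in setT f t l -> is_derive t 1 f l.
Proof.
move=> /is_deriv_inP H.
have E : (fun h : R => h^-1 *: (f (h *: 1 + t) - f t)) @ 0^' --> l.
  apply/cvgrPdist_le => e e0.
  have /nbhs_ballP[d /= d0 {}H] := H e e0.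
  apply/nbhs_ballP; exists d => //= h; rewrite -ball_normE /= sub0r normrN => hd h0.
  have := H (h + t); rewrite -ball_normE /= opprD addrCA subrr addr0 normrN => /(_ hd I).
  rewrite addrK [h *: 1]mulr1 distrC => Hu.
  rewrite -[l](scale1r l) -(mulVf h0) -scalerA -scalerBr normrZ normfV mulrC.
  by rewrite ler_pdivrMr ?normr_gt0.
by split; [apply/cvg_ex; exists l|apply/cvg_lim].
Qed.

Lemma is_deriv_in_sub I J f t l : J `<=` I -> is_deriv_in I f t l -> is_deriv_in J f t l.
Proof.
move=> JI /is_deriv_inP H; apply/is_deriv_inP => e e0.
by apply: filterS (H e e0) => u Hu /JI.
Qed.

Lemma is_deriv_in_cst I (w : W) t : is_deriv_in I (fun _ => w) t 0.
Proof.
apply/is_deriv_inP => e e0; near=> u => _.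
by rewrite subrr scaler0 subr0 normr0 mulr_ge0 // ltW.
Unshelve. all: by end_near. Qed.

Lemma is_deriv_in_add I f g t l k : is_deriv_in I f t l -> is_deriv_in I g t k ->
  is_deriv_in I (fun u => f u + g u) t (l + k).
Proof.
move=> /is_deriv_inP Hf /is_deriv_inP Hg; apply/is_deriv_inP => e e0.
have e2 : 0 < e / 2 by rewrite divr_gt0.
near=> u => Iu.
have -> : f u + g u - (f t + g t) - (u - t) *: (l + k) =
  (f u - f t - (u - t) *: l) + (g u - g t - (u - t) *: k).
  by rewrite scalerDr !opprD [f u + g u + _]addrACA [LHS]addrACA.
rewrite [e]splitr mulrDl (le_trans (ler_normD _ _)) // lerD //.
  by move: Iu; near: u; exact: Hf.
by move: Iu; near: u; exact: Hg.
Unshelve. all: by end_near. Qed.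

Lemma is_deriv_in_sum I (J : Type) (s : seq J) (F : J -> R -> W) (L : J -> W) t :
  (forall j, is_deriv_in I (F j) t (L j)) ->
  is_deriv_in I (fun u => \sum_(j <- s) F j u) t (\sum_(j <- s) L j).
Proof.
move=> H; elim: s => [|j s IH].
  rewrite big_nil; apply: is_deriv_in_eq (is_deriv_in_cst I 0 t).
    by near=> u; rewrite big_nil.
  by rewrite big_nil.
rewrite big_cons; apply: is_deriv_in_eq (is_deriv_in_add (H j) IH).
  by near=> u; rewrite big_cons.
by rewrite big_cons.
Unshelve. all: by end_near. Qed.

Lemma is_deriv_in_lim I f t l : is_deriv_in I f t l -> f @ within I (nbhs t) --> f t.
Proof.
move=> /is_deriv_inP /(_ 1 ltr01) H; apply/cvgrPdist_le => e e0.
rewrite near_withinE.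
have c0 : 0 < e / (1 + `|l|) by rewrite divr_gt0 // ltr_wpDr.
near=> u => Iu.
have Hu : `|f u - f t - (u - t) *: l| <= 1 * `|u - t| by move: Iu; near: u.
rewrite distrC -[f u - f t](subrK ((u - t) *: l)) (le_trans (ler_normD _ _)) //.
rewrite (le_trans (lerD Hu (lexx _))) // normrZ mul1r -[X in X + _]mulr1 -mulrDr.
rewrite [1 + _]addrC -ler_pdivlMr; last by rewrite ltr_wpDl.
near: u; have /cvgrPdist_le /(_ _ c0) : id @ t --> t by exact: cvg_id.
by apply: filterS => u; rewrite distrC addrC.
Unshelve. all: by end_near. Qed.

Lemma is_deriv_in_unique I f t l k : ProperFilter (within I t^') ->
  is_deriv_in I f t l -> is_deriv_in I f t k -> l = k.
Proof. by move=> pF; apply: cvg_unique. Qed.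

End DerivIn.

Lemma is_deriv_in_comp (R : realType) (W : normedModType R) I J (f : R -> W) (m : R -> R) t l k :
  (\forall u \near t, J u -> I (m u)) ->
  is_deriv_in J m t k -> is_deriv_in I f (m t) l ->
  is_deriv_in J (f \o m) t (k *: l).
Proof.
move=> JI Hm Hf; have cm := is_deriv_in_lim Hm.
move/is_deriv_inP: Hm => Hm; move/is_deriv_inP: Hf => Hf.
apply/is_deriv_inP => e e0.
have p1 : 0 < `|k| + 1 by rewrite ltr_wpDl.
have p2 : 0 < `|l| + 1 by rewrite ltr_wpDl.
(* The total error is that of [f] at [m u], at most e1 |m u - m t|, plus that of [m] times |l|. As
   |m u - m t| <= (|k| + 1) |u - t|, each contributes at most (e / 2) |u - t|. *)
pose e1 := e / 2 / (`|k| + 1); pose e2 := e / 2 / (`|l| + 1).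
have e10 : 0 < e1 by rewrite !divr_gt0.
have e20 : 0 < e2 by rewrite !divr_gt0.
have H1 : \forall u \near t, J u -> I (m u) ->
    `|f (m u) - f (m t) - (m u - m t) *: l| <= e1 * `|m u - m t|.
  by have := cm _ (Hf e1 e10); rewrite /within /=.
near=> u => Ju /=.
have Iu : I (m u) by move: Ju; near: u.
have H1u : `|f (m u) - f (m t) - (m u - m t) *: l| <= e1 * `|m u - m t|.
  by move: Ju Iu; near: u.
have H2 : `|m u - m t - (u - t) *: k| <= e2 * `|u - t| by move: Ju; near: u; exact: Hm.
have H3 : `|m u - m t - (u - t) *: k| <= 1 * `|u - t| by move: Ju; near: u; exact: Hm.
have H4 : `|m u - m t| <= (`|k| + 1) * `|u - t|.
  rewrite -[m u - m t](subrK ((u - t) *: k)) (le_trans (ler_normD _ _)) //.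
  by rewrite mulrDl addrC lerD // normrZ mulrC.
have -> : f (m u) - f (m t) - (u - t) *: (k *: l) =
   (f (m u) - f (m t) - (m u - m t) *: l) + (m u - m t - (u - t) *: k) *: l.
  by rewrite [(m u - m t - _) *: l]scalerBl addrA subrK scalerA.
rewrite (le_trans (ler_normD _ _)) // [e]splitr mulrDl lerD //.
  apply: le_trans H1u _; apply: le_trans (ler_wpM2l (ltW e10) H4) _.
  by rewrite mulrA /e1 divfK // gt_eqF.
rewrite normrZ; apply: le_trans (ler_wpM2r (normr_ge0 _) H2) _.
rewrite mulrAC ler_wpM2r // /e2 [leLHS]mulrAC ler_pdivrMr //.
by rewrite ler_wpM2l ?lerDl // divr_ge0 // ltW.
Unshelve. all: by end_near. Qed.



Section DerivInR.
Variable (R : realType).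
Implicit Types (I : set R) (f g : R -> R) (t : R).

Lemma is_deriv_in_mul I f g t l k : is_deriv_in I f t l -> is_deriv_in I g t k ->
  is_deriv_in I (fun u => f u * g u) t (l * g t + f t * k).
Proof.
move=> Hf Hg; have cg := is_deriv_in_lim Hg.
have cg' : g @ within I t^' --> g t.
  move=> P /cg; rewrite /nbhs /= /within /dnbhs /=.
  by apply: filterS => u + _; apply.
have H : (fun u => (u - t)^-1 * (f u - f t) * g u + f t * ((u - t)^-1 * (g u - g t)))
    @ within I t^' --> l * g t + f t * k.
  apply: cvgD; first by apply: cvgM.
  by apply: cvgM => //; exact: cvg_cst.
rewrite /is_deriv_in; apply: cvg_trans H; apply: near_eq_cvg; near=> u.
by rewrite /GRing.scale /=; ring.
Unshelve. all: by end_near. Qed.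

(** Makes one-sided derivatives unique, also at the end-points, where nearby points have to be taken
    on the inner side. *)
Lemma proper_itv (a b t : R) : a < b -> t \in `[a, b] -> ProperFilter (within `[a, b]%classic t^').
Proof.
rewrite in_itv /= => ab /andP[at_ tb]; apply: Build_ProperFilter_ex => P.
rewrite /within /dnbhs /= => /nbhs_ballP[e /= e0 H].
have e2 : 0 < e / 2 by rewrite divr_gt0.
have ee : e / 2 < e by rewrite ltr_pdivrMr // ltr_pMr // ltr1n.
have [tb'|bt] := ltP t b.
  have m0 : 0 < Num.min (e / 2) (b - t) by rewrite lt_min e2 subr_gt0.
  exists (t + Num.min (e / 2) (b - t)); apply: H.
  - rewrite -ball_normE /= opprD addrA subrr sub0r normrN gtr0_norm //.
    by rewrite gt_min ee.
  - by rewrite -subr_eq0 addrAC subrr add0r gt_eqF.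
  rewrite /= in_itv /=; apply/andP; split; first by rewrite (le_trans at_) // lerDl ltW.
  by rewrite -lerBrDl ge_min lexx orbT.
have at' : a < t by apply: lt_le_trans bt.
have m0 : 0 < Num.min (e / 2) (t - a) by rewrite lt_min e2 subr_gt0.
exists (t - Num.min (e / 2) (t - a)); apply: H.
- rewrite -ball_normE /= opprB addrC subrK gtr0_norm //.
  by rewrite gt_min ee.
- by rewrite -subr_eq0 addrAC subrr add0r oppr_eq0 gt_eqF.
rewrite /= in_itv /=; apply/andP; split; last by rewrite (le_trans _ tb) // gerBl ltW.
by rewrite lerBrDl -lerBrDr ge_min lexx orbT.
Qed.

End DerivInR.

Section Int01.
Variable R : realType.
Local Notation I01 := (`[0:R, 1]%classic).
Local Notation int01 f := (\int[@lebesgue_measure R]_(t in `[0%R, 1%R]) f t).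
Implicit Types f g : R -> R.

Lemma within_contP (A : set R) f : {within A, continuous f} <->
  forall t, A t -> f @ within A (nbhs t) --> f t.
Proof. exact: subspace_continuousP. Qed.

Lemma int01_integrable f : {within I01, continuous f} ->
  (@lebesgue_measure R).-integrable I01 (EFin \o f).
Proof. by apply: continuous_compact_integrable; exact: segment_compact. Qed.

Lemma int01_cst (k : R) : int01 (fun _ : R => k) = k.
Proof.
rewrite Rintegral_cst //= lebesgue_measure_itv /= lte_fin ltr01.
by rewrite -EFinB /= subr0 mulr1.
Qed.

Lemma norm_continuous_within (A : set R) f : {within A, continuous f} ->
  {within A, continuous (fun t => `|f t|)}.
Proof.
move=> /within_contP cf; apply/within_contP => t At.
by apply: (cvg_comp _ _ (cf t At)); exact: norm_continuous.
Qed.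

Lemma int01_norm_le f (e : R) : {within I01, continuous f} ->
  (forall t, I01 t -> `|f t| <= e) -> `|int01 f| <= e.
Proof.
move=> cf H; apply: le_trans (le_normr_Rintegral _ _) _ => //.
  exact: int01_integrable.
rewrite -[leRHS]int01_cst; apply: le_Rintegral => //.
- by apply: int01_integrable; exact: norm_continuous_within.
- by apply: int01_integrable; apply/within_contP => t _; exact: cvg_cst.
Qed.

Lemma within_cont_sub (A : set R) f g : {within A, continuous f} ->
  {within A, continuous g} -> {within A, continuous (fun t => f t - g t)}.
Proof.
move=> /within_contP cf /within_contP cg; apply/within_contP => t At.
by apply: cvgB; [exact: cf|exact: cg].
Qed.

Lemma within_cont_mul (A : set R) f g : {within A, continuous f} ->
  {within A, continuous g} -> {within A, continuous (fun t => f t * g t)}.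
Proof.
move=> /within_contP cf /within_contP cg; apply/within_contP => t At.
by apply: cvgM; [exact: cf|exact: cg].
Qed.

Lemma int01_B f g : {within I01, continuous f} -> {within I01, continuous g} ->
  int01 (fun t => f t - g t) = int01 f - int01 g.
Proof. by move=> cf cg; apply: RintegralB => //; exact: int01_integrable. Qed.

Lemma int01_Zl (k : R) f : {within I01, continuous f} ->
  int01 (fun t => k * f t) = k * int01 f.
Proof. by move=> cf; apply: RintegralZl => //; exact: int01_integrable. Qed.

Lemma int01_eq f g : (forall t, I01 t -> f t = g t) -> int01 f = int01 g.
Proof. by move=> fg; apply: eq_Rintegral => t; rewrite inE => /fg. Qed.

(** Compactness of the interval upgrades the joint local estimate in [t'] and [x] to a bound valid
    for all [t'] at once, and uniform convergence passes to the integral. *)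
Lemma int01_cvg (T : Type) (F : set_system T) {FF : Filter F}
    (f : T -> R -> R) g :
  (\forall x \near F, {within I01, continuous (f x)}) ->
  {within I01, continuous g} ->
  (forall t, I01 t -> forall e, 0 < e ->
     \forall t' \near t & x \near F, I01 t' -> `|f x t' - g t'| <= e) ->
  (fun x => int01 (f x)) @ F --> int01 g.
Proof.
move=> cf cg H; apply/cvgrPdist_le => e e0.
have : \forall x \near F, I01 `<=` (fun t' => I01 t' -> `|f x t' - g t'| <= e).
  apply: ((compact_near_coveringP I01).1 (@segment_compact R 0 1) _ F
    (fun x t' => I01 t' -> `|f x t' - g t'| <= e) _) => t It.
  exact: H.
move=> H'; near=> x.
have cfx : {within I01, continuous (f x)} by near: x.
rewrite distrC -int01_B //; apply: int01_norm_le; first exact: within_cont_sub.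
move=> t It; have : I01 `<=` (fun t' => I01 t' -> `|f x t' - g t'| <= e) by near: x.
by apply.
Unshelve. all: by end_near. Qed.

Lemma is_deriv_in_interior (I : set R) f t l : nbhs t I -> is_deriv_in I f t l ->
  is_derive t 1 f l.
Proof.
move=> nI /is_deriv_inP H; apply: is_deriv_in_derive; apply/is_deriv_inP => e e0.
by near=> u => _; have Iu : I u; [near: u|move: Iu; near: u; exact: H].
Unshelve. all: by end_near. Qed.

Lemma FTC01 F f : {within I01, continuous f} ->
  (forall t, I01 t -> is_deriv_in I01 F t (f t)) -> int01 f = F 1 - F 0.
Proof.
move=> cf dF.
have dFo (t : R) : t \in `]0, 1[ -> is_derive t 1 F (f t).
  move=> t01; apply: (@is_deriv_in_interior I01); last first.
    by apply: dF; move: t01; rewrite /= !in_itv /= => /andP[? ?]; rewrite !ltW.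
  have := near_in_itvoo t01; apply: filterS => u.
  by rewrite /= !in_itv /= => /andP[? ?]; rewrite !ltW.
have n0 : \forall u \near (0:R), u <= 1.
  apply/nbhs_ballP; exists 1 => //= u; rewrite -ball_normE /= sub0r normrN ltr_norml.
  by move=> /andP[_ /ltW].
have n1 : \forall u \near (1:R), 0 <= u.
  apply/nbhs_ballP; exists 1 => //= u; rewrite -ball_normE /= ltr_norml.
  by move=> /andP[_ ?]; lra.
have E : (\int[lebesgue_measure]_(x in `[0%R, 1%R]) (f x)%:E)%E = ((F 1)%:E - (F 0)%:E)%E.
  apply: continuous_FTC2 => //.
    split.
    - by move=> t /dFo [].
    - have := is_deriv_in_lim (dF 0 _); rewrite /= in_itv /= lexx ler01 => /(_ isT) H.
      move=> P /H; rewrite /nbhs /= /at_right /within /= => HP.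
      near=> u => u0; have : I01 u -> P (F u) by near: u.
      apply; rewrite /= in_itv /= (ltW u0) /=; near: u.
      exact: n0.
    - have := is_deriv_in_lim (dF 1 _); rewrite /= in_itv /= lexx ler01 => /(_ isT) H.
      move=> P /H; rewrite /nbhs /= /at_left /within /= => HP.
      near=> u => u1; have : I01 u -> P (F u) by near: u.
      apply; rewrite /= in_itv /= (ltW u1) andbT; near: u.
      exact: n1.
  by move=> t /dFo [? <-]; rewrite derive1E.
by rewrite /Rintegral E.
Unshelve. all: by end_near. Qed.

(** Continuity keeps [f] above f t0 / 2 on a nondegenerate interval inside [0,1], taken to the right
    of [t0], or to its left when [t0] is 1. *)
Lemma int01_pos f t0 : {within I01, continuous f} -> (forall t, I01 t -> 0 <= f t) ->
  I01 t0 -> 0 < f t0 -> 0 < int01 f.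
Proof.
move=> cf f0 I0 ft0.
have [a [b [ab abI Hf]]] : exists a b, [/\ a < b, `[a, b]%classic `<=` I01 &
    forall t, `[a, b]%classic t -> f t0 / 2 <= f t].
  have e0 : 0 < f t0 / 2 by rewrite divr_gt0.
  move/within_contP : (cf) => /(_ t0 I0) /cvgrPdist_le /(_ _ e0).
  rewrite near_withinE => /nbhs_ballP[d /= d0 H].
  have d2 : 0 < d / 2 by rewrite divr_gt0.
  have dd : d / 2 < d by rewrite ltr_pdivrMr // ltr_pMr // ltr1n.
  have {}H t : I01 t -> `|t0 - t| <= d / 2 -> f t0 / 2 <= f t.
    move=> It td; have := H t; rewrite -ball_normE /= => /(_ (le_lt_trans td dd) It).
    by rewrite ler_norml => /andP[_ ?]; lra.
  move: I0; rewrite /= in_itv /= => /andP[t00 t01].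
  have [t1|t1] := ltP t0 1.
    have m0 : 0 < Num.min (d / 2) (1 - t0) by rewrite lt_min d2 subr_gt0.
    have m1 : Num.min (d / 2) (1 - t0) <= d / 2 by rewrite ge_min lexx.
    have m2 : Num.min (d / 2) (1 - t0) <= 1 - t0 by rewrite ge_min lexx orbT.
    exists t0, (t0 + Num.min (d / 2) (1 - t0)); split; first by rewrite ltrDl.
      by move=> t; rewrite /= !in_itv /= => /andP[? ?]; lra.
    move=> t; rewrite /= !in_itv /= => /andP[? ?]; apply: H; first by rewrite /= in_itv /=; lra.
    by rewrite ler_norml; lra.
  have m0 : 0 < Num.min (d / 2) t0 by rewrite lt_min d2 (lt_le_trans _ t1).
  have m1 : Num.min (d / 2) t0 <= d / 2 by rewrite ge_min lexx.
  have m2 : Num.min (d / 2) t0 <= t0 by rewrite ge_min lexx orbT.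
  exists (t0 - Num.min (d / 2) t0), t0; split; first by rewrite gtrBl.
    by move=> t; rewrite /= !in_itv /= => /andP[? ?]; lra.
  move=> t; rewrite /= !in_itv /= => /andP[? ?]; apply: H; first by rewrite /= in_itv /=; lra.
  by rewrite ler_norml; lra.
have iF := int01_integrable cf.
have H1 : ((f t0 / 2 * (b - a))%:E <= \int[lebesgue_measure]_(x in `[0%R, 1%R]) (f x)%:E)%E.
  apply: (@le_trans _ _ (\int[lebesgue_measure]_(x in `[a, b]) (f x)%:E)%E); last first.
    apply: ge0_subset_integral => //.
    - by case/integrableP: iF.
  apply: (@le_trans _ _ (\int[lebesgue_measure]_(x in `[a, b]) (f t0 / 2)%:E)%E).
    by rewrite integral_cst //= lebesgue_measure_itv /= lte_fin ab -EFinB -EFinM.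
  apply: ge0_le_integral => //.
  - by move=> t _; rewrite lee_fin divr_ge0 // ltW.
  - case/integrableP: iF => mf _; apply: measurable_funS mf => //.
have E : (int01 f)%:E = (\int[lebesgue_measure]_(x in `[0%R, 1%R]) (f x)%:E)%E.
  by rewrite /Rintegral fineK //; exact: integrable_fin_num.
rewrite -lte_fin E; apply: lt_le_trans H1.
by rewrite lte_fin mulr_gt0 ?subr_gt0 // divr_gt0.
Qed.

End Int01.

(** * Differentiation under the integral sign *)

Section NearPair.
Variables (R : realType) (T : Type).
Implicit Types (a b : R) (P : R * R -> Prop).

Lemma near_pairr P a b : (\forall z \near (a, b), P z) -> \forall t \near b, P (a, t).
Proof.
move=> /nbhs_ballP[d /= d0 H]; apply/nbhs_ballP; exists d => //= t bt; apply: H.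
by split=> //=; exact: ballxx.
Qed.

Lemma near_pairl P a b : (\forall z \near (a, b), P z) -> \forall e \near a, P (e, b).
Proof.
move=> /nbhs_ballP[d /= d0 H]; apply/nbhs_ballP; exists d => //= t bt; apply: H.
by split=> //=; exact: ballxx.
Qed.

Lemma near_pair_swap (G : set_system R) {FG : Filter G} P a b :
  (forall A, nbhs a A -> G A) ->
  (\forall z \near (a, b), P z) -> \forall t \near b & e \near G, P (e, t).
Proof.
move=> aG /nbhs_ballP[d /= d0 H].
exists (ball b d, ball a d); first by split=> /=; [|apply: aG]; exact: nbhsx_ballx.
by move=> [t e] /= [bt ae]; apply: H.
Qed.

End NearPair.

Section ParamDeriv.
Variable R : realType.
Local Notation I01 := (`[0:R, 1]%classic).
Local Notation int01 f := (\int[@lebesgue_measure R]_(t in `[0%R, 1%R]) f t).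

(** Difference quotients are partial derivatives of a local extension [h] at intermediate points,
    hence converge uniformly in [t]. The set [B] admits both one-sided parameters, for variations,
    and the whole line, for ray integrals. *)
Lemma int01_deriv (B : set R) (F : R -> R -> R) (e0 : R) (dF : R -> R) : B e0 ->
  (forall t, I01 t -> exists h : R * R -> R, [/\ Csm h (e0, t),
     \forall z \near (e0, t), B z.1 -> I01 z.2 -> F z.1 z.2 = h z &
     \forall t' \near t, I01 t' -> dF t' = 'D_(1, 0) h (e0, t')]) ->
  is_deriv_in B (fun e => int01 (F e)) e0 (int01 dF).
Proof.
move=> Be0 H.
(* One neighborhood of [e0] must serve all [t]: compactness of [0,1] in its near-covering form. *)
have cF : \forall e \near e0, B e -> {within I01, continuous (F e)}.
  have : \forall e \near e0, I01 `<=` (fun t => B e -> I01 t ->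
      F e @ within I01 (nbhs t) --> F e t).
    apply: ((compact_near_coveringP I01).1 (@segment_compact R 0 1) _ (nbhs e0)
      (fun e t => B e -> I01 t -> F e @ within I01 (nbhs t) --> F e t) _) => t It.
    have [h [Ch Fh _]] := H t It.
    have : \forall z \near (e0, t), B z.1 -> I01 z.2 ->
        F z.1 @ within I01 (nbhs z.2) --> F z.1 z.2.
      have Fh' := near_join Fh; have Ch' := Csm_open Ch.
      near=> z => Bz Iz.
      have Cz : Csm h z by near: z.
      have Fz : \forall w \near z, B w.1 -> I01 w.2 -> F w.1 w.2 = h w by near: z.
      rewrite (nbhs_singleton Fz Bz Iz).
      have hz : (fun t' => h (z.1, t')) @ within I01 (nbhs z.2) --> h z.
        move=> A /(Csm_cont Cz); rewrite /nbhs /= /within => HA.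
        have : \forall w \near (z.1, z.2), A (h w) by rewrite -surjective_pairing.
        by move=> /near_pairr; apply: filterS.
      apply: cvg_trans hz; apply: near_eq_cvg; rewrite near_withinE.
      have : \forall w \near (z.1, z.2), B w.1 -> I01 w.2 -> F w.1 w.2 = h w.
        by rewrite -surjective_pairing.
      by move=> /near_pairr; apply: filterS => t' /= E It'; rewrite E.
    by apply: near_pair_swap.
  by apply: filterS => e He Be; apply/within_contP => t It; exact: He.
have cdF : {within I01, continuous dF}.
  apply/within_contP => t It; have [h [Ch _ Fh]] := H t It.
  rewrite (nbhs_singleton Fh It).
  have hz : (fun t' => 'D_(1, 0) h (e0, t')) @ within I01 (nbhs t) --> 'D_(1, 0) h (e0, t).
    have D1 : Csm ('D_(1, 0) h) (e0, t) by exact: Csm_derive.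
    move=> A /(Csm_cont D1); rewrite /nbhs /= /within => HA.
    by have := near_pairr HA; apply: filterS.
  apply: cvg_trans hz; apply: near_eq_cvg; rewrite near_withinE.
  by apply: filterS Fh => t' /= E It'; rewrite E.
have FG : Filter (within B e0^') by exact: within_filter.
have sub A : nbhs e0 A -> within B e0^' A.
  move=> HA; suff : \forall u \near e0, u != e0 -> B u -> A u by [].
  by apply: filterS HA => e + _ _.
pose Q e t := (e - e0)^-1 * (F e t - F e0 t).
have cF' : \forall e \near within B e0^', {within I01, continuous (F e)}.
  suff : \forall e \near e0, e != e0 -> B e -> {within I01, continuous (F e)} by [].
  by apply: filterS cF => e + _.
have cF0 : {within I01, continuous (F e0)} by exact: nbhs_singleton cF Be0.
have cQ : \forall e \near within B e0^', {within I01, continuous (Q e)}.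
  apply: filterS cF' => e cFe; apply: within_cont_mul.
    by apply/within_contP => t _; exact: cvg_cst.
  exact: within_cont_sub.
have : (fun e => int01 (Q e)) @ within B e0^' --> int01 dF.
  apply: int01_cvg => // t It e ep.
  have [h [Ch Fh Fd]] := H t It.
  have e2 : 0 < e / 2 by rewrite divr_gt0.
  have D1 : Csm ('D_(1, 0) h) (e0, t) by exact: Csm_derive.
  have /cvgrPdist_le /(_ _ e2) cD := Csm_cont D1.
  have dh := Csm_open Ch.
  have Fd' : \forall z \near (e0, t), I01 z.2 -> dF z.2 = 'D_(1, 0) h (e0, z.2).
    have /nbhs_ballP[d /= d0 Hd] := Fd; apply/nbhs_ballP; exists d => //= z [_ /=].
    exact: Hd.
  have /nbhs_ballP[d /= d0 Hd] : \forall z \near (e0, t), [/\ Csm h z,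
      (B z.1 -> I01 z.2 -> F z.1 z.2 = h z),
      `|'D_(1, 0) h (e0, t) - 'D_(1, 0) h z| <= e / 2 &
      I01 z.2 -> dF z.2 = 'D_(1, 0) h (e0, z.2)].
    by near=> z; split; near: z.
  have : \forall t' \near t & u \near within B e0^',
      (ball (e0, t) d (u, t') /\ u != e0) /\ B u.
    exists (ball t d, [set u | (ball e0 d u /\ u != e0) /\ B u]).
      split=> /=; first exact: nbhsx_ballx.
      suff : \forall u \near e0, u != e0 -> B u -> (ball e0 d u /\ u != e0) /\ B u by [].
      by near=> u => ? ?; do !split=> //; near: u; exact: nbhsx_ballx.
    by move=> [t' u] /= [? [[? ?] ?]].
  apply: filterS => -[t' u] /= [[bu ue] Bu] It'.
  have ue0 : u - e0 != 0 by rewrite subr_eq0.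
  have [/= bu1 bu2] := bu.
  have shift (s : R) : s *: ((1, 0) : R * R) + (e0, t') = (s + e0, t').
    by congr (_, _) => /=; rewrite /GRing.scale /= ?mulr1 ?mulr0 ?add0r.
  have inb (s : R) : `|s| <= `|u - e0| -> ball (e0, t) d (s + e0, t').
    move=> su; split=> //=; rewrite -ball_normE /= opprD addrCA subrr addr0 normrN.
    by apply: le_lt_trans su _; move: bu1; rewrite -ball_normE /= distrC.
  (* The quotient equals the partial derivative of [h] at (s + e0, t'), a point still in the ball
     where that derivative is within e / 2 of its value at (e0, t). *)
  have [|s su E] := @MVT_dir R _ h ('D_(1, 0) h) (e0, t') (1, 0) (u - e0).
    move=> s su; apply: derivableP; apply: diff_derivable; rewrite shift.
    by have [/Csm_diff] := Hd _ (inb s su).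
  move: E; rewrite !shift subrK => E.
  have [_ Fu _ _] := Hd _ bu.
  have in0 : ball (e0, t) d (e0, t') by split=> //=; exact: ballxx.
  have [_ F0 D0 dF0] := Hd _ in0; have [_ _ Ds _] := Hd _ (inb s su).
  rewrite /Q (Fu Bu It') (F0 Be0 It') /= E mulKf // (dF0 It') /=.
  move: D0 Ds; rewrite !ler_norml => /andP[? ?] /andP[? ?]; lra.
rewrite /is_deriv_in; apply: cvg_trans; apply: near_eq_cvg.
near=> e; rewrite /Q.
have ce : {within I01, continuous (F e)} by near: e.
by rewrite int01_Zl ?int01_B //; exact: within_cont_sub.
Unshelve. all: by end_near. Qed.

End ParamDeriv.

(** * Bump functions *)

Section Bump.
Variable R : realType.

(* The derivatives of exp(-1/x) are combinations of the x^-m exp(-1/x). *)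
Definition flat (m : nat) (x : R) : R :=
  if 0 < x then x^-1 ^+ m * expR (- x^-1) else 0.

Lemma flat_ge0 m x : 0 <= flat m x.
Proof.
rewrite /flat; case: ifP => // x0.
by rewrite mulr_ge0 ?expR_ge0 // exprn_ge0 // invr_ge0 ltW.
Qed.

(** With u = 1/x, the exponential series gives u^(m+1) / (m+1)! <= exp u. This linear bound is what
    differentiability at 0 requires. *)
Lemma flat_bound m (x : R) : flat m x <= (m.+1)`!%:R * `|x|.
Proof.
rewrite /flat; case: ifP => x0; last by rewrite mulr_ge0.
have u0 : 0 < x^-1 by rewrite invr_gt0.
have H : x^-1 ^+ m.+1 <= (m.+1)`!%:R * expR x^-1.
  have := expR_ge1Dxn m (ltW u0) => H.
  rewrite -ler_pdivrMl ?ltr0n ?fact_gt0 // mulrC.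
  by apply: le_trans H; rewrite lerDr.
rewrite expRN ler_pdivrMr ?expR_gt0 // (gtr0_norm x0).
move: H; rewrite exprS => H.
by rewrite mulrAC -ler_pdivrMr // mulrC.
Qed.

Lemma is_derive_inv (x : R) : x != 0 -> is_derive x 1 (fun y : R => y^-1) (- (x^-1 ^+ 2)).
Proof.
move=> x0; apply: DeriveDef; first exact: (derivableV x0).
rewrite (_ : (fun _ => _) = (fun y => (id y)^-1)) // deriveV // derive_id.
by rewrite /GRing.scale /= mulr1 -exprVn.
Qed.

Lemma is_derive_flat m (x : R) : is_derive x 1 (flat m) (- m%:R * flat m.+1 x + flat m.+2 x).
Proof.
have [x0|x0|x0] := ltgtP x 0.
- have -> : - m%:R * flat m.+1 x + flat m.+2 x = 0.
    by rewrite /flat ltNge (ltW x0) /= mulr0 addr0.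
  apply: (@near_eq_is_derive _ _ _ (cst 0)).
    have : \forall y \near x, y < 0 by exact: lt_nbhsl.
    by apply: filterS => y y0; rewrite /flat ltNge (ltW y0).
- have u0 : x^-1 != 0 by rewrite invr_eq0 gt_eqF.
  have xn0 : x != 0 by rewrite gt_eqF.
  apply: (@near_eq_is_derive _ _ _ (((fun y : R => y^-1) ^+ m) * (expR \o (fun y => - y^-1)))).
    have : \forall y \near x, 0 < y by exact: lt_nbhsr.
    by apply: filterS => y y0; rewrite /flat y0 !fctE.
  have d1 := is_derive_inv xn0.
  have d2 : is_derive x 1 (fun y : R => - y^-1) (x^-1 ^+ 2).
    by rewrite -[_ ^+ 2]opprK; exact: is_deriveN.
  have d3 := @is_derive1_comp R (@expR R) (fun y => - y^-1) x _ _ (is_derive_expR (- x^-1)) d2.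
  have d4 := is_deriveX m d1.
  apply: is_derive_eq (is_deriveM d4 d3) _.
  rewrite /flat x0 !fctE /GRing.scale /=.
  case: (m) => [|k] /=; first by rewrite !mul0r mulr0 addr0 oppr0 mul0r add0r expr0 mul1r mulrC.
  by rewrite !exprS; ring.
rewrite x0.
have -> : - m%:R * flat m.+1 0 + flat m.+2 0 = 0 :> R.
  by rewrite /flat ltxx mulr0 addr0.
apply: is_deriv_in_derive; apply/is_deriv_inP => e e0.
have C0 : 0 < (m.+2)`!%:R :> R by rewrite ltr0n fact_gt0.
have : \forall u \near (0 : R), `|u| <= e / (m.+2)`!%:R.
  have eC : 0 < e / (m.+2)`!%:R by rewrite divr_gt0.
  have /cvgrPdist_le /(_ _ eC) := @cvg_id _ (nbhs (0 : R)).
  by apply: filterS => u; rewrite sub0r normrN.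
apply: filterS => u Hu _.
rewrite scaler0 !subr0 {2}/flat ltxx subr0 ger0_norm ?flat_ge0 //.
have [u0|u0] := ltP 0 u; last by rewrite /flat ltNge u0 /= mulr_ge0 // ltW.
(* At 0 the difference quotient of [flat m] is [flat m.+1], which [flat_bound] makes small. *)
have -> : flat m u = flat m.+1 u * u.
  rewrite /flat u0 exprS; set p := _ ^+ m; set e' := expR _.
  by field; rewrite gt_eqF.
rewrite (gtr0_norm u0) ler_wpM2r ?(ltW u0) //.
apply: le_trans (flat_bound _ _) _.
by rewrite mulrC -ler_pdivlMr.
Qed.

Lemma Csm_flat m (x : R) : Csm (flat m) x.
Proof.
exists setT; first by split=> //; exact: openT.
move=> k; elim: k m => [|k IH] m.
  move=> y _; have [dy _] := is_derive_flat m y.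
  by apply: differentiable_continuous; apply/derivable1_diffP.
apply: (@Ck_R1 _ k _ _ (fun y => - m%:R * flat m.+1 y + flat m.+2 y)).
- exact: openT.
- by move=> y _; exact: is_derive_flat.
apply: Ck_add; [exact: openT| |exact: IH].
apply: Ck_mul; [exact: openT| |exact: IH].
by apply: Ck_cst; exact: openT.
Qed.

Lemma flat_gt0 (x : R) : 0 < x -> 0 < flat 0 x.
Proof. by move=> x0; rewrite /flat x0 mul1r expR_gt0. Qed.

Lemma flat_le0 m (x : R) : x <= 0 -> flat m x = 0.
Proof. by move=> x0; rewrite /flat ltNge x0. Qed.

(** The standard transition function: 0 for x <= 0 and 1 for x >= 1. *)
Definition smooth_step (x : R) : R := flat 0 x / (flat 0 x + flat 0 (1 - x)).

Lemma smooth_step_den (x : R) : 0 < flat 0 x + flat 0 (1 - x).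
Proof.
have [x0|x0] := ltP 0 x; first by rewrite ltr_pwDl ?flat_gt0 ?flat_ge0.
by rewrite ltr_wpDl ?flat_ge0 // flat_gt0 // subr_gt0 (le_lt_trans x0).
Qed.

Lemma Csm_div (V : normedModType R) (a b : V -> R) x : Csm a x -> Csm b x -> b x != 0 ->
  Csm (fun y => a y / b y) x.
Proof.
move=> Ha Hb bx; apply: Csm_mul => //.
exact: (@Csm_comp _ _ _ _ _ _ b (fun y => y^-1) x Hb (Csm_inv bx)).
Qed.

Lemma Csm_smooth_step (x : R) : Csm smooth_step x.
Proof.
apply: Csm_div; last by rewrite gt_eqF ?smooth_step_den.
  exact: Csm_flat.
apply: Csm_add; first exact: Csm_flat.
apply: (@Csm_comp _ _ _ _ _ _ (fun y : R => 1 - y) (flat 0) x); last exact: Csm_flat.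
by apply: Csm_sub; [exact: Csm_cst|exact: Csm_id].
Qed.

(** The square stands in for |x| and keeps the function smooth at 0; the plateau is |x| <= 1, and
    the function vanishes once x^2 >= 2. *)
Definition bump1 (x : R) : R := smooth_step (2 - x * x).

Lemma Csm_bump1 x : Csm bump1 x.
Proof.
apply: (@Csm_comp _ _ _ _ _ _ (fun y : R => 2 - y * y) smooth_step x); last exact: Csm_smooth_step.
by apply: Csm_sub; [exact: Csm_cst|apply: Csm_mul; exact: Csm_id].
Qed.

Lemma bump1_1 (x : R) : `|x| <= 1 -> bump1 x = 1.
Proof.
rewrite ler_norml => /andP[x1 x2]; rewrite /bump1 /smooth_step.
rewrite (flat_le0 0 (x := 1 - (2 - x * x))); last by nra.
by rewrite addr0 divff // gt_eqF // flat_gt0 //; nra.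
Qed.

Lemma bump1_0 (x : R) : 2 <= `|x| -> bump1 x = 0.
Proof.
move=> x2; rewrite /bump1 /smooth_step flat_le0 ?mul0r //.
have : 2 * 2 <= `|x| * `|x| by apply: ler_pM.
by rewrite -normrM ger0_norm; [lra|rewrite -expr2 sqr_ge0].
Qed.

Lemma bump1_ge0 (x : R) : 0 <= bump1 x.
Proof. by rewrite /bump1 /smooth_step divr_ge0 ?flat_ge0 // ltW ?smooth_step_den. Qed.

Lemma bump1_le1 (x : R) : bump1 x <= 1.
Proof.
rewrite /bump1 /smooth_step ler_pdivrMr ?smooth_step_den // mul1r lerDl; exact: flat_ge0.
Qed.

Lemma rV_norm_le n (y : 'rV[R]_n) (e : R) : 0 <= e ->
  `|y| <= e <-> forall i, `|y 0 i| <= e.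
Proof.
move=> e0; split.
  move=> H i; apply: le_trans H; rewrite [leRHS]/Num.norm /= mx_normrE.
  exact: (le_bigmax _ (fun ij => `|y ij.1 ij.2|) (0, i)).
move=> H; rewrite [leLHS]/Num.norm /= mx_normrE; apply: bigmax_le => //= -[i j] _ /=.
by rewrite (ord1 i).
Qed.

Lemma rV_norm_lt n (y : 'rV[R]_n) (e : R) : 0 < e ->
  `|y| < e <-> forall i, `|y 0 i| < e.
Proof.
move=> e0; split.
  by move=> H i; apply: le_lt_trans H; apply: (rV_norm_le _ _).1.
move=> H; rewrite [ltLHS]/Num.norm /= mx_normrE; apply: bigmax_lt => //= -[i j] _ /=.
by rewrite (ord1 i).
Qed.

(** Balls for the sup norm are cubes, so a product of bumps in the coordinates is a bump in the
    norm. *)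
Lemma bump_rV n (y0 : 'rV[R]_n) (rho : R) : 0 < rho -> exists psi : 'rV[R]_n -> R,
  [/\ forall y, Csm psi y, forall y, `|y - y0| <= rho -> psi y = 1,
      forall y, 2 * rho <= `|y - y0| -> psi y = 0 & forall y, 0 <= psi y <= 1].
Proof.
move=> r0; exists (fun y => \prod_(i < n) bump1 ((y 0 i - y0 0 i) / rho)); split.
- move=> y; apply: Csm_prod => i _.
  apply: (@Csm_comp _ _ _ _ _ _ (fun y : 'rV[R]_n => (y 0 i - y0 0 i) / rho) bump1 y).
    apply: Csm_mul; last exact: Csm_cst.
    apply: Csm_sub; last exact: Csm_cst.
    by have /Csm_rV := Csm_id y; exact.
  exact: Csm_bump1.
- move=> y /(rV_norm_le _ (ltW r0)) H; rewrite big1 // => i _; apply: bump1_1.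
  rewrite normrM normfV (gtr0_norm r0) ler_pdivrMr // mul1r.
  by have := H i; rewrite !mxE.
- move=> y H.
  have [i Hi] : exists i, 2 * rho <= `|y 0 i - y0 0 i|.
    apply: contrapT => nH; move: H; apply/negP; rewrite -ltNge.
    apply/rV_norm_lt => [|i]; first by rewrite mulr_gt0.
    by rewrite !mxE ltNge; apply/negP => Hi; apply: nH; exists i.
  rewrite (bigD1 i) //= bump1_0 ?mul0r //.
  by rewrite normrM normfV (gtr0_norm r0) ler_pdivlMr.
- move=> y; apply/andP; split.
    by apply: prodr_ge0 => i _; exact: bump1_ge0.
  by apply: prodr_ile1 => i _; rewrite bump1_ge0 bump1_le1.
Qed.

(** The germ of [f] is kept and the rest cut off. The radius d / 4 makes the bump vanish from
    distance d / 2 on, well inside the ball of radius d where [f] is smooth. *)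
Lemma Csm_extend n (W : normedModType R) {fW : fdim W} (f : 'rV[R]_n -> W) y0 : Csm f y0 ->
  exists2 g : 'rV[R]_n -> W, (forall y, Csm g y) & {near y0, g =1 f}.
Proof.
move=> Hf; have /nbhs_ballP[d /= d0 Hd] := Csm_open Hf.
have r0 : 0 < d / 4 by rewrite divr_gt0.
have [psi [p1 p2 p3 _]] := bump_rV y0 r0.
exists (fun y => psi y *: f y).
  move=> y; have [yd|yd] := ltP `|y - y0| d.
    apply: Csm_scale; first exact: p1.
    by apply: Hd; rewrite -ball_normE /= distrC.
  apply: (@Csm_near _ _ _ (fun _ => 0)); last exact: Csm_cst.
  have d2 : 0 < d / 2 by rewrite divr_gt0.
  apply/nbhs_ballP; exists (d / 2) => //= z; rewrite -ball_normE /= => yz.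
  rewrite p3 ?scale0r //.
  have := ler_normD (y - z) (z - y0); rewrite addrA subrK => H.
  by have : d <= `|y - z| + `|z - y0|; [exact: le_trans H|lra].
apply/nbhs_ballP; exists (d / 4) => //= y; rewrite -ball_normE /= distrC => /ltW yd.
by rewrite p2 // scale1r.
Qed.

End Bump.

(** * Smooth functions on manifolds *)

Section MSm.
Variables (R : realType) (n : nat) (M : manifold R n).

Definition msmooth_at (W : normedModType R) (f : M -> W) (x : M) :=
  forall c, atlas c -> cdom c x -> Csm (f \o cinv c) (cmap c x).

Lemma cinv_at (c : chart R n M) x : cdom c x -> {for cmap c x, continuous (cinv c)}.
Proof. by move=> cx; apply: cinv_cont; exists x. Qed.

Lemma near_cimg (c : chart R n M) x (P : set M) : cdom c x -> nbhs x P ->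
  \forall y \near cmap c x, P (cinv c y).
Proof.
move=> cx Px; have := @cinv_at c x cx P; apply.
by rewrite cmapK.
Qed.

Lemma cdom_nbhs (c : chart R n M) x : cdom c x -> nbhs x (cdom c).
Proof. by move=> cx; apply: open_nbhs_nbhs; split=> //; exact: cdom_open. Qed.

Lemma near_cinvK (c : chart R n M) x : cdom c x ->
  \forall y \near cmap c x, cdom c (cinv c y) /\ cmap c (cinv c y) = y.
Proof.
move=> cx; have : nbhs (cmap c x) (cmap c @` cdom c).
  by apply: open_nbhs_nbhs; split; [exact: cimg_open|exists x].
by apply: filterS => _ [z cz <-]; rewrite cmapK.
Qed.

Lemma near_cmap (c : chart R n M) x (P : set 'rV[R]_n) : cdom c x -> nbhs (cmap c x) P ->
  \forall y \near x, P (cmap c y).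
Proof. by move=> cx Px; exact: (cmap_cont cx). Qed.

Lemma cimg_nbhs (c : chart R n M) (U : set M) x : open U -> U x -> cdom c x ->
  nbhs (cmap c x) (cmap c @` (cdom c `&` U)).
Proof.
move=> oU Ux cx.
have H1 := near_cimg cx (open_nbhs_nbhs (conj oU Ux)); have H2 := near_cinvK cx.
near=> y; exists (cinv c y); last by have [] : cdom c (cinv c y) /\ cmap c (cinv c y) = y by near: y.
split; last by near: y.
by have [] : cdom c (cinv c y) /\ cmap c (cinv c y) = y by near: y.
Unshelve. all: by end_near. Qed.

Lemma cimg_openI (c : chart R n M) (U : set M) : open U -> open (cmap c @` (cdom c `&` U)).
Proof.
move=> oU; rewrite openE => _ [x [cx Ux] <-].
exact: cimg_nbhs.
Qed.

Lemma msmooth_onP (W : normedModType R) (U : set M) (f : M -> W) : open U ->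
  msmooth_on U f <-> (forall x, U x -> msmooth_at f x).
Proof.
move=> oU; split=> H.
  move=> x Ux c ac cx; apply: (@Cinf_Csm _ _ _ (cmap c @` (cdom c `&` U))).
  - exact: cimg_openI.
  - by exists x.
  - exact: H.
move=> c ac; apply: Csm_Cinf => _ [x [cx Ux] <-].
exact: H.
Qed.

Lemma msmoothP (f : M -> R) : msmooth f <-> (forall x, msmooth_at f x).
Proof.
rewrite /msmooth (msmooth_onP _ openT).
by split=> [H x|H x _]; exact: H.
Qed.

(** Transition maps are smooth, so one chart around [x] decides for all. *)
Lemma msmooth_at_chart (W : normedModType R) {fW : fdim W} (f : M -> W) x c : atlas c -> cdom c x ->
  Csm (f \o cinv c) (cmap c x) -> msmooth_at f x.
Proof.
move=> ac cx Hf c' ac' c'x.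
have Ht : Csm (cmap c \o cinv c') (cmap c' x).
  apply: (@Cinf_Csm _ _ _ (cmap c' @` (cdom c' `&` cdom c))).
  - by apply: cimg_openI; exact: cdom_open.
  - by exists x.
  - exact: atlas_compat.
apply: (@Csm_near _ _ _ ((f \o cinv c) \o (cmap c \o cinv c'))).
  have := near_cimg c'x (cdom_nbhs cx).
  by apply: filterS => y cy /=; rewrite cmapK.
by apply: (@Csm_comp _ _ _ (fdim_rV R n)) => //=; rewrite cmapK.
Qed.

Lemma msmooth_at_near (W : normedModType R) (f g : M -> W) x : {near x, f =1 g} -> msmooth_at f x -> msmooth_at g x.
Proof.
move=> fg Hf c ac cx; apply: Csm_near (Hf c ac cx).
exact: (near_cimg cx fg).
Qed.

Lemma msmooth_at_cst (W : normedModType R) (w : W) x : msmooth_at (fun _ => w) x.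
Proof. by move=> c ac cx; exact: (Csm_cst w). Qed.

Lemma msmooth_at_add (W : normedModType R) (f g : M -> W) x : msmooth_at f x -> msmooth_at g x ->
  msmooth_at (fun y => f y + g y) x.
Proof. by move=> Hf Hg c ac cx; exact: (Csm_add (Hf c ac cx) (Hg c ac cx)). Qed.

Lemma msmooth_at_sum (W : normedModType R) (I : Type) (s : seq I) (F : I -> M -> W) x :
  (forall i, msmooth_at (F i) x) -> msmooth_at (fun y => \sum_(i <- s) F i y) x.
Proof. by move=> H c ac cx; apply: (@Csm_sum _ _ _ _ s xpredT (fun i => F i \o cinv c)) => i _; exact: H. Qed.

Lemma msmooth_at_mul (f g : M -> R) x : msmooth_at f x -> msmooth_at g x -> msmooth_at (fun y => f y * g y) x.
Proof. by move=> Hf Hg c ac cx; exact: (Csm_mul (Hf c ac cx) (Hg c ac cx)). Qed.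

Lemma msmooth_at_scale (W : normedModType R) {fW : fdim W} (f : M -> R) (g : M -> W) x :
  msmooth_at f x -> msmooth_at g x -> msmooth_at (fun y => f y *: g y) x.
Proof. by move=> Hf Hg c ac cx; exact: (Csm_scale (Hf c ac cx) (Hg c ac cx)). Qed.

Lemma msmooth_at_rV m (f : M -> 'rV[R]_m) x : (forall i, msmooth_at (fun y => f y 0 i : R) x) <-> msmooth_at f x.
Proof.
split=> H.
  by move=> c ac cx; apply/Csm_rV => i; exact: (H i c ac cx).
by move=> i c ac cx; have /Csm_rV := H c ac cx; apply.
Qed.

Lemma msmooth_at_cmap c x : atlas c -> cdom c x -> msmooth_at (cmap c) x.
Proof.
move=> ac cx; apply: (msmooth_at_chart ac cx).
apply: Csm_near (Csm_id _).
by apply: filterS (near_cinvK cx) => y [_ /= ->].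
Qed.

Lemma msmooth_at_compl (W X : normedModType R) {fW : fdim W} {fX : fdim X} (f : M -> W) (h : W -> X) x :
  msmooth_at f x -> Csm h (f x) -> msmooth_at (h \o f) x.
Proof.
move=> Hf Hh c ac cx.
by apply: (@Csm_comp _ _ _ _ _ _ (f \o cinv c) h); [exact: Hf|rewrite /= cmapK].
Qed.

Lemma msmooth_at_open (W : normedModType R) {fW : fdim W} (f : M -> W) x : msmooth_at f x ->
  \forall y \near x, msmooth_at f y.
Proof.
move=> Hf; have [c ac cx] := atlas_cover x.
have := near_cmap cx (Csm_open (Hf c ac cx)).
have := cdom_nbhs cx; apply: filterS2 => y cy Hy.
exact: (msmooth_at_chart ac cy).
Qed.

(** A bump in a chart is extended by 0. The Hausdorff property makes the compact set [K] carrying it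
    closed in [M], hence the extension smooth off the chart. Vanishing near, and not only at, each
    point outside [U] makes products with objects defined on [U] globally smooth. *)
Lemma bump_manifold (x : M) (U : set M) : nbhs x U -> exists chi : M -> R,
  [/\ msmooth chi, \forall y \near x, chi y = 1 &
      forall y : M, ~ U y -> \forall z \near y, chi z = 0].
Proof.
move=> nU; have [c ac cx] := atlas_cover x.
have nU' : nbhs (cmap c x) [set y | U (cinv c y) /\ (cdom c (cinv c y) /\ cmap c (cinv c y) = y)].
  by apply: filterI; [exact: near_cimg|exact: near_cinvK].
move: nU' => /nbhs_ballP[d /= d0 Hd].
have r0 : 0 < d / 4 by rewrite divr_gt0.
have [psi [p1 p2 p3 p4]] := bump_rV (cmap c x) r0.
pose B := [set y : 'rV[R]_n | `|y - cmap c x| <= d / 2].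
have Bd y : B y -> [/\ U (cinv c y), cdom c (cinv c y) & cmap c (cinv c y) = y].
  move=> By; have : ball (cmap c x) d y.
    rewrite -ball_normE /= distrC; apply: le_lt_trans By _.
    by rewrite ltr_pdivrMr // ltr_pMr // ltr1n.
  by move=> /Hd[? [? ?]].
pose K := cinv c @` B.
have cB : compact B.
  apply: bounded_closed_compact.
    exists (`|cmap c x| + d / 2); split; first exact: num_real.
    move=> m Hm y By /=; apply: le_trans (ltW Hm).
    have := ler_normD (y - cmap c x) (cmap c x); rewrite subrK => H.
    by apply: le_trans H _; rewrite addrC lerD2l.
  apply: (@closed_comp _ _ (fun y : 'rV[R]_n => `|y - cmap c x|) [set z | z <= d / 2]).
    move=> y _; apply: continuous_comp; last exact: norm_continuous.
    exact: (Csm_cont (Csm_add (Csm_id y) (Csm_cst (- cmap c x) y))).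
  exact: closed_le.
have cK : closed K.
  apply: compact_closed; first exact: mhausdorff.
  apply: continuous_compact => //; apply: continuous_in_subspaceT => y.
  rewrite inE => /Bd [_ cy <-]; exact: cinv_at.
pose chi (y : M) := if pselect (cdom c y) then psi (cmap c y) else 0.
have chiE y : cdom c y -> chi y = psi (cmap c y).
  by rewrite /chi; case: pselect.
have chi0 y : ~ K y -> chi y = 0.
  move=> nK; rewrite /chi; case: pselect => // cy; apply: p3.
  rewrite leNgt; apply/negP => H; apply: nK; exists (cmap c y); last by rewrite cmapK.
  by rewrite /B /=; lra.
exists chi; split.
- apply/msmoothP => y; have [cy|cy] := pselect (cdom c y).
    apply: (@msmooth_at_near _ (psi \o cmap c)).
      by apply: filterS (cdom_nbhs cy) => z cz; rewrite chiE.
    by apply: msmooth_at_compl; [exact: msmooth_at_cmap|exact: p1].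
  have nKy : ~ K y by move=> [z /Bd [_ cz _] E]; apply: cy; rewrite -E.
  apply: (@msmooth_at_near _ (fun _ => 0)); last exact: msmooth_at_cst.
  have : nbhs y (~` K) by apply: open_nbhs_nbhs; split=> //; exact: closed_openC.
  by apply: filterS => z nz; rewrite chi0.
- have : nbhs (cmap c x) (ball (cmap c x) (d / 4)) by exact: nbhsx_ballx.
  move=> /(near_cmap cx); apply: filterS2 (cdom_nbhs cx) => y cy.
  by rewrite -ball_normE /= distrC => /ltW H; rewrite chiE // p2.
- move=> y nUy; have nKy : ~ K y by move=> [z /Bd [Uz _ _] E]; apply: nUy; rewrite -E.
  have : nbhs y (~` K) by apply: open_nbhs_nbhs; split=> //; exact: closed_openC.
  by apply: filterS => z nz; rewrite chi0.
Qed.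

Lemma msmooth_at_extend (W : normedModType R) {fW : fdim W} (f : M -> W) x : msmooth_at f x ->
  exists2 g : M -> W, (forall y, msmooth_at g y) & {near x, g =1 f}.
Proof.
move=> Hf; have [chi [c1 c2 c3]] := bump_manifold (msmooth_at_open Hf).
exists (fun y => chi y *: f y).
  move=> y; have [My|nMy] := pselect (msmooth_at f y).
    by apply: msmooth_at_scale => //; exact: (msmoothP chi).1.
  apply: (@msmooth_at_near _ (fun _ => 0)); last exact: msmooth_at_cst.
  by apply: filterS (c3 y nMy) => z ->; rewrite scale0r.
by apply: filterS c2 => y ->; rewrite scale1r.
Qed.

End MSm.

(** * Families of solutions of differential equations *)

Section Estimates.
Variables (R : realType) (N : nat).
Local Notation E := 'rV[R]_N.

Lemma compact_cball (r : R) : compact [set y : E | `|y| <= r].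
Proof.
apply: bounded_closed_compact.
  exists r; split; first exact: num_real.
  by move=> m Hm y /= yr; exact: le_trans yr (ltW Hm).
apply: (@closed_comp _ _ (fun y : E => `|y|) [set z | z <= r]).
  by move=> y _; exact: norm_continuous.
exact: closed_le.
Qed.

Lemma Csm_bounded (f : E -> R) (r : R) : (forall y, Csm f y) ->
  exists2 B, 0 <= B & forall y, `|y| <= r -> `|f y| <= B.
Proof.
move=> Hf; have : compact (f @` [set y : E | `|y| <= r]).
  apply: continuous_compact; last exact: compact_cball.
  by apply: continuous_subspaceT => y; exact: Csm_cont.
move=> /compact_bounded [B [_ HB]].
exists (Num.max 0 (B + 1)); first by rewrite le_max lexx.
move=> y yr; apply: (HB (Num.max 0 (B + 1))).
  by rewrite lt_max ltrDl ltr01 orbT.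
by exists y.
Qed.

Lemma coord_le (y : E) i : `|y 0 i| <= `|y|.
Proof. by have := (rV_norm_le y (normr_ge0 y)).1 (lexx _) i. Qed.

Lemma derive_rVE (X : normedModType R) (f : E -> X) y v : differentiable f y ->
  'D_v f y = \sum_i v 0 i *: 'D_(delta_mx 0 i) f y.
Proof. by move=> df; rewrite (@derive_fbE _ _ (fdim_rV R N)). Qed.

Lemma derive_bound (f : E -> R) y v (B : R) : differentiable f y ->
  (forall i, `|'D_(delta_mx 0 i) f y| <= B) -> `|'D_v f y| <= N%:R * B * `|v|.
Proof.
move=> df HB; rewrite derive_rVE //.
apply: le_trans (ler_norm_sum _ _ _) _.
have -> : N%:R * B * `|v| = \sum_(i < N) `|v| * B.
  by rewrite sumr_const card_ord -mulr_natl; ring.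
by apply: ler_sum => i _; rewrite normrM ler_pM // coord_le.
Qed.

(** [MVT_dir] locates its parameter only by |s| <= 1, so the point may lie on the prolongation of
    the segment beyond [v]; hence the radius 3 r. *)
Lemma segment_le (u v : E) (s r : R) : `|s| <= 1 -> `|u| <= r -> `|v| <= r ->
  `|s *: (u - v) + v| <= 3 * r.
Proof.
move=> s1 ur vr; apply: le_trans (ler_normD _ _) _; rewrite normrZ.
have : `|s| * `|u - v| <= 1 * (r + r).
  by rewrite ler_pM //; apply: le_trans (ler_normB _ _) _; exact: lerD.
by move=> H; apply: le_trans (lerD H vr) _; lra.
Qed.

Lemma Csm_dbounded (f : E -> R) (r : R) : (forall y, Csm f y) ->
  exists2 B, 0 <= B & forall y i, `|y| <= r -> `|'D_(delta_mx 0 i) f y| <= B.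
Proof.
move=> Hf.
have H i : exists B, 0 <= B /\ forall y : E, `|y| <= r -> `|'D_(delta_mx 0 i) f y| <= B.
  have [|B B0 HB] := @Csm_bounded ('D_(delta_mx 0 i) f) r; last by exists B.
  by move=> y; exact: Csm_derive.
have [B HB] := choice H.
exists (\sum_i B i); first by apply: sumr_ge0 => i _; have [] := HB i.
move=> y i yr; apply: le_trans ((HB i).2 y yr) _.
by rewrite (bigD1 i) //= lerDl sumr_ge0 // => j _; have [] := HB j.
Qed.

Lemma Csm_lip (f : E -> R) (r : R) : (forall y, Csm f y) ->
  exists2 L, 0 <= L & forall u v, `|u| <= r -> `|v| <= r -> `|f u - f v| <= L * `|u - v|.
Proof.
move=> Hf; have [B B0 HB] := Csm_dbounded (3 * r) Hf.
exists (N%:R * B); first by rewrite mulr_ge0.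
move=> u v ur vr.
have [|s s1 E] := @MVT_dir R _ f ('D_(u - v) f) v (u - v) 1.
  by move=> s _; apply: derivableP; apply: diff_derivable; exact: Csm_diff.
move: E; rewrite scale1r subrK mul1r => ->.
apply: derive_bound; first exact: Csm_diff.
by move=> i; apply: HB; rewrite normr1 in s1; exact: segment_le.
Qed.

(** The derivative at the mean value point is compared with the one at [v] through Lipschitz
    continuity of the partial derivatives, which yields the quadratic remainder. *)
Lemma Csm_lip2 (f : E -> R) (r : R) : (forall y, Csm f y) ->
  exists2 L, 0 <= L & forall u v, `|u| <= r -> `|v| <= r ->
    `|f u - f v - 'D_(u - v) f v| <= L * `|u - v| ^+ 2.
Proof.
move=> Hf.
have H i : exists L, 0 <= L /\ forall u v : E, `|u| <= 3 * r -> `|v| <= 3 * r ->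
    `|'D_(delta_mx 0 i) f u - 'D_(delta_mx 0 i) f v| <= L * `|u - v|.
  have [|B B0 HB] := @Csm_lip ('D_(delta_mx 0 i) f) (3 * r); last by exists B.
  by move=> y; exact: Csm_derive.
have [B HB] := choice H.
exists (\sum_i B i); first by apply: sumr_ge0 => i _; have [] := HB i.
move=> u v ur vr.
have r0 : 0 <= r by exact: le_trans ur.
have [|s s1 E] := @MVT_dir R _ f ('D_(u - v) f) v (u - v) 1.
  by move=> s _; apply: derivableP; apply: diff_derivable; exact: Csm_diff.
move: E; rewrite scale1r subrK mul1r => ->; rewrite normr1 in s1.
rewrite !derive_rVE; try exact: Csm_diff.
rewrite -sumrB mulr_suml; apply: le_trans (ler_norm_sum _ _ _) _.
apply: ler_sum => i _; rewrite -mulrBr normrM expr2 mulrA mulrC ler_pM //; last exact: coord_le.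
apply: le_trans ((HB i).2 _ _ (segment_le s1 ur vr) _) _.
  by apply: le_trans vr _; lra.
rewrite addrK normrZ ler_wpM2l //; first by have [] := HB i.
by rewrite -[leRHS]mul1r ler_wpM2r.
Qed.

End Estimates.

(** * Limits of differentiable functions, and primitives *)

Section LimitDerivative.
Variable R : realType.

Lemma MVT_bound (f g : R -> R) (c K : R) : (forall s : R, `|s| < c -> is_derive s 1 f (g s)) ->
  (forall s : R, `|s| < c -> `|g s| <= K) -> forall s u, `|s| < c -> `|u| < c ->
  `|f u - f s| <= K * `|u - s|.
Proof.
move=> df Hg; wlog su : / true by exact.
move=> s u sc uc; wlog lesu : s u sc uc / s <= u.
  move=> H; have [/H|/ltW/H] := leP s u; first exact.
  by rewrite distrC [X in _ * X]distrC; exact.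
have [||x] := @MVT_segment R f g s u lesu.
- move=> x; rewrite in_itv /= => /andP[sx xu]; apply: df.
  by move: sc uc; rewrite !ltr_norml => /andP[? ?] /andP[? ?]; lra.
- apply: continuous_in_subspaceT => x; rewrite inE /= in_itv /= => /andP[sx xu].
  have [dx _] : is_derive x 1 f (g x).
    by apply: df; move: sc uc; rewrite !ltr_norml => /andP[? ?] /andP[? ?]; lra.
  by apply: differentiable_continuous; apply/derivable1_diffP.
rewrite in_itv /= => /andP[sx xu] ->; rewrite normrM ler_wpM2r //; apply: Hg.
by move: sc uc; rewrite !ltr_norml => /andP[? ?] /andP[? ?]; lra.
Qed.

Lemma derive_lim (f g : R -> R) (c : R) :
  (forall e : R, 0 < e -> exists f1 g1 : R -> R, forall s : R, `|s| < c ->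
     [/\ is_derive s 1 f1 (g1 s), `|f1 s - f s| <= e & `|g1 s - g s| <= e]) ->
  forall s : R, `|s| < c -> is_derive s 1 f (g s).
Proof.
move=> H s sc; apply: is_deriv_in_derive; apply/is_deriv_inP => e e0.
have e4 : 0 < e / 4 by rewrite divr_gt0.
have [f1 [g1 H1]] := H _ e4.
(* The mean value inequality compares [f1] with a second approximant [f2]; letting [f2] approach
   [f], as [k] is arbitrary, gives the same bound for the error of [f1]. *)
have K (u : R) : `|u| < c -> `|(f1 u - f u) - (f1 s - f s)| <= 2 * (e / 4) * `|u - s|.
  move=> uc; apply/ler_addgt0Pr => k k0.
  pose k' := Num.min (e / 4) (k / 2 ).
  have k'0 : 0 < k' by rewrite lt_min e4 divr_gt0.
  have [f2 [g2 H2]] := H _ k'0.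
  have : `|(f1 u - f2 u) - (f1 s - f2 s)| <= 2 * (e / 4) * `|u - s|.
    apply: (@MVT_bound (fun u => f1 u - f2 u) (fun u => g1 u - g2 u) c) => // v vc.
      have [d1 _ _] := H1 v vc; have [d2 _ _] := H2 v vc.
      exact: is_deriveB.
    have [_ _ b1] := H1 v vc; have [_ _ b2] := H2 v vc.
    have -> : g1 v - g2 v = (g1 v - g v) - (g2 v - g v) by ring.
    apply: le_trans (ler_normB _ _) _.
    have : k' <= e / 4 by rewrite ge_min lexx.
    by lra.
  have [_ a1 _] := H2 u uc; have [_ a2 _] := H2 s sc.
  have kk : k' <= k / 2 by rewrite ge_min lexx orbT.
  move=> H3.
  have -> : f1 u - f u - (f1 s - f s) = (f1 u - f2 u - (f1 s - f2 s)) + ((f2 u - f u) - (f2 s - f s)) by ring.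
  apply: le_trans (ler_normD _ _) _; apply: lerD => //.
  by apply: le_trans (ler_normB _ _) _; lra.
have [d1 _ b1] := H1 s sc.
have /is_deriv_inP /(_ _ e4) D1 := @is_derive_in _ _ setT _ _ _ d1.
have nc : \forall u \near s, `|u| < c.
  have : {for s, continuous (fun u : R => `|u|)} by exact: norm_continuous.
  by move=> /(_ _ (lt_nbhsl sc)).
near=> u => _.
have uc : `|u| < c by near: u.
have Du : `|f1 u - f1 s - (u - s) *: g1 s| <= e / 4 * `|u - s|.
  have : [set: R] u -> `|f1 u - f1 s - (u - s) *: g1 s| <= e / 4 * `|u - s| by near: u.
  exact.
have Ku := K u uc.
have -> : f u - f s - (u - s) *: g s = (f1 u - f1 s - (u - s) *: g1 s) -
   ((f1 u - f u) - (f1 s - f s)) + (u - s) * (g1 s - g s).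
  by rewrite /GRing.scale /=; ring.
apply: le_trans (ler_normD _ _) _; apply: le_trans (lerD (ler_normB _ _) (lexx _)) _.
rewrite normrM.
have : `|u - s| * `|g1 s - g s| <= `|u - s| * (e / 4) by rewrite ler_wpM2l.
by lra.
Unshelve. all: by end_near. Qed.

(** The limit is the supremum of the numbers u_i - 2 D 2^-i, each of which lies below every u_j + 2
    D 2^-j; the rate of convergence comes with this choice. *)
Lemma geo_lim (u : nat -> R) (D : R) : (forall j, `|u j.+1 - u j| <= D * 2^-1 ^+ j) ->
  exists l, forall j, `|u j - l| <= 2 * D * 2^-1 ^+ j.
Proof.
move=> H.
have D0 : 0 <= D by have := H 0%N; rewrite expr0 mulr1; exact: le_trans.
have ij i k : `|u (i + k)%N - u i| <= 2 * D * (2^-1 ^+ i - 2^-1 ^+ (i + k)).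
  elim: k => [|k IH]; first by rewrite addn0 !subrr normr0 mulr0.
  have := H (i + k)%N; rewrite addnS exprS => Hk.
  have -> : u (i + k).+1 - u i = (u (i + k).+1 - u (i + k)%N) + (u (i + k)%N - u i) by ring.
  apply: le_trans (ler_normD _ _) _; apply: le_trans (lerD Hk IH) _.
  by set a := _ ^+ i; set b := _ ^+ (i + k); lra.
have p0 j : 0 <= 2^-1 ^+ j :> R by rewrite exprn_ge0.
have b i j : u i - 2 * D * 2^-1 ^+ i <= u j + 2 * D * 2^-1 ^+ j.
  have Dp k : 0 <= 2 * D * 2^-1 ^+ k by rewrite !mulr_ge0.
  have [ij'|/ltnW ij'] := leqP i j.
    have := ij i (j - i)%N; rewrite subnKC // ler_norml mulrBr => /andP[? ?].
    by have := Dp j; have := Dp i; lra.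
  have := ij j (i - j)%N; rewrite subnKC // ler_norml mulrBr => /andP[? ?].
  by have := Dp j; have := Dp i; lra.
pose A := [set x | exists i, x = u i - 2 * D * 2^-1 ^+ i].
have uA j : ubound A (u j + 2 * D * 2^-1 ^+ j) by move=> _ [i ->]; exact: b.
have hA : has_sup A.
  by split; [exists (u 0%N - 2 * D * 2^-1 ^+ 0); exists 0%N|exists (u 0%N + 2 * D * 2^-1 ^+ 0)].
exists (sup A) => j.
have h1 : u j - 2 * D * 2^-1 ^+ j <= sup A.
  by have /ubP := sup_upper_bound hA; apply; exists j.
have h2 : sup A <= u j + 2 * D * 2^-1 ^+ j by apply: ge_sup => //; case: hA.
by rewrite ler_norml; lra.
Qed.

(** Integrating from [- c] rather than from 0 makes every |s| < c an interior upper limit; the value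
    at 0 is subtracted afterwards. *)
Lemma primitive (f : R -> R) (c : R) : continuous f -> 0 < c ->
  exists2 P : R -> R, P 0 = 0 & forall s : R, `|s| < c -> is_derive s 1 P (f s).
Proof.
move=> cf c0.
pose I (s : R) := \int[@lebesgue_measure R]_(t in `[- c, s]) f t.
have dI (s : R) : `|s| < c -> is_derive s 1 I (f s).
  rewrite ltr_norml => /andP[s1 s2].
  have [||||dI eI] := @continuous_FTC1 R f (BLeft (- c)) s c.
  - exact: s2.
  - apply: continuous_compact_integrable; first exact: segment_compact.
    by apply: continuous_subspaceT.
  - exact: s1.
  - exact: cf.
  by split; [exact: dI|rewrite -derive1E; exact: eI].
exists (fun s => I s - I 0); first by rewrite subrr.
move=> s sc; rewrite -[f s]subr0.
by apply: is_deriveB; exact: dI.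
Qed.

End LimitDerivative.

(** * Gronwall estimates *)

Section Gronwall.
Variable R : realType.

(** As |v'| <= A v, the function v(s) exp(- A s) is nonincreasing and v(s) exp(A s) nondecreasing;
    the first serves s >= 0, the second s < 0. The factor [a] in [main] is 1 or -1 accordingly. *)
Lemma gronwall1 (v v' : R -> R) (c A : R) : (forall s : R, `|s| < c -> is_derive s 1 v (v' s)) ->
  (forall s : R, `|s| < c -> `|v' s| <= A * v s) -> forall s : R, `|s| < c -> v s <= v 0 * expR (A * `|s|).
Proof.
move=> dv Hv s sc.
have c0 : 0 < c by exact: le_lt_trans sc.
have main (a : R) : `|a| <= 1 -> forall x : R, `|x| < c ->
   is_derive x 1 (fun u => v u * expR (- (a * A) * u)) ((v' x - a * A * v x) * expR (- (a * A) * x)).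
  move=> a1 x xc; have d1 := dv x xc.
  have d2 : is_derive x 1 (fun u : R => - (a * A) * u) (- (a * A)).
    have := is_deriveM (is_derive_cst (- (a * A)) x 1) (is_derive_id x (1 : R)).
    move=> d; apply: is_derive_eq d _; rewrite /cst /GRing.scale /= mulr1 mulr0; ring.
  have d3 := @is_derive1_comp R (@expR R) _ x _ _ (is_derive_expR _) d2.
  apply: is_derive_eq (is_deriveM d1 d3) _.
  by rewrite /GRing.scale /=; ring.
have [s0|s0] := leP 0 s.
  have [|y ys E] := @MVT_dir R _ (fun u => v u * expR (- (1 * A) * u)) 
     (fun x => (v' x - 1 * A * v x) * expR (- (1 * A) * x)) 0 1 s.
    move=> t ts; rewrite addr0 [t *: 1]mulr1; apply: main; first by rewrite normr1.
    exact: le_lt_trans sc.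
  move: E; rewrite !addr0 [s *: 1]mulr1 [y *: 1]mulr1 mulr0 expR0 mulr1 mul1r => E.
  have : s * ((v' y - A * v y) * expR (- A * y)) <= 0.
    rewrite mulr_ge0_le0 // mulr_le0_ge0 ?expR_ge0 // subr_le0.
    by apply: le_trans (Hv y _); [exact: ler_norm|exact: le_lt_trans sc].
  rewrite -E subr_le0 mulNr expRN ler_pdivrMr ?expR_gt0 // ger0_norm //.
have [|y ys E] := @MVT_dir R _ (fun u => v u * expR (- (-1 * A) * u)) 
   (fun x => (v' x - -1 * A * v x) * expR (- (-1 * A) * x)) 0 1 s.
  move=> t ts; rewrite addr0 [t *: 1]mulr1; apply: main; first by rewrite normrN normr1.
  exact: le_lt_trans sc.
move: E; rewrite !addr0 [s *: 1]mulr1 [y *: 1]mulr1 mulr0 expR0 mulr1 !mulN1r !mulNr !opprK => E.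
have : s * ((v' y + A * v y) * expR (A * y)) <= 0.
  rewrite mulr_le0_ge0 ?(ltW s0) // mulr_ge0 ?expR_ge0 //.
  have := Hv y (le_lt_trans ys sc); rewrite ler_norml => /andP[? ?]; lra.
rewrite -E subr_le0 (ltr0_norm s0) mulrN expRN -ler_pdivlMr ?expR_gt0 //.
Qed.

(** The sup norm is not differentiable, so [gronwall1] is applied to the sum of the squared
    coordinates plus d^2. The constant is fixed before [w] and [d], which yields estimates uniform
    over families of solutions. *)
Lemma gronwall N (c K : R) : 0 < c -> 0 <= K -> exists2 C, 0 < C &
  forall (w w' : R -> 'rV[R]_N) (d : R), 0 <= d ->
    (forall s : R, `|s| < c -> forall i, is_derive s 1 (fun s => w s 0 i) (w' s 0 i)) ->
    (forall s : R, `|s| < c -> `|w' s| <= K * `|w s| + d) ->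
    forall s : R, `|s| < c -> `|w s| <= C * (`|w 0| + d).
Proof.
move=> c0 K0; pose n1 : R := N%:R.
have n0 : 0 <= n1 by [].
(* From 2 a (K a + d) <= (2 K + 1) a^2 + d^2 with a = |w|, summed over the coordinates. *)
pose A := 2 * n1 * K + n1.
have A0 : 0 <= A by rewrite addr_ge0 // !mulr_ge0.
pose C := (n1 + 1) * expR (A * c).
have C1 : 1 <= C.
  rewrite -[leLHS]mul1r ler_pM // ?lerDr //.
  by apply: le_trans (expR_ge1Dx _); rewrite lerDl mulr_ge0 // ltW.
exists C; first exact: lt_le_trans C1.
move=> w w' d d0 dw Hw s sc.
pose u s := \sum_i w s 0 i * w s 0 i.
pose u' s := \sum_i 2 * (w s 0 i * w' s 0 i).
have du (x : R) : `|x| < c -> is_derive x 1 (fun s => u s + d ^+ 2) (u' x).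
  move=> xc.
  have H : is_derive x 1 (\sum_i (fun s => w s 0 i * w s 0 i)) (u' x).
    apply: is_derive_sum => i; have di := dw x xc i.
    by apply: is_derive_eq (is_deriveM di di) _; rewrite /GRing.scale /=; ring.
  have := is_deriveD H (is_derive_cst (d ^+ 2) x 1); rewrite addr0.
  by rewrite (_ : _ + _ = (fun s => u s + d ^+ 2)) // funeqE => y; rewrite /= fctE fct_sumE.
have le1 x : `|w x| ^+ 2 <= u x.
  have H i : w x 0 i ^+ 2 <= u x.
    rewrite /u (bigD1 i) //= expr2 lerDl sumr_ge0 // => j _.
    by rewrite -expr2 sqr_ge0.
  have u0 : 0 <= u x by apply: sumr_ge0 => j _; rewrite -expr2 sqr_ge0.
  have : `|w x| <= Num.sqrt (u x).
    apply/rV_norm_le => [|i]; first exact: sqrtr_ge0.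
    by rewrite -sqrtr_sqr ler_sqrt.
  by move=> H'; rewrite -(sqr_sqrtr u0) lerXn2r ?nnegrE ?sqrtr_ge0.
have le2 x : u x <= n1 * `|w x| ^+ 2.
  apply: (@le_trans _ _ (\sum_(i < N) `|w x| ^+ 2)).
    apply: ler_sum => i _; rewrite -expr2 -(ger0_norm (sqr_ge0 (w x 0 i))) normrX.
    by rewrite lerXn2r ?nnegrE // coord_le.
  by rewrite sumr_const card_ord -mulr_natl.
have Hu (x : R) : `|x| < c -> `|u' x| <= A * (u x + d ^+ 2).
  move=> xc; apply: le_trans (ler_norm_sum _ _ _) _.
  apply: (@le_trans _ _ (\sum_(i < N) 2 * (`|w x| * (K * `|w x| + d)))).
    apply: ler_sum => i _; rewrite !normrM [`|2|]ger0_norm // ler_wpM2l // ler_pM ?coord_le //.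
    by apply: le_trans (coord_le _ _) (Hw x xc).
  rewrite sumr_const card_ord -[leLHS]mulr_natl -/n1.
  have := le1 x; set a := `|w x|; set b := u x => ab.
  have a0 : 0 <= a by exact: normr_ge0.
  have e1 : 2 * (a * (K * a + d)) <= 2 * K * b + b + d ^+ 2.
    have : 2 * a * d <= a ^+ 2 + d ^+ 2 by have := sqr_ge0 (a - d); rewrite sqrrB; lra.
    have : K * a ^+ 2 <= K * b by rewrite ler_wpM2l.
    by rewrite expr2 in ab *; lra.
  apply: le_trans (ler_wpM2l n0 e1) _; rewrite /A.
  have : 0 <= n1 * K * d ^+ 2 by rewrite !mulr_ge0 // sqr_ge0.
  by lra.
have G := @gronwall1 _ u' c A du Hu s sc.
have E1 : expR (A * `|s|) <= expR (A * c) by rewrite ler_expR ler_wpM2l // ltW.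
have sq : `|w s| ^+ 2 <= C * (`|w 0| ^+ 2 + d ^+ 2).
  apply: le_trans (le1 s) _.
  have : u s + d ^+ 2 <= (u 0 + d ^+ 2) * expR (A * c).
    apply: le_trans G _; rewrite ler_wpM2l // addr_ge0 ?sqr_ge0 //.
    by apply: le_trans (le1 0); exact: sqr_ge0.
  have : (u 0 + d ^+ 2) * expR (A * c) <= C * (`|w 0| ^+ 2 + d ^+ 2).
    rewrite /C -mulrA [expR _ * _]mulrC mulrA ler_wpM2r ?expR_ge0 //.
    have := le2 0; have := sqr_ge0 d; have : 0 <= n1 * d ^+ 2 by rewrite mulr_ge0 ?sqr_ge0.
    by have := sqr_ge0 `|w 0|; lra.
  by have := sqr_ge0 d; lra.
have p0 : 0 <= `|w 0| + d by rewrite addr_ge0.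
have C0 : 0 <= C by apply: le_trans C1.
suff H : `|w s| ^+ 2 <= (C * (`|w 0| + d)) ^+ 2.
  have CP := mulr_ge0 C0 p0; rewrite leNgt; apply/negP => L.
  by have := ltr_pM CP CP L L; rewrite -!expr2 ltNge H.
apply: le_trans sq _.
rewrite exprMn [C ^+ 2]expr2 -[leRHS]mulrA ler_wpM2l //.
apply: (@le_trans _ _ ((`|w 0| + d) ^+ 2)).
  rewrite sqrrD; have : 0 <= `|w 0| * d *+ 2 by rewrite mulrn_wge0 // mulr_ge0.
  by lra.
by rewrite -[leLHS]mul1r ler_wpM2r // sqr_ge0.
Qed.

End Gronwall.

Lemma lip_continuous (R : realType) (V W : normedModType R) (f : V -> W) (L : R) : 0 <= L ->
  (forall u v, `|f u - f v| <= L * `|u - v|) -> continuous f.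
Proof.
move=> L0 H u; apply/cvgrPdist_le => e e0.
have Le : 0 < e / (L + 1) by rewrite divr_gt0 // ltr_wpDl.
have /cvgrPdist_le /(_ _ Le) := @cvg_id _ (nbhs u).
apply: filterS => v uv; apply: le_trans (H u v) _.
apply: le_trans (ler_wpM2l L0 uv) _.
rewrite mulrA ler_pdivrMr; last by rewrite ltr_wpDl.
by rewrite mulrC ler_wpM2l ?lerDl // ltW.
Qed.

Lemma sum_cont_at (R : realType) (T : topologicalType) (W : normedModType R)
    (I : Type) (s : seq I) (F : I -> T -> W) (x : T) :
  (forall i, {for x, continuous (F i)}) -> {for x, continuous (fun y => \sum_(i <- s) F i y)}.
Proof.
move=> cF; elim: s => [|i s IH].
  by rewrite (_ : (fun _ => _) = cst 0); [exact: cvg_cst|apply: funext => y; rewrite big_nil].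
rewrite (_ : (fun _ => _) = (fun y => F i y + \sum_(i <- s) F i y)); last first.
  by apply: funext => y; rewrite big_cons.
by apply: (@cvgD _ _ _ (nbhs x) _ (F i)) IH; exact: cF.
Qed.

Lemma rV_cont (R : realType) N (T : topologicalType) (f : T -> 'rV[R]_N) (x : T) :
  (forall i, {for x, continuous (fun y => f y 0 i : R)}) -> {for x, continuous f}.
Proof.
move=> H.
have -> : f = (fun y => \sum_i f y 0 i *: delta_mx 0 i) by apply: funext => y; exact: row_sum_delta.
apply: (@sum_cont_at R T 'rV[R]_N _ _ (fun i y => f y 0 i *: delta_mx 0 i)) => i.
by apply: cvgZr_tmp; exact: H.
Qed.

(** * Picard iteration *)

Section Picard.
Variables (R : realType) (N : nat).
Local Notation E := 'rV[R]_N.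

Lemma is_derive_cont (f : R -> R) (s l : R) : is_derive s 1 f l -> {for s, continuous f}.
Proof. by move=> [d _]; apply: differentiable_continuous; apply/derivable1_diffP. Qed.


(** The 1-Lipschitz retraction onto [-c, c]. Applied to time it makes Picard iterates continuous on
    the whole line; applied to coordinates it makes a vector field globally Lipschitz. *)
Definition clip (c s : R) : R := Num.max (- c) (Num.min c s).

Lemma clip_norm (c s : R) : 0 <= c -> `|clip c s| <= c.
Proof.
move=> c0; rewrite /clip ler_norml le_max lexx /= ge_max ge_min lexx /= andbT.
by rewrite (le_trans _ c0) // oppr_le0.
Qed.

Lemma clip_id (c s : R) : `|s| <= c -> clip c s = s.
Proof.
rewrite ler_norml => /andP[s1 s2].
by rewrite /clip (min_idPr s2) (max_idPr s1).
Qed.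

Lemma clip_lip (c s t : R) : `|clip c s - clip c t| <= `|s - t|.
Proof.
rewrite /clip.
have A (a x y : R) : `|Num.min a x - Num.min a y| <= `|x - y|.
  wlog xy : x y / x <= y.
    move=> H; have [/H//|/ltW/H] := leP x y.
    by rewrite distrC [leRHS]distrC.
  rewrite [leRHS]distrC [leRHS]ger0_norm ?subr_ge0 // ler_norml.
  by rewrite /Num.min; case: ltP => ?; case: ltP => ?; apply/andP; split; lra.
have B (a x y : R) : `|Num.max a x - Num.max a y| <= `|x - y|.
  wlog xy : x y / x <= y.
    move=> H; have [/H//|/ltW/H] := leP x y.
    by rewrite distrC [leRHS]distrC.
  rewrite [leRHS]distrC [leRHS]ger0_norm ?subr_ge0 // ler_norml.
  by rewrite /Num.max; case: ltP => ?; case: ltP => ?; apply/andP; split; lra.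
exact: le_trans (B _ _ _) (A _ _ _).
Qed.

Lemma clip_continuous (c : R) : continuous (clip c).
Proof.
move=> s; apply/cvgrPdist_le => e e0.
near=> t; apply: le_trans (clip_lip _ _ _) _.
near: t; have /cvgrPdist_le /(_ _ e0) := @cvg_id _ (nbhs s); exact.
Unshelve. all: by end_near. Qed.

(** Each integration multiplies the gap between successive iterates by at most c L <= 1/2, so the
    increments decay geometrically, and the iterates converge uniformly together with their
    derivatives. *)
Lemma picard (G : E -> E) (B L c : R) (z : E) : 0 < c -> 0 <= B -> 0 <= L ->
  (forall u v, `|G u - G v| <= L * `|u - v|) -> (forall u, `|G u| <= B) -> c * L <= 2^-1 ->
  exists y : R -> E, y 0 = z /\ forall s : R, `|s| < c ->
    `|y s - z| <= c * B /\ forall i, is_derive s 1 (fun s => y s 0 i) (G (y s) 0 i).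
Proof.
move=> c0 B0 L0 lipG bG cL.
have GC i u v : `|G u 0 i - G v 0 i| <= L * `|u - v|.
  apply: le_trans (lipG u v); have := coord_le (G u - G v) i; by rewrite !mxE.
have GB i u : `|G u 0 i| <= B by exact: le_trans (coord_le _ _) (bG u).
have cG i : continuous (fun u : E => G u 0 i).
  exact: (@lip_continuous R E R _ L L0 (GC i)).
have c1 : 0 < 2 * c by rewrite mulr_gt0.
pose Y := {y : R -> E | forall i, continuous (fun s => y s 0 i)}.
have cY (y : R -> E) : (forall i, continuous (fun s => y s 0 i)) -> continuous y.
  by move=> cy s; apply: rV_cont => i; exact: cy.
have step (y : Y) : exists y' : Y, sval y' 0 = z /\ forall s : R, `|s| < c -> forall i,
    is_derive s 1 (fun s => sval y' s 0 i) (G (sval y s) 0 i).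
  have cGy i : continuous (fun s => G (sval y s) 0 i).
    move=> s; apply: (@continuous_comp _ _ _ (sval y) (fun u => G u 0 i)); last exact: cG.
    by apply: cY; exact: (svalP y).
  (* Primitives on ]-2c, 2c[, because the clipped time can reach the values c and -c. *)
  have HP i : exists P : R -> R, P 0 = 0 /\ forall s : R, `|s| < 2 * c -> is_derive s 1 P (G (sval y s) 0 i).
    by have [P P0 HP] := primitive (cGy i) c1; exists P.
  have [P {}HP] := choice HP.
  pose y' s : E := \row_i (z 0 i + P i (clip c s)).
  have cy' i : continuous (fun s => y' s 0 i).
    move=> s; rewrite (_ : (fun s => _) = (fun s => z 0 i + P i (clip c s))); last first.
      by apply: funext => t; rewrite mxE.
    apply: cvgD; first exact: cvg_cst.
    apply: (@continuous_comp _ _ _ (clip c) (P i)); first exact: clip_continuous.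
    have cc : `|clip c s| < 2 * c by apply: le_lt_trans (clip_norm _ (ltW c0)) _; lra.
    exact: is_derive_cont ((HP i).2 _ cc).
  exists (exist _ y' cy'); split=> /=.
    apply/rowP => i; rewrite mxE clip_id ?normr0 ?(ltW c0) //.
    by rewrite (HP i).1 addr0.
  move=> s sc i; apply: (@near_eq_is_derive _ _ _ (fun s => z 0 i + P i s)).
    have : \forall t \near s, `|t| < c.
      have : {for s, continuous (fun u : R => `|u|)} by exact: norm_continuous.
      by move=> /(_ _ (lt_nbhsl sc)).
    by apply: filterS => t tc; rewrite mxE clip_id // ltW.
  have sc2 : `|s| < 2 * c by lra.
  have d1 := (HP i).2 s sc2.
  by have := is_deriveD (is_derive_cst (z 0 i) s 1) d1; rewrite add0r.
have [T HT] := choice step.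
have cz i : continuous (fun s : R => (fun=> z) s 0 i) by move=> s; exact: cvg_cst.
pose y0 : Y := exist _ (fun _ : R => z) cz.
pose y j : Y := iter j T y0.
have dy j (s : R) i : `|s| < c -> is_derive s 1 (fun s => sval (y j.+1) s 0 i) (G (sval (y j) s) 0 i).
  by move=> sc; exact: (HT (y j)).2.
have y00 j : sval (y j) 0 = z by case: j => [//|j]; exact: (HT (y j)).1.
pose D := c * B.
have D0 : 0 <= D by rewrite mulr_ge0 // ltW.
have n0c : `|0 : R| < c by rewrite normr0.
have incr j (s : R) : `|s| < c -> `|sval (y j.+1) s - sval (y j) s| <= D * 2^-1 ^+ j.
  elim: j s => [|j IH] s sc.
    rewrite expr0 mulr1; apply/rV_norm_le => // i; rewrite 2!mxE.
    have := @MVT_bound R (fun s => sval (y 1%N) s 0 i) (fun s => G (sval (y 0%N) s) 0 i) c B.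
    move=> /(_ (fun s sc => dy 0%N s i sc) (fun s _ => GB i _) 0 s n0c sc).
    rewrite y00 subr0 /= => H; apply: le_trans H _.
    by rewrite /D mulrC ler_wpM2r // ltW.
  apply/rV_norm_le => [|i]; first by rewrite mulr_ge0 // exprn_ge0.
  rewrite 2!mxE.
  have := @MVT_bound R (fun s => sval (y j.+2) s 0 i - sval (y j.+1) s 0 i)
    (fun s => G (sval (y j.+1) s) 0 i - G (sval (y j) s) 0 i) c (L * (D * 2^-1 ^+ j)).
  move=> /(_ _ _ 0 s n0c sc); rewrite !y00 subrr !subr0 => H.
  apply: le_trans (H _ _) _.
  - by move=> x xc; apply: is_deriveB; exact: dy.
  - by move=> x xc; apply: le_trans (GC _ _ _) _; rewrite ler_wpM2l //; exact: IH.
  rewrite exprS; set q := 2^-1 ^+ j.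
  have Dq : 0 <= D * q by rewrite mulr_ge0 // exprn_ge0.
  have sL : `|s| * L <= 2^-1 by apply: le_trans cL; rewrite ler_wpM2r // ltW.
  by have := ler_wpM2r Dq sL; lra.
have lim (s : R) i : exists l, `|s| < c -> forall j, `|sval (y j) s 0 i - l| <= 2 * D * 2^-1 ^+ j.
  have [sc|sc] := pselect (`|s| < c); last by exists 0.
  have [|l Hl] := @geo_lim R (fun j => sval (y j) s 0 i) D.
    move=> j; apply: le_trans (incr j s sc).
    by have := coord_le (sval (y j.+1) s - sval (y j) s) i; rewrite !mxE.
  by exists l.
pose l s := projT1 (choice (lim s)); have Hl s i : `|s| < c -> _ := projT2 (choice (lim s)) i.
have q0 j : 0 <= 2 * D * 2^-1 ^+ j by apply: mulr_ge0; [exact: mulr_ge0|exact: exprn_ge0].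
pose u s : E := \row_i l s i.
have Hu j (s : R) : `|s| < c -> `|sval (y j) s - u s| <= 2 * D * 2^-1 ^+ j.
  move=> sc; apply/rV_norm_le => [|i]; first exact: q0.
  by rewrite !mxE; exact: Hl.
have small (e : R) : 0 < e -> exists j : nat, 2 * D * 2^-1 ^+ j <= e.
  move=> e0.
  have K0 : 0 < e / (2 * D + 1) by rewrite divr_gt0 // ltr_wpDl // mulr_ge0.
  have : \forall j \near \oo, `|(2^-1 : R) ^+ j| <= e / (2 * D + 1).
    have h2 : `|2^-1 : R| < 1 by rewrite ger0_norm // invf_lt1 ?ltr1n.
    have /cvgr0Pnorm_le := @cvg_expr R 2^-1 h2; exact.
  move=> [j _ /(_ j (leqnn j))] /= Hj; exists j.
  rewrite ger0_norm ?exprn_ge0 // in Hj.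
  have D2 : 0 <= 2 * D by rewrite mulr_ge0.
  apply: le_trans (ler_wpM2l D2 Hj) _.
  rewrite mulrA ler_pdivrMr; last by rewrite ltr_wpDl.
  by rewrite mulrC ler_wpM2l ?lerDl // ltW.
exists u; split.
  apply/rowP => i; rewrite mxE; apply/eqP; rewrite eq_sym -subr_eq0 -normr_le0.
  apply/ler_addgt0Pr => e e0; rewrite add0r; have [j Hj] := small e e0.
  by apply: le_trans Hj; have := Hl 0 i n0c j; rewrite y00.
move=> s sc; split.
  have main j : `|sval (y j) s - z| <= c * B.
    case: j => [|j]; first by rewrite subrr normr0.
    apply/rV_norm_le => // i; rewrite 2!mxE.
    have := @MVT_bound R (fun s => sval (y j.+1) s 0 i) (fun s => G (sval (y j) s) 0 i) c B.
    move=> /(_ (fun s sc => dy j s i sc) (fun s _ => GB i _) 0 s n0c sc).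
    rewrite y00 subr0 => H; apply: le_trans H _.
    by rewrite /D mulrC ler_wpM2r // ltW.
  apply/ler_addgt0Pr => e e0; have [j Hj] := small e e0.
  have -> : u s - z = (sval (y j) s - z) - (sval (y j) s - u s).
    by rewrite opprB [RHS]addrC addrA subrK.
  apply: le_trans (ler_normB _ _) _; rewrite lerD //.
  exact: le_trans (Hu j s sc) Hj.
move=> i; move: s sc; apply: derive_lim => e e0.
have e1 : 0 < Num.min e (e / (L + 1)) by rewrite lt_min e0 divr_gt0 // ltr_wpDl.
have [j Hj] := small _ e1.
have Hj1 : 2 * D * 2^-1 ^+ j <= e by apply: le_trans Hj _; rewrite ge_min lexx.
have Hj2 : 2 * D * 2^-1 ^+ j <= e / (L + 1) by apply: le_trans Hj _; rewrite ge_min lexx orbT.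
exists (fun s => sval (y j.+1) s 0 i), (fun s => G (sval (y j) s) 0 i) => s sc; split.
- exact: dy.
- rewrite mxE; apply: le_trans (Hl s i sc j.+1) _; apply: le_trans Hj1.
  by have := q0 j; rewrite exprS; lra.
- apply: le_trans (GC _ _ _) _; apply: le_trans (ler_wpM2l L0 (Hu j s sc)) _.
  apply: le_trans (ler_wpM2l L0 Hj2) _.
  rewrite mulrA ler_pdivrMr; last by rewrite ltr_wpDl.
  by rewrite mulrC ler_wpM2l ?lerDl // ltW.
Qed.

End Picard.

(* [phi s t] is the value at time [s] of the solution of [y' = F y] that starts
   at [z0 t]; local boundedness in [t] is part of the definition. *)
Definition solution_family (R : realType) (N : nat) (F : 'rV[R]_N -> 'rV[R]_N) (c : R) (J : set R)
    (z0 : R -> 'rV[R]_N) (phi : R -> R -> 'rV[R]_N) : Prop :=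
  [/\ forall t s : R, J t -> `|s| < c -> forall i,
        is_derive s 1 (fun s => phi s t 0 i : R) (F (phi s t) 0 i),
      forall t, J t -> phi 0 t = z0 t, forall t, J t -> Csm z0 t &
      forall t, J t -> exists B : R, \forall t' \near t, forall s : R, `|s| < c -> `|phi s t'| <= B].

Section FieldBounds.
Variables (R : realType) (N : nat) (F : 'rV[R]_N -> 'rV[R]_N).
Hypothesis hF : forall y, Csm F y.
Local Notation E := 'rV[R]_N.

Definition dF (z v : E) : E := \row_i 'D_v (fun y => F y 0 i : R) z.

Lemma CsmF i y : Csm (fun y => F y 0 i : R) y.
Proof. by have /Csm_rV := hF y; exact. Qed.

Lemma dF_lin z (a : R) u v : dF z (a *: u + v) = a *: dF z u + dF z v.
Proof.
apply/rowP => i; rewrite !mxE !deriveE; try by apply: Csm_diff; exact: CsmF.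
by rewrite linearP.
Qed.

Lemma rV_uniform_bound (P : 'I_N -> R -> Prop) (mono : forall i a b, a <= b -> P i a -> P i b) :
  (forall i, exists2 B, 0 <= B & P i B) -> exists2 B, 0 <= B & forall i, P i B.
Proof.
move=> H; have H' i : exists B, 0 <= B /\ P i B by have [B ? ?] := H i; exists B.
have [B HB] := choice H'.
exists (\sum_i B i); first by apply: sumr_ge0 => i _; have [] := HB i.
move=> i; apply: mono (HB i).2; rewrite (bigD1 i) //= lerDl sumr_ge0 // => j _.
by have [] := HB j.
Qed.

Lemma F_bounded (r : R) : exists2 B, 0 <= B & forall y, `|y| <= r -> `|F y| <= B.
Proof.
have [||B B0 HB] := @rV_uniform_bound (fun i B => forall y : E, `|y| <= r -> `|F y 0 i| <= B).
- by move=> i a b ab H y yr; exact: le_trans (H y yr) ab.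
- by move=> i; exact: (Csm_bounded r (CsmF i)).
by exists B => // y yr; apply/rV_norm_le => // i; exact: HB.
Qed.

Lemma F_lip (r : R) : exists2 L, 0 <= L & forall u v, `|u| <= r -> `|v| <= r ->
  `|F u - F v| <= L * `|u - v|.
Proof.
have [||B B0 HB] := @rV_uniform_bound (fun i B => forall u v : E, `|u| <= r -> `|v| <= r ->
  `|F u 0 i - F v 0 i| <= B * `|u - v|).
- by move=> i a b ab H u v ur vr; apply: le_trans (H u v ur vr) _; rewrite ler_wpM2r.
- by move=> i; exact: (Csm_lip r (CsmF i)).
exists B => // u v ur vr; apply/rV_norm_le => [|i]; first by rewrite mulr_ge0.
by rewrite !mxE; exact: HB.
Qed.

Lemma F_lip2 (r : R) : exists2 L, 0 <= L & forall u v, `|u| <= r -> `|v| <= r ->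
  `|F u - F v - dF v (u - v)| <= L * `|u - v| ^+ 2.
Proof.
have [||B B0 HB] := @rV_uniform_bound (fun i B => forall u v : E, `|u| <= r -> `|v| <= r ->
  `|F u 0 i - F v 0 i - 'D_(u - v) (fun y => F y 0 i : R) v| <= B * `|u - v| ^+ 2).
- by move=> i a b ab H u v ur vr; apply: le_trans (H u v ur vr) _; rewrite ler_wpM2r ?sqr_ge0.
- by move=> i; exact: (Csm_lip2 r (CsmF i)).
exists B => // u v ur vr; apply/rV_norm_le => [|i]; first by rewrite mulr_ge0 ?sqr_ge0.
by rewrite !mxE; exact: HB.
Qed.

Lemma dF_bounded (r : R) : exists2 K, 0 <= K & forall y v, `|y| <= r -> `|dF y v| <= K * `|v|.
Proof.
have [||B B0 HB] := @rV_uniform_bound (fun i B => forall y v : E, `|y| <= r ->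
  `|'D_v (fun y => F y 0 i : R) y| <= B * `|v|).
- by move=> i a b ab H y v yr; apply: le_trans (H y v yr) _; rewrite ler_wpM2r.
- move=> i; have [B B0 HB] := Csm_dbounded r (CsmF i).
  exists (N%:R * B); first by rewrite mulr_ge0.
  by move=> y v yr; apply: derive_bound => [|j]; [apply: Csm_diff; exact: CsmF|exact: HB].
exists B => // y v yr; apply/rV_norm_le => [|i]; first by rewrite mulr_ge0.
by rewrite !mxE; exact: HB.
Qed.

End FieldBounds.

(** * Differentiability in the parameter of a family of solutions *)

Section Family.
Variables (R : realType) (N : nat) (F : 'rV[R]_N -> 'rV[R]_N) (c : R) (J : set R).
Variables (z0 : R -> 'rV[R]_N) (phi : R -> R -> 'rV[R]_N).
Hypothesis c0 : 0 < c.
Hypothesis oJ : open J.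
Hypothesis hF : forall y, Csm F y.
Hypothesis S : solution_family F c J z0 phi.
Local Notation E := 'rV[R]_N.

Let n0c : `|0 : R| < c. Proof. by rewrite normr0. Qed.

Lemma fam_bound t : J t -> exists2 B : R, 0 <= B & \forall t' \near t,
  J t' /\ forall s : R, `|s| < c -> `|phi s t'| <= B.
Proof.
move=> Jt; have [_ _ _ /(_ t Jt) [B HB]] := S.
exists (Num.max 0 B); first by rewrite le_max lexx.
near=> t'; split; first by near: t'; exact: open_nbhs_nbhs.
move=> s sc; rewrite le_max; apply/orP; right; move: s sc; near: t'; exact: HB.
Unshelve. all: by end_near. Qed.

(** Gronwall for the difference of two solutions, with d = 0: local boundedness keeps both in one
    ball, on which [F] is Lipschitz. *)
Lemma fam_lip t : J t -> exists2 C : R, 0 <= C & \forall t' \near t, forall s : R, `|s| < c ->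
  `|phi s t' - phi s t| <= C * `|z0 t' - z0 t|.
Proof.
move=> Jt; have [B B0 HB] := fam_bound Jt.
have [L L0 HL] := F_lip hF B; have [dphi phi0 _ _] := S.
have [C C0 HC] := gronwall N c0 L0.
exists C; first exact: ltW.
near=> t' => s sc.
have [Jt' Bt'] : J t' /\ forall s : R, `|s| < c -> `|phi s t'| <= B by near: t'.
have [_ Bt] := nbhs_singleton HB.
have := HC (fun s => phi s t' - phi s t) (fun s => F (phi s t') - F (phi s t)) 0 (lexx _) _ _ s sc.
rewrite !phi0 // addr0; apply.
- move=> u uc i; rewrite (_ : (fun _ => _) = (fun s => phi s t' 0 i - phi s t 0 i)).
    by rewrite !mxE; apply: is_deriveB; exact: dphi.
  by apply: funext => v; rewrite !mxE.
- by move=> u uc; rewrite addr0; apply: HL; [exact: Bt'|exact: Bt].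
Unshelve. all: by end_near. Qed.

Lemma z0_lip t : J t -> exists2 C : R, 0 <= C & \forall h \near (0 : R), `|z0 (t + h) - z0 t| <= C * `|h|.
Proof.
move=> Jt; have [_ _ /(_ t Jt) Cz _] := S.
have d : derivable z0 t 1 by apply: diff_derivable; exact: Csm_diff.
have := is_derive_in setT (derivableP d).
move=> /is_deriv_inP /(_ 1 ltr01) H.
exists (`|'D_1 z0 t| + 1); first by rewrite addr_ge0.
have H' : \forall h \near (0 : R), [set: R] (t + h) ->
    `|z0 (t + h) - z0 t - (t + h - t) *: 'D_1 z0 t| <= 1 * `|t + h - t|.
  move: H; rewrite (near_shift 0) /= subr0.
  by apply: filterS => h; rewrite [t + h]addrC.
apply: filterS H' => h /(_ I); rewrite [t + h]addrC addrK mul1r => Hh.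
rewrite -[z0 _ - _](subrK (h *: 'D_1 z0 t)); apply: le_trans (ler_normD _ _) _.
by apply: le_trans (lerD Hh (lexx _)) _; rewrite normrZ; lra.
Qed.

Definition dphi s t : E := \row_i 'D_1 (fun t => phi s t 0 i : R) t.

(* The difference quotients in [t] solve the linearized equation up to a small
   error, so by Gronwall's lemma they are Cauchy, uniformly in [s]. *)
Lemma fam_diff t : J t ->
  [/\ forall (s : R) i, `|s| < c -> is_derive t 1 (fun t => phi s t 0 i : R) (dphi s t 0 i),
      forall (s : R) i, `|s| < c ->
        is_derive s 1 (fun s => dphi s t 0 i : R) (dF F (phi s t) (dphi s t) 0 i) &
      dphi 0 t = \row_i 'D_1 (fun t => z0 t 0 i : R) t].
Proof.
move=> Jt; have [B B0 HB] := fam_bound Jt; have [ds phi0 Cz0 _] := S.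
have [K K0 HK] := dF_bounded hF B; have [L L0 HL] := F_lip2 hF B.
have [C C0 HC] := gronwall N c0 K0.
have [C1 C10 HC1] := fam_lip Jt; have [C2 C20 HC2] := z0_lip Jt.
have [_ Bt] := nbhs_singleton HB.
pose w h s : E := h^-1 *: (phi s (t + h) - phi s t).
pose r h s : E := h^-1 *: (F (phi s (t + h)) - F (phi s t)) - dF F (phi s t) (w h s).
(* The second-order remainder of [F] is at most L |phi s (t+h) - phi s t|^2 <= L (C1 C2 |h|)^2;
   dividing by h leaves D |h|. *)
pose D := L * (C1 * C2) ^+ 2.
have D0 : 0 <= D by rewrite mulr_ge0 ?sqr_ge0.
have good : \forall h \near (0 : R), [/\ J (t + h), forall s : R, `|s| < c -> `|phi s (t + h)| <= B
    & forall s : R, `|s| < c -> `|phi s (t + h) - phi s t| <= C1 * C2 * `|h|].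
  have H1 : \forall h \near (0 : R), J (t + h) /\ forall s : R, `|s| < c -> `|phi s (t + h)| <= B.
    have := HB; rewrite (near_shift 0) /= subr0.
    by apply: filterS => h; rewrite addrC.
  have H2 : \forall h \near (0 : R), forall s : R, `|s| < c ->
     `|phi s (t + h) - phi s t| <= C1 * `|z0 (t + h) - z0 t|.
    have := HC1; rewrite (near_shift 0) /= subr0.
    by apply: filterS => h; rewrite addrC.
  near=> h.
  have [Jh Bh] : J (t + h) /\ forall s : R, `|s| < c -> `|phi s (t + h)| <= B by near: h.
  split=> // s sc.
  have Hs : `|phi s (t + h) - phi s t| <= C1 * `|z0 (t + h) - z0 t| by move: s sc; near: h.
  apply: le_trans Hs _; rewrite -mulrA ler_wpM2l //; near: h; exact: HC2.
have dw (h : R) : h != 0 -> J (t + h) -> forall s : R, `|s| < c -> forall i,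
    is_derive s 1 (fun s => w h s 0 i : R) ((dF F (phi s t) (w h s) + r h s) 0 i).
  move=> h0 Jh s sc i; rewrite /r addrC subrK.
  rewrite (_ : (fun _ => _) = (fun s => h^-1 *: (phi s (t + h) 0 i - phi s t 0 i))).
    by rewrite !mxE; apply: is_deriveZ; apply: is_deriveB; exact: ds.
  by apply: funext => u; rewrite !mxE.
have rb (h : R) : h != 0 -> (forall s : R, `|s| < c -> `|phi s (t + h)| <= B) ->
    (forall s : R, `|s| < c -> `|phi s (t + h) - phi s t| <= C1 * C2 * `|h|) ->
    forall s : R, `|s| < c -> `|r h s| <= D * `|h|.
  move=> h0 Bh Hh s sc.
  have -> : r h s = h^-1 *: (F (phi s (t + h)) - F (phi s t) - dF F (phi s t) (phi s (t + h) - phi s t)).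
    rewrite /r /w [RHS]scalerBr; congr (_ - _).
    by have := dF_lin hF (phi s t) h^-1 (phi s (t + h) - phi s t) 0; rewrite addr0 => ->;
      rewrite (_ : dF F (phi s t) 0 = 0) ?addr0 //; apply/rowP => i; rewrite !mxE derive0.
  rewrite normrZ normfV mulrC ler_pdivrMr ?normr_gt0 //.
  apply: le_trans (HL _ _ (Bh s sc) (Bt s sc)) _.
  have -> : D * `|h| * `|h| = L * (C1 * C2 * `|h|) ^+ 2 by rewrite /D; ring.
  rewrite ler_wpM2l // !expr2; have := Hh s sc => Hs.
  by apply: ler_pM.
pose w0 : E := \row_i 'D_1 (fun t => z0 t 0 i : R) t.
have wlim : forall e : R, 0 < e -> \forall h \near (0 : R), h != 0 -> `|w h 0 - w0| <= e.
  move=> e e0.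
  have D1 : derivable z0 t 1 by apply: diff_derivable; exact: Csm_diff (Cz0 t Jt).
  have E0 : 'D_1 z0 t = w0.
    by rewrite derive_mx //; apply/rowP => i; rewrite !mxE.
  have : (fun h : R => h^-1 *: (z0 (h *: 1 + t) - z0 t)) @ 0^' --> w0 by rewrite -E0; exact: D1.
  move=> /cvgrPdist_le /(_ e e0) H.
  have {}H : \forall h \near (0 : R), h != 0 -> `|w0 - h^-1 *: (z0 (h *: 1 + t) - z0 t)| <= e := H.
  apply: filterS2 good H => h [Jh _ _] + h0; rewrite /w !phi0 // distrC.
  by rewrite [h *: 1]mulr1 [h + t]addrC; apply.
have dF_sub z u v : dF F z (u - v) = dF F z u - dF F z v.
  by rewrite addrC -scaleN1r dF_lin // scaleN1r addrC.
(* Collects both sources of error of the quotient [w h]: its initial value and the inhomogeneous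
   term of its equation. *)
pose b h := `|w h 0 - w0| + D * `|h|.
have b0 h : 0 <= b h by rewrite addr_ge0 // mulr_ge0.
have goodW : \forall h \near 0^', [/\ h != 0, J (t + h), forall s : R, `|s| < c -> `|phi s (t + h)| <= B
    & forall s : R, `|s| < c -> `|r h s| <= D * `|h|].
  suff : \forall h \near (0 : R), h != 0 -> [/\ h != 0, J (t + h),
      forall s : R, `|s| < c -> `|phi s (t + h)| <= B
    & forall s : R, `|s| < c -> `|r h s| <= D * `|h|] by [].
  by apply: filterS good => h [g1 g2 g3] h0; split=> //; exact: rb.
have blim (e : R) : 0 < e -> \forall h \near 0^', b h <= e.
  move=> e0; have e2 : 0 < e / 2 by rewrite divr_gt0.
  have De : 0 < e / 2 / (D + 1) by rewrite divr_gt0 // ltr_wpDl.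
  have H1 := wlim _ e2.
  have H2 : \forall h \near (0 : R), `|h| <= e / 2 / (D + 1).
    have /cvgrPdist_le /(_ _ De) := @cvg_id _ (nbhs (0 : R)).
    by apply: filterS => h; rewrite sub0r normrN.
  suff : \forall h \near (0 : R), h != 0 -> b h <= e by [].
  apply: filterS2 H1 H2 => h H1 H2 h0.
  rewrite /b [e]splitr lerD ?H1 //; apply: le_trans (ler_wpM2l D0 H2) _.
  rewrite mulrA ler_pdivrMr; last by rewrite ltr_wpDl.
  by rewrite mulrC ler_wpM2l ?lerDl // ltW.
have pick (P : R -> Prop) (e : R) : (\forall h \near 0^', P h) -> 0 < e -> exists h : R, (P h /\ b h <= e) /\
   [/\ h != 0, J (t + h), forall s : R, `|s| < c -> `|phi s (t + h)| <= B
    & forall s : R, `|s| < c -> `|r h s| <= D * `|h|].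
  move=> HP e0; apply: (@filter_ex _ (0 : R)^').
  by apply: filterS3 HP goodW (blim _ e0) => h h1 h2 h3.
have T1 : \forall h \near (0 : R)^', True by near=> h.
(* Two quotients solve the same linear equation up to r h - r k, so Gronwall bounds their distance
   uniformly in [s]. *)
have W2 h k : [/\ h != 0, J (t + h), forall s : R, `|s| < c -> `|phi s (t + h)| <= B
    & forall s : R, `|s| < c -> `|r h s| <= D * `|h|] ->
   [/\ k != 0, J (t + k), forall s : R, `|s| < c -> `|phi s (t + k)| <= B
    & forall s : R, `|s| < c -> `|r k s| <= D * `|k|] ->
   forall s : R, `|s| < c -> `|w h s - w k s| <= C * (b h + b k).
  move=> [h0 Jh _ rh] [k0 Jk _ rk] s sc.
  have Dhk : 0 <= D * `|h| + D * `|k| by rewrite addr_ge0 // mulr_ge0.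
  have := HC (fun s => w h s - w k s)
    (fun s => (dF F (phi s t) (w h s) + r h s) - (dF F (phi s t) (w k s) + r k s)) _ Dhk _ _ s sc.
  move=> H; apply: le_trans (H _ _) _.
  - move=> u uc i; rewrite (_ : (fun _ => _) = (fun s => w h s 0 i - w k s 0 i)).
      by rewrite [X in is_derive _ _ _ X]mxE [X in _ + X]mxE; apply: is_deriveB; exact: dw.
    by apply: funext => v; rewrite [LHS]mxE [X in _ + X]mxE.
  - move=> u uc.
    have -> : dF F (phi u t) (w h u) + r h u - (dF F (phi u t) (w k u) + r k u) =
       dF F (phi u t) (w h u - w k u) + (r h u - r k u).
      by rewrite dF_sub opprD addrACA.
    apply: le_trans (ler_normD _ _) _; apply: lerD; first by apply: HK; exact: Bt.
    by apply: le_trans (ler_normB _ _) _; apply: lerD; [exact: rh|exact: rk].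
  - rewrite ler_wpM2l ?(ltW C0) // /b.
    have : `|w h 0 - w k 0| <= `|w h 0 - w0| + `|w k 0 - w0|.
      have -> : w h 0 - w k 0 = (w h 0 - w0) - (w k 0 - w0) by rewrite opprB addrA subrK.
      exact: ler_normB.
    by lra.
have wE (s : R) i : (fun h : R => h^-1 *: (phi s (h *: 1 + t) 0 i - phi s t 0 i)) = (fun h => w h s 0 i).
  by apply: funext => h; rewrite !mxE [h *: 1]mulr1 [h + t]addrC.
have dt (s : R) i : `|s| < c -> is_derive t 1 (fun t => phi s t 0 i : R) (dphi s t 0 i).
  move=> sc; rewrite mxE; apply: derivableP.
  rewrite /derivable wE; apply: cauchy_cvg; apply: cauchy_exP => e e0.
  have e4 : 0 < e / 4 / C by rewrite !divr_gt0.
  have [h [[_ bh] gh]] := pick (fun _ => True) _ T1 e4.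
  exists (w h s 0 i).
  apply: filterS2 goodW (blim _ e4) => k gk bk.
  rewrite -ball_normE /=.
  have := coord_le (w h s - w k s) i; rewrite [X in `|X| <= _]mxE [X in _ + X]mxE => H.
  apply: le_lt_trans H _; apply: le_lt_trans (W2 _ _ gh gk s sc) _.
  have : C * (b h + b k) <= C * (e / 4 / C + e / 4 / C) by rewrite ler_wpM2l ?lerD // ltW.
  have -> : C * (e / 4 / C + e / 4 / C) = e / 2 by field; rewrite gt_eqF.
  by lra.
have Wb h : [/\ h != 0, J (t + h), forall s : R, `|s| < c -> `|phi s (t + h)| <= B
    & forall s : R, `|s| < c -> `|r h s| <= D * `|h|] ->
    forall s : R, `|s| < c -> `|w h s - dphi s t| <= C * b h.
  move=> gh s sc; apply/rV_norm_le => [|i]; first by rewrite mulr_ge0 // ltW.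
  rewrite [X in `|X| <= _]mxE [X in _ + X]mxE.
  apply/ler_addgt0Pr => e e0.
  have e2 : 0 < e / 2 by rewrite divr_gt0.
  have e4 : 0 < e / 2 / C by rewrite !divr_gt0.
  have [d1 d2] := dt s i sc.
  have : (fun h : R => h^-1 *: (phi s (h *: 1 + t) 0 i - phi s t 0 i)) @ 0^' --> dphi s t 0 i.
    by rewrite -d2; exact: d1.
  rewrite wE => /cvgrPdist_le /(_ _ e2) H.
  have [k [[Hk bk] gk]] := pick _ _ H e4.
  have := coord_le (w h s - w k s) i; rewrite [X in `|X| <= _]mxE [X in _ + X]mxE => H1.
  have H2 := le_trans H1 (W2 _ _ gh gk s sc).
  have -> : w h s 0 i - dphi s t 0 i = (w h s 0 i - w k s 0 i) - (dphi s t 0 i - w k s 0 i) by ring.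
  apply: le_trans (ler_normB _ _) _.
  have : C * b k <= C * (e / 2 / C) by rewrite ler_wpM2l // ltW.
  have -> : C * (e / 2 / C) = e / 2 by field; rewrite gt_eqF.
  by lra.
split=> //.
(* The equation of [dphi] in [s] is the limit of the equations of the quotients [w h], whose
   [s]-derivatives converge uniformly as well. *)
- move=> s i; move: s; apply: derive_lim => e e0.
  have KC : 0 < K * C + C + 1 by rewrite ltr_wpDl // addr_ge0 ?mulr_ge0 // ltW.
  have e1 : 0 < e / (K * C + C + 1) by rewrite divr_gt0.
  have [h [[_ +] gh]] := pick (fun _ => True) _ T1 e1.
  rewrite ler_pdivlMr // => bh.
  have [h0 Jh _ rh] := gh.
  have Cb : 0 <= C * b h by rewrite mulr_ge0 // ltW.
  have KCb : 0 <= K * (C * b h) by rewrite mulr_ge0.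
  exists (fun s => w h s 0 i), (fun s => (dF F (phi s t) (w h s) + r h s) 0 i) => s sc; split.
  + exact: dw.
  + have := coord_le (w h s - dphi s t) i; rewrite [X in `|X| <= _]mxE [X in _ + X]mxE => H1.
    apply: le_trans H1 _; apply: le_trans (Wb h gh s sc) _.
    by have := b0 h; lra.
  + have := coord_le ((dF F (phi s t) (w h s) + r h s) - dF F (phi s t) (dphi s t)) i.
    rewrite [X in `|X| <= _]mxE [X in _ + X]mxE => H1; apply: le_trans H1 _.
    rewrite addrAC -dF_sub; apply: le_trans (ler_normD _ _) _.
    have H2 := rh s sc; have H3 := HK _ (w h s - dphi s t) (Bt s sc).
    have H4 : K * `|w h s - dphi s t| <= K * (C * b h) by rewrite ler_wpM2l //; exact: Wb.
    have H5 : D * `|h| <= b h by rewrite /b lerDr.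
    move: bh H2 H3 H4 H5 Cb KCb; move: (b h) `|dF _ _ _| `|r _ _| (K * `|_|) => bb x1 x2 x3; clear; lra.
- apply/rowP => i; rewrite !mxE; apply: near_eq_derive.
  have : \forall t' \near t, J t' by exact: open_nbhs_nbhs.
  by apply: filterS => t' Jt'; rewrite phi0.
Unshelve. all: by end_near. Qed.

End Family.

(** * Joint smoothness and existence of flows *)

Section Tangent.
Variable (R : realType).

Lemma near_fst (a b : R) (P : R -> Prop) : (\forall x \near a, P x) ->
  \forall z \near (a, b), P z.1.
Proof.
move=> /nbhs_ballP[d /= d0 H]; apply/nbhs_ballP; exists d => //= z [z1 _]; exact: H.
Qed.

Lemma near_snd (a b : R) (P : R -> Prop) : (\forall x \near b, P x) ->
  \forall z \near (a, b), P z.2.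
Proof.
move=> /nbhs_ballP[d /= d0 H]; apply/nbhs_ballP; exists d => //= z [_ z2]; exact: H.
Qed.

Lemma Csm_lsub n1 n2 (x : 'rV[R]_(n1 + n2)) : Csm (@lsubmx R 1 n1 n2) x.
Proof.
apply/Csm_rV => i; apply: Csm_eq ((Csm_rV _ _).2 (Csm_id x) (lshift n2 i)) => y.
by rewrite mxE.
Qed.

Lemma Csm_rsub n1 n2 (x : 'rV[R]_(n1 + n2)) : Csm (@rsubmx R 1 n1 n2) x.
Proof.
apply/Csm_rV => i; apply: Csm_eq ((Csm_rV _ _).2 (Csm_id x) (rshift n1 i)) => y.
by rewrite mxE.
Qed.

Lemma Csm_row_mx (V : normedModType R) n1 n2 (f : V -> 'rV[R]_n1) (g : V -> 'rV[R]_n2) x :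
  Csm f x -> Csm g x -> Csm (fun y => row_mx (f y) (g y)) x.
Proof.
move=> Hf Hg; apply/Csm_rV => i; rewrite -(splitK i).
case: (fintype.split i) => j /=.
  by apply: Csm_eq ((Csm_rV _ _).2 Hf j) => y; rewrite row_mxEl.
by apply: Csm_eq ((Csm_rV _ _).2 Hg j) => y; rewrite row_mxEr.
Qed.

(* The tangent lift of [F]: a family of solutions together with its
   [t]-derivative is a family of solutions of [tangent_lift F], so differentiability of
   families gives C^k-regularity by induction on [k]. *)
Definition tangent_lift N (F : 'rV[R]_N -> 'rV[R]_N) (x : 'rV[R]_(N + N)) : 'rV[R]_(N + N) :=
  row_mx (F (lsubmx x)) (dF F (lsubmx x) (rsubmx x)).

Lemma Csm_tangent_lift N (F : 'rV[R]_N -> 'rV[R]_N) : (forall y, Csm F y) -> forall x, Csm (tangent_lift F) x.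
Proof.
move=> hF x; apply: Csm_row_mx.
  by apply: (@Csm_comp _ _ _ (fdim_rV R N) _ (fdim_rV R N)); [exact: Csm_lsub|exact: hF].
apply/Csm_rV => i.
apply: (@Csm_eq _ _ _ (fun y => \sum_k (rsubmx y) 0 k *
    'D_(delta_mx 0 k) (fun y => F y 0 i : R) (lsubmx y))).
  by move=> y; rewrite mxE derive_rVE //; apply: Csm_diff; exact: CsmF.
apply: Csm_sum => k _; apply: Csm_mul.
  by have /Csm_rV := @Csm_rsub N N x; exact.
apply: (@Csm_comp _ _ _ (fdim_rV R N) _ (fdim_R R) _ ('D_(delta_mx 0 k) (fun y => F y 0 i : R))).
  exact: Csm_lsub.
by apply: Csm_derive; exact: CsmF.
Qed.

Lemma row_mx_norm n1 n2 (a : 'rV[R]_n1) (b : 'rV[R]_n2) (B : R) : `|a| <= B -> `|b| <= B ->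
  `|row_mx a b| <= B.
Proof.
move=> aB bB; have B0 : 0 <= B by exact: le_trans aB.
apply/rV_norm_le => // i; rewrite -(splitK i).
case: (fintype.split i) => j /=; rewrite ?row_mxEl ?row_mxEr; exact: le_trans (coord_le _ _) _.
Qed.

(** Beyond [fam_diff], what has to be shown is local boundedness of [dphi] in [t]: Gronwall for the
    linearized equation, whose initial values are bounded near [t] by continuity. *)
Lemma solfam_T N (F : 'rV[R]_N -> 'rV[R]_N) c J z0 phi : 0 < c -> open J ->
  (forall y, Csm F y) -> solution_family F c J z0 phi ->
  solution_family (tangent_lift F) c J (fun t => row_mx (z0 t) (\row_i 'D_1 (fun t => z0 t 0 i : R) t))
    (fun s t => row_mx (phi s t) (dphi phi s t)).
Proof.
move=> c0 oJ hF S; have [ds phi0 Cz0 _] := S.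
have diff := fam_diff c0 oJ hF S.
have Cw0 t : J t -> Csm (fun t => \row_i 'D_1 (fun t => z0 t 0 i : R) t : 'rV[R]_N) t.
  move=> Jt; apply/Csm_rV => i; apply: (@Csm_eq _ _ _ ('D_1 (fun t => z0 t 0 i : R))).
    by move=> u; rewrite mxE.
  by apply: Csm_derive; have /Csm_rV := Cz0 t Jt; exact.
split.
- move=> t s Jt sc i; have [_ d2 _] := diff t Jt; rewrite /tangent_lift row_mxKl row_mxKr.
  rewrite -(splitK i); case: (fintype.split i) => j /=.
    rewrite row_mxEl (_ : (fun s => _) = (fun s => phi s t 0 j)); first exact: ds.
    by apply: funext => u; rewrite row_mxEl.
  rewrite row_mxEr (_ : (fun s => _) = (fun s => dphi phi s t 0 j)); first exact: d2.
  by apply: funext => u; rewrite row_mxEr.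
- by move=> t Jt; have [_ _ d3] := diff t Jt; rewrite d3 phi0.
- by move=> t Jt; apply: Csm_row_mx; [exact: Cz0|exact: Cw0].
- move=> t Jt; have [B B0 HB] := fam_bound oJ S Jt.
  have [K K0 HK] := dF_bounded hF B.
  have [C C0 HC] := gronwall N c0 K0.
  pose w0 t : 'rV[R]_N := \row_i 'D_1 (fun t => z0 t 0 i : R) t.
  have Hw : \forall t' \near t, `|w0 t'| <= `|w0 t| + 1.
    have /cvgrPdist_le /(_ 1 ltr01) := Csm_cont (Cw0 t Jt).
    apply: filterS => t' Ht'; rewrite -[w0 t'](subrK (w0 t)).
    by apply: le_trans (ler_normD _ _) _; rewrite addrC lerD2l distrC.
  have p0 : 0 <= `|w0 t| + 1 by rewrite addr_ge0.
  exists (B + C * (`|w0 t| + 1)); near=> t' => s sc.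
  have [Jt' Bt'] : J t' /\ forall s : R, `|s| < c -> `|phi s t'| <= B by near: t'.
  have Hw' : `|w0 t'| <= `|w0 t| + 1 by near: t'.
  have CB : 0 <= C * (`|w0 t| + 1) by rewrite mulr_ge0 // ltW.
  apply: row_mx_norm; first by apply: le_trans (Bt' s sc) _; rewrite lerDl.
  have [_ d2 d3] := diff t' Jt'.
  have := HC (fun s => dphi phi s t') (fun s => dF F (phi s t') (dphi phi s t')) 0 (lexx _) _ _ s sc.
  move=> H; apply: le_trans (H _ _) _.
  + by move=> u uc i; exact: d2.
  + by move=> u uc; rewrite addr0; apply: HK; exact: Bt'.
  + rewrite addr0 d3; apply: le_trans (_ : C * (`|w0 t| + 1) <= _); last by rewrite lerDr.
    by rewrite ler_wpM2l // ltW.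
Unshelve. all: by end_near. Qed.

Definition box (c : R) (J : set R) : set (R * R) := [set z | `|z.1| < c /\ J z.2].

Lemma open_box c J : open J -> open (box c J).
Proof.
move=> oJ; apply: openI.
  apply: (@open_comp _ _ (fun z : R * R => `|z.1|) [set x | x < c]); last exact: open_lt.
  by move=> z _; apply: continuous_comp; [exact: cvg_fst|exact: norm_continuous].
by apply: (@open_comp _ _ (snd : R * R -> R) J) => // z _; exact: cvg_snd.
Qed.

(** The Lipschitz estimate in [t] is uniform in [s], so together with continuity in [s] it gives
    joint continuity. *)
Lemma solfam_cont N (F : 'rV[R]_N -> 'rV[R]_N) c J z0 phi : 0 < c -> open J ->
  (forall y, Csm F y) -> solution_family F c J z0 phi -> Ck 0 (box c J) (fun z => phi z.1 z.2).
Proof.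
move=> c0 oJ hF S [s t] [/= sc Jt]; have [ds phi0 Cz0 _] := S.
have [C C0 HC] := fam_lip c0 oJ hF S Jt.
have cz := Csm_cont (Cz0 t Jt).
have cs : {for s, continuous (fun s => phi s t)}.
  by apply: rV_cont => i; exact: is_derive_cont (ds t s Jt sc i).
apply/cvgrPdist_le => e e0.
have e2 : 0 < e / 2 by rewrite divr_gt0.
have eC : 0 < e / 2 / (C + 1) by rewrite divr_gt0 // ltr_wpDl.
have /cvgrPdist_le /(_ _ eC) H1 := cz.
have /cvgrPdist_le /(_ _ e2) H2 := cs.
have H3 : \forall s' \near s, `|s'| < c.
  have : {for s, continuous (fun u : R => `|u|)} by exact: norm_continuous.
  by move=> /(_ _ (lt_nbhsl sc)).
have H4 : \forall z \near (s, t), (`|z0 t - z0 z.2| <= e / 2 / (C + 1)) /\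
   (forall s, `|s| < c -> `|phi s z.2 - phi s t| <= C * `|z0 z.2 - z0 t|).
  apply: (@near_snd s t (fun t' => `|z0 t - z0 t'| <= e / 2 / (C + 1) /\
    (forall s, `|s| < c -> `|phi s t' - phi s t| <= C * `|z0 t' - z0 t|))).
  exact: filterS2 H1 HC.
have H5 : \forall z \near (s, t), `|phi s t - phi z.1 t| <= e / 2 /\ `|z.1| < c.
  apply: (@near_fst s t (fun s' => `|phi s t - phi s' t| <= e / 2 /\ `|s'| < c)).
  exact: filterS2 H2 H3.
apply: filterS2 H4 H5 => -[s' t'] /= [h1 h2] [h3 h4].
have -> : phi s t - phi s' t' = (phi s t - phi s' t) - (phi s' t' - phi s' t).
  by rewrite opprB addrA subrK.
apply: le_trans (ler_normB _ _) _; rewrite [e]splitr lerD //.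
apply: le_trans (h2 s' h4) _; rewrite distrC.
apply: le_trans (ler_wpM2l C0 h1) _.
rewrite mulrA ler_pdivrMr; last by rewrite ltr_wpDl.
by rewrite mulrC ler_wpM2l ?lerDl // ltW.
Qed.

(** [N] and [F] are quantified after [k]: the [t]-derivative is a component of a family for
    [tangent_lift F], of doubled dimension, and the induction hypothesis is used there. *)
Theorem solfam_Ck k : forall N (F : 'rV[R]_N -> 'rV[R]_N) c J z0 phi, 0 < c -> open J ->
  (forall y, Csm F y) -> solution_family F c J z0 phi -> Ck k (box c J) (fun z => phi z.1 z.2).
Proof.
elim: k => [|k IH] N F c J z0 phi c0 oJ hF S; first exact: solfam_cont S.
have oB := @open_box c J oJ.
have ST := solfam_T c0 oJ hF S.
have Cphi := IH _ _ _ _ _ _ c0 oJ hF S.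
have CT := IH _ _ _ _ _ _ c0 oJ (Csm_tangent_lift hF) ST.
have [ds _ _ _] := S; have diff := fam_diff c0 oJ hF S.
apply/(@Ck_coord _ _ _ (fdim_rV R N)) => // i.
apply: (@Ck_partials _ _ (fdim_RR R) k _ _ (fun j z =>
    if j == 0 then F (phi z.1 z.2) 0 i else dphi phi z.1 z.2 0 i)) => //.
- move=> j [s t] [/= sc Jt]; rewrite /fb_vec /= /RR_vec; case: ifP => _ /=.
    have := (@is_derive_line R (R * R)%type R (fun z => phi z.1 z.2 0 i) (0, t) (1, 0) s (F (phi s t) 0 i)).2.
    rewrite (_ : s *: _ + _ = (s, t)); last first.
      by congr (_, _) => /=; rewrite /GRing.scale /= ?mulr1 ?mulr0 ?add0r ?addr0.
    apply; rewrite (_ : (fun u => _) = (fun u => phi u t 0 i)); first exact: ds.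
    by apply: funext => u /=; rewrite /GRing.scale /= ?mulr1 ?mulr0 ?add0r ?addr0.
  have := (@is_derive_line R (R * R)%type R (fun z => phi z.1 z.2 0 i) (s, 0) (0, 1) t (dphi phi s t 0 i)).2.
  rewrite (_ : t *: _ + _ = (s, t)); last first.
    by congr (_, _) => /=; rewrite /GRing.scale /= ?mulr1 ?mulr0 ?add0r ?addr0.
  apply; rewrite (_ : (fun u => _) = (fun u => phi s u 0 i)).
    by have [d1 _ _] := diff t Jt; exact: d1.
  by apply: funext => u /=; rewrite /GRing.scale /= ?mulr1 ?mulr0 ?add0r ?addr0.
- move=> j; case Ej: (j == 0).
    apply: (@Ck_comp_R _ _ _ (fdim_rV R N) k _ setT (fun z => phi z.1 z.2) (fun y => F y 0 i)) => //.
    by apply: Csm_Cinf => y _; exact: CsmF.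
  have /(@Ck_coord _ _ _ (fdim_rV R (N + N)) k _ _ oB) /(_ (rshift N i)) := CT.
  by apply: Ck_eq => // z _ /=; rewrite row_mxEr.
Qed.

Theorem flow_exists N (F : 'rV[R]_N -> 'rV[R]_N) (z0 : R -> 'rV[R]_N) (t0 : R) :
  (forall y, Csm F y) -> Csm z0 t0 -> exists c d phi,
  [/\ 0 < c, 0 < d & solution_family F c (ball t0 d) z0 phi].
Proof.
(* Initial values within 1 of [z0 t0] and a displacement of at most c B <= 1/2 keep solutions in the
   ball of radius [r], where clipping is the identity; the clipped field is globally bounded and
   Lipschitz, as [picard] asks. *)
move=> hF Cz; pose r := `|z0 t0| + 2.
have r0 : 0 < r by rewrite ltr_wpDl.
pose cl (y : 'rV[R]_N) : 'rV[R]_N := \row_i clip r (y 0 i).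
have cl_lip u v : `|cl u - cl v| <= `|u - v|.
  apply/rV_norm_le => // i; rewrite !mxE; apply: le_trans (clip_lip _ _ _) _.
  by have := coord_le (u - v) i; rewrite !mxE.
have cl_r y : `|cl y| <= r.
  by apply/rV_norm_le => [|i]; [exact: ltW|rewrite mxE; apply: clip_norm; exact: ltW].
have cl_id y : `|y| <= r -> cl y = y.
  move=> yr; apply/rowP => i; rewrite mxE clip_id //; exact: le_trans (coord_le _ _) yr.
have [B B0 HB] := F_bounded hF r; have [L L0 HL] := F_lip hF r.
pose c := Num.min (2^-1 / (L + 1)) (2^-1 / (B + 1)).
have L1 : 0 < L + 1 by rewrite ltr_wpDl.
have B1 : 0 < B + 1 by rewrite ltr_wpDl.
have c0 : 0 < c by rewrite lt_min !divr_gt0.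
have cL : c * L <= 2^-1.
  apply: le_trans (_ : 2^-1 / (L + 1) * L <= _); first by rewrite ler_wpM2r // ge_min lexx.
  by rewrite mulrAC ler_pdivrMr // ler_wpM2l // lerDl.
have cB : c * B <= 2^-1.
  apply: le_trans (_ : 2^-1 / (B + 1) * B <= _); first by rewrite ler_wpM2r // ge_min lexx orbT.
  by rewrite mulrAC ler_pdivrMr // ler_wpM2l // lerDl.
have near1 : \forall t \near t0, Csm z0 t /\ `|z0 t0 - z0 t| <= 1.
  have /cvgrPdist_le /(_ 1 ltr01) H := Csm_cont Cz.
  exact: filterS2 (Csm_open Cz) H.
have [d /= d0 Hd] := (nbhs_ballP _ _).1 near1.
have H t : exists y : R -> 'rV[R]_N, ball t0 d t -> y 0 = z0 t /\ forall s : R, `|s| < c ->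
    `|y s| <= r /\ forall i, is_derive s 1 (fun s => y s 0 i) (F (y s) 0 i).
  have [bt|nbt] := pselect (ball t0 d t); last by exists (fun _ => 0).
  have [_ zt] := Hd t bt.
  have [y [y0 Hy]] := @picard R N (F \o cl) B L c (z0 t) c0 B0 L0
    (fun u v => le_trans (HL _ _ (cl_r u) (cl_r v)) (ler_wpM2l L0 (cl_lip u v)))
    (fun u => HB _ (cl_r u)) cL.
  exists y => _; split=> // s sc; have [ys dy] := Hy s sc.
  have yr : `|y s| <= r.
    have -> : y s = (y s - z0 t) - (z0 t0 - z0 t) + z0 t0 by rewrite opprB !addrA subrK subrK.
    apply: le_trans (ler_normD _ _) _; rewrite /r addrC lerD2l.
    by apply: le_trans (ler_normB _ _) _; lra.
  by split=> // i; have := dy i; rewrite /= cl_id.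
have [phi Hphi] := choice H.
exists c, d, (fun s t => phi t s); split=> //; split.
- by move=> t s bt sc i; exact: ((Hphi t bt).2 s sc).2.
- by move=> t bt; exact: (Hphi t bt).1.
- by move=> t /Hd [].
- move=> t bt; exists r; have : \forall t' \near t, ball t0 d t'.
    by apply: open_nbhs_nbhs; split=> //; exact: ball_open.
  by apply: filterS => t' bt' s sc; exact: ((Hphi t' bt').2 s sc).1.
Qed.

End Tangent.

Lemma lip_cont_at (R : realType) (V W : normedModType R) (f : V -> W) (w : V) (L : R) : 0 <= L ->
  (forall w', `|w'| <= `|w| + 1 -> `|f w - f w'| <= L * `|w - w'|) -> {for w, continuous f}.
Proof.
move=> L0 H; apply/cvgrPdist_le => e e0.
have Le : 0 < e / (L + 1) by rewrite divr_gt0 // ltr_wpDl.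
have /cvgrPdist_le /(_ _ Le) H1 := @cvg_id _ (nbhs w).
have /cvgrPdist_le /(_ _ ltr01) H2 := @cvg_id _ (nbhs w).
apply: filterS2 H1 H2 => w' h1 h2.
have w'r : `|w'| <= `|w| + 1.
  rewrite -[w'](subrK w); apply: le_trans (ler_normD _ _) _.
  by rewrite addrC lerD2l distrC.
apply: le_trans (H w' w'r) _; apply: le_trans (ler_wpM2l L0 h1) _.
rewrite mulrA ler_pdivrMr; last by rewrite ltr_wpDl.
by rewrite mulrC ler_wpM2l ?lerDl // ltW.
Qed.

(** * Derivations in coordinates *)

Section Hadamard.
Variables (R : realType) (n : nat).
Local Notation E := 'rV[R]_n.
Local Notation I01 := (`[0:R, 1]%classic).
Local Notation int01 f := (\int[@lebesgue_measure R]_(t in `[0%R, 1%R]) f t).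

Lemma Csm_within_cont (A : set R) (f : R -> R) : (forall t, Csm f t) -> {within A, continuous f}.
Proof. by move=> Hf; apply: continuous_subspaceT => t; exact: Csm_cont. Qed.

Lemma int01_D (f g : R -> R) : {within I01, continuous f} -> {within I01, continuous g} ->
  int01 (fun t => f t + g t) = int01 f + int01 g.
Proof. by move=> cf cg; apply: RintegralD => //; exact: int01_integrable. Qed.

Lemma int01_sum (J : Type) (s : seq J) (F : J -> R -> R) : (forall j t, Csm (F j) t) ->
  int01 (fun t => \sum_(j <- s) F j t) = \sum_(j <- s) int01 (F j).
Proof.
move=> HF; elim: s => [|j s IH].
  by rewrite big_nil -[RHS](int01_cst 0); apply: int01_eq => t _; rewrite big_nil.
rewrite big_cons -IH -int01_D.
- by apply: int01_eq => t _; rewrite big_cons.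
- exact: Csm_within_cont.
- by apply: Csm_within_cont => t; apply: (@Csm_sum _ _ _ _ s xpredT).
Qed.

(** Each derivative in [w] brings out a factor t; the exponent [m] records these factors and closes
    the family under differentiation. *)
Definition ray_integral (m : nat) (f : E -> R) (w : E) : R := int01 (fun t => t ^+ m * f (t *: w)).

Lemma Csm_exp (V : normedModType R) (a : V -> R) (m : nat) x : Csm a x -> Csm (fun y => a y ^+ m) x.
Proof.
move=> Ha; elim: m => [|m IH].
  by apply: Csm_eq (Csm_cst (1 : R) x) => y; rewrite expr0.
by apply: Csm_eq (Csm_mul Ha IH) => y; rewrite exprS.
Qed.

Lemma Csm_ray (m : nat) (f : E -> R) (w : E) (t : R) : (forall y, Csm f y) ->
  Csm (fun t : R => t ^+ m * f (t *: w)) t.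
Proof.
move=> Hf; apply: Csm_mul; first by apply: Csm_exp; exact: Csm_id.
apply: (@Csm_comp _ _ _ (fdim_rV R n) _ (fdim_R R) (fun t : R => t *: w) f); last exact: Hf.
by apply: Csm_Zl; exact: Csm_id.
Qed.

Lemma ray_integral_deriv m (f : E -> R) (w v : E) : (forall y, Csm f y) ->
  is_derive w v (ray_integral m f) (ray_integral m.+1 ('D_v f) w).
Proof.
move=> Hf.
have := (@is_derive_line R E R (ray_integral m f) w v 0 (ray_integral m.+1 ('D_v f) w)).2.
rewrite scale0r add0r; apply; apply: is_deriv_in_derive.
apply: (@int01_deriv R setT (fun e t => t ^+ m * f (t *: (e *: v + w))) 0
  (fun t => t ^+ m.+1 * 'D_v f (t *: w))) => // t It.
have shift (s t' : R) : s *: ((1, 0) : R * R) + (0, t') = (s, t').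
  by congr (_, _) => /=; rewrite /GRing.scale /= ?mulr1 ?mulr0 ?addr0 ?add0r.
pose h (z : R * R) := z.2 ^+ m * f (z.2 *: (z.1 *: v + w)).
have Ch z : Csm h z.
  apply: Csm_mul; first by apply: Csm_exp; apply: Csm_snd; exact: Csm_id.
  apply: (@Csm_comp _ _ _ (fdim_rV R n) _ (fdim_R R) (fun z : R * R => z.2 *: (z.1 *: v + w)) f); last exact: Hf.
  apply: Csm_scale; first by apply: Csm_snd; exact: Csm_id.
  apply: Csm_add; last exact: Csm_cst.
  by apply: Csm_Zl; apply: Csm_fst; exact: Csm_id.
exists h; split=> //; first by near=> z.
near=> t' => _.
have d1 : is_derive (0 : R) 1 (fun u : R => f (u *: (t' *: v) + t' *: w)) (t' * 'D_v f (t' *: w)).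
  have := (@is_derive_line R E R f (t' *: w) (t' *: v) 0 (t' * 'D_v f (t' *: w))).1.
  apply; rewrite scale0r add0r; apply: DeriveDef.
    by apply: diff_derivable; exact: Csm_diff.
  by rewrite !deriveE ?linearZ //; exact: Csm_diff.
have d2 : is_derive ((0, t') : R * R) (1, 0) h (t' ^+ m.+1 * 'D_v f (t' *: w)).
  rewrite -(shift 0 t'); apply/is_derive_line.
  rewrite (_ : (fun u => _) = (fun u => t' ^+ m * f (u *: (t' *: v) + t' *: w))); last first.
    by apply: funext => u; rewrite shift /h /= scalerDr !scalerA [t' * u]mulrC.
  apply: is_derive_eq (is_deriveM (is_derive_cst (t' ^+ m) (0 : R) (1 : R)) d1) _.
  by rewrite /cst /GRing.scale /= mulr0 addr0 exprS; ring.
by rewrite (@derive_val _ _ _ _ _ _ _ d2).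
Unshelve. all: by end_near. Qed.

Lemma Ck_ray_integral k : forall m (f : E -> R), (forall y, Csm f y) -> Ck k setT (ray_integral m f).
Proof.
elim: k => [|k IH] m f Hf.
  move=> w _; have [L L0 HL] := Csm_lip (`|w| + 1) Hf.
  apply: (@lip_cont_at R E R _ w L L0) => w' w'r.
  rewrite -int01_B; try by apply: Csm_within_cont => t; exact: Csm_ray.
  have wr : `|w| <= `|w| + 1 by rewrite lerDl.
  apply: int01_norm_le.
    by apply: within_cont_sub; apply: Csm_within_cont => t; exact: Csm_ray.
  move=> t; rewrite /= in_itv /= => /andP[t0 t1].
  rewrite -mulrBr normrM normrX (ger0_norm t0).
  have tm : t ^+ m <= 1 by rewrite exprn_ile1.
  have tz (z : E) : `|z| <= `|w| + 1 -> `|t *: z| <= `|w| + 1.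
    by move=> zr; rewrite normrZ (ger0_norm t0) -[leRHS]mul1r ler_pM.
  apply: le_trans (_ : 1 * (L * `|t *: w - t *: w'|) <= _).
    by rewrite ler_pM ?exprn_ge0 //; apply: HL; exact: tz.
  rewrite mul1r -scalerBr normrZ (ger0_norm t0).
  by rewrite ler_wpM2l // -[leRHS]mul1r ler_wpM2r.
apply: (@Ck_partials _ _ (fdim_rV R n) k setT _ (fun i => ray_integral m.+1 ('D_(delta_mx 0 i) f))).
- exact: openT.
- by move=> i w _; exact: ray_integral_deriv.
- by move=> i; apply: IH => y; exact: Csm_derive.
Qed.

(** [G i] is the mean of the i-th partial derivative over the segment from [y0] to [y]; the
    expansion is the fundamental theorem of calculus along that segment. *)
Lemma hadamard (f : E -> R) (y0 : E) : (forall y, Csm f y) ->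
  exists G : 'I_n -> E -> R, [/\ forall i y, Csm (G i) y,
    forall i, G i y0 = 'D_(delta_mx 0 i) f y0 &
    forall y, f y = f y0 + \sum_i (y 0 i - y0 0 i) * G i y].
Proof.
move=> Hf; pose f1 (w : E) := f (w + y0).
have Hs y : Csm (fun w : E => w + y0) y by apply: Csm_add; [exact: Csm_id|exact: Csm_cst].
have Hf1 y : Csm f1 y.
  by apply: (@Csm_comp _ _ _ (fdim_rV R n) _ (fdim_R R) (fun w => w + y0) f); [exact: Hs|exact: Hf].
exists (fun i y => ray_integral 0 ('D_(delta_mx 0 i) f1) (y - y0)); split.
- move=> i y; apply: (@Csm_comp _ _ _ (fdim_rV R n) _ (fdim_R R) (fun y => y - y0) (ray_integral 0 ('D_(delta_mx 0 i) f1))).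
    by apply: Csm_add; [exact: Csm_id|exact: Csm_cst].
  exists setT; first by split=> //; exact: openT.
  by move=> k; apply: Ck_ray_integral => z; exact: Csm_derive.
- move=> i; rewrite subrr /ray_integral -[RHS]int01_cst; apply: int01_eq => t _.
  rewrite expr0 mul1r scaler0 /f1; apply: (@derive_val _ _ _ _ _ _ _ _).
  have := @is_derive_line R E R f1 0 (delta_mx 0 i) 0 ('D_(delta_mx 0 i) f y0).
  rewrite scale0r addr0 => -[_]; apply.
  have := @is_derive_line R E R f y0 (delta_mx 0 i) 0 ('D_(delta_mx 0 i) f y0).
  rewrite scale0r add0r => -[+ _].
  rewrite /f1 (_ : (fun u : R => f (u *: delta_mx 0 i + y0)) = (fun u : R => f (u *: delta_mx 0 i + 0 + y0))).
    by apply; apply: derivableP; apply: diff_derivable; exact: Csm_diff.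
  by apply: funext => u; rewrite addr0.
- move=> y; set w := y - y0.
  have -> : f y = f1 (1 *: w) by rewrite /f1 scale1r subrK.
  have -> : f y0 = f1 (0 *: w) by rewrite /f1 scale0r add0r.
  have dt (t : R) : is_derive t 1 (fun t : R => f1 (t *: w)) ('D_w f1 (t *: w)).
    have := @is_derive_line R E R f1 0 w t ('D_w f1 (t *: w)).
    rewrite (_ : (fun u : R => f1 (u *: w + 0)) = (fun u : R => f1 (u *: w))).
      rewrite addr0 => -[+ _]; apply; apply: derivableP; apply: diff_derivable; exact: Csm_diff.
    by apply: funext => u; rewrite addr0.
  have CD : forall t : R, Csm (fun t : R => 'D_w f1 (t *: w)) t.
    move=> t; apply: Csm_eq (@Csm_ray 0 ('D_w f1) w t _) => [u|z]; first by rewrite expr0 mul1r.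
    exact: Csm_derive.
  have := @FTC01 R (fun t : R => f1 (t *: w)) (fun t : R => 'D_w f1 (t *: w)) (Csm_within_cont CD).
  move=> /(_ (fun t _ => is_derive_in I01 (dt t))) E1.
  have E2 : f1 (1 *: w) = f1 (0 *: w) + int01 (fun t : R => 'D_w f1 (t *: w)) by rewrite E1; ring.
  rewrite E2; congr (_ + _).
  rewrite (_ : (fun t : R => 'D_w f1 (t *: w)) = (fun t : R => \sum_i w 0 i * (t ^+ 0 * 'D_(delta_mx 0 i) f1 (t *: w)))).
    rewrite int01_sum.
      apply: eq_bigr => i _; rewrite int01_Zl; last first.
        apply: (@Csm_within_cont I01 (fun t : R => t ^+ 0 * 'D_(delta_mx 0 i) f1 (t *: w))) => t.
        by apply: (@Csm_ray 0 ('D_(delta_mx 0 i) f1) w t) => z; exact: Csm_derive.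
      by rewrite /w !mxE.
    move=> i t; apply: Csm_mul; first exact: Csm_cst.
    by apply: (@Csm_ray 0 ('D_(delta_mx 0 i) f1) w t) => z; exact: Csm_derive.
  apply: funext => t; rewrite derive_rVE; last exact: Csm_diff.
  by apply: eq_bigr => i _; rewrite expr0 mul1r.
Qed.

End Hadamard.

(** * Tangent vectors as derivations *)

Section Derivations.
Variables (R : realType) (n : nat) (M : manifold R n) (x : M) (v : (M -> R) -> R).
Hypothesis tv : tangent_vector x v.

Lemma tv_lin (k : R) f g : msmooth f -> msmooth g -> v (fun y => k * f y + g y) = k * v f + v g.
Proof. by case: tv => H _; exact: H. Qed.

Lemma tv_mul f g : msmooth f -> msmooth g -> v (fun y => f y * g y) = v f * g x + f x * v g.
Proof. by case: tv => _ H; exact: H. Qed.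

Lemma msmooth_cst (k : R) : msmooth (fun _ : M => k).
Proof. by apply/msmoothP => y; exact: msmooth_at_cst. Qed.

Lemma tv_cst (k : R) : v (fun _ => k) = 0.
Proof.
have H0 : v (fun _ => 0) = 0.
  have := tv_lin 1 (msmooth_cst 0) (msmooth_cst 0).
  rewrite (_ : (fun y : M => 1 * 0 + 0) = (fun=> 0)).
    by rewrite mul1r => H; apply: (@addrI _ (v (fun=> 0))); rewrite addr0 -H.
  by apply: funext => y; rewrite mulr0 addr0.
have H1 : v (fun _ => 1) = 0.
  have := tv_mul (msmooth_cst 1) (msmooth_cst 1).
  rewrite (_ : (fun y : M => 1 * 1) = (fun=> 1)); last by apply: funext => y; rewrite mulr1.
  by rewrite mulr1 mul1r => H; apply: (@addrI _ (v (fun=> 1))); rewrite addr0 -H.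
have E := tv_lin k (msmooth_cst 1) (msmooth_cst 0).
rewrite H0 H1 mulr0 [X in _ = X]addr0 in E; rewrite -[RHS]E; congr v.
by apply: funext => y; rewrite mulr1 addr0.
Qed.

Lemma tv_add f g : msmooth f -> msmooth g -> v (fun y => f y + g y) = v f + v g.
Proof.
move=> Hf Hg; have := tv_lin 1 Hf Hg; rewrite mul1r => <-.
by congr v; apply: funext => y; rewrite mul1r.
Qed.

Lemma tv_sum (J : Type) (s : seq J) (F : J -> M -> R) : (forall j, msmooth (F j)) ->
  v (fun y => \sum_(j <- s) F j y) = \sum_(j <- s) v (F j).
Proof.
move=> HF; elim: s => [|j s IH].
  by rewrite big_nil -[RHS](tv_cst 0); congr v; apply: funext => y; rewrite big_nil.
rewrite big_cons -IH -tv_add //.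
  by congr v; apply: funext => y; rewrite big_cons.
by apply/msmoothP => y; apply: msmooth_at_sum => i; exact: (msmoothP (F i)).1 (HF i) y.
Qed.

(** With a bump [chi] vanishing wherever [f] and [g] differ, chi f = chi g everywhere, and the
    Leibniz rule at [x], where [chi] is 1, compares [v f] with [v g]. *)
Lemma tv_near f g : msmooth f -> msmooth g -> (\forall y \near x, f y = g y) -> v f = v g.
Proof.
move=> Hf Hg fg; have [chi [c1 c2 c3]] := bump_manifold fg.
have E : (fun y => chi y * f y) = (fun y => chi y * g y).
  apply: funext => y; have [->//|ne] := pselect (f y = g y).
  by rewrite (nbhs_singleton (c3 y ne)) !mul0r.
have := tv_mul c1 Hf; rewrite E (tv_mul c1 Hg).
rewrite (nbhs_singleton c2) (nbhs_singleton fg) !mul1r => H.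
by apply: (addrI (v chi * g x)); rewrite H.
Qed.

(* By Hadamard's lemma a derivation only sees the first-order Taylor expansion
   in the coordinates. *)
Lemma tv_coord c (X : 'I_n -> M -> R) f : atlas c -> cdom c x ->
  (forall k, msmooth (X k)) -> (\forall y \near x, forall k, X k y = cmap c y 0 k) ->
  msmooth f ->
  v f = \sum_k v (X k) * 'D_(delta_mx 0 k) (f \o cinv c) (cmap c x).
Proof.
move=> ac cx HX EX Hf; set y0 := cmap c x.
have Cf : Csm (f \o cinv c) y0 by apply: (msmoothP f).1.
have [fh Hfh Efh] := @Csm_extend R n R (fdim_R R) _ _ Cf.
have [G [HG HG0 EG]] := hadamard y0 Hfh.
have HGc i : exists g : M -> R, msmooth g /\ {near x, g =1 G i \o cmap c}.
  have [|g Hg Eg] := @msmooth_at_extend R n M R (fdim_R R) (G i \o cmap c) x.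
    by apply: msmooth_at_compl; [exact: msmooth_at_cmap|exact: HG].
  by exists g; split=> //; exact/msmoothP.
have [g Hg] := choice HGc.
have gx i : g i x = 'D_(delta_mx 0 i) (f \o cinv c) y0.
  by rewrite (nbhs_singleton (Hg i).2) /= HG0; apply: near_eq_derive.
have Xx k : X k x = y0 0 k by rewrite (nbhs_singleton EX).
have Hterm i : msmooth (fun y => (X i y + - y0 0 i) * g i y).
  apply/msmoothP => y; apply: msmooth_at_mul; last exact: (msmoothP (g i)).1 (Hg i).1 y.
  by apply: msmooth_at_add; [exact: (msmoothP (X i)).1|exact: msmooth_at_cst].
have HR : msmooth (fun y => f x + \sum_i (X i y + - y0 0 i) * g i y).
  apply/msmoothP => y; apply: msmooth_at_add; first exact: msmooth_at_cst.
  by apply: msmooth_at_sum => i; exact: (msmoothP _).1 (Hterm i) y.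
rewrite (@tv_near f (fun y => f x + \sum_i (X i y + - y0 0 i) * g i y)) //; last first.
  have N1 : \forall y \near x, fh (cmap c y) = f (cinv c (cmap c y)) by exact: (near_cmap cx Efh).
  have N2 : \forall y \near x, forall i, g i y = G i (cmap c y).
    by apply: filter_forall => i; exact: (Hg i).2.
  near=> y.
  have cy : cdom c y by near: y; exact: cdom_nbhs.
  have E1 : fh (cmap c y) = f (cinv c (cmap c y)) by near: y.
  have E2 : forall k, X k y = cmap c y 0 k by near: y.
  have E3 : forall i, g i y = G i (cmap c y) by near: y.
  rewrite -[f y](_ : f (cinv c (cmap c y)) = _); last by rewrite cmapK.
  rewrite -E1 EG (nbhs_singleton Efh) /= cmapK //; congr (_ + _).
  by apply: eq_bigr => i _; rewrite E2 E3.
rewrite tv_add; [|exact: msmooth_cst|]; last first.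
  by apply/msmoothP => y; apply: msmooth_at_sum => i; exact: (msmoothP _).1 (Hterm i) y.
rewrite tv_cst add0r tv_sum //; apply: eq_bigr => i _.
have HXi : msmooth (fun y => X i y + - y0 0 i).
  by apply/msmoothP => y; apply: msmooth_at_add; [exact: (msmoothP (X i)).1|exact: msmooth_at_cst].
rewrite tv_mul //; last exact: (Hg i).1.
rewrite Xx subrr mul0r addr0 gx tv_add //; last exact: msmooth_cst.
by rewrite tv_cst addr0.
Unshelve. all: by end_near. Qed.

End Derivations.

(** * Sections, metrics and the Levi-Civita connection *)

Section Bundle.
Variables (R : realType) (n : nat) (M : manifold R n) (r : nat) (A : vector_bundle M r).
Implicit Types (a b c : section A) (x y : M).

Definition smooth_section_at a x := forall T, trivs T -> tdom T x ->
  msmooth_at (fun y => @tcoord _ _ _ _ _ T y (a y)) x.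

Lemma smooth_sectionP a : smooth_section a <-> forall x, smooth_section_at a x.
Proof.
split=> [H x T tT Tx|H T tT].
  by have := (msmooth_onP _ (tdom_open T)).1 (H T tT); apply.
by apply/(msmooth_onP _ (tdom_open T)) => x Tx; exact: H.
Qed.

Section Triv.
Variables (T : trivialization r A) (x : M).
Hypothesis Tx : tdom T x.

Lemma tcoordP (k : R) (u v : A x) : tcoord T (k *: u + v) = k *: tcoord T u + tcoord T v.
Proof. exact: tcoord_linear. Qed.

Lemma tcoord0 : tcoord T (0 : A x) = 0.
Proof.
have := tcoordP 1 0 0; rewrite scaler0 addr0 scale1r => H.
by apply: (@addrI _ (tcoord T (0 : A x))); rewrite addr0 -H.
Qed.

Lemma tcoordD (u v : A x) : tcoord T (u + v) = tcoord T u + tcoord T v.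
Proof. by have := tcoordP 1 u v; rewrite !scale1r. Qed.

Lemma tcoordZ (k : R) (u : A x) : tcoord T (k *: u) = k *: tcoord T u.
Proof. by have := tcoordP k u 0; rewrite tcoord0 !addr0. Qed.

Lemma tcoord_sum (I : Type) (s : seq I) (F : I -> A x) :
  tcoord T (\sum_(i <- s) F i) = \sum_(i <- s) tcoord T (F i).
Proof.
elim: s => [|i s IH]; first by rewrite !big_nil tcoord0.
by rewrite !big_cons tcoordD IH.
Qed.

Lemma tinvE (v : 'rV[R]_r) : tinv T x v = \sum_i v 0 i *: tinv T x (delta_mx 0 i).
Proof.
apply: (can_inj (tcoordK Tx)); rewrite tinvK // tcoord_sum.
rewrite [LHS]row_sum_delta; apply: eq_bigr => i _.
by rewrite tcoordZ tinvK.
Qed.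

End Triv.

Lemma smooth_section_at_triv a x T : trivs T -> tdom T x ->
  msmooth_at (fun y => @tcoord _ _ _ _ _ T y (a y)) x -> smooth_section_at a x.
Proof.
move=> tT Tx Ha T' tT' T'x.
have nT : \forall y \near x, tdom T y.
  by apply: open_nbhs_nbhs; split; [exact: tdom_open|].
have nT' : \forall y \near x, tdom T' y.
  by apply: open_nbhs_nbhs; split; [exact: tdom_open|].
apply: (@msmooth_at_near _ _ _ _ (fun y => \sum_i tcoord T (a y) 0 i *: tcoord T' (tinv T y (delta_mx 0 i)))).
  apply: filterS2 nT nT' => y Ty T'y.
  rewrite -[in RHS](tcoordK Ty (a y)) [in RHS]tinvE // tcoord_sum //.
  by apply: eq_bigr => i _; rewrite tcoordZ.
apply: (@msmooth_at_sum _ _ _ _ _ _ (fun i y => tcoord T (a y) 0 i *: tcoord T' (tinv T y (delta_mx 0 i)))) => i.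
apply: (@msmooth_at_scale _ _ _ _ (fdim_rV R r)); first by have /msmooth_at_rV := Ha; exact.
have := (msmooth_onP _ (openI (tdom_open T) (tdom_open T'))).1 (trivs_compat tT tT' (delta_mx 0 i)).
by apply.
Qed.

Lemma smooth_section_at_near a b x : (\forall y \near x, a y = b y) ->
  smooth_section_at a x -> smooth_section_at b x.
Proof.
move=> ab Ha T tT Tx; apply: (msmooth_at_near (f := fun y => tcoord T (a y))); last exact: Ha.
by apply: filterS ab => y ->.
Qed.

Lemma near_tdom (T : trivialization r A) x : tdom T x -> \forall y \near x, tdom T y.
Proof. by move=> Tx; apply: open_nbhs_nbhs; split; [exact: tdom_open|]. Qed.

Lemma smooth_section_at_add a b x : smooth_section_at a x -> smooth_section_at b x ->
  smooth_section_at (fun y => a y + b y) x.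
Proof.
move=> Ha Hb T tT Tx.
apply: (msmooth_at_near (f := fun y => tcoord T (a y) + tcoord T (b y))).
  by apply: filterS (near_tdom Tx) => y Ty; rewrite tcoordD.
by apply: msmooth_at_add; [exact: Ha|exact: Hb].
Qed.

Lemma smooth_section_at_scale (f : M -> R) a x : msmooth_at f x -> smooth_section_at a x ->
  smooth_section_at (fun y => f y *: a y) x.
Proof.
move=> Hf Ha T tT Tx.
apply: (msmooth_at_near (f := fun y => f y *: tcoord T (a y))).
  by apply: filterS (near_tdom Tx) => y Ty; rewrite tcoordZ.
by apply: (@msmooth_at_scale _ _ _ _ (fdim_rV R r)) => //; exact: Ha.
Qed.

Lemma smooth_section_at_0 x : smooth_section_at (fun _ => 0) x.
Proof.
move=> T tT Tx; apply: (msmooth_at_near (f := fun _ => 0)); last exact: msmooth_at_cst.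
by apply: filterS (near_tdom Tx) => y Ty; rewrite tcoord0.
Qed.

Lemma smooth_section_0 : smooth_section (fun x => 0 : A x).
Proof. by apply/smooth_sectionP => x; exact: smooth_section_at_0. Qed.

Lemma smooth_section_add a b : smooth_section a -> smooth_section b ->
  smooth_section (fun y => a y + b y).
Proof.
move=> /smooth_sectionP Ha /smooth_sectionP Hb; apply/smooth_sectionP => x.
by apply: smooth_section_at_add.
Qed.

Lemma smooth_section_scale (f : M -> R) a : msmooth f -> smooth_section a ->
  smooth_section (fun y => f y *: a y).
Proof.
move=> /msmoothP Hf /smooth_sectionP Ha; apply/smooth_sectionP => x.
by apply: smooth_section_at_scale.
Qed.

Lemma smooth_section_sum (I : Type) (s : seq I) (F : I -> section A) :
  (forall i, smooth_section (F i)) -> smooth_section (fun y => \sum_(i <- s) F i y).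
Proof.
move=> H; elim: s => [|i s IH].
  rewrite (_ : (fun y => _) = (fun y => 0 : A y)); first exact: smooth_section_0.
  by apply: functional_extensionality_dep => y; rewrite big_nil.
rewrite (_ : (fun y => _) = (fun y => F i y + \sum_(j <- s) F j y)).
  exact: smooth_section_add.
by apply: functional_extensionality_dep => y; rewrite big_cons.
Qed.

Definition is_frame (T : trivialization r A) (e : 'I_r -> section A) (y : M) :=
  tdom T y /\ forall i, e i y = tinv T y (delta_mx 0 i).

(** A bump function extends the basis of a trivialization by 0. Global sections are required because
    the bracket and [D] accept nothing else. *)
Lemma frame_exists x : exists (T : trivialization r A) (e : 'I_r -> section A),
  [/\ trivs T, forall i, smooth_section (e i) & \forall y \near x, is_frame T e y].
Proof.
have [T tT Tx] := trivs_cover A x.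
have [chi [c1 c2 c3]] := bump_manifold (near_tdom Tx).
exists T, (fun i y => chi y *: tinv T y (delta_mx 0 i)); split=> //.
  move=> i; apply/smooth_sectionP => y; have [Ty|nTy] := pselect (tdom T y).
    apply: smooth_section_at_scale; first exact: (msmoothP chi).1.
    apply: (smooth_section_at_triv tT Ty).
    apply: (msmooth_at_near (f := fun _ => delta_mx 0 i)); last exact: msmooth_at_cst.
    by apply: filterS (near_tdom Ty) => z Tz; rewrite tinvK.
  apply: (@smooth_section_at_near (fun _ => 0)); last exact: smooth_section_at_0.
  by apply: filterS (c3 y nTy) => z ->; rewrite scale0r.
by apply: filterS2 c2 (near_tdom Tx) => y Ey Ty; split=> // i /=; rewrite Ey scale1r.
Qed.

Lemma frame_expand T e y (u : A y) : is_frame T e y ->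
  u = \sum_i tcoord T u 0 i *: e i y.
Proof.
move=> [Ty He]; rewrite -[LHS](tcoordK Ty) tinvE //.
by apply: eq_bigr => i _; rewrite He.
Qed.

Lemma frame_lincomb T e y (v : 'rV[R]_r) : is_frame T e y -> lincomb y v e = tinv T y v.
Proof. by move=> [Ty He]; rewrite tinvE //; apply: eq_bigr => i _; rewrite He. Qed.

Lemma frame_bij T e y : is_frame T e y -> bijective (fun v => lincomb y v e).
Proof.
move=> F; exists (@tcoord _ _ _ _ _ T y) => v; rewrite (frame_lincomb _ F); case: F => Ty _.
  exact: tinvK.
exact: tcoordK.
Qed.

Lemma section_through x (u : A x) : exists2 a : section A, smooth_section a & a x = u.
Proof.
have [T [e [tT He /nbhs_singleton Fx]]] := frame_exists x.
exists (fun y => \sum_i tcoord T u 0 i *: e i y); last by rewrite -frame_expand.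
apply: smooth_section_sum => i; apply: smooth_section_scale => //.
exact: msmooth_cst.
Qed.

Lemma section_expand a x : smooth_section a -> exists (e : 'I_r -> section A) (f : 'I_r -> M -> R),
  [/\ forall i, smooth_section (e i), forall i, msmooth (f i),
      \forall y \near x, a y = \sum_i f i y *: e i y & a x = 0 -> forall i, f i x = 0].
Proof.
move=> /smooth_sectionP Ha; have [T [e [tT He Fx]]] := frame_exists x.
have [Tx _] := nbhs_singleton Fx.
have H i : exists g : M -> R, msmooth g /\ {near x, g =1 fun y => tcoord T (a y) 0 i}.
  have [|g Hg Eg] := @msmooth_at_extend R n M R (fdim_R R) (fun y => tcoord T (a y) 0 i) x.
    by have /msmooth_at_rV := Ha x T tT Tx; exact.
  by exists g; split=> //; exact/msmoothP.
have [f Hf] := choice H.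
exists e, f; split=> //.
- by move=> i; have [] := Hf i.
- have N : \forall y \near x, forall i, f i y = tcoord T (a y) 0 i.
    by apply: filter_forall => i; exact: (Hf i).2.
  apply: filterS2 Fx N => y Fy Ny; rewrite [LHS](frame_expand _ Fy).
  by apply: eq_bigr => i _; rewrite Ny.
- by move=> a0 i; rewrite (nbhs_singleton (Hf i).2) a0 tcoord0 // mxE.
Qed.

End Bundle.

Section Metric.
Variables (R : realType) (n : nat) (M : manifold R n) (r : nat) (A : vector_bundle M r).
Variable g : riemannian_metric A.

Section At.
Variable x : M.
Implicit Types u v w : A x.

Lemma inner0l w : g x 0 w = 0.
Proof.
have := inner_linear g 1 0 0 w; rewrite scaler0 addr0 mul1r => H.
by apply: (@addrI _ (g x 0 w)); rewrite addr0 -H.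
Qed.

Lemma innerDl u v w : g x (u + v) w = g x u w + g x v w.
Proof. by have := inner_linear g 1 u v w; rewrite scale1r mul1r. Qed.

Lemma innerZl (k : R) u w : g x (k *: u) w = k * g x u w.
Proof. by have := inner_linear g k u 0 w; rewrite inner0l !addr0. Qed.

Lemma innerNl u w : g x (- u) w = - g x u w.
Proof. by rewrite -scaleN1r innerZl mulN1r. Qed.

Lemma innerBl u v w : g x (u - v) w = g x u w - g x v w.
Proof. by rewrite innerDl innerNl. Qed.

Lemma innerDr u v w : g x w (u + v) = g x w u + g x w v.
Proof. by rewrite ![g x w _]inner_sym innerDl. Qed.

Lemma innerZr (k : R) u w : g x w (k *: u) = k * g x w u.
Proof. by rewrite ![g x w _]inner_sym innerZl. Qed.

Lemma inner0r w : g x w 0 = 0.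
Proof. by rewrite inner_sym inner0l. Qed.

Lemma inner_suml (I : Type) (s : seq I) (F : I -> A x) w :
  g x (\sum_(i <- s) F i) w = \sum_(i <- s) g x (F i) w.
Proof.
elim: s => [|i s IH]; first by rewrite !big_nil inner0l.
by rewrite !big_cons innerDl IH.
Qed.

Lemma inner_sumr (I : Type) (s : seq I) (F : I -> A x) w :
  g x w (\sum_(i <- s) F i) = \sum_(i <- s) g x w (F i).
Proof. by rewrite inner_sym inner_suml; apply: eq_bigr => i _; rewrite inner_sym. Qed.

(** Every vector of a fiber extends to a smooth global section, in particular [u - v], on which the
    metric is definite. *)
Lemma inner_nondeg u v : (forall c : section A, smooth_section c -> g x u (c x) = g x v (c x)) ->
  u = v.
Proof.
move=> H; apply/eqP; rewrite -subr_eq0; apply/negPn/negP => /(inner_pos g).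
have [c Hc cx] := section_through (u - v).
by have := H c Hc; rewrite cx => E; rewrite innerBl E subrr ltxx.
Qed.

End At.

Lemma inner_msmooth (a b : section A) : smooth_section a -> smooth_section b ->
  msmooth (fun x => g x (a x) (b x)).
Proof. exact: inner_smooth. Qed.

End Metric.

(** * The Koszul formula and its consequences *)

Section LeviCivita.
Variables (R : realType) (n : nat) (M : manifold R n) (r : nat) (A : lie_algebroid M r).
Variables (g : riemannian_metric A) (D : connection_op A).
Hypothesis HD : levi_civita g D.
Implicit Types (a b c : section A) (x y : M).

Lemma anchorZ x (k : R) (u : A x) f : msmooth f -> anchor (k *: u) f = k * anchor u f.
Proof.
move=> Hf; have H0 : anchor (0 : A x) f = 0.
  have := anchor_linear 1 (0 : A x) 0 Hf; rewrite scaler0 addr0 mul1r => H.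
  by apply: (@addrI _ (anchor (0 : A x) f)); rewrite addr0 -H.
by have := anchor_linear k u 0 Hf; rewrite H0 !addr0.
Qed.

Lemma anchorD x (u v : A x) f : msmooth f -> anchor (u + v) f = anchor u f + anchor v f.
Proof. by move=> Hf; have := anchor_linear 1 u v Hf; rewrite scale1r mul1r. Qed.

Lemma anchor0 x f : msmooth f -> anchor (0 : A x) f = 0.
Proof. by move=> Hf; have := anchorZ 0 (0 : A x) Hf; rewrite scale0r mul0r. Qed.

Lemma anchor_sum x (I : Type) (s : seq I) (F : I -> A x) f : msmooth f ->
  anchor (\sum_(i <- s) F i) f = \sum_(i <- s) anchor (F i) f.
Proof.
move=> Hf; elim: s => [|i s IH]; first by rewrite !big_nil anchor0.
by rewrite !big_cons anchorD // IH.
Qed.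

Lemma D_smooth a b : smooth_section a -> smooth_section b -> smooth_section (D a b).
Proof. by move=> Ha Hb; have [] := HD Ha Hb. Qed.

Lemma koszul a b c x : smooth_section a -> smooth_section b -> smooth_section c ->
  2 * g x (D a b x) (c x) =
        anchor (a x) (fun y => g y (b y) (c y)) +
        anchor (b x) (fun y => g y (a y) (c y)) -
        anchor (c x) (fun y => g y (a y) (b y)) +
        g x (bracket c a x) (b x) + g x (bracket c b x) (a x) +
        g x (bracket a b x) (c x).
Proof. by move=> Ha Hb Hc; have [_] := HD Ha Hb; apply. Qed.

(** In the sum of the Koszul formulas with [b] and [c] exchanged all bracket terms cancel by
    antisymmetry. *)
Lemma metric_compat a b c x : smooth_section a -> smooth_section b -> smooth_section c ->
  anchor (a x) (fun y => g y (b y) (c y)) = g x (D a b x) (c x) + g x (b x) (D a c x).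
Proof.
move=> Ha Hb Hc.
have H1 := koszul x Ha Hb Hc; have H2 := koszul x Ha Hc Hb.
have sym p q : (fun y => g y (p y) (q y)) = (fun y => g y (q y) (p y)) :> (M -> R).
  by apply: funext => y; rewrite inner_sym.
rewrite (sym c b) in H2; rewrite [g x (b x) _]inner_sym.
rewrite (bracket_antisym Hb Ha) (bracket_antisym Hb Hc) (bracket_antisym Ha Hc) !innerNl in H2.
set p := anchor _ _ in H1 H2 *; set q := anchor _ _ in H1 H2; set s := anchor _ _ in H1 H2.
by lra.
Qed.

(** In the Koszul formula everything but the last bracket term is symmetric in [a] and [b]. *)
Lemma torsion_free a b x : smooth_section a -> smooth_section b ->
  D a b x - D b a x = bracket a b x.
Proof.
move=> Ha Hb; apply: (inner_nondeg (g := g)) => c Hc.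
have H1 := koszul x Ha Hb Hc; have H2 := koszul x Hb Ha Hc.
have sym p q : (fun y => g y (p y) (q y)) = (fun y => g y (q y) (p y)) :> (M -> R).
  by apply: funext => y; rewrite inner_sym.
rewrite (sym b a) (bracket_antisym Hb Ha) innerNl in H2.
by rewrite innerBl; lra.
Qed.

Lemma bracketZl f a c x : msmooth f -> smooth_section a -> smooth_section c ->
  bracket (fun y => f y *: a y) c x = f x *: bracket a c x - anchor (c x) f *: a x.
Proof.
move=> Hf Ha Hc.
rewrite (bracket_antisym (smooth_section_scale Hf Ha) Hc) bracket_leibniz //.
by rewrite (bracket_antisym Hc Ha) scalerN opprD opprK.
Qed.

Lemma anchor_mul x (u : A x) f h : msmooth f -> msmooth h ->
  anchor u (fun y => f y * h y) = anchor u f * h x + f x * anchor u h.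
Proof. by move=> Hf Hh; apply: (tv_mul (anchor_tangent u)). Qed.

(** The derivatives of [f] produced by the anchor terms of the Koszul formula cancel those produced
    by the brackets. *)
Lemma D_scalel f a b x : msmooth f -> smooth_section a -> smooth_section b ->
  D (fun y => f y *: a y) b x = f x *: D a b x.
Proof.
move=> Hf Ha Hb; apply: (inner_nondeg (g := g)) => c Hc.
have Hfa := smooth_section_scale Hf Ha.
have H1 := koszul x Hfa Hb Hc; have H2 := koszul x Ha Hb Hc.
have E p : (fun y => g y (f y *: a y) (p y)) = (fun y => f y * g y (a y) (p y)).
  by apply: funext => y; rewrite innerZl.
rewrite !E !anchor_mul ?anchorZ // in H1; try exact: inner_msmooth.
rewrite !bracketZl // (bracket_leibniz Hc Ha Hf) innerZl in H1 *.
rewrite !innerDl !innerNl !innerZl innerZr in H1.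
move: H1 H2.
set p1 := anchor _ _; set p2 := anchor _ _; set p3 := anchor _ _; set p4 := anchor _ _.
move=> H1 H2; apply: (@mulfI _ 2); first by rewrite pnatr_eq0.
by rewrite H1 mulrCA H2; ring.
Qed.

Lemma D_addl a a' b x : smooth_section a -> smooth_section a' -> smooth_section b ->
  D (fun y => a y + a' y) b x = D a b x + D a' b x.
Proof.
move=> Ha Ha' Hb; apply: (inner_nondeg (g := g)) => c Hc.
have H0 := koszul x (smooth_section_add Ha Ha') Hb Hc.
have H1 := koszul x Ha Hb Hc; have H2 := koszul x Ha' Hb Hc.
have E p : (fun y => g y (a y + a' y) (p y)) = (fun y => g y (a y) (p y) + g y (a' y) (p y)).
  by apply: funext => y; rewrite innerDl.
have B d : smooth_section d -> bracket (fun y => a y + a' y) d x = bracket a d x + bracket a' d x.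
  move=> Hd; have := bracket_linear 1 Ha Ha' Hd x; rewrite scale1r => <-.
  rewrite (_ : (fun y => 1 *: a y + a' y) = (fun y => a y + a' y)) //.
  by apply: functional_extensionality_dep => y; rewrite scale1r.
have B' : bracket c (fun y => a y + a' y) x = bracket c a x + bracket c a' x.
  rewrite (bracket_antisym Hc (smooth_section_add Ha Ha')) B //.
  by rewrite (bracket_antisym Hc Ha) (bracket_antisym Hc Ha') opprD.
rewrite !E anchorD ?(tv_add (anchor_tangent _)) ?B ?B' ?innerDl ?innerDr // in H0; try exact: inner_msmooth.
by rewrite innerDl; lra.
Qed.

Lemma D_suml (I : Type) (s : seq I) (F : I -> section A) b x : (forall i, smooth_section (F i)) ->
  smooth_section b -> D (fun y => \sum_(i <- s) F i y) b x = \sum_(i <- s) D (F i) b x.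
Proof.
move=> HF Hb; elim: s => [|i s IH].
  rewrite (_ : (fun y => _) = (fun y => (0 : R) *: (0 : A y))).
    rewrite (D_scalel _ (@msmooth_cst R n M 0) (@smooth_section_0 R n M r A) Hb) big_nil scale0r //.
  by apply: functional_extensionality_dep => y; rewrite big_nil scale0r.
rewrite big_cons -IH -D_addl //; last exact: smooth_section_sum.
by congr (D _ b x); apply: functional_extensionality_dep => y; rewrite big_cons.
Qed.

(* Near [x], [a] is a combination of global sections whose coefficients vanish
   at [x]. *)
Lemma D_tensor0 a b x : smooth_section a -> smooth_section b -> a x = 0 -> D a b x = 0.
Proof.
move=> Ha Hb ax; have [e [f [He Hf E f0]]] := section_expand x Ha.
have [chi [c1 c2 c3]] := bump_manifold E.
(* Multiplication by [chi], which is 1 at [x], turns the expansion near [x] into an identity of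
   global sections, and by [D_scalel] it does not change [D a b x]. *)
have EQ : (fun y => chi y *: a y) = (fun y => \sum_i (chi y * f i y) *: e i y).
  apply: functional_extensionality_dep => y.
  have [Ey|nEy] := pselect (a y = \sum_i f i y *: e i y).
    by rewrite Ey scaler_sumr; apply: eq_bigr => i _; rewrite scalerA.
  rewrite (nbhs_singleton (c3 y nEy)) scale0r big1 // => i _.
  by rewrite mul0r scale0r.
have Hcf i : msmooth (fun y => chi y * f i y).
  by apply/msmoothP => y; apply: msmooth_at_mul; [exact: (msmoothP chi).1|exact: (msmoothP (f i)).1].
have := D_scalel x c1 Ha Hb; rewrite (nbhs_singleton c2) scale1r => <-.
rewrite EQ D_suml //; last by move=> i; exact: smooth_section_scale.
rewrite big1 // => i _; rewrite D_scalel // f0 //.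
by rewrite mulr0 scale0r.
Qed.

Definition ext_section x (u : A x) : section A := sval (cid2 (section_through u)).
Lemma ext_section_smooth x (u : A x) : smooth_section (ext_section u).
Proof. by rewrite /ext_section; case: cid2. Qed.
Lemma ext_sectionE x (u : A x) : ext_section u x = u.
Proof. by rewrite /ext_section; case: cid2. Qed.

(* [D] acts on global sections only; by [D_tensor0] the choice of the extension
   of [u] is irrelevant. *)
Definition nabla b x (u : A x) : A x := D (ext_section u) b x.

Lemma nablaE a b x : smooth_section a -> smooth_section b -> D a b x = nabla b (a x).
Proof.
move=> Ha Hb; apply/eqP; rewrite -subr_eq0; apply/eqP.
have Ht := ext_section_smooth (a x).
have Hn : smooth_section (fun y => (-1 : R) *: ext_section (a x) y).
  by apply: smooth_section_scale => //; exact: msmooth_cst.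
have H0 : D (fun y => a y + (-1 : R) *: ext_section (a x) y) b x = 0.
  apply: D_tensor0 => //; first exact: smooth_section_add.
  by rewrite ext_sectionE scaleN1r subrr.
rewrite -H0 (D_addl _ Ha Hn Hb).
by rewrite (D_scalel _ (@msmooth_cst R n M (-1)) Ht Hb) scaleN1r.
Qed.

Lemma nablaP b x (k : R) (u v : A x) : smooth_section b ->
  nabla b (k *: u + v) = k *: nabla b u + nabla b v.
Proof.
move=> Hb; have Hu := ext_section_smooth u; have Hv := ext_section_smooth v.
have Hk : smooth_section (fun y => k *: ext_section u y).
  by apply: smooth_section_scale => //; exact: msmooth_cst.
have := @nablaE (fun y => k *: ext_section u y + ext_section v y) b x (smooth_section_add Hk Hv) Hb.
by rewrite !ext_sectionE => <-; rewrite D_addl // (D_scalel _ (@msmooth_cst R n M k) Hu Hb).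
Qed.

Lemma nabla0 b x : smooth_section b -> nabla b (0 : A x) = 0.
Proof.
move=> Hb; have := nablaP 1 (0 : A x) 0 Hb; rewrite scaler0 addr0 scale1r => H.
by apply: (@addrI _ (nabla b (0 : A x))); rewrite addr0 -H.
Qed.

Lemma nablaZ b x (k : R) (u : A x) : smooth_section b -> nabla b (k *: u) = k *: nabla b u.
Proof. by move=> Hb; have := nablaP k u 0 Hb; rewrite nabla0 // !addr0. Qed.

Lemma nabla_sum b x (I : Type) (s : seq I) (F : I -> A x) : smooth_section b ->
  nabla b (\sum_(i <- s) F i) = \sum_(i <- s) nabla b (F i).
Proof.
move=> Hb; elim: s => [|i s IH]; first by rewrite !big_nil nabla0.
rewrite !big_cons -IH; have := nablaP 1 (F i) (\sum_(i <- s) F i) Hb.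
by rewrite !scale1r.
Qed.

Lemma nabla_compat x (u : A x) b c : smooth_section b -> smooth_section c ->
  anchor u (fun y => g y (b y) (c y)) = g x (nabla b u) (c x) + g x (b x) (nabla c u).
Proof.
move=> Hb Hc; have := metric_compat x (ext_section_smooth u) Hb Hc.
by rewrite ext_sectionE.
Qed.

End LeviCivita.

(** * Sections along maps and their derivatives *)

Section SmoothWithinAlgebra.
Variables (R : realType) (V : normedModType R) (S : set V) (z : V).
Implicit Types W X : normedModType R.
Hypothesis Sz : S z.

Lemma sw_Csm W (f : V -> W) : Csm f z -> smooth_within S z f.
Proof. by move=> Hf; apply/smooth_withinP; exists f => //; apply: nearW. Qed.

Lemma sw_eq W (f h : V -> W) : (\forall w \near z, S w -> f w = h w) ->
  smooth_within S z f -> smooth_within S z h.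
Proof.
move=> E /smooth_withinP[k Hk Ek]; apply/smooth_withinP; exists k => //.
by apply: filterS2 E Ek => w Ew Kw Sw; rewrite -Ew // Kw.
Qed.

Lemma sw_add W (f h : V -> W) : smooth_within S z f -> smooth_within S z h ->
  smooth_within S z (fun w => f w + h w).
Proof.
move=> /smooth_withinP[k Hk Ek] /smooth_withinP[l Hl El]; apply/smooth_withinP.
exists (fun w => k w + l w); first exact: Csm_add.
by apply: filterS2 Ek El => w Kw Lw Sw; rewrite Kw // Lw.
Qed.

Lemma sw_sum W (I : Type) (s : seq I) (F : I -> V -> W) :
  (forall i, smooth_within S z (F i)) -> smooth_within S z (fun w => \sum_(i <- s) F i w).
Proof.
move=> H; elim: s => [|i s IH].
  by apply: (sw_eq (f := fun _ => 0)); [apply: nearW => w _; rewrite big_nil|exact/sw_Csm/Csm_cst].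
apply: (sw_eq (f := fun w => F i w + \sum_(j <- s) F j w)); last exact: sw_add.
by apply: nearW => w _; rewrite big_cons.
Qed.

Lemma sw_mul (f h : V -> R) : smooth_within S z f -> smooth_within S z h ->
  smooth_within S z (fun w => f w * h w).
Proof.
move=> /smooth_withinP[k Hk Ek] /smooth_withinP[l Hl El]; apply/smooth_withinP.
exists (fun w => k w * l w); first exact: Csm_mul.
by apply: filterS2 Ek El => w Kw Lw Sw; rewrite Kw // Lw.
Qed.

Lemma sw_scale W {fW : fdim W} (f : V -> R) (h : V -> W) : smooth_within S z f -> smooth_within S z h ->
  smooth_within S z (fun w => f w *: h w).
Proof.
move=> /smooth_withinP[k Hk Ek] /smooth_withinP[l Hl El]; apply/smooth_withinP.
exists (fun w => k w *: l w); first exact: Csm_scale.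
by apply: filterS2 Ek El => w Kw Lw Sw; rewrite Kw // Lw.
Qed.

Lemma sw_compl W X {fW : fdim W} {fX : fdim X} (f : V -> W) (k : W -> X) :
  smooth_within S z f -> Csm k (f z) -> smooth_within S z (k \o f).
Proof.
move=> /smooth_withinP[h Hh Eh] Hk; apply/smooth_withinP; exists (k \o h).
  by apply: Csm_comp => //; rewrite -(nbhs_singleton Eh).
by apply: filterS Eh => w Ew Sw /=; rewrite Ew.
Qed.

Lemma sw_near W (f : V -> W) (P : W -> Prop) : smooth_within S z f -> nbhs (f z) P ->
  \forall w \near z, S w -> P (f w).
Proof.
move=> /smooth_withinP[h Hh Eh]; rewrite (nbhs_singleton Eh) // => nP.
have := Csm_cont Hh nP; rewrite nbhs_filterE => nP'.
by apply: filterS2 Eh nP' => w Ew Pw Sw; rewrite Ew.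
Qed.

Lemma sw_cvg W (f : V -> W) : smooth_within S z f -> f @ within S (nbhs z) --> f z.
Proof.
move=> Hf P nP; rewrite nbhs_filterE /fmap /within /=.
exact: (sw_near Hf nP).
Qed.

Lemma sw_rV m (f : V -> 'rV[R]_m) :
  (forall i, smooth_within S z (fun w => f w 0 i : R)) <-> smooth_within S z f.
Proof.
split=> [H|Hf i]; last first.
  move/smooth_withinP: Hf => [h Hh Eh]; apply/smooth_withinP.
  exists (fun w => h w 0 i); first by have /Csm_rV := Hh; exact.
  by apply: filterS Eh => w Ew Sw; rewrite Ew.
have H' i : exists h : V -> R, Csm h z /\ \forall w \near z, S w -> f w 0 i = h w.
  by move/smooth_withinP: (H i) => [h Hh Eh]; exists h.
have [h Hh] := choice H'.
apply/smooth_withinP; exists (fun w => \row_i h i w).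
  by apply/Csm_rV => i; apply: (Csm_eq (f := h i)) => [w|]; [rewrite mxE|exact: (Hh i).1].
have N : \forall w \near z, forall i, S w -> f w 0 i = h i w.
  by apply: filter_forall => i; exact: (Hh i).2.
by apply: filterS N => w Nw Sw; apply/rowP => i; rewrite mxE Nw.
Qed.

End SmoothWithinAlgebra.

Lemma sw_pre (R : realType) (V V' W : normedModType R) {fV : fdim V} {fW : fdim W} (S : set V) (S' : set V') (z : V')
    (m : V' -> V) (f : V -> W) : S' z -> smooth_within S' z m ->
  (\forall w \near z, S' w -> S (m w)) -> smooth_within S (m z) f ->
  smooth_within S' z (f \o m).
Proof.
move=> Sz Hm SS' /smooth_withinP[h Hh Eh].
have E := sw_near Sz Hm Eh.
apply: (sw_eq (f := h \o m)); last exact: sw_compl.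
by apply: filterS2 E SS' => w Ew Sw S'w /=; rewrite Ew //; exact: Sw.
Qed.

Section MapsToManifold.
Variables (R : realType) (n : nat) (M : manifold R n) (V : normedModType R).
Variables (S : set V) (gamma : V -> M) (z : V).
Hypothesis Sz : S z.

Definition smooth_map_at := forall c, atlas c -> cdom c (gamma z) ->
    (\forall w \near within S (nbhs z), cdom c (gamma w)) /\
    smooth_within S z (cmap c \o gamma).

Lemma smooth_map_near (P : set M) : smooth_map_at -> nbhs (gamma z) P -> \forall w \near z, S w -> P (gamma w).
Proof.
move=> H nP; have [c ac cz] := atlas_cover (gamma z); have [H1 H2] := H c ac cz.
have {}H1 : \forall w \near z, S w -> cdom c (gamma w) := H1.
have := sw_near Sz H2 (near_cimg cz nP).
by apply: filterS2 H1 => w Cw Pw Sw; have := Pw Sw; rewrite /= cmapK //; exact: Cw.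
Qed.

Lemma smooth_map_msm (W : normedModType R) {fW : fdim W} (f : M -> W) : smooth_map_at -> msmooth_at f (gamma z) ->
  smooth_within S z (f \o gamma).
Proof.
move=> H Hf; have [c ac cz] := atlas_cover (gamma z); have [H1 H2] := H c ac cz.
have {}H1 : \forall w \near z, S w -> cdom c (gamma w) := H1.
apply: (sw_eq (f := (f \o cinv c) \o (cmap c \o gamma))).
  by apply: filterS H1 => w Cw Sw /=; rewrite cmapK //; exact: Cw.
by apply: sw_compl => //; exact: Hf.
Qed.

Lemma smooth_map_chart c : atlas c -> cdom c (gamma z) ->
  (\forall w \near z, S w -> cdom c (gamma w)) ->
  smooth_within S z (cmap c \o gamma) -> smooth_map_at.
Proof.
move=> ac cz Hc Hs c' ac' cz'.
have N := sw_near Sz Hs (near_cimg cz (cdom_nbhs cz')).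
split; first by apply: filterS2 Hc N => w Cw Nw Sw; have := Nw Sw; rewrite /= cmapK //; exact: Cw.
apply: (sw_eq (f := (cmap c' \o cinv c) \o (cmap c \o gamma))).
  by apply: filterS Hc => w Cw Sw /=; rewrite cmapK //; exact: Cw.
by apply: sw_compl => //; exact: (msmooth_at_cmap ac' cz').
Qed.

End MapsToManifold.

Section Along.
Variables (R : realType) (n : nat) (M : manifold R n) (r : nat) (A : vector_bundle M r).
Variables (V : normedModType R) (S : set V) (z : V).
Hypothesis Sz : S z.

Definition smooth_along_at (gamma : V -> M) (s : forall w, A (gamma w)) := smooth_map_at S gamma z /\
  forall T, trivs T -> tdom T (gamma z) -> smooth_within S z (fun w => tcoord T (s w)).

(** Over different base maps the values lie in different fiber types, so agreement is stated in the
    total space. *)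
Lemma along_eq gamma gamma' (s : forall w, A (gamma w)) (s' : forall w, A (gamma' w)) :
  (\forall w \near z, S w -> existT (fun x => A x : Type) (gamma w) (s w) =
    existT (fun x => A x : Type) (gamma' w) (s' w)) -> smooth_along_at s -> smooth_along_at s'.
Proof.
move=> E [H1 H2].
have Eg : \forall w \near z, S w -> gamma w = gamma' w.
  by apply: filterS E => w Ew Sw; have := congr1 (@projT1 _ _) (Ew Sw).
have gz := nbhs_singleton Eg Sz.
split=> [c ac|T tT]; rewrite -gz => cz.
  have [N H] := H1 c ac cz; split.
    by apply: filterS2 Eg N => w Ew Nw Sw; rewrite -Ew //; exact: Nw.
  by apply: sw_eq H; apply: filterS Eg => w Ew Sw /=; rewrite Ew.
apply: sw_eq (H2 T tT cz); apply: filterS E => w Ew Sw.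
by have := congr1 (fun p => tcoord T (projT2 p)) (Ew Sw).
Qed.

Variable gamma : V -> M.
Implicit Types s : forall w, A (gamma w).

Lemma along_coord s T i : smooth_along_at s -> trivs T -> tdom T (gamma z) ->
  smooth_within S z (fun w => tcoord T (s w) 0 i : R).
Proof. by move=> [_ H] tT Tz; have /sw_rV := H T tT Tz; exact. Qed.

Lemma along_sec (c : section A) : smooth_map_at S gamma z -> smooth_section c -> smooth_along_at (fun w => c (gamma w)).
Proof.
move=> H /smooth_sectionP Hc; split=> // T tT Tz.
exact: (smooth_map_msm Sz H (Hc (gamma z) T tT Tz)).
Qed.

Lemma along_near (s s' : forall w, A (gamma w)) : (\forall w \near z, S w -> s w = s' w) ->
  smooth_along_at s -> smooth_along_at s'.
Proof. by move=> E; apply: along_eq; apply: filterS E => w Ew Sw; rewrite Ew. Qed.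

Lemma along_add s s' : smooth_along_at s -> smooth_along_at s' -> smooth_along_at (fun w => s w + s' w).
Proof.
move=> [H1 H2] [_ H3]; split=> // T tT Tz.
apply: (sw_eq (f := fun w => tcoord T (s w) + tcoord T (s' w))).
  by apply: filterS (smooth_map_near Sz H1 (near_tdom Tz)) => w Tw Sw; rewrite tcoordD //; exact: Tw.
by apply: sw_add; [exact: H2|exact: H3].
Qed.

Lemma along_scale (f : V -> R) s : smooth_within S z f -> smooth_along_at s -> smooth_along_at (fun w => f w *: s w).
Proof.
move=> Hf [H1 H2]; split=> // T tT Tz.
apply: (sw_eq (f := fun w => f w *: tcoord T (s w))).
  by apply: filterS (smooth_map_near Sz H1 (near_tdom Tz)) => w Tw Sw; rewrite tcoordZ //; exact: Tw.
by apply: (@sw_scale _ _ _ _ _ (fdim_rV R r)) => //; exact: H2.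
Qed.

Lemma along_0 : smooth_map_at S gamma z -> smooth_along_at (fun w => 0 : A (gamma w)).
Proof.
move=> H; split=> // T tT Tz; apply: (sw_eq (f := fun w => 0)).
  by apply: filterS (smooth_map_near Sz H (near_tdom Tz)) => w Tw Sw; rewrite tcoord0 //; exact: Tw.
exact/sw_Csm/Csm_cst.
Qed.

Lemma along_sum (I : Type) (l : seq I) (F : I -> forall w, A (gamma w)) : smooth_map_at S gamma z ->
  (forall i, smooth_along_at (F i)) -> smooth_along_at (fun w => \sum_(i <- l) F i w).
Proof.
move=> H0 H; elim: l => [|i l IH].
  by apply: (along_near (s := fun w => 0 : A (gamma w))); [apply: nearW => w _; rewrite big_nil|exact: along_0].
apply: (along_near (s := fun w => F i w + \sum_(j <- l) F j w)); last exact: along_add.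
by apply: nearW => w _; rewrite big_cons.
Qed.

Lemma along_frame s T e : smooth_along_at s -> is_frame T e (gamma z) -> (\forall y \near gamma z, is_frame T e y) ->
  \forall w \near z, S w -> is_frame T e (gamma w) /\ s w = \sum_i tcoord T (s w) 0 i *: e i (gamma w).
Proof.
move=> [H _] _ Fz; apply: filterS (smooth_map_near Sz H Fz) => w Fw Sw.
by split; [exact: Fw|exact: (frame_expand (s w) (Fw Sw))].
Qed.

Lemma along_inner (g : riemannian_metric A) s s' : smooth_along_at s -> smooth_along_at s' ->
  smooth_within S z (fun w => g (gamma w) (s w) (s' w)).
Proof.
move=> Hs Hs'; have [T [e [tT He Fz]]] := frame_exists A (gamma z).
have F0 := nbhs_singleton Fz; have [Tz _] := F0.
apply: (sw_eq (f := fun w => \sum_i \sum_j (tcoord T (s w) 0 i * tcoord T (s' w) 0 j) *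
    g (gamma w) (e i (gamma w)) (e j (gamma w)))).
  apply: filterS2 (along_frame Hs F0 Fz) (along_frame Hs' F0 Fz) => w Ew Ew' Sw.
  have [_ E] := Ew Sw; have [_ E'] := Ew' Sw.
  rewrite [in RHS]E inner_suml; apply: eq_bigr => i _.
  rewrite [in RHS]E' innerZl inner_sumr mulr_sumr; apply: eq_bigr => j _.
  by rewrite innerZr mulrA.
apply: sw_sum => i; apply: sw_sum => j; apply: sw_mul.
  by apply: sw_mul; exact: along_coord.
apply: (@smooth_map_msm _ _ _ _ _ _ _ Sz _ (fdim_R R) (fun x => g x (e i x) (e j x)) Hs.1).
by have /msmoothP := inner_msmooth g (He i) (He j); exact.
Qed.

End Along.

Lemma smooth_map_pre (R : realType) (n : nat) (M : manifold R n) (V V' : normedModType R) {fV : fdim V}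
    (S : set V) (S' : set V') (z : V') (m : V' -> V) (gamma : V -> M) : S' z -> S (m z) ->
  smooth_within S' z m -> (\forall w \near z, S' w -> S (m w)) -> smooth_map_at S gamma (m z) ->
  smooth_map_at S' (gamma \o m) z.
Proof.
move=> S'z Smz Hm SS' H c ac cz; have [H1 H2] := H c ac cz; split.
  by apply: filterS2 (sw_near S'z Hm H1) SS' => w Hw Sw S'w; apply: Hw => //; exact: Sw.
exact: (@sw_pre _ _ _ _ _ (fdim_rV R n) S S' z m (cmap c \o gamma)).
Qed.

Lemma along_pre (R : realType) (n : nat) (M : manifold R n) r (A : vector_bundle M r) (V V' : normedModType R) {fV : fdim V}
    (S : set V) (S' : set V') (z : V') (m : V' -> V) (gamma : V -> M) (s : forall w, A (gamma w)) :
  S' z -> S (m z) ->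
  smooth_within S' z m -> (\forall w \near z, S' w -> S (m w)) -> smooth_along_at S (m z) s ->
  smooth_along_at S' z (gamma := gamma \o m) (fun w => s (m w)).
Proof.
move=> S'z Smz Hm SS' [H1 H2]; split; first exact: (smooth_map_pre (S := S)).
move=> T tT Tz.
exact: (@sw_pre _ _ _ _ _ (fdim_rV R r) S S' z m (fun w => tcoord T (s w))) (H2 T tT Tz).
Qed.

Section OneVar.
Variable R : realType.
Implicit Types (I : set R) (W : normedModType R).

Lemma Csm_is_derive W (k : R -> W) (t : R) : Csm k t -> is_derive t 1 k ('D_1 k t).
Proof. by move=> /Csm_diff/diff_derivable Hk; exact/derivableP. Qed.

Lemma sw_deriv W I (f : R -> W) (t : R) : I t -> smooth_within I t f ->
  exists2 k : R -> W, Csm k t &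
    \forall u \near t, I u -> f u = k u /\ is_deriv_in I f u ('D_1 k u).
Proof.
move=> It /smooth_withinP[k Hk Ek]; exists k => //.
have Ek' : \forall u \near t, \forall v \near u, I v -> f v = k v := near_join Ek.
apply: filterS2 (Csm_open Hk) Ek' => u Hu Eu Iu.
have E0 := nbhs_singleton Eu Iu; split=> //.
apply: (is_deriv_in_eq (f := k)); first by apply: filterS Eu => v Ev Iv; rewrite Ev.
  by rewrite E0.
exact/is_derive_in/Csm_is_derive.
Qed.

Lemma sw_deriv1 W I (f : R -> W) (t : R) : I t -> smooth_within I t f ->
  exists l, is_deriv_in I f t l.
Proof. by move=> It /(sw_deriv It)[k _ /nbhs_singleton/(_ It)[_ H]]; exists ('D_1 k t). Qed.

Lemma is_deriv_in_coord I m (f : R -> 'rV[R]_m) t l i : is_deriv_in I f t l ->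
  is_deriv_in I (fun u => f u 0 i : R) t (l 0 i : R).
Proof.
move=> /is_deriv_inP H; apply/is_deriv_inP => e e0.
apply: filterS (H e e0) => u Hu Iu; apply: le_trans (Hu Iu).
have -> : f u 0 i - f t 0 i - (u - t) *: l 0 i = (f u - f t - (u - t) *: l) 0 i.
  by rewrite !mxE.
exact: coord_le.
Qed.

Lemma sw_deriv_fun I (f df : R -> R) (t : R) : I t ->
  (forall u, I u -> ProperFilter (within I u^')) ->
  (forall u, I u -> is_deriv_in I f u (df u)) ->
  smooth_within I t f -> smooth_within I t df.
Proof.
move=> It PI Hd /(sw_deriv It)[k Hk Ek]; apply/smooth_withinP.
exists ('D_1 k); first exact: Csm_derive.
apply: filterS Ek => u Eu Iu; have [_ H] := Eu Iu.
exact: (is_deriv_in_unique (PI u Iu) (Hd u Iu) H).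
Qed.

End OneVar.

(** * Covariant derivatives along paths *)

Section Covder.
Variables (R : realType) (n : nat) (M : manifold R n) (r : nat) (A : lie_algebroid M r).
Variables (g : riemannian_metric A) (D : connection_op A).
Hypothesis HD : levi_civita g D.
Variable I : set R.
Hypothesis PI : forall t, I t -> ProperFilter (within I t^').

Section Pairing.
Variables (gamma : R -> M) (alpha : forall t, A (gamma t)).

(* Metric compatibility characterizes the derivative of [s] along [alpha] by
   the derivatives of its inner products with global sections. *)
Definition pairs (s : forall t, A (gamma t)) t (v : A (gamma t)) :=
  forall c : section A, smooth_section c ->
  is_deriv_in I (fun u => g (gamma u) (s u) (c (gamma u))) t
    (g (gamma t) v (c (gamma t)) + g (gamma t) (s t) (nabla D c (alpha t)) : R).

Variable t : R.
Hypothesis It : I t.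

Lemma pairs_unique (s : forall t, A (gamma t)) (v v' : A (gamma t)) :
  pairs s v -> pairs s v' -> v = v'.
Proof.
move=> H H'; apply: (inner_nondeg (g := g)) => c Hc.
by have /addIr := is_deriv_in_unique (PI It) (H c Hc) (H' c Hc).
Qed.

Hypothesis vel : is_velocity I gamma t (anchor (alpha t)).

(** The product rule handles the coefficients. The inner products of frame sections with [c] are
    functions on [M], which the velocity differentiates, and metric compatibility splits the
    result. *)
Lemma pairs_sum (J : finType) (e : J -> section A) (f : J -> R -> R) (df : J -> R)
    (s : forall t, A (gamma t)) : (forall j, smooth_section (e j)) ->
  (\forall u \near t, I u -> s u = \sum_j f j u *: e j (gamma u)) ->
  (forall j, is_deriv_in I (f j) t (df j)) ->
  pairs s (\sum_j (df j *: e j (gamma t) + f j t *: nabla D (e j) (alpha t))).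
Proof.
move=> He Es Hf c Hc.
have st := nbhs_singleton Es It.
apply: (is_deriv_in_eq (f := fun u => \sum_j f j u * g (gamma u) (e j (gamma u)) (c (gamma u)))).
- apply: filterS Es => u Eu Iu; rewrite Eu // inner_suml; apply: eq_bigr => j _.
  by rewrite innerZl.
- by rewrite st inner_suml; apply: eq_bigr => j _; rewrite innerZl.
rewrite st !inner_suml -big_split /=.
apply: is_deriv_in_sum => j.
have := is_deriv_in_mul (Hf j) (vel (inner_msmooth g (He j) Hc)).
rewrite (nabla_compat HD (alpha t) (He j) Hc) innerDl !innerZl mulrDr addrA.
by [].
Qed.

(** The frame disappears from the conclusion, so by [pairs_unique] all frames give the same
    derivative. *)
Lemma is_covder_pairs (s : forall t, A (gamma t)) (v : A (gamma t)) :
  is_covder D I alpha s v -> pairs s v.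
Proof.
move=> [e [ca [cs [ds [He _ Es Hds ->]]]]].
have {}Es : \forall u \near t, I u -> alpha u = lincomb (gamma u) (ca u) e /\
        s u = lincomb (gamma u) (cs u) e := Es.
have [Ea _] := nbhs_singleton Es It.
have := @pairs_sum _ e (fun j u => cs u 0 j) (fun j => ds 0 j) s He.
rewrite big_split /=.
have -> : \sum_j cs t 0 j *: nabla D (e j) (alpha t) =
  \sum_i \sum_j (ca t 0 i * cs t 0 j) *: D (e i) (e j) (gamma t).
  rewrite exchange_big /=; apply: eq_bigr => j _.
  rewrite Ea /lincomb (nabla_sum HD) // scaler_sumr; apply: eq_bigr => i _.
  by rewrite (nablaZ HD) // (nablaE HD _ (He i) (He j)) scalerA mulrC.
apply; last by move=> j; exact: is_deriv_in_coord.
by apply: filterS Es => u Eu Iu; have [_ ->] := Eu Iu.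
Qed.

Hypothesis Ha : smooth_along_at I t alpha.

Lemma covder_exists (s : forall t, A (gamma t)) : smooth_along_at I t s ->
  exists v : A (gamma t), is_covder D I alpha s v.
Proof.
move=> Hs; have [T [e [tT He Fz]]] := frame_exists A (gamma t).
have F0 := nbhs_singleton Fz; have [Tz _] := F0.
have [ds Hds] := sw_deriv1 It (Hs.2 T tT Tz).
exists (\sum_j ds 0 j *: e j (gamma t) +
          \sum_i \sum_j (tcoord T (alpha t) 0 i * tcoord T (s t) 0 j) *: D (e i) (e j) (gamma t)).
exists e, (fun u => tcoord T (alpha u)), (fun u => tcoord T (s u)), ds; split=> //.
  by apply: filterS Fz => y; exact: frame_bij.
have N : \forall u \near t, I u -> alpha u = lincomb (gamma u) (tcoord T (alpha u)) e /\
        s u = lincomb (gamma u) (tcoord T (s u)) e.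
  apply: filterS2 (along_frame It Ha F0 Fz) (along_frame It Hs F0 Fz) => u Hu Hu' Iu.
  by split; [exact: (Hu Iu).2|exact: (Hu' Iu).2].
exact: N.
Qed.

(** [covder_exists] excludes the default value 0 of [xget]. *)
Lemma covder_pairs (s : forall t, A (gamma t)) : smooth_along_at I t s -> pairs s (covder D I alpha s t).
Proof.
move=> /covder_exists[v Hv]; apply: is_covder_pairs.
by rewrite /covder; case: xgetP => [w -> //|/(_ v)].
Qed.

Lemma covder_eq (s : forall t, A (gamma t)) (v : A (gamma t)) : smooth_along_at I t s -> pairs s v ->
  covder D I alpha s t = v.
Proof. by move=> Hs; apply: pairs_unique; exact: covder_pairs. Qed.

(** [pairs] tests only restrictions of global sections; expanding [s'] in a frame reduces a section
    along the path to these. *)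
Lemma pairs_inner (s s' : forall t, A (gamma t)) v v' : smooth_along_at I t s -> smooth_along_at I t s' ->
  pairs s v -> pairs s' v' ->
  is_deriv_in I (fun u => g (gamma u) (s u) (s' u)) t
    (g (gamma t) v (s' t) + g (gamma t) (s t) v' : R).
Proof.
move=> Hs Hs' Pv Pv'; have [T [e [tT He Fz]]] := frame_exists A (gamma t).
have F0 := nbhs_singleton Fz; have [Tz _] := F0.
have [ds Hds] := sw_deriv1 It (Hs'.2 T tT Tz).
have N := along_frame It Hs' F0 Fz.
have N' : \forall u \near t, I u -> s' u = \sum_j tcoord T (s' u) 0 j *: e j (gamma u).
  by apply: filterS N => u Nu Iu; exact: (Nu Iu).2.
have Ps := @pairs_sum _ e (fun j u => tcoord T (s' u) 0 j) (fun j => ds 0 j) s' He N'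
  (fun j => is_deriv_in_coord (i := j) Hds).
rewrite (pairs_unique Pv' Ps) {1}(nbhs_singleton N' It).
apply: (is_deriv_in_eq (f := fun u => \sum_j tcoord T (s' u) 0 j * g (gamma u) (s u) (e j (gamma u)))).
- apply: filterS N' => u Eu Iu; rewrite [in RHS]Eu // inner_sumr; apply: eq_bigr => j _.
  by rewrite innerZr.
- rewrite [in RHS](nbhs_singleton N' It) inner_sumr; apply: eq_bigr => j _; by rewrite innerZr.
rewrite !inner_sumr -big_split /=.
apply: is_deriv_in_sum => j.
have := is_deriv_in_mul (is_deriv_in_coord (i := j) Hds) (Pv (e j) (He j)).
rewrite innerDr !innerZr mulrDr.
set a := _ * _; set b := _ * _; set c := _ * _.
by rewrite (_ : a + (b + c) = b + (a + c)) //; rewrite addrCA.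
Qed.

Lemma pairs_scale (f : R -> R) (df : R) (s : forall t, A (gamma t)) v :
  is_deriv_in I f t df -> pairs s v ->
  pairs (fun u => f u *: s u) (df *: s t + f t *: v).
Proof.
move=> Hf Pv c Hc.
apply: (is_deriv_in_eq (f := fun u => f u * g (gamma u) (s u) (c (gamma u)))).
- by apply: (@nearW R (nbhs t)) => u _; rewrite innerZl.
- by rewrite innerZl.
have := is_deriv_in_mul Hf (Pv c Hc).
by rewrite innerDl !innerZl mulrDr addrA.
Qed.

End Pairing.

(** Each value of [covder] may come from its own frame. Uniqueness identifies all values near [t]
    with the formula in one fixed frame, which is visibly smooth. *)
Lemma covder_sal (gamma : R -> M) (alpha s : forall t, A (gamma t)) t : I t ->
  (forall u, I u -> is_velocity I gamma u (anchor (alpha u))) ->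
  (forall u, I u -> smooth_along_at I u alpha) -> (forall u, I u -> smooth_along_at I u s) ->
  smooth_along_at I t (fun u => covder D I alpha s u).
Proof.
move=> It vel Ha Hs; have [T [e [tT He Fz]]] := frame_exists A (gamma t).
have F0 := nbhs_singleton Fz; have [Tz _] := F0.
have [k Hk Ek] := sw_deriv It ((Hs t It).2 T tT Tz).
have Na := along_frame It (Ha t It) F0 Fz.
have Ns := along_frame It (Hs t It) F0 Fz.
have smt := (Hs t It).1.
apply: (@along_near _ _ _ _ _ _ _ _ It _ (fun u => \sum_j ('D_1 k u 0 j *: e j (gamma u) +
   tcoord T (s u) 0 j *: \sum_i tcoord T (alpha u) 0 i *: D (e i) (e j) (gamma u)))).
  have Ns' := near_join Ns.
  apply: filterS (filterI Ek (filterI Na Ns')) => u [Eu [Nau Nsu]] Iu.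
  have [_ du] := Eu Iu.
  symmetry; apply: (covder_eq Iu (vel u Iu) (Ha u Iu) (Hs u Iu)).
  have N' : \forall v \near u, I v -> s v = \sum_j tcoord T (s v) 0 j *: e j (gamma v).
    by apply: filterS Nsu => v Nv Iv; exact: (Nv Iv).2.
  have := @pairs_sum gamma alpha u Iu (vel u Iu) _ e (fun j u => tcoord T (s u) 0 j)
    (fun j => 'D_1 k u 0 j) s He N' (fun j => is_deriv_in_coord (i := j) du).
  congr pairs; apply: eq_bigr => j _; congr (_ + _ *: _).
  rewrite [in LHS](Nau Iu).2 (nabla_sum HD) //; apply: eq_bigr => i _.
  by rewrite (nablaZ HD) // (nablaE HD _ (He i) (He j)).
apply: (along_sum It) => // j; apply: (along_add It).
  apply: (along_scale It) (along_sec It smt (He j)).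
  apply: sw_Csm; have /Csm_rV := Csm_derive (1 : R) Hk; exact.
apply: (along_scale It); first exact: (along_coord _ (Hs t It)).
apply: (along_sum It) => // i; apply: (along_scale It); first exact: (along_coord _ (Ha t It)).
apply: (along_sec It smt); exact: (D_smooth HD).
Qed.

End Covder.

Section Reparam.
Variables (R : realType) (n : nat) (M : manifold R n) (r : nat) (A : lie_algebroid M r).
Variables (g : riemannian_metric A) (D : connection_op A).
Hypothesis HD : levi_civita g D.
Variables (I J : set R) (m : R -> R) (t dm : R) (gamma : R -> M) (alpha : forall t, A (gamma t)).
Hypothesis IJ : \forall u \near t, J u -> I (m u).
Hypothesis dmt : is_deriv_in J m t dm.

Lemma velocity_reparam : is_velocity I gamma (m t) (anchor (alpha (m t))) ->
  is_velocity J (gamma \o m) t (anchor (dm *: alpha (m t))).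
Proof.
move=> H f Hf; rewrite anchorZ //.
exact: (is_deriv_in_comp IJ dmt (H f Hf)).
Qed.

(** Only the value of [a] at [t] matters, since the derivative along a path is tensorial in the
    path. *)
Lemma pairs_reparam (a : R -> R) (s : forall t, A (gamma t)) v : a t = dm -> pairs g D I alpha s v ->
  pairs g D J (gamma := gamma \o m) (fun u => a u *: alpha (m u)) (fun u => s (m u)) (t := t) (dm *: v).
Proof.
move=> at_ H c Hc; have := is_deriv_in_comp IJ dmt (H c Hc).
rewrite at_ (nablaZ HD) // innerZl innerZr.
by rewrite -mulrDr.
Qed.

End Reparam.

(** * First variation of energy and length *)

Section SquareIntegrals.
Variable R : realType.
Local Notation I := (`[0:R, 1]%classic).
Local Notation int01 f := (\int[@lebesgue_measure R]_(t in `[0%R, 1%R]) f t).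

Lemma proper01 (t : R) : I t -> ProperFilter (within I t^').
Proof. by move=> It; apply: proper_itv => //; rewrite ltr01. Qed.

Lemma sw_within_cont (f : R -> R) : (forall t, I t -> smooth_within I t f) ->
  {within I, continuous f}.
Proof. by move=> H; apply/within_contP => t It; exact: sw_cvg (H t It). Qed.

Lemma derive_slice (h : R * R -> R) (e t : R) : Csm h (e, t) ->
  is_derive e 1 (fun u : R => h (u, t)) ('D_(1, 0) h (e, t)).
Proof.
move=> Hh; have E u : u *: ((1, 0) : R * R) + (0, t) = (u, t).
  by rewrite -[LHS]/(u * 1 + 0, u * 0 + t) mulr1 mulr0 addr0 add0r.
have H : is_derive (e *: ((1, 0) : R * R) + (0, t)) (1, 0) h ('D_(1, 0) h (e, t)).
  by rewrite E; apply/derivableP/diff_derivable/Csm_diff.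
move/is_derive_line: H; congr (is_derive _ _ _ _).
by apply: funext => u; rewrite E.
Qed.

(** The smooth extensions of [F] differ from one point of [0,1] to another; uniqueness of one-sided
    derivatives glues their partial derivatives into a single function. *)
Lemma square_deriv (F : R -> R -> R) (e0 : R) : I e0 ->
  (forall t, I t -> smooth_within (@square R) (e0, t) (fun z => F z.1 z.2)) ->
  exists dF : R -> R, [/\ forall t, I t -> is_deriv_in I (F^~ t) e0 (dF t),
    forall t, I t -> smooth_within I t dF &
    is_deriv_in I (fun e => int01 (F e)) e0 (int01 dF)].
Proof.
move=> Ie HF.
have key t : I t -> exists h : R * R -> R, [/\ Csm h (e0, t),
     \forall z \near (e0, t), I z.1 -> I z.2 -> F z.1 z.2 = h z &
     \forall t' \near t, I t' -> is_deriv_in I (F^~ t') e0 ('D_(1, 0) h (e0, t'))].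
  move=> It; have /smooth_withinP[h Hh Eh] := HF t It.
  have Eh' : \forall z \near (e0, t), I z.1 -> I z.2 -> F z.1 z.2 = h z.
    by apply: filterS Eh => z Ez I1 I2; exact: Ez.
  exists h; split=> //.
  have N1 := near_pairr (near_join Eh'); have N2 := near_pairr (Csm_open Hh).
  apply: filterS2 N1 N2 => t' N1 N2 It'.
  apply: (is_deriv_in_eq (f := fun e => h (e, t'))).
  - by apply: filterS (near_pairl N1) => e Ee Ie'; rewrite -Ee.
  - by have := nbhs_singleton N1; rewrite /= => ->.
  exact/is_derive_in/derive_slice.
have ex t : exists d : R, I t -> is_deriv_in I (F^~ t) e0 d.
  have [It|nIt] := pselect (I t); last by exists 0.
  by have [h [_ _ /nbhs_singleton/(_ It) H]] := key t It; exists ('D_(1, 0) h (e0, t)).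
have [dF HdF] := choice ex.
have loc t : I t -> exists h : R * R -> R, [/\ Csm h (e0, t),
     \forall z \near (e0, t), I z.1 -> I z.2 -> F z.1 z.2 = h z &
     \forall t' \near t, I t' -> dF t' = 'D_(1, 0) h (e0, t')].
  move=> It; have [h [h1 h2 h3]] := key t It; exists h; split=> //.
  apply: filterS h3 => t' H It'.
  exact: (is_deriv_in_unique (proper01 Ie) (HdF t' It') (H It')).
exists dF; split=> //; last exact: int01_deriv.
move=> t It; have [h [h1 h2 h3]] := loc t It; apply/smooth_withinP.
exists ('D_(1, 0) h \o (fun t' : R => (e0, t'))) => //.
apply: (@Csm_comp _ _ _ (fdim_RR R) _ (fdim_R R) (fun t' : R => (e0, t')) ('D_(1, 0) h)); last exact: Csm_derive.
by apply: Csm_pair; [exact: Csm_cst|exact: Csm_id].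
Qed.

Lemma is_deriv_in_Zl (B : set R) (f : R -> R) (t l k : R) : is_deriv_in B f t l ->
  is_deriv_in B (fun u => k * f u) t (k * l).
Proof.
move=> H; have := is_deriv_in_mul (is_deriv_in_cst B k t) H.
by rewrite mul0r add0r.
Qed.

End SquareIntegrals.

Section FirstVariation.
Variables (R : realType) (n : nat) (M : manifold R n) (r : nat) (A : lie_algebroid M r).
Variables (g : riemannian_metric A) (D : connection_op A).
Hypothesis HD : levi_civita g D.
Local Notation I := (`[0:R, 1]%classic).
Local Notation int01 f := (\int[@lebesgue_measure R]_(t in `[0%R, 1%R]) f t).

Lemma inner_ge0 x (u : A x) : 0 <= g x u u.
Proof.
have [->|/(inner_pos g)/ltW //] := eqVneq u 0; by rewrite inner0l.
Qed.

Lemma inner_gt0 x (u : A x) : (0 < g x u u) = (u != 0).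
Proof.
apply/idP/idP => [|/(inner_pos g)//]; apply: contraTneq => ->.
by rewrite inner0l ltxx.
Qed.

Lemma smooth_alongE (V : normedModType R) (S : set V) (gamma : V -> M) (s : forall z, A (gamma z)) :
  smooth_along S s <-> forall z, S z -> smooth_along_at S z s.
Proof.
split=> [[H1 H2] z Sz|H].
  by split; [exact: H1|exact: H2].
by split=> z Sz; have [H1 H2] := H z Sz; [exact: H1|exact: H2].
Qed.

Section Slices.
Variables (gamma : R -> R -> M) (s : forall e t, A (gamma e t)).
Hypothesis Hs : @smooth_along R n M r A (R * R)%type (@square R) (fun z => gamma z.1 z.2) (fun z => s z.1 z.2).

Lemma along_square e t : I e -> I t ->
  @smooth_along_at R n M r A (R * R)%type (@square R) (e, t) (fun z => gamma z.1 z.2) (fun z => s z.1 z.2).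
Proof. by move=> Ie It; have /smooth_alongE := Hs; apply. Qed.

Lemma along_slice_t e t : I e -> I t -> smooth_along_at I t (s e).
Proof.
move=> Ie It; have H := along_square Ie It.
apply: (@along_pre R n M r A (R * R)%type R (fdim_RR R) (@square R) I t (fun u : R => (e, u)) _ _ It _ _ _ H).
- by split.
- by apply: sw_Csm; apply: Csm_pair; [exact: Csm_cst|exact: Csm_id].
- by apply: (@nearW R (nbhs _)) => u Iu; split.
Qed.

Lemma along_slice_e e t : I e -> I t -> smooth_along_at I e (gamma := fun e => gamma e t) (fun e => s e t).
Proof.
move=> Ie It; have H := along_square Ie It.
apply: (@along_pre R n M r A (R * R)%type R (fdim_RR R) (@square R) I e (fun u : R => (u, t)) _ _ Ie _ _ _ H).
- by split.
- by apply: sw_Csm; apply: Csm_pair; [exact: Csm_id|exact: Csm_cst].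
- by apply: (@nearW R (nbhs _)) => u Iu; split.
Qed.

End Slices.

Section Variation.
Variables (gamma : R -> R -> M) (alpha beta : forall e t, A (gamma e t)).
Hypothesis Ha : A_variation alpha.
Hypothesis Hb : transverse beta.

Let F e t := g (gamma e t) (alpha e t) (alpha e t).

Lemma energy_density_sw e t : I e -> I t ->
  smooth_within (@square R) (e, t) (fun z => g (gamma z.1 z.2) (alpha z.1 z.2) (alpha z.1 z.2)).
Proof.
case: Ha => H _ _ Ie It; have Hz := along_square H Ie It.
exact: (@along_inner R n M r A (R * R)%type (@square R) (e, t) (conj Ie It) _ g _ _ Hz Hz).
Qed.

Lemma density_deriv e t : I e -> I t ->
  is_deriv_in I (fun e => g (gamma e t) (alpha e t) (alpha e t)) e
    (2 * g (gamma e t) (covder_eps D beta alpha e t) (alpha e t)).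
Proof.
case: Ha => H _ _; case: Hb => K K' Ie It.
have Sa := along_slice_e H Ie It; have Sb := along_slice_e K Ie It.
have P := covder_pairs HD Ie (K' e t Ie It) Sb Sa.
have := pairs_inner HD (@proper01 R) Ie (K' e t Ie It) Sa Sa P P.
congr is_deriv_in; rewrite /covder_eps mulr_natl mulr2n; congr (_ + _).
exact: inner_sym.
Qed.

Lemma vel_t e t : I e -> I t -> is_velocity I (gamma e) t (anchor (alpha e t)).
Proof. by case: Ha => _ H _ Ie It; case: (H e Ie) => _; apply. Qed.

Lemma inner_parts e t (s s' : forall t, A (gamma e t)) : I e -> I t ->
  (forall t, I t -> smooth_along_at I t s) -> (forall t, I t -> smooth_along_at I t s') ->
  is_deriv_in I (fun t => g (gamma e t) (s t) (s' t)) t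
    (g (gamma e t) (covder D I (alpha e) s t) (s' t) +
     g (gamma e t) (s t) (covder D I (alpha e) s' t)).
Proof.
move=> Ie It Hs Hs'; case: (Ha) => H _ _; have Sa := along_slice_t H Ie It.
have v := vel_t Ie It.
apply: (pairs_inner HD (@proper01 R) It v (Hs t It) (Hs' t It)).
  exact: (covder_pairs HD It v Sa (Hs t It)).
exact: (covder_pairs HD It v Sa (Hs' t It)).
Qed.

Lemma covder_slice_sal e (s : forall t, A (gamma e t)) : I e ->
  (forall t, I t -> smooth_along_at I t s) -> forall t, I t -> smooth_along_at I t (fun t => covder D I (alpha e) s t).
Proof.
move=> Ie Hs t It; case: (Ha) => H _ _.
apply: (covder_sal HD (@proper01 R) It) => // u Iu; first exact: vel_t.
exact: (along_slice_t H Ie Iu).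
Qed.

Lemma inner_cont e (s s' : forall t, A (gamma e t)) :
  (forall t, I t -> smooth_along_at I t s) -> (forall t, I t -> smooth_along_at I t s') ->
  {within I, continuous (fun t => g (gamma e t) (s t) (s' t))}.
Proof. by move=> Hs Hs'; apply: sw_within_cont => t It; exact: (along_inner It g (Hs t It) (Hs' t It)). Qed.

Lemma parts_integral e (s s' : forall t, A (gamma e t)) : I e ->
  (forall t, I t -> smooth_along_at I t s) -> (forall t, I t -> smooth_along_at I t s') ->
  int01 (fun t => g (gamma e t) (covder D I (alpha e) s t) (s' t)) +
  int01 (fun t => g (gamma e t) (s t) (covder D I (alpha e) s' t)) =
  g (gamma e 1) (s 1) (s' 1) - g (gamma e 0) (s 0) (s' 0).
Proof.
move=> Ie Hs Hs'; have Ds := covder_slice_sal Ie Hs; have Ds' := covder_slice_sal Ie Hs'.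
rewrite -int01_D; [|exact: inner_cont|exact: inner_cont].
apply: (FTC01 (F := fun t => g (gamma e t) (s t) (s' t))); last by move=> t It; exact: inner_parts.
apply: sw_within_cont => t It; apply: sw_add.
  exact: (along_inner It g (Ds t It) (Hs' t It)).
exact: (along_inner It g (Hs t It) (Ds' t It)).
Qed.

Lemma energy_first_variation e : I e ->
  is_deriv_in I (fun e => A_energy g (alpha e)) e
    (g (gamma e 1) (beta e 1) (alpha e 1)
           - g (gamma e 0) (beta e 0) (alpha e 0)
           - int01 (fun t => g (gamma e t) (beta e t) (covder_t D alpha alpha e t))
           - int01 (fun t => g (gamma e t) (Delta D alpha beta e t) (alpha e t)) : R).
Proof.
move=> Ie; case: (Ha) => H _ _; case: (Hb) => K _.
have Sa t : I t -> smooth_along_at I t (alpha e) by move=> It; exact: (along_slice_t H Ie It).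
have Sb t : I t -> smooth_along_at I t (beta e) by move=> It; exact: (along_slice_t K Ie It).
have [dF [d1 d2 d3]] := square_deriv (F := fun e t => g (gamma e t) (alpha e t) (alpha e t)) Ie (fun t It => energy_density_sw Ie It).
have EdF t : I t -> dF t = 2 * g (gamma e t) (covder_eps D beta alpha e t) (alpha e t).
  by move=> It; exact: (is_deriv_in_unique (proper01 Ie) (d1 t It) (density_deriv Ie It)).
have cdF : {within I, continuous dF} by exact: sw_within_cont.
have := is_deriv_in_Zl (k := 2^-1) d3.
congr is_deriv_in.
(* Half of [dF] is <D_eps alpha, alpha> = <D_t beta, alpha> - <Delta, alpha>; integrating the first
   term by parts gives the boundary values and the term in D_t alpha. *)
rewrite -int01_Zl // -parts_integral // addrK.
have -> : int01 (fun t => g (gamma e t) (Delta D alpha beta e t) (alpha e t)) =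
  int01 (fun t => g (gamma e t) (covder D I (alpha e) (beta e) t) (alpha e t) - 2^-1 * dF t).
  apply: int01_eq => t It; by rewrite innerBl EdF // mulrA mulVf ?mul1r // pnatr_eq0.
rewrite int01_B; first by rewrite opprB addrC subrK.
  by apply: inner_cont => //; exact: covder_slice_sal.
by apply: sw_within_cont => t It; apply: sw_mul (d2 t It); apply/sw_Csm/Csm_cst.
Qed.

End Variation.

(** Where [alpha t] vanishes the value is 0, because 0^-1 = 0; smoothness along the path is claimed
    only away from such points. *)
Definition unit_direction (gamma : R -> M) (alpha : forall t, A (gamma t)) t : A (gamma t) :=
  (Num.sqrt (g (gamma t) (alpha t) (alpha t)))^-1 *: alpha t.

Lemma along_unit_direction (J : set R) (gamma : R -> M) (alpha : forall t, A (gamma t)) t : J t ->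
  smooth_along_at J t alpha -> alpha t != 0 -> smooth_along_at J t (unit_direction alpha).
Proof.
move=> Jt Sa nz; apply: (along_scale Jt) => //.
have Hs := along_inner Jt g Sa Sa.
have := @sw_compl R R J t Jt R R (fdim_R R) (fdim_R R) _ ((fun x : R => x^-1) \o @Num.sqrt R) Hs; apply.
have gt0 : 0 < g (gamma t) (alpha t) (alpha t) by rewrite inner_gt0.
apply: (@Csm_comp _ _ _ (fdim_R R) _ (fdim_R R) (@Num.sqrt R) (fun x : R => x^-1)); first exact: Csm_sqrt.
by apply: Csm_inv; rewrite gt_eqF // sqrtr_gt0.
Qed.

(** * Variation of the length *)

Section Length.
Variables (gamma : R -> R -> M) (alpha : forall e t, A (gamma e t)).
Hypothesis Ha : A_variation alpha.
Hypothesis nz : forall t, I t -> alpha 0 t != 0.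

Let I0 : I 0.
Proof. by rewrite /= in_itv /= lexx ler01. Qed.

(** Smoothness at (0, t) is local, so positivity of the density at eps = 0 is enough for its square
    root. The relation between [dF] and [dG] comes from differentiating the square of that root. *)
Lemma length_density_deriv : exists dF dG : R -> R,
  [/\ forall t, I t -> is_deriv_in I (fun e => g (gamma e t) (alpha e t) (alpha e t)) 0 (dF t),
      forall t, I t -> dF t = 2 * Num.sqrt (g (gamma 0 t) (alpha 0 t) (alpha 0 t)) * dG t,
      is_deriv_in I (fun e => A_energy g (alpha e)) 0 (2^-1 * int01 dF),
      forall t, I t -> smooth_within I t dG &
      is_deriv_in I (fun e => A_length g (alpha e)) 0 (int01 dG)].
Proof.
have HF t : I t -> smooth_within (@square R) (0, t) (fun z => g (gamma z.1 z.2) (alpha z.1 z.2) (alpha z.1 z.2)).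
  by move=> It; exact: energy_density_sw.
have HG t : I t -> smooth_within (@square R) (0, t)
    (fun z => Num.sqrt (g (gamma z.1 z.2) (alpha z.1 z.2) (alpha z.1 z.2))).
  move=> It; apply: (@sw_compl R (R * R)%type (@square R) (0, t) (conj I0 It) R R (fdim_R R) (fdim_R R) _ (@Num.sqrt R) (HF t It)).
  by apply: Csm_sqrt; rewrite inner_gt0; exact: nz.
have [dF [f1 f2 f3]] := square_deriv (F := fun e t => g (gamma e t) (alpha e t) (alpha e t)) I0 HF.
have [dG [g1 g2 g3]] := square_deriv (F := fun e t => Num.sqrt (g (gamma e t) (alpha e t) (alpha e t))) I0 HG.
exists dF, dG; split=> //; last exact: is_deriv_in_Zl.
move=> t It; apply: (is_deriv_in_unique (proper01 I0) (f1 t It)).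
have := is_deriv_in_mul (g1 t It) (g1 t It).
rewrite [X in is_deriv_in _ _ _ X](_ : _ = 2 * Num.sqrt (g (gamma 0 t) (alpha 0 t) (alpha 0 t)) * dG t); last by ring.
apply: is_deriv_in_eq; last by rewrite -expr2 sqr_sqrtr // inner_ge0.
by apply: (@nearW R (nbhs _)) => e _; rewrite -expr2 sqr_sqrtr // inner_ge0.
Qed.

Lemma energy_length_deriv : (forall t, I t -> g (gamma 0 t) (alpha 0 t) (alpha 0 t) = 1) ->
  exists2 l : R, is_deriv_in I (fun e => A_energy g (alpha e)) 0 l &
    is_deriv_in I (fun e => A_length g (alpha e)) 0 l.
Proof.
move=> H1; have [dF [dG [_ E HE cG HL]]] := length_density_deriv.
exists (int01 dG) => //; move: HE; congr is_deriv_in.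
rewrite (int01_eq (g := fun t => 2 * dG t)); last first.
  by move=> t It; rewrite E // H1 // sqrtr1 mulr1.
rewrite int01_Zl; last by apply: sw_within_cont.
by rewrite mulrA mulVf ?mul1r // pnatr_eq0.
Qed.

(** Delta = 0 lets D_t beta replace D_eps alpha, so the speed has derivative <D_t beta, w> with w
    the unit direction; integration by parts leaves no boundary term because [beta] vanishes at both
    ends. *)
Lemma length_first_variation (beta : forall e t, A (gamma e t)) : transverse beta ->
  (forall t, I t -> Delta D alpha beta 0 t = 0) -> beta 0 0 = 0 -> beta 0 1 = 0 ->
  is_deriv_in I (fun e => A_length g (alpha e)) 0
   (- int01 (fun t => g (gamma 0 t) (beta 0 t) (covder D I (alpha 0) (unit_direction (alpha 0)) t))).
Proof.
move=> Hb D0 b0 b1; have [dF [dG [f1 E _ cG HL]]] := length_density_deriv.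
case: (Hb) => K _.
have Sb t : I t -> smooth_along_at I t (beta 0) by move=> It; exact: (along_slice_t K I0 It).
move: HL; congr is_deriv_in.
have Su t : I t -> smooth_along_at I t (unit_direction (alpha 0)).
  move=> It; case: (Ha) => H _ _; exact: (along_unit_direction It (along_slice_t H I0 It) (nz It)).
have := parts_integral Ha I0 Sb Su.
rewrite b0 b1 !inner0l subr0 => P.
apply/eqP; rewrite -addr_eq0; apply/eqP; rewrite -[RHS]P; congr (_ + _).
apply: int01_eq => t It.
have gt0 : 0 < g (gamma 0 t) (alpha 0 t) (alpha 0 t) by rewrite inner_gt0 nz.
have s0 : Num.sqrt (g (gamma 0 t) (alpha 0 t) (alpha 0 t)) != 0 by rewrite gt_eqF // sqrtr_gt0.
have := is_deriv_in_unique (proper01 I0) (f1 t It) (density_deriv Ha Hb I0 It).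
have -> : covder_eps D beta alpha 0 t = covder D I (alpha 0) (beta 0) t.
  by have /eqP := D0 t It; rewrite subr_eq0 => /eqP <-.
rewrite E // -mulrA => /mulfI H; rewrite innerZr -[dG t](mulKf s0) H //.
Qed.

End Length.
End FirstVariation.

Lemma derive_row (R : realType) n (f : R -> 'rV[R]_n) u : Csm f u ->
  'D_1 f u = \row_l 'D_1 (fun u : R => f u 0 l : R) u.
Proof.
move=> Hf; apply/rowP => l; rewrite mxE.
by symmetry; exact: (derive_lin_comp (@fb_cont_rV R n l) (1 : R) (Csm_diff Hf)).
Qed.

Lemma derive_lsub (R : realType) n1 n2 (f : 'rV[R]_n1 -> R) (z v : 'rV[R]_(n1 + n2)) :
  differentiable f (lsubmx z) ->
  'D_v (fun z : 'rV[R]_(n1 + n2) => f (lsubmx z)) z = 'D_(lsubmx v) f (lsubmx z).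
Proof.
move=> Hf; have dl : differentiable (fun z : 'rV[R]_(n1 + n2) => lsubmx z) z.
  exact/Csm_diff/Csm_lsub.
rewrite -[LHS]/('D_v (f \o (fun z : 'rV[R]_(n1 + n2) => lsubmx z)) z) derive_comp //.
congr ('D__ f _).
have cL : continuous (lsubmx : {linear 'rV[R]_(n1 + n2) -> 'rV[R]_n1}).
  by move=> w; exact: (Csm_cont (Csm_lsub w)).
have := derive_lin_comp cL v (Csm_diff (Csm_id z)).
by rewrite derive_id.
Qed.

(** * Construction of A-homotopies *)

Section LocalFlow.
Variables (R : realType) (n : nat) (M : manifold R n) (r : nat) (A : lie_algebroid M r).
Variables (c : chart R n M) (T : trivialization r A) (e : 'I_r -> section A) (m : 'I_r).
Variables (X : 'I_n -> M -> R).
Hypothesis ac : atlas c.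
Hypothesis tT : trivs T.
Hypothesis He : forall i, smooth_section (e i).
Hypothesis HX : forall k, msmooth (X k).

(* [X] extends the coordinates of the chart [c] to global smooth functions, on
   which tangent vectors can be evaluated. *)
Definition adapted (y : 'rV[R]_n) := [/\ cdom c (cinv c y), cmap c (cinv c y) = y,
  is_frame T e (cinv c y) & \forall x \near cinv c y, forall k, X k x = cmap c x 0 k].

Definition rho i k (y : 'rV[R]_n) : R := anchor (e i (cinv c y)) (X k).
(** One entry of the bracket is always [e m], because [beta] will be a multiple of that section. *)
Definition structure_fun i j (y : 'rV[R]_n) : R := tcoord T (bracket (e j) (e m) (cinv c y)) 0 i.

Lemma adapted_near x : cdom c x -> (\forall y \near x, is_frame T e y) ->
  (\forall y \near x, forall k, X k y = cmap c y 0 k) -> \forall y \near cmap c x, adapted y.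
Proof.
move=> cx F E; have E' := near_join E.
apply: filterS (filterI (near_cinvK cx) (filterI (near_cimg cx F) (near_cimg cx E'))).
by move=> y [[H1 H2] [H3 H4]]; split.
Qed.

Lemma Csm_cinv (W : normedModType R) (f : M -> W) y : adapted y -> (forall x, msmooth_at f x) ->
  Csm (f \o cinv c) y.
Proof. by move=> [cy Ey _ _] Hf; have := Hf _ c ac cy; rewrite Ey. Qed.

Lemma anchor_chart y (u : A (cinv c y)) f : adapted y -> msmooth f ->
  'D_(\row_l anchor u (X l)) (f \o cinv c) y = anchor u f.
Proof.
move=> Hy Hf; have [cy Ey _ EX] := Hy.
rewrite (tv_coord (anchor_tangent u) ac cy HX EX Hf) Ey.
rewrite derive_rVE; last by apply/Csm_diff/Csm_cinv => //; exact: (msmoothP f).1.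
by apply: eq_bigr => k _; rewrite mxE.
Qed.

Lemma rho_smooth i k : msmooth (fun x => anchor (e i x) (X k)).
Proof. exact: anchor_smooth. Qed.

Lemma Csm_rho i k y : adapted y -> Csm (rho i k) y.
Proof.
move=> Hy; apply: (Csm_cinv (f := fun x => anchor (e i x) (X k)) Hy).
exact: (msmoothP _).1 (rho_smooth i k).
Qed.

Lemma bracket_expand j y : adapted y ->
  bracket (e j) (e m) (cinv c y) = \sum_i structure_fun i j y *: e i (cinv c y).
Proof. by move=> [_ _ F _]; rewrite [LHS](frame_expand _ F). Qed.

Lemma Csm_structure_fun i j y : adapted y -> Csm (structure_fun i j) y.
Proof.
move=> [cy Ey [Ty _] _].
have /smooth_sectionP := bracket_smooth (He j) (He m).
move=> /(_ _ T tT Ty) /msmooth_at_rV /(_ i) H.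
by have := H c ac cy; rewrite Ey.
Qed.

(** The coordinate form of [anchor_bracket], and the identity that makes the equation of the A-path
    defect linear. *)
Lemma rho_bracket j k y : adapted y ->
  \sum_i structure_fun i j y * rho i k y =
  'D_(\row_l rho j l y) (rho m k) y - 'D_(\row_l rho m l y) (rho j k) y.
Proof.
move=> Hy.
have H i h : 'D_(\row_l rho i l y) (rho h k) y =
    anchor (e i (cinv c y)) (fun x => anchor (e h x) (X k)).
  exact: (anchor_chart (e i (cinv c y)) Hy (rho_smooth h k)).
rewrite !H -anchor_bracket // (bracket_expand _ Hy) anchor_sum //.
by apply: eq_bigr => i _; rewrite anchorZ.
Qed.

Local Notation N := (n + r)%N.

(* For beta = chi e_m, the equation Delta(alpha, beta) = 0 becomes
   [z' = homotopy_field z] in the variable s = eps chi(t), where [z] collects the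
   coordinates of the base point and those of the A-path in the frame [e]. *)
Definition homotopy_field (z : 'rV[R]_N) : 'rV[R]_N :=
  row_mx (\row_k rho m k (lsubmx z)) (\row_i \sum_j rsubmx z 0 j * structure_fun i j (lsubmx z)).

Lemma Csm_homotopy_field z : adapted (lsubmx z) -> Csm homotopy_field z.
Proof.
move=> Hz.
have L (f : 'rV[R]_n -> R) : Csm f (lsubmx z) -> Csm (fun z : 'rV[R]_N => f (lsubmx z)) z.
  by move=> Hf; apply: (@Csm_comp _ _ _ (fdim_rV R n) _ (fdim_R R) (fun z : 'rV[R]_N => lsubmx z) f) => //; exact: Csm_lsub.
apply: Csm_row_mx; apply/Csm_rV => i.
  apply: (Csm_eq (f := fun z : 'rV[R]_N => rho m i (lsubmx z))); first by move=> w; rewrite mxE.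
  by apply: L; exact: Csm_rho.
apply: (Csm_eq (f := fun z : 'rV[R]_N => \sum_j rsubmx z 0 j * structure_fun i j (lsubmx z))); first by move=> w; rewrite mxE.
apply: Csm_sum => j _; apply: Csm_mul; last by apply: L; exact: Csm_structure_fun.
by have /Csm_rV := Csm_rsub z; exact.
Qed.

Variables (z0 : R -> 'rV[R]_N) (t0 : R).
Hypothesis Hz0 : Csm z0 t0.
Hypothesis ad0 : \forall y \near lsubmx (z0 t0), adapted y.
Hypothesis path0 : \forall t \near t0, forall k,
  'D_1 (fun u : R => lsubmx (z0 u) 0 k : R) t = \sum_i rsubmx (z0 t) 0 i * rho i k (lsubmx (z0 t)).

Lemma near_lsub (z : 'rV[R]_N) (P : 'rV[R]_n -> Prop) : (\forall y \near lsubmx z, P y) ->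
  \forall w \near z, P (lsubmx w).
Proof. by move=> H; exact: (Csm_cont (Csm_lsub z) H). Qed.

(* The defect [w] of the A-path condition vanishes at s = 0 and, because the
   anchor is a Lie algebra homomorphism, solves a linear equation in [s]. *)
Theorem local_flow : exists (c1 d1 : R) (phi : R -> R -> 'rV[R]_N), [/\ 0 < c1, 0 < d1,
  forall t, `|t - t0| < d1 -> phi 0 t = z0 t &
  forall s t, `|s| < c1 -> `|t - t0| < d1 ->
  [/\ Csm (fun z => phi z.1 z.2) (s, t), adapted (lsubmx (phi s t)),
      forall i, is_derive s 1 (fun s => phi s t 0 i : R) (homotopy_field (phi s t) 0 i) &
      forall k, is_derive t 1 (fun t => lsubmx (phi s t) 0 k : R)
        (\sum_i rsubmx (phi s t) 0 i * rho i k (lsubmx (phi s t)))]].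
Proof.
(* [flow_exists] wants a field that is smooth everywhere, while [homotopy_field] is controlled near
   [z0 t0] only; solutions are then confined to the region where both agree. *)
have [F HF EF] := @Csm_extend R N _ (fdim_rV R N) homotopy_field (z0 t0) (Csm_homotopy_field (nbhs_singleton ad0)).
have [c0 [d0 [phi [c0_gt0 d0_gt0 S]]]] := flow_exists HF Hz0.
have oJ : open (ball t0 d0) by exact: ball_open.
have J0 : ball t0 d0 t0 by exact: ballxx.
have Cphi s t : `|s| < c0 -> ball t0 d0 t -> Csm (fun z => phi z.1 z.2) (s, t).
  move=> Hs Ht; exists (box c0 (ball t0 d0)); first by split; [exact: open_box|split].
  by move=> k; exact: (solfam_Ck k c0_gt0 oJ HF S).
have [S1 S2 S3 S4] := S.
have phi00 : phi 0 t0 = z0 t0 by exact: S2.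
have C0 : {for (0, t0), continuous (fun z : R * R => phi z.1 z.2)}.
  by apply/Csm_cont/Cphi => //; rewrite normr0.
have W0 : \forall w \near phi 0 t0, [/\ F w = homotopy_field w, adapted (lsubmx w) & `|w| < `|z0 t0| + 1].
  rewrite phi00; have B : \forall w \near z0 t0, `|w| < `|z0 t0| + 1.
    have : {for z0 t0, continuous (fun w : 'rV[R]_N => `|w|)} by exact: norm_continuous.
    move/(_ [set x | x < `|z0 t0| + 1]); apply.
    by apply: open_nbhs_nbhs; split; [exact: open_lt|rewrite /= ltrDl].
  by apply: filterS (filterI EF (filterI (near_lsub ad0) B)) => w [? [? ?]]; split.
(* Agreement is kept in a neighborhood of each value, not only at the value, because derivatives of
   [F] along the flow will be read off from [homotopy_field]. *)
have W1 : \forall z \near ((0, t0) : R * R),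
    \forall w \near phi z.1 z.2, [/\ F w = homotopy_field w, adapted (lsubmx w) & `|w| < `|z0 t0| + 1].
  exact: (C0 _ (near_join W0)).
have [/= [U V] [/= NU NV] UV] := W1.
have [c1 c1_gt0 Hc1] : exists2 c1, 0 < c1 & forall s, `|s| < c1 -> U s.
  move/nbhs_ballP: NU => [c1 c1_gt0 Hc1]; exists c1 => // s Hs; apply: Hc1.
  by rewrite /ball /= sub0r normrN.
have [d1 d1_gt0 Hd1] : exists2 d1, 0 < d1 & forall t, `|t - t0| < d1 ->
   V t /\ forall k, 'D_1 (fun u : R => lsubmx (z0 u) 0 k : R) t = \sum_i rsubmx (z0 t) 0 i * rho i k (lsubmx (z0 t)).
  have NP : \forall t \near t0, V t /\ forall k, 'D_1 (fun u : R => lsubmx (z0 u) 0 k : R) t =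
      \sum_i rsubmx (z0 t) 0 i * rho i k (lsubmx (z0 t)) by exact: filterI NV path0.
  have [d1 /= d1_gt0 Hd1] := iffLR (nbhs_ballP _ _) NP.
  by exists d1 => // t Ht; apply: Hd1; rewrite /ball /= distrC.
pose c2 := Num.min c0 c1; pose d2 := Num.min d0 d1.
have c2_gt0 : 0 < c2 by rewrite lt_min c0_gt0.
have d2_gt0 : 0 < d2 by rewrite lt_min d0_gt0.
have key s t : `|s| < c2 -> `|t - t0| < d2 -> [/\ `|s| < c0, ball t0 d0 t &
    \forall w \near phi s t, [/\ F w = homotopy_field w, adapted (lsubmx w) & `|w| < `|z0 t0| + 1]].
  rewrite !lt_min => /andP[s1 s2] /andP[t1 t2]; split; first exact: s1.
    by rewrite /ball /= distrC.
  by apply: (UV (s, t)); split=> /=; [exact: Hc1|exact: (Hd1 t t2).1].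
exists c2, d2, phi; split=> //.
  move=> t Ht; apply: S2; have [] := key 0 t _ Ht => //; by rewrite normr0.
have [K K0 HK] : exists2 K, 0 <= K & forall y v, `|y| <= `|z0 t0| + 1 -> `|dF F y v| <= K * `|v|.
  exact: dF_bounded.
have [C C_gt0 G] := @gronwall R n c2 K c2_gt0 K0.
move=> s t Hs Ht; have [Hs0 Jt near_st] := key s t Hs Ht.
have [Fst ad_st Bst] := nbhs_singleton near_st.
split=> //; first exact: Cphi.
  by move=> i; rewrite -Fst; exact: S1.
have [D1 D2 D3] := fam_diff c0_gt0 oJ HF S Jt.
pose w s := \row_k (dphi phi s t 0 (lshift r k) -
  \sum_i rsubmx (phi s t) 0 i * rho i k (lsubmx (phi s t))) : 'rV[R]_n.
pose emb (v : 'rV[R]_n) : 'rV[R]_N := row_mx v 0.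
(* The expected derivative of the defect: the base component of [F] linearized in the direction (w,
   0), hence linear in [w]. *)
pose w' s := lsubmx (dF F (phi s t) (emb (w s))) : 'rV[R]_n.
suff W : forall k, w s 0 k = 0.
  move=> k; have := W k; rewrite mxE => /eqP; rewrite subr_eq0 => /eqP <-.
  have := D1 s (lshift r k) Hs0; congr is_derive.
  by apply: funext => u; rewrite mxE.
have w0 : w 0 = 0.
  apply/rowP => k; rewrite mxE [RHS]mxE (S2 t Jt) D3 mxE.
  move: Ht; rewrite lt_min => /andP[_ t2]; rewrite -(Hd1 t t2).2.
  apply/eqP; rewrite subr_eq0; apply/eqP; congr ('D_1 _ t).
  by apply: funext => u; rewrite mxE.
have ww : `|w s| <= C * (`|w 0| + 0).
  apply: (G w w' 0 (lexx 0) _ _ s Hs).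
    move=> u Hu k; have [Hu0 _ near_ut] := key u t Hu Ht.
    have [Fut ad_ut But] := nbhs_singleton near_ut.
    have ad : adapted (lsubmx (phi u t)) by [].
    set y := lsubmx (phi u t) in ad.
    (* The first n components of [homotopy_field] depend on the base point only, so only the base
       part of the direction [v] counts. *)
    have dFk v : dF F (phi u t) v 0 (lshift r k) = 'D_(lsubmx v) (rho m k) y.
      rewrite mxE -(@derive_lsub R n r (rho m k) (phi u t) v); last exact/Csm_diff/Csm_rho.
      apply: near_eq_derive.
      apply: filterS near_ut => z [-> _ _].
      by rewrite row_mxEl mxE.
    have Cl : Csm (fun s => lsubmx (phi s t)) u.
      apply: (@Csm_comp _ _ _ (fdim_rV R N) _ (fdim_rV R n) (fun s => phi s t) (fun z : 'rV[R]_N => lsubmx z)); last exact: Csm_lsub.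
      apply: (@Csm_comp _ _ _ (fdim_RR R) _ (fdim_rV R N) (fun s : R => (s, t)) (fun z => phi z.1 z.2)).
        by apply: Csm_pair; [exact: Csm_id|exact: Csm_cst].
      exact: Cphi.
    have Drow : 'D_1 (fun s => lsubmx (phi s t)) u = \row_l rho m l y.
      rewrite derive_row //; apply/rowP => l; rewrite !mxE.
      have H := S1 t u Jt Hu0 (lshift r l).
      rewrite (_ : (fun s => _) = (fun s => phi s t 0 (lshift r l))); last by apply: funext => s'; rewrite mxE.
      by rewrite derive_val Fut row_mxEl mxE.
    have drho i : is_derive u 1 (fun s => rho i k (lsubmx (phi s t))) ('D_(\row_l rho m l y) (rho i k) y).
      rewrite -Drow -(derive_comp (g := fun s => lsubmx (phi s t)) (f := rho i k)); first last.
      - exact/Csm_diff/Csm_rho.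
      - exact: Csm_diff.
      apply/derivableP/diff_derivable/Csm_diff.
      by apply: (@Csm_comp _ _ _ (fdim_rV R n) _ (fdim_R R)) => //; exact: Csm_rho.
    have da i : is_derive u 1 (fun s => rsubmx (phi s t) 0 i : R) (\sum_j rsubmx (phi u t) 0 j * structure_fun i j y).
      have := S1 t u Jt Hu0 (rshift n i); rewrite Fut row_mxEr mxE; congr is_derive.
      by apply: funext => s'; rewrite mxE.
    have Hsum : is_derive u 1 (fun s => \sum_i rsubmx (phi s t) 0 i * rho i k (lsubmx (phi s t)))
       (\sum_i ((\sum_j rsubmx (phi u t) 0 j * structure_fun i j y) * rho i k y +
          rsubmx (phi u t) 0 i * 'D_(\row_l rho m l y) (rho i k) y)).
      apply: is_deriv_in_derive; apply: is_deriv_in_sum => i.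
      exact: is_deriv_in_mul (is_derive_in setT (da i)) (is_derive_in setT (drho i)).
    have := is_deriv_in_derive (is_deriv_in_add (is_derive_in setT (D2 u (lshift r k) Hu0))
       (is_deriv_in_Zl (k := -1) (is_derive_in setT Hsum))).
    rewrite (_ : (fun s => _) = (fun s => w s 0 k)); last first.
      by apply: funext => s'; rewrite mulN1r [RHS]mxE.
    congr is_derive.
    rewrite [RHS]mxE !dFk row_mxKl mulN1r.
    have dr : differentiable (rho m k) y by exact/Csm_diff/Csm_rho.
    have -> : w u = lsubmx (dphi phi u t) - \sum_i rsubmx (phi u t) 0 i *: \row_l rho i l y.
      apply/rowP => l; rewrite !mxE summxE; congr (_ - _); apply: eq_bigr => i _.
      by rewrite !mxE.
    have -> : 'D_(lsubmx (dphi phi u t) - \sum_i rsubmx (phi u t) 0 i *: \row_l rho i l y) (rho m k) y =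
      'D_(lsubmx (dphi phi u t)) (rho m k) y - \sum_i rsubmx (phi u t) 0 i * 'D_(\row_l rho i l y) (rho m k) y.
      rewrite (deriveE _ dr) linearB -(deriveE _ dr); congr (_ - _).
      rewrite linear_sum; apply: eq_bigr => i _.
      by rewrite linearZ -(deriveE _ dr).
    congr (_ - _).
    (* What remains is [rho_bracket] summed against the coordinates of the path; its second term
       cancels the derivative of the anchor matrix along the flow. *)
    rewrite big_split /=.
    under eq_bigr do rewrite mulr_suml.
    rewrite exchange_big /= -big_split /=; apply: eq_bigr => j _.
    under eq_bigr do rewrite -mulrA.
    rewrite -mulr_sumr -mulrDr rho_bracket // subrK.
    by [].
  move=> u Hu; rewrite addr0; have [Hu0 _ near_ut] := key u t Hu Ht.
  have [Fut ad_ut But] := nbhs_singleton near_ut.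
  have E1 : `|w' u| <= `|dF F (phi u t) (emb (w u))|.
    by apply/rV_norm_le => // i; rewrite mxE coord_le.
  have E2 : `|emb (w u)| <= `|w u| by apply: row_mx_norm => //; rewrite normr0.
  apply: (le_trans E1); apply: (le_trans (HK _ _ (ltW But))).
  by rewrite ler_wpM2l.
have {}ww : w s = 0.
  by apply/eqP; rewrite -normr_le0; apply: le_trans ww _; rewrite w0 normr0 addr0 mulr0.
by move=> k; rewrite ww mxE.
Qed.

End LocalFlow.

(** * Comparison of paths in the total space *)

Section TotalSpace.
Variables (R : realType) (n : nat) (M : manifold R n) (r : nat) (A : lie_algebroid M r).
Variables (g : riemannian_metric A) (D : connection_op A).
Definition tot (x : M) (u : A x) := existT (fun x => A x : Type) x u.
(** The fiber component is recovered without transport because [M] has a boolean equality, on which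
    [tagged_as] relies. *)
Lemma tot_inj x (u v : A x) : tot u = tot v -> u = v.
Proof. by move=> /(congr1 (tagged_as (tot u))); rewrite !(@tagged_asE _ (fun x => A x : Type)). Qed.

Variables (I : set R) (t : R).
Hypothesis It : I t.
Variables (gamma gamma' : R -> M).

Lemma vel_tot (alpha : forall u, A (gamma u)) (alpha' : forall u, A (gamma' u)) :
  (\forall u \near t, I u -> gamma u = gamma' u) -> tot (alpha t) = tot (alpha' t) ->
  is_velocity I gamma' t (anchor (alpha' t)) -> is_velocity I gamma t (anchor (alpha t)).
Proof.
move=> E Et H f Hf; have := H f Hf.
have -> : anchor (alpha' t) f = anchor (alpha t) f by have := congr1 (fun p => anchor (projT2 p) f) Et.
apply: is_deriv_in_eq; first by apply: filterS E => u Eu Iu /=; rewrite Eu.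
by have := congr1 (@projT1 _ _) Et => /= ->.
Qed.

(** Passes between two presentations of one curve. The sections are differentiated and must agree
    near [t]; the driving paths enter through their values at [t] alone. *)
Lemma pairs_tot (alpha s : forall u, A (gamma u)) (alpha' s' : forall u, A (gamma' u)) v v' :
  (\forall u \near t, I u -> tot (s u) = tot (s' u)) -> tot (alpha t) = tot (alpha' t) ->
  tot v = tot v' -> pairs g D I alpha' s' (t := t) v' -> pairs g D I alpha s (t := t) v.
Proof.
move=> Es Ea Ev H c Hc; have := H c Hc.
have st := nbhs_singleton Es It.
have Eg := congr1 (@projT1 _ _) Ea; simpl in Eg.
have -> : g (gamma' t) v' (c (gamma' t)) = g (gamma t) v (c (gamma t)).
  by have := congr1 (fun p => g (projT1 p) (projT2 p) (c (projT1 p))) Ev.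
have -> : g (gamma' t) (s' t) (nabla D c (alpha' t)) = g (gamma t) (s t) (nabla D c (alpha t)).
  move: (s t) (s' t) (alpha t) (alpha' t) st Ea; rewrite -Eg => p p' q q' Ep Eq.
  by rewrite (tot_inj Ep) (tot_inj Eq).
apply: is_deriv_in_eq.
  apply: filterS Es => u Eu Iu.
  by have := congr1 (fun p => g (projT1 p) (projT2 p) (c (projT1 p))) (Eu Iu).
by have := congr1 (fun p => g (projT1 p) (projT2 p) (c (projT1 p))) st.
Qed.

End TotalSpace.

Section PairsSection.
Variables (R : realType) (n : nat) (M : manifold R n) (r : nat) (A : lie_algebroid M r).
Variables (g : riemannian_metric A) (D : connection_op A).
Hypothesis HD : levi_civita g D.

Lemma pairs_section (I : set R) (gamma : R -> M) (alpha : forall t, A (gamma t)) t (b : section A) :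
  is_velocity I gamma t (anchor (alpha t)) -> smooth_section b ->
  pairs g D I alpha (fun u => b (gamma u)) (nabla D b (alpha t)).
Proof.
move=> vel Hb c Hc; have := vel _ (inner_msmooth g Hb Hc).
by rewrite (nabla_compat HD).
Qed.

End PairsSection.

Section Calculus.
Variable R : realType.

Lemma sw_interior (V W : normedModType R) (S : set V) z (f : V -> W) : nbhs z S ->
  smooth_within S z f -> Csm f z.
Proof.
move=> nS /smooth_withinP[h Hh E]; apply: Csm_near Hh.
by apply: filterS2 nS E => w Sw Ew; rewrite Ew.
Qed.

Lemma derive_slice2 (h : R * R -> R) (e t : R) : Csm h (e, t) ->
  is_derive t 1 (fun u : R => h (e, u)) ('D_(0, 1) h (e, t)).
Proof.
move=> Hh; have E u : u *: ((0, 1) : R * R) + (e, 0) = (e, u).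
  by rewrite -[LHS]/(u * 0 + e, u * 1 + 0) mulr1 mulr0 addr0 add0r.
have H : is_derive (t *: ((0, 1) : R * R) + (e, 0)) (0, 1) h ('D_(0, 1) h (e, t)).
  by rewrite E; apply/derivableP/diff_derivable/Csm_diff.
move/is_derive_line: H; congr (is_derive _ _ _ _).
by apply: funext => u; rewrite E.
Qed.

(** Serves [phi (eps * chi t) t], of which the flow provides the two partial derivatives separately;
    joint smoothness justifies combining them. *)
Lemma chain2 (h : R * R -> R) (p q : R -> R) (u dp dq l k : R) : Csm h (p u, q u) ->
  Csm p u -> Csm q u -> is_derive u 1 p dp -> is_derive u 1 q dq ->
  is_derive (p u) 1 (fun s => h (s, q u)) l -> is_derive (q u) 1 (fun t => h (p u, t)) k ->
  is_derive u 1 (fun u => h (p u, q u)) (dp * l + dq * k).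
Proof.
move=> Hh Hp Hq dpu dqu Hl Hk; have Hpq := Csm_pair Hp Hq.
have Hc : Csm (h \o (fun u => (p u, q u))) u by exact: (@Csm_comp _ _ _ (fdim_RR R) _ (fdim_R R)).
have := Csm_is_derive Hc; congr is_derive.
rewrite derive_comp; [|exact: Csm_diff Hpq|exact: Csm_diff Hh].
rewrite (@derive_fbE _ _ (fdim_RR R)); last exact: Csm_diff Hh.
rewrite big_ord_recl big_ord1 /=.
have H i : RR_co R i ('D_1 (fun u => (p u, q u)) u) = 'D_1 (RR_co R i \o (fun u => (p u, q u))) u.
  by symmetry; exact: (derive_lin_comp (@fb_cont_RR R i) (1 : R) (Csm_diff Hpq)).
have -> : ('D_1 (fun u => (p u, q u)) u).1 = dp by rewrite -(@derive_val _ _ _ _ _ _ _ dpu); exact: (H ord0).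
have -> : ('D_1 (fun u => (p u, q u)) u).2 = dq by rewrite -(@derive_val _ _ _ _ _ _ _ dqu); exact: (H (lift ord0 ord0)).
congr (_ *: _ + _ *: _).
  by rewrite -[RHS](@derive_val _ _ _ _ _ _ _ Hl) -(@derive_val _ _ _ _ _ _ _ (derive_slice Hh)).
by rewrite -[RHS](@derive_val _ _ _ _ _ _ _ Hk) -(@derive_val _ _ _ _ _ _ _ (derive_slice2 Hh)).
Qed.

End Calculus.

Lemma sum_kronecker (R : realType) r (m : 'I_r) (k : R) (f : 'I_r -> R) :
  \sum_i k * (i == m)%:R * f i = k * f m.
Proof.
rewrite (bigD1 m) //= eqxx mulr1 big1 ?addr0 // => i /negbTE ->.
by rewrite mulr0 mul0r.
Qed.

(** * The homotopy attached to a bump function *)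

Section Homotopy.
Variables (R : realType) (n : nat) (M : manifold R n) (r : nat) (A : lie_algebroid M r).
Variables (g : riemannian_metric A) (D : connection_op A).
Hypothesis HD : levi_civita g D.
Local Notation I := (`[0:R, 1]%classic).
Variables (c : chart R n M) (T : trivialization r A) (e : 'I_r -> section A) (m : 'I_r).
Variables (X : 'I_n -> M -> R).
Hypothesis ac : atlas c.
Hypothesis tT : trivs T.
Hypothesis He : forall i, smooth_section (e i).
Hypothesis HX : forall k, msmooth (X k).
Variables (gamma0 : R -> M) (alpha0 : forall t, A (gamma0 t)).
Hypothesis path0 : A_path 0 1 alpha0.
Variables (t0 c1 d : R) (phi : R -> R -> 'rV[R]_(n+r)) (chi : R -> R).
Hypothesis d_gt0 : 0 < d.
Hypothesis inI : forall t, `|t - t0| < d -> 0 < t < 1.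
Hypothesis flow : forall s t, `|s| < c1 -> `|t - t0| < d ->
  [/\ Csm (fun z => phi z.1 z.2) (s, t), adapted c T e X (lsubmx (phi s t)),
      forall i, is_derive s 1 (fun s => phi s t 0 i : R) (homotopy_field c T e m X (phi s t) 0 i) &
      forall k, is_derive t 1 (fun t => lsubmx (phi s t) 0 k : R)
        (\sum_i rsubmx (phi s t) 0 i * rho c e X i k (lsubmx (phi s t)))].
Hypothesis flow0 : forall t, `|t - t0| < d ->
  [/\ phi 0 t = row_mx (cmap c (gamma0 t)) (tcoord T (alpha0 t)), cdom c (gamma0 t) & is_frame T e (gamma0 t)].
Hypothesis chi_sm : forall t, Csm chi t.
Hypothesis chi_bd : forall t, 0 <= chi t < c1.
Hypothesis chi_0 : forall t, d / 2 <= `|t - t0| -> chi t = 0.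

Let dchi (t : R) : R := 'D_1 chi t.
Let y eps t : 'rV[R]_n := lsubmx (phi (eps * chi t) t).
Let a eps t i : R := rsubmx (phi (eps * chi t) t) 0 i.
(* The term eps chi'(t) e_m comes from the time change s = eps chi(t). *)
Let v eps t i : R := a eps t i + eps * dchi t * (i == m)%:R.
Let gL eps t := cinv c (y eps t).
Let aL eps t : A (gL eps t) := \sum_i v eps t i *: e i (gL eps t).
(* Taking values in the total space makes it possible to compare points of the
   fibers over [gL eps t] and [gamma0 t]. *)
Let G eps t : {x : M & A x : Type} := if `|t - t0| < d then tot (aL eps t) else tot (alpha0 t).
Definition homotopy_base eps t := projT1 (G eps t).
Definition homotopy_path eps t : A (homotopy_base eps t) := projT2 (G eps t).
Definition homotopy_transverse eps t : A (homotopy_base eps t) := chi t *: e m (homotopy_base eps t).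

Lemma tot_halp eps t : tot (homotopy_path eps t) = G eps t.
Proof. by rewrite /homotopy_path /homotopy_base; case: (G eps t). Qed.

Lemma near_inside t : `|t - t0| < d -> \forall u \near t, `|u - t0| < d.
Proof.
move=> H; have e0 : 0 < d - `|t - t0| by rewrite subr_gt0.
apply: filterS (nbhsx_ballx t _ e0) => u; rewrite /ball /= => Hu.
have := ler_normD (u - t) (t - t0); rewrite [`|u - t|]distrC addrA subrK; lra.
Qed.

Lemma near_outside t : d / 2 < `|t - t0| -> \forall u \near t, d / 2 < `|u - t0|.
Proof.
move=> H; have e0 : 0 < `|t - t0| - d / 2 by rewrite subr_gt0.
apply: filterS (nbhsx_ballx t _ e0) => u; rewrite /ball /= => Hu.
have := ler_normD (t - u) (u - t0); rewrite addrA subrK; lra.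
Qed.

(** Both conditions are open and overlap where d / 2 < |t - t0| < d, a region on which [chi]
    vanishes. Each time thus has a neighborhood on which a single description of the homotopy is
    valid. *)
Lemma in_or_out t : `|t - t0| < d \/ d / 2 < `|t - t0|.
Proof.
have [|H] := ltP `|t - t0| d; [by left|right].
by apply: lt_le_trans H; rewrite ltr_pdivrMr // ltr_pMr // ltr1n.
Qed.

Lemma dchi_0 t : d / 2 < `|t - t0| -> dchi t = 0.
Proof.
move=> H; rewrite /dchi (near_eq_derive _ (g := fun _ => 0)) ?derive_cst //.
by apply: filterS (near_outside H) => u /ltW; exact: chi_0.
Qed.

Lemma chi_deriv (t : R) : is_derive t 1 chi (dchi t).
Proof. exact: Csm_is_derive. Qed.

Lemma Csm_dchi (t : R) : Csm dchi t.
Proof. exact: Csm_derive. Qed.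

Lemma time_small eps t : I eps -> `|eps * chi t| < c1.
Proof.
rewrite /= in_itv /= => /andP[e0 e1]; have /andP[x0 x1] := chi_bd t.
rewrite ger0_norm ?mulr_ge0 //; apply: le_lt_trans x1.
by rewrite ler_piMl.
Qed.

(** Covers at once eps = 0 and the region where [chi] vanishes: no flow time elapses and the
    correction term is absent, so the flow formula returns [alpha0]. *)
Lemma tot_flat eps t : `|t - t0| < d -> eps * chi t = 0 -> eps * dchi t = 0 ->
  tot (aL eps t) = tot (alpha0 t).
Proof.
move=> Ht E1 E2; have [P0 cd F] := flow0 Ht.
have Ev i : v eps t i = tcoord T (alpha0 t) 0 i.
  by rewrite /v /a E1 E2 mul0r addr0 P0 row_mxKr.
have Ey : gL eps t = gamma0 t by rewrite /gL /y E1 P0 row_mxKl cmapK.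
rewrite (frame_expand (alpha0 t) F) /aL.
rewrite (eq_bigr (fun i => tcoord T (alpha0 t) 0 i *: e i (gL eps t))); last by move=> i _; rewrite Ev.
by rewrite Ey.
Qed.

Lemma tot_in eps t : `|t - t0| < d -> tot (homotopy_path eps t) = tot (aL eps t).
Proof. by rewrite tot_halp /G => ->. Qed.

Lemma tot_out eps t : d / 2 < `|t - t0| -> tot (homotopy_path eps t) = tot (alpha0 t).
Proof.
move=> H; rewrite tot_halp /G; case: ltP => // Hd.
by apply: tot_flat => //; rewrite ?chi_0 ?dchi_0 ?mulr0 // ltW.
Qed.

Lemma tot_start t : tot (homotopy_path 0 t) = tot (alpha0 t).
Proof.
by rewrite tot_halp /G; case: ltP => // Hd; apply: tot_flat => //; rewrite mul0r.
Qed.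

Lemma gam_in eps t : `|t - t0| < d -> homotopy_base eps t = gL eps t.
Proof. by move=> /(tot_in eps)/(congr1 (@projT1 _ _)). Qed.

Lemma gam_out eps t : d / 2 < `|t - t0| -> homotopy_base eps t = gamma0 t.
Proof. by move=> /(tot_out eps)/(congr1 (@projT1 _ _)). Qed.

Section Inside.
Variables (eps t : R).
Hypotheses (Ie : I eps) (Ht : `|t - t0| < d).

Let ad : adapted c T e X (y eps t).
Proof. by have [] := flow (time_small t Ie) Ht. Qed.

Lemma It_in : I t.
Proof. by have /andP[] := inI Ht; rewrite /= in_itv /= => /ltW -> /ltW ->. Qed.

Lemma Csm_time : Csm (fun z : R * R => z.1 * chi z.2) (eps, t).
Proof.
have Cs : Csm (fun z : R * R => z.2) (eps, t) by apply: Csm_snd; exact: Csm_id.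
apply: Csm_mul; first by apply: Csm_fst; exact: Csm_id.
exact: (@Csm_comp _ _ _ (fdim_R R) _ (fdim_R R) (fun z : R * R => z.2) chi).
Qed.

Lemma Csm_phi : Csm (fun z : R * R => phi (z.1 * chi z.2) z.2) (eps, t).
Proof.
have [C _ _ _] := flow (time_small t Ie) Ht.
apply: (@Csm_comp _ _ _ (fdim_RR R) _ (fdim_rV R (n + r)) (fun z : R * R => (z.1 * chi z.2, z.2)) (fun z => phi z.1 z.2)) => //.
by apply: Csm_pair; [exact: Csm_time|apply: Csm_snd; exact: Csm_id].
Qed.

Lemma Csm_y : Csm (fun z : R * R => y z.1 z.2) (eps, t).
Proof.
apply: (@Csm_comp _ _ _ (fdim_rV R (n + r)) _ (fdim_rV R n) (fun z : R * R => phi (z.1 * chi z.2) z.2) (fun z => lsubmx z)).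
  exact: Csm_phi.
exact: Csm_lsub.
Qed.

Lemma Csm_a i : Csm (fun z : R * R => a z.1 z.2 i) (eps, t).
Proof.
have : Csm (fun z : R * R => rsubmx (phi (z.1 * chi z.2) z.2)) (eps, t).
  apply: (@Csm_comp _ _ _ (fdim_rV R (n + r)) _ (fdim_rV R r) (fun z : R * R => phi (z.1 * chi z.2) z.2) (fun z => rsubmx z)).
    exact: Csm_phi.
  exact: Csm_rsub.
by move=> /Csm_rV; exact.
Qed.

Lemma Csm_v i : Csm (fun z : R * R => v z.1 z.2 i) (eps, t).
Proof.
apply: Csm_add; first exact: Csm_a.
apply: Csm_mul; last exact: Csm_cst.
apply: Csm_mul; first by apply: Csm_fst; exact: Csm_id.
apply: (@Csm_comp _ _ _ (fdim_R R) _ (fdim_R R) (fun z : R * R => z.2) dchi); last exact: Csm_dchi.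
by apply: Csm_snd; exact: Csm_id.
Qed.

Lemma smooth_map_gL : smooth_map_at (@square R) (fun z => gL z.1 z.2) (eps, t).
Proof.
have Sz : @square R (eps, t) by split=> //; exact: It_in.
have [cy Ey _ _] := ad.
have N : \forall z \near (eps, t), cdom c (cinv c (y z.1 z.2)) /\ cmap c (cinv c (y z.1 z.2)) = y z.1 z.2.
  by have := near_cinvK cy; rewrite Ey => H; exact: (Csm_cont Csm_y H).
apply: (smooth_map_chart Sz ac cy); first by apply: filterS N => z [].
apply: (@sw_eq _ _ _ _ _ (fun z : R * R => y z.1 z.2)); last exact/sw_Csm/Csm_y.
by apply: filterS N => z [_ <-].
Qed.

Lemma along_aL : smooth_along_at (@square R) (eps, t) (gamma := fun z => gL z.1 z.2) (fun z => aL z.1 z.2).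
Proof.
have Sz : @square R (eps, t) by split=> //; exact: It_in.
apply: (along_sum Sz); first exact: smooth_map_gL.
move=> i; apply: (along_scale Sz); first exact/sw_Csm/Csm_v.
by apply: (along_sec Sz); [exact: smooth_map_gL|exact: He].
Qed.

Lemma sum_v (f : 'I_r -> R) : \sum_i v eps t i * f i = \sum_i a eps t i * f i + eps * dchi t * f m.
Proof.
rewrite -sum_kronecker -big_split /=; apply: eq_bigr => i _.
by rewrite -mulrDl.
Qed.

Lemma anchor_aL k : anchor (aL eps t) (X k) =
  \sum_i a eps t i * rho c e X i k (y eps t) + eps * dchi t * rho c e X m k (y eps t).
Proof.
rewrite anchor_sum // -(sum_v (fun i => rho c e X i k (y eps t))).
by apply: eq_bigr => i _; rewrite anchorZ.
Qed.

Lemma Csm_phi_l k : Csm (fun z : R * R => lsubmx (phi z.1 z.2) 0 k : R) (eps * chi t, t).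
Proof.
have [C _ _ _] := flow (time_small t Ie) Ht.
have : Csm (fun z : R * R => lsubmx (phi z.1 z.2)) (eps * chi t, t).
  apply: (@Csm_comp _ _ _ (fdim_rV R (n + r)) _ (fdim_rV R n) (fun z : R * R => phi z.1 z.2) (fun z => lsubmx z)) => //.
  exact: Csm_lsub.
by move=> /Csm_rV; exact.
Qed.

Lemma Csm_phi_r i : Csm (fun z : R * R => rsubmx (phi z.1 z.2) 0 i : R) (eps * chi t, t).
Proof.
have [C _ _ _] := flow (time_small t Ie) Ht.
have : Csm (fun z : R * R => rsubmx (phi z.1 z.2)) (eps * chi t, t).
  apply: (@Csm_comp _ _ _ (fdim_rV R (n + r)) _ (fdim_rV R r) (fun z : R * R => phi z.1 z.2) (fun z => rsubmx z)) => //.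
  exact: Csm_rsub.
by move=> /Csm_rV; exact.
Qed.

Lemma ds_l k : is_derive (eps * chi t) 1 (fun s => lsubmx (phi s t) 0 k : R) (rho c e X m k (y eps t)).
Proof.
have [_ _ H _] := flow (time_small t Ie) Ht; have := H (lshift r k).
rewrite row_mxEl mxE; congr is_derive; by apply: funext => s; rewrite mxE.
Qed.

Lemma ds_r i : is_derive (eps * chi t) 1 (fun s => rsubmx (phi s t) 0 i : R)
  (\sum_j a eps t j * structure_fun c T e m i j (y eps t)).
Proof.
have [_ _ H _] := flow (time_small t Ie) Ht; have := H (rshift n i).
rewrite row_mxEr mxE; congr is_derive; by apply: funext => s; rewrite mxE.
Qed.

(** By the chain rule the flow time contributes eps chi'(t) times the anchor of [e m], which the
    correction term in [v] was made to absorb. *)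
Lemma dt_y k : is_derive t 1 (fun t => y eps t 0 k : R) (anchor (aL eps t) (X k)).
Proof.
have [_ _ _ H] := flow (time_small t Ie) Ht.
have Cp : Csm (fun u => eps * chi u) t by apply: Csm_mul => //; exact: Csm_cst.
have dp : is_derive t 1 (fun u => eps * chi u) (eps * dchi t).
  exact: is_deriv_in_derive (is_deriv_in_Zl (k := eps) (is_derive_in setT (chi_deriv t))).
have := @chain2 _ _ (fun u => eps * chi u) (fun u => u) t _ 1 _ _ (Csm_phi_l k) Cp (Csm_id t) dp
  (is_derive_id _ _) (ds_l k) (H k).
by rewrite mul1r addrC -anchor_aL.
Qed.

Lemma de_time : is_derive eps 1 (fun u : R => u * chi t) (chi t).
Proof.
have := is_deriv_in_derive (is_deriv_in_mul (is_derive_in setT (is_derive_id eps (1 : R)))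
  (is_deriv_in_cst setT (chi t) eps)).
by rewrite mul1r mulr0 addr0.
Qed.

Lemma de_y k : is_derive eps 1 (fun eps => y eps t 0 k : R) (anchor (chi t *: e m (gL eps t)) (X k)).
Proof.
have [_ _ _ H] := flow (time_small t Ie) Ht.
have Cp : Csm (fun u : R => u * chi t) eps by apply: Csm_mul; [exact: Csm_id|exact: Csm_cst].
have := @chain2 _ _ (fun u => u * chi t) (fun u => t) eps _ 0 _ _ (Csm_phi_l k) Cp (Csm_cst t _) de_time
  (is_derive_cst _ _ _) (ds_l k) (H k).
by rewrite mul0r addr0 anchorZ.
Qed.

Lemma de_v i : is_derive eps 1 (fun eps => v eps t i)
  (chi t * (\sum_j a eps t j * structure_fun c T e m i j (y eps t)) + dchi t * (i == m)%:R).
Proof.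
have Cp : Csm (fun u : R => u * chi t) eps by apply: Csm_mul; [exact: Csm_id|exact: Csm_cst].
have H1 := @chain2 _ _ (fun u => u * chi t) (fun u => t) eps _ 0 _ _ (Csm_phi_r i) Cp (Csm_cst t _) de_time
  (is_derive_cst _ _ _) (ds_r i) (derive_slice2 (Csm_phi_r i)).
have H2 : is_deriv_in setT (fun u : R => u * dchi t * (i == m)%:R) eps (dchi t * (i == m)%:R).
  have := is_deriv_in_mul (is_derive_in setT (is_derive_id eps (1 : R)))
    (is_deriv_in_cst setT (dchi t * (i == m)%:R) eps).
  rewrite mul1r mulr0 addr0; apply: is_deriv_in_eq; last by rewrite mulrA.
  by apply: (@nearW R (nbhs _)) => u _; rewrite mulrA.
have := is_deriv_in_derive (is_deriv_in_add (is_derive_in setT H1) H2).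
by rewrite mul0r addr0.
Qed.

(** By [anchor_chart], derivatives of the coordinates along the curve determine those of every
    smooth function. *)
Lemma chart_curve (Y : R -> 'rV[R]_n) u (w : A (cinv c (Y u))) f : Csm Y u ->
  adapted c T e X (Y u) -> (forall k, is_derive u 1 (fun u => Y u 0 k : R) (anchor w (X k))) ->
  msmooth f -> is_derive u 1 (fun u => f (cinv c (Y u))) (anchor w f).
Proof.
move=> CY aY dY Hf; rewrite -(anchor_chart ac HX w aY Hf).
have Cf : Csm (f \o cinv c) (Y u) by apply: (Csm_cinv ac aY); exact: (msmoothP f).1.
have := Csm_is_derive (@Csm_comp _ _ _ (fdim_rV R n) _ (fdim_R R) Y (f \o cinv c) u CY Cf).
congr is_derive; rewrite derive_comp; [|exact: Csm_diff CY|exact: Csm_diff Cf].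
congr ('D__ _ _); rewrite derive_row //; apply/rowP => k; rewrite !mxE.
exact: (@derive_val _ _ _ _ _ _ _ (dY k)).
Qed.

Lemma vel_t_in : is_velocity I (gL eps) t (anchor (aL eps t)).
Proof.
move=> f Hf; apply: is_derive_in; apply: (chart_curve (Y := y eps)) => //; last exact: dt_y.
apply: (@Csm_comp _ _ _ (fdim_RR R) _ (fdim_rV R n) (fun u : R => (eps, u)) (fun z => y z.1 z.2)).
  by apply: Csm_pair; [exact: Csm_cst|exact: Csm_id].
exact: Csm_y.
Qed.

Lemma vel_e_in : is_velocity I (fun eps => gL eps t) eps (anchor (chi t *: e m (gL eps t))).
Proof.
move=> f Hf; apply: is_derive_in; apply: (chart_curve (Y := fun eps => y eps t)) => //; last exact: de_y.
apply: (@Csm_comp _ _ _ (fdim_RR R) _ (fdim_rV R n) (fun u : R => (u, t)) (fun z => y z.1 z.2)).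
  by apply: Csm_pair; [exact: Csm_id|exact: Csm_cst].
exact: Csm_y.
Qed.

(* Torsion-freeness turns the structure functions in the flow equation into
   [D_t beta = D_eps alpha]. *)
Lemma pairs_e_in : pairs g D I (gamma := fun eps => gL eps t) (fun eps => chi t *: e m (gL eps t))
  (fun eps => aL eps t) (t := eps)
  (dchi t *: e m (gL eps t) + chi t *: nabla D (e m) (aL eps t)).
Proof.
have dv i := is_derive_in I (de_v i).
have N : \forall u \near eps, I u -> aL u t = \sum_i v u t i *: e i (gL u t).
  by apply: (@nearW R (nbhs _)) => u _.
have := @pairs_sum R n M r A g D HD I (fun eps => gL eps t) (fun eps => chi t *: e m (gL eps t)) eps Ie
  vel_e_in _ e (fun i eps => v eps t i) _ (fun eps => aL eps t) He N dv.
have br j : \sum_i structure_fun c T e m i j (y eps t) *: e i (gL eps t) = bracket (e j) (e m) (gL eps t).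
  by symmetry; exact: (bracket_expand m j ad).
have tf i : D (e i) (e m) (gL eps t) = D (e m) (e i) (gL eps t) + bracket (e i) (e m) (gL eps t).
  by rewrite -(torsion_free HD) // addrC subrK.
have bmm : bracket (e m) (e m) (gL eps t) = 0.
  have /eqP := bracket_antisym (He m) (He m) (gL eps t); rewrite -addr_eq0 -mulr2n -scaler_nat scaler_eq0.
  by rewrite pnatr_eq0 /= => /eqP.
congr pairs.
rewrite big_split /=.
have -> : \sum_i (chi t * (\sum_j a eps t j * structure_fun c T e m i j (y eps t)) + dchi t * (i == m)%:R) *: e i (gL eps t)
  = chi t *: (\sum_j a eps t j *: bracket (e j) (e m) (gL eps t)) + dchi t *: e m (gL eps t).
  under eq_bigr do rewrite scalerDl.
  rewrite big_split /=; congr (_ + _).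
    rewrite scaler_sumr; under [RHS]eq_bigr do rewrite -br !scaler_sumr.
    rewrite exchange_big /=; apply: eq_bigr => i _.
    by rewrite mulr_sumr scaler_suml; apply: eq_bigr => j _; rewrite !scalerA mulrA.
  rewrite (bigD1 m) //= eqxx mulr1 big1 ?addr0 // => i /negbTE ->.
  by rewrite mulr0 scale0r.
rewrite [_ + dchi t *: _]addrC -addrA; congr (_ + _).
rewrite /aL (nabla_sum HD) // !scaler_sumr.
under [RHS]eq_bigr do rewrite (nablaZ HD) // -(nablaE HD) // tf scalerDr scalerDr.
rewrite big_split /= addrC; congr (_ + _).
  apply: eq_bigr => i _; rewrite (nablaZ HD) // -(nablaE HD) // !scalerA.
  by rewrite mulrC.
(* The correction term of [v] points along [e m], and its bracket with [e m] vanishes, so only the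
   coefficients [a] remain. *)
rewrite /v; under [RHS]eq_bigr do rewrite scalerDl scalerDr.
rewrite big_split /= [X in _ = _ + X]big1 ?addr0 // => i _.
have [->|] := eqVneq i m; first by rewrite bmm !scaler0.
by rewrite mulr0 scale0r scaler0.
Qed.

End Inside.

Lemma smooth_halp : @smooth_along R n M r A (R * R)%type (@square R) (fun z => homotopy_base z.1 z.2) (fun z => homotopy_path z.1 z.2).
Proof.
apply/smooth_alongE => -[eps t] [/= Ie It]; have Sz : @square R (eps, t) by split.
have [Ht|Ht] := in_or_out t.
  apply: (along_eq Sz _ (along_aL Ie Ht)).
  by apply: filterS (near_snd eps (near_inside Ht)) => z Hz _; rewrite [RHS]tot_in.
have S0 : smooth_along_at (@square R) (eps, t) (gamma := gamma0 \o snd) (fun z => alpha0 z.2).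
  case: path0 => /smooth_alongE P _.
  apply: (@along_pre R n M r A R (R * R)%type (fdim_R R) I (@square R) (eps, t) snd gamma0 alpha0 Sz It _ _ (P t It)).
    by apply: sw_Csm; apply: Csm_snd; exact: Csm_id.
  by apply: (@nearW _ (nbhs ((eps, t) : R * R))) => z [].
apply: (along_eq Sz _ S0).
by apply: filterS (near_snd eps (near_outside Ht)) => z Hz _; rewrite [RHS]tot_out.
Qed.

Lemma vel_halp eps t : I eps -> I t -> is_velocity I (homotopy_base eps) t (anchor (homotopy_path eps t)).
Proof.
move=> Ie It; have [Ht|Ht] := in_or_out t.
  apply: (vel_tot _ (tot_in eps Ht)); last exact: vel_t_in.
  by apply: filterS (near_inside Ht) => u Hu _; rewrite gam_in.
apply: (vel_tot _ (tot_out eps Ht)); last by case: path0 => _; apply.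
by apply: filterS (near_outside Ht) => u Hu _; rewrite gam_out.
Qed.

Lemma vel_hbet eps t : I eps -> I t -> is_velocity I (fun eps => homotopy_base eps t) eps (anchor (homotopy_transverse eps t)).
Proof.
move=> Ie It; have [Ht|Ht] := in_or_out t.
  apply: (@vel_tot R n M r A I eps _ (fun eps => gL eps t) (fun eps => homotopy_transverse eps t)
    (fun eps => chi t *: e m (gL eps t))); last exact: vel_e_in.
    by apply: (@nearW R (nbhs _)) => u _; rewrite gam_in.
  by rewrite /homotopy_transverse; rewrite gam_in.
apply: (@vel_tot R n M r A I eps _ (fun eps => gamma0 t) (fun eps => homotopy_transverse eps t)
    (fun eps => 0)).
- by apply: (@nearW R (nbhs _)) => u _; rewrite gam_out.
- by rewrite /homotopy_transverse chi_0 ?ltW // scale0r gam_out.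
by move=> f Hf; rewrite anchor0 //; exact: is_deriv_in_cst.
Qed.

Lemma smooth_hbet : @smooth_along R n M r A (R * R)%type (@square R) (fun z => homotopy_base z.1 z.2) (fun z => homotopy_transverse z.1 z.2).
Proof.
apply/smooth_alongE => -[eps t] [/= Ie It]; have Sz : @square R (eps, t) by split.
have [Sm _] := along_square smooth_halp Ie It.
apply: (along_scale Sz); last by apply: (along_sec Sz).
apply: sw_Csm; apply: (@Csm_comp _ _ _ (fdim_R R) _ (fdim_R R) (fun z : R * R => z.2) chi) => //.
by apply: Csm_snd; exact: Csm_id.
Qed.

Lemma path_halp eps : I eps -> A_path 0 1 (homotopy_path eps).
Proof.
move=> Ie; split; last by move=> t It; exact: vel_halp.
by apply/smooth_alongE => t It; exact: (along_slice_t smooth_halp Ie It).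
Qed.

Lemma out0 : d / 2 < `|0 - t0|.
Proof. by have [/inI/andP[]|//] := in_or_out 0; rewrite ltxx. Qed.

Lemma out1 : d / 2 < `|1 - t0|.
Proof. by have [/inI/andP[]|//] := in_or_out 1; rewrite ltxx. Qed.

(** The arc of the homotopy up to time [t], rescaled to [0,1], is an A-path issued from the fixed
    initial point. *)
Lemma leaf_halp eps t : I eps -> I t -> same_leaf A (gamma0 0) (homotopy_base eps t).
Proof.
move=> Ie It; rewrite -(gam_out eps out0); apply: Relation_Operators.rst_step.
have [t0' t1'] : 0 <= t /\ t <= 1 by move: It; rewrite /= in_itv /= => /andP.
have II u : I u -> I (t * u).
  rewrite /= !in_itv /= => /andP[u0 u1]; rewrite mulr_ge0 //=.
  by apply: le_trans t1'; rewrite ler_piMr.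
have dm (u : R) : is_derive u 1 (fun u => t * u) t.
  have := is_deriv_in_derive (is_deriv_in_Zl (k := t) (is_derive_in setT (is_derive_id u (1 : R)))).
  by rewrite mulr1.
exists (homotopy_base eps \o (fun u => t * u)), (fun u => t *: homotopy_path eps (t * u)); split.
- split=> [|u Iu].
    apply/smooth_alongE => u Iu; apply: (along_scale Iu); first exact/sw_Csm/Csm_cst.
    apply: (@along_pre R n M r A R R (fdim_R R) I I u (fun u => t * u) (homotopy_base eps) (homotopy_path eps) Iu (II u Iu)).
    + by apply: sw_Csm; apply: Csm_mul; [exact: Csm_cst|exact: Csm_id].
    + by apply: (@nearW R (nbhs _)) => w Iw; exact: II.
    + exact: (along_slice_t smooth_halp Ie (II u Iu)).
  apply: (@velocity_reparam R n M r A I I (fun u => t * u) u t (homotopy_base eps) (homotopy_path eps)).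
  + by apply: (@nearW R (nbhs _)) => w Iw; exact: II.
  + exact: (is_derive_in I (dm u)).
  + by apply: vel_halp => //; exact: II.
- by rewrite /= mulr0.
- by rewrite /= mulr1.
Qed.

Lemma variation_halp : A_variation homotopy_path.
Proof.
split; [exact: smooth_halp|by move=> eps Ie; exact: path_halp|].
by exists (gamma0 0) => eps t Ie It; exact: leaf_halp.
Qed.

Lemma transverse_hbet : transverse homotopy_transverse.
Proof. by split; [exact: smooth_hbet|move=> eps t Ie It; exact: vel_hbet]. Qed.

(** The common value of D_t beta and D_eps alpha, which is why Delta vanishes. *)
Let V eps t : A (homotopy_base eps t) := dchi t *: e m (homotopy_base eps t) + chi t *: nabla D (e m) (homotopy_path eps t).

Lemma covder_t_hbet eps t : I eps -> I t -> covder_t D homotopy_path homotopy_transverse eps t = V eps t.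
Proof.
move=> Ie It; have vel := vel_halp Ie It.
apply: (covder_eq HD (@proper01 R) It vel (along_slice_t smooth_halp Ie It) (along_slice_t smooth_hbet Ie It)).
have P := pairs_section HD vel (He m).
exact: (pairs_scale (is_derive_in I (chi_deriv t)) P).
Qed.

Lemma covder_eps_halp eps t : I eps -> I t -> covder_eps D homotopy_transverse homotopy_path eps t = V eps t.
Proof.
move=> Ie It; have vel := vel_hbet Ie It.
apply: (covder_eq HD (@proper01 R) Ie vel (along_slice_e smooth_hbet Ie It) (along_slice_e smooth_halp Ie It)).
have [Ht|Ht] := in_or_out t.
  apply: (@pairs_tot R n M r A g D I eps Ie _ (fun eps => gL eps t) (fun eps => homotopy_transverse eps t) (fun eps => homotopy_path eps t)
    (fun eps => chi t *: e m (gL eps t)) (fun eps => aL eps t) _ _ _ _ _ (pairs_e_in Ie Ht)).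
  - by apply: (@nearW R (nbhs _)) => u _; exact: tot_in.
  - by rewrite /homotopy_transverse; rewrite gam_in.
  - exact: (congr1 (fun p => tot (dchi t *: e m (projT1 p) + chi t *: nabla D (e m) (projT2 p))) (tot_in eps Ht)).
(* Outside the support of [chi] nothing in the total space depends on eps, so the derivative is
   0. *)
apply: (@pairs_tot R n M r A g D I eps Ie _ (fun eps => gamma0 t) (fun eps => homotopy_transverse eps t) (fun eps => homotopy_path eps t)
    (fun eps => 0) (fun eps => alpha0 t) _ 0).
- by apply: (@nearW R (nbhs _)) => u _; exact: tot_out.
- by rewrite /homotopy_transverse chi_0 ?ltW // scale0r gam_out.
- by rewrite /V chi_0 ?ltW // dchi_0 // !scale0r addr0 gam_out.
move=> b Hb; rewrite (nabla0 HD) // inner0l inner0r addr0.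
exact: is_deriv_in_cst.
Qed.

Theorem homotopy_halp : [/\ A_variation homotopy_path,
  forall t, tot (homotopy_path 0 t) = tot (alpha0 t),
  forall eps, homotopy_base eps 0 = homotopy_base 0 0 /\ homotopy_base eps 1 = homotopy_base 0 1,
  transverse homotopy_transverse & forall eps t, I eps -> I t -> Delta D homotopy_path homotopy_transverse eps t = 0].
Proof.
split=> [||eps||eps t Ie It].
- exact: variation_halp.
- exact: tot_start.
- by rewrite !(gam_out _ out0) !(gam_out _ out1).
- exact: transverse_hbet.
- by rewrite /Delta covder_t_hbet // covder_eps_halp // subrr.
Qed.

End Homotopy.

Section HomotopyExists.
Variables (R : realType) (n : nat) (M : manifold R n) (r : nat) (A : lie_algebroid M r).
Variables (g : riemannian_metric A) (D : connection_op A).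
Hypothesis HD : levi_civita g D.
Local Notation I := (`[0:R, 1]%classic).

Lemma near_I01 (t : R) : 0 < t < 1 -> nbhs t I.
Proof.
move=> /andP[t0 t1]; have e0 : 0 < Num.min t (1 - t) by rewrite lt_min t0 subr_gt0.
apply: filterS (nbhsx_ballx t _ e0) => u; rewrite /ball /= lt_min in_itv /=.
by rewrite !ltr_norml => /andP[/andP[_ H1] /andP[H2 _]]; apply/andP; split; lra.
Qed.

Variables (gamma0 : R -> M) (alpha0 : forall t, A (gamma0 t)).
Hypothesis path0 : A_path 0 1 alpha0.
Variables (T : trivialization r A) (e : 'I_r -> section A) (m : 'I_r) (t0 delta : R).
Hypothesis t01 : 0 < t0 < 1.
Hypothesis tT : trivs T.
Hypothesis He : forall i, smooth_section (e i).
Hypothesis Fr : \forall x \near gamma0 t0, is_frame T e x.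
Hypothesis delta_gt0 : 0 < delta.

Theorem homotopy_exists : exists (gamma : R -> R -> M) (alpha : forall eps t, A (gamma eps t)) (chi : R -> R),
  [/\ A_variation alpha,
  forall t, tot (alpha 0 t) = tot (alpha0 t),
  forall eps, gamma eps 0 = gamma 0 0 /\ gamma eps 1 = gamma 0 1,
  transverse (fun eps t => chi t *: e m (gamma eps t)) &
  [/\ forall eps t, I eps -> I t -> Delta D alpha (fun eps t => chi t *: e m (gamma eps t)) eps t = 0,
      forall t, Csm chi t /\ 0 <= chi t, 0 < chi t0, chi 0 = 0 /\ chi 1 = 0 &
      forall t, delta <= `|t - t0| -> chi t = 0]].
Proof.
have nI := near_I01 t01; have It0 := nbhs_singleton nI.
case: (path0) => /smooth_alongE Sal Vel.
have [sm0 _] := Sal t0 It0.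
have [c ac cx] := atlas_cover (gamma0 t0).
have HXk k : exists Xk : M -> R, msmooth Xk /\ \forall x \near gamma0 t0, Xk x = cmap c x 0 k.
  have [|Xk H1 H2] := @msmooth_at_extend R n M R (fdim_R R) (fun x => cmap c x 0 k) (gamma0 t0).
    by have /msmooth_at_rV := msmooth_at_cmap ac cx; exact.
  by exists Xk; split=> //; exact/msmoothP.
have [X HX'] := choice HXk.
have HX k : msmooth (X k) by have [] := HX' k.
have EX : \forall x \near gamma0 t0, forall k, X k x = cmap c x 0 k.
  by apply: filter_forall => k; exact: (HX' k).2.
have near_in (P : M -> Prop) : (\forall x \near gamma0 t0, P x) -> \forall t \near t0, P (gamma0 t).
  by move=> /(smooth_map_near It0 sm0) H; apply: filterS2 H nI => t Ht It; exact: Ht.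
pose z0 t : 'rV[R]_(n + r) := row_mx (cmap c (gamma0 t)) (tcoord T (alpha0 t)).
have F0 := nbhs_singleton Fr; have [Tx _] := F0.
have Hz0 : Csm z0 t0.
  apply: Csm_row_mx; apply: (sw_interior nI).
    by have [_] := sm0 c ac cx.
  exact: ((Sal t0 It0).2 T tT Tx).
have ad0 : \forall y \near lsubmx (z0 t0), adapted c T e X y.
  by rewrite row_mxKl; exact: adapted_near.
have near_good : \forall t \near t0, I t /\ [/\ cdom c (gamma0 t), is_frame T e (gamma0 t) &
    forall k, X k (gamma0 t) = cmap c (gamma0 t) 0 k].
  apply: filterS (filterI nI (filterI (near_in _ (cdom_nbhs cx)) (filterI (near_in _ Fr) (near_in _ EX)))).
  by move=> t [? [? [? ?]]].
(* The A-path condition of [alpha0], evaluated on the functions [X k] that extend the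
   coordinates. *)
have p0 : \forall t \near t0, forall k,
  'D_1 (fun u : R => lsubmx (z0 u) 0 k : R) t = \sum_i rsubmx (z0 t) 0 i * rho c e X i k (lsubmx (z0 t)).
  apply: filterS (near_join near_good) => t Nt k.
  have [It [ct Ft _]] := nbhs_singleton Nt.
  have nIt : nbhs t I by apply: filterS Nt => u [].
  have H := is_deriv_in_interior nIt (Vel t It _ (HX k)).
  rewrite (near_eq_derive _ (g := X k \o gamma0)); last first.
    by apply: filterS Nt => u [_ [_ _ /= ->]]; rewrite row_mxKl.
  rewrite (@derive_val _ _ _ _ _ _ _ H) {1}(frame_expand (alpha0 t) Ft) anchor_sum //.
  rewrite row_mxKr row_mxKl; apply: eq_bigr => i _; rewrite anchorZ //.
  by rewrite /rho cmapK.
have [c1 [d1 [phi [c1_gt0 d1_gt0 ph0 fl]]]] := local_flow m ac tT He HX Hz0 ad0 p0.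
have [d2 d2_gt0 Hd2] : exists2 d2, 0 < d2 & forall t, `|t - t0| < d2 -> cdom c (gamma0 t) /\ is_frame T e (gamma0 t).
  have [d2 /= d2_gt0 Hd2] := iffLR (nbhs_ballP _ _) near_good.
  exists d2 => // t Ht; have [] := Hd2 t; first by rewrite /ball /= distrC.
  by move=> _ [].
have /andP[t0_gt0 t0_lt1] := t01.
(* Five constraints: the flow exists, chart and frame are valid, [t] stays above 0 and below 1, and
   the support respects [delta]. *)
pose d := Num.min d1 (Num.min d2 (Num.min t0 (Num.min (1 - t0) delta))).
have d_gt0 : 0 < d by rewrite !lt_min d1_gt0 d2_gt0 t0_gt0 subr_gt0 t0_lt1 delta_gt0.
have Hd t : `|t - t0| < d -> [/\ `|t - t0| < d1, `|t - t0| < d2, 0 < t < 1 & `|t - t0| < delta].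
  rewrite !lt_min => /and5P[h1 h2 h3 h4 h5]; split=> //.
  by move: h3 h4; rewrite !ltr_norml => /andP[H1 _] /andP[_ H2]; apply/andP; split; lra.
(* The factor c1 / 2 keeps the flow time eps chi(t) below the lifetime [c1]; the factor 4 / d turns
   the radius 2, beyond which [bump1] vanishes, into d / 2. *)
pose chi t := c1 / 2 * bump1 ((t - t0) * (4 / d)).
have chi_sm (t : R) : Csm chi t.
  apply: Csm_mul; first exact: Csm_cst.
  apply: (@Csm_comp _ _ _ (fdim_R R) _ (fdim_R R) (fun t => (t - t0) * (4 / d)) (@bump1 R)); last exact: Csm_bump1.
  apply: Csm_mul; last exact: Csm_cst.
  by apply: Csm_sub; [exact: Csm_id|exact: Csm_cst].
have chi_bd t : 0 <= chi t < c1.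
  have b0 := bump1_ge0 ((t - t0) * (4 / d)); have b1 := bump1_le1 ((t - t0) * (4 / d)).
  rewrite /chi; set b := bump1 _ in b0 b1 *; apply/andP; split; first by rewrite mulr_ge0 // divr_ge0 // ltW.
  apply: (@le_lt_trans _ _ (c1 / 2)); last by rewrite ltr_pdivrMr // ltr_pMr // ltr1n.
  by rewrite ler_piMr // divr_ge0 // ltW.
have chi_0 t : d / 2 <= `|t - t0| -> chi t = 0.
  have d4 : 0 <= 4 / d by rewrite divr_ge0 // ltW.
  move=> H; rewrite /chi bump1_0 ?mulr0 // normrM (ger0_norm d4).
  rewrite mulrA ler_pdivlMr //; lra.
have fl' s t : `|s| < c1 -> `|t - t0| < d ->
  [/\ Csm (fun z => phi z.1 z.2) (s, t), adapted c T e X (lsubmx (phi s t)),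
      forall i, is_derive s 1 (fun s => phi s t 0 i : R) (homotopy_field c T e m X (phi s t) 0 i) &
      forall k, is_derive t 1 (fun t => lsubmx (phi s t) 0 k : R)
        (\sum_i rsubmx (phi s t) 0 i * rho c e X i k (lsubmx (phi s t)))].
  by move=> Hs /Hd[Ht _ _ _]; exact: fl.
have fl0 t : `|t - t0| < d ->
  [/\ phi 0 t = row_mx (cmap c (gamma0 t)) (tcoord T (alpha0 t)), cdom c (gamma0 t) & is_frame T e (gamma0 t)].
  by move=> /Hd[h1 /Hd2[h2 h3] _ _]; split=> //; exact: ph0.
have inI t : `|t - t0| < d -> 0 < t < 1 by move=> /Hd[].
have [H1 H2 H3 H4 H5] := homotopy_halp HD ac He HX path0 d_gt0 inI fl' fl0 chi_sm chi_bd chi_0.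
exists (homotopy_base c e m alpha0 t0 d phi chi), (homotopy_path c e m alpha0 t0 d phi chi), chi; split=> //.
have far t : d <= `|t - t0| -> chi t = 0.
  by move=> H; apply: chi_0; apply: le_trans H; rewrite ler_pdivrMr // ler_pMr // ler1n.
split=> //.
- by move=> t; split=> //; have /andP[] := chi_bd t.
- by rewrite /chi subrr mul0r bump1_1 ?normr0 // mulr1 divr_gt0.
- split; apply: far; rewrite leNgt; apply/negP => /inI; by rewrite ltxx ?andbF.
- by move=> t H; apply: far; apply: le_trans H; rewrite !ge_min lexx !orbT.
Qed.

End HomotopyExists.

(** * Arc length and critical points *)

Section OneDim.
Variable R : realType.
Local Notation I := (`[0:R, 1]%classic).

(** The real variable is passed as a row of length one, which reduces the claim to [Csm_extend]. *)
Lemma Csm_extend1 (f : R -> R) (t0 : R) : Csm f t0 ->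
  exists2 h : R -> R, (forall t, Csm h t) & {near t0, h =1 f}.
Proof.
move=> Hf; pose row (t : R) : 'rV[R]_1 := \row_i t.
have Crow (t : R) : Csm row t.
  by apply/Csm_rV => i; apply: (Csm_eq (f := fun t : R => t)) => [u|]; [rewrite mxE|exact: Csm_id].
have Cf : Csm (fun y : 'rV[R]_1 => f (y 0 0)) (row t0).
  apply: (@Csm_comp _ _ _ (fdim_R R) _ (fdim_R R) (fun y : 'rV[R]_1 => y 0 0 : R) f); last by rewrite mxE.
  by have /Csm_rV := Csm_id (row t0); exact.
have [h Hh Eh] := @Csm_extend R 1 _ (fdim_R R) _ _ Cf.
exists (h \o row) => [t|].
  by apply: (@Csm_comp _ _ _ (fdim_rV R 1) _ (fdim_R R)).
have H : \forall t \near t0, h (row t) = f (row t 0 0) := Csm_cont (Crow t0) Eh.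
by apply: filterS H => t /= ->; rewrite mxE.
Qed.

(* Smoothness at an end-point only provides an extension near it, so the
   extensions at [0] and [1] are glued with bump functions. *)
Lemma extend_pos (L : R -> R) : (forall t, I t -> smooth_within I t L) ->
  (forall t, I t -> 0 < L t) -> exists Lt : R -> R,
  [/\ forall t, Csm Lt t, forall t, 0 < Lt t & forall t, I t -> Lt t = L t].
Proof.
move=> HL L0.
have local p : I p -> exists (h : R -> R) (rho : R), [/\ forall t, Csm h t, 0 < rho &
    forall t, `|t - p| < rho -> 0 < h t /\ (I t -> h t = L t)].
  move=> Ip; have /smooth_withinP[k Hk Ek] := HL p Ip.
  have [h Hh Eh] := Csm_extend1 Hk.
  have hp : 0 < h p by rewrite (nbhs_singleton Eh) -(nbhs_singleton Ek) // L0.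
  have N0 : \forall t \near p, 0 < h t.
    have P : nbhs (h p) [set x | 0 < x] by apply: open_nbhs_nbhs; split; [exact: open_gt|].
    exact: (Csm_cont (Hh p) P).
  have N : \forall t \near p, 0 < h t /\ (I t -> h t = L t).
    by apply: filterS (filterI N0 (filterI Ek Eh)) => t [? [E1 E2]]; split=> // It; rewrite E2 E1.
  have [rho /= rho0 H] := iffLR (nbhs_ballP _ _) N.
  by exists h, rho; split=> // t Ht; apply: H; rewrite /ball /= distrC.
have I0 : I 0 by rewrite /= in_itv /= lexx ler01.
have I1 : I 1 by rewrite /= in_itv /= lexx ler01.
have [h0 [r0 [Ch0 r0_gt0 H0]]] := local 0 I0; have [h1 [r1 [Ch1 r1_gt0 H1]]] := local 1 I1.
(* At most 1/2, so the bumps around 0 and 1 are never both nonzero. *)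
pose rho := Num.min 2^-1 (Num.min r0 r1).
have rho_gt0 : 0 < rho by rewrite !lt_min r0_gt0 r1_gt0 invr_gt0 ltr0n.
have Hrho x : x < rho -> [/\ x < 2^-1, x < r0 & x < r1].
  by rewrite !lt_min => /and3P.
pose b (p t : R) := bump1 ((t - p) * (2 / rho)).
have Cb p (t : R) : Csm (b p) t.
  apply: (@Csm_comp _ _ _ (fdim_R R) _ (fdim_R R) (fun t => (t - p) * (2 / rho)) (@bump1 R)); last exact: Csm_bump1.
  apply: Csm_mul; last exact: Csm_cst.
  by apply: Csm_sub; [exact: Csm_id|exact: Csm_cst].
have k0 : 0 <= 2 / rho by rewrite divr_ge0 // ltW.
have b_out p t : rho <= `|t - p| -> b p t = 0.
  move=> H; rewrite /b bump1_0 // normrM (ger0_norm k0) mulrA ler_pdivlMr //; lra.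
have b_in p : \forall t \near p, b p t = 1.
  have e0 : 0 < rho / 2 by rewrite divr_gt0.
  apply: filterS (nbhsx_ballx p _ e0) => t; rewrite /ball /= distrC => H.
  rewrite /b bump1_1 // normrM (ger0_norm k0) mulrA ler_pdivrMr //; lra.
(* This may jump at 0 and 1, but its coefficient in [Lt] vanishes near both points; at interior
   points of [0,1] [L] is smooth already. *)
pose Lin t := if (0 <= t) && (t <= 1) then L t else 1.
have Lin_gt0 t : 0 < Lin t.
  by rewrite /Lin; case: ifP => [H|_]; [apply: L0; rewrite /= in_itv|exact: ltr01].
pose Lt t := b 0 t * h0 t + b 1 t * h1 t + (1 - b 0 t - b 1 t) * Lin t.
have C2 t : Csm (fun t => b 0 t * h0 t + b 1 t * h1 t) t.
  by apply: Csm_add; apply: Csm_mul.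
have flat p : (p == 0) || (p == 1) -> Csm Lt p.
  move=> Hp; apply: Csm_near (C2 p); have far q t : `|t - p| < 2^-1 -> (q == 0) || (q == 1) -> q != p -> b q t = 0.
    move=> Ht Hq qp; apply: b_out; apply: (@le_trans _ _ 2^-1); first by rewrite ge_min lexx.
    by case/orP: Hp Ht Hq qp => /eqP-> + /orP[]/eqP->; rewrite ?eqxx // ltr_norml => /andP[??] _;
      rewrite ler_normr; apply/orP; [right|left]; lra.
  have h2 : 0 < 2^-1 :> R by rewrite invr_gt0 ltr0n.
  apply: filterS2 (b_in p) (nbhsx_ballx p _ h2) => t b1; rewrite /ball /= distrC => Ht.
  move: far => /(_ _ t Ht); move: b1 Hp; rewrite /Lt => b1 /orP[]/eqP pE; subst p; rewrite b1 => far.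
    by rewrite (far 1) ?eqxx ?orbT ?oner_neq0 //; ring.
  by rewrite (far 0) ?eqxx ?orbT // 1?eq_sym ?oner_neq0 //; ring.
exists Lt; split.
- move=> t; have [->|t0] := eqVneq t 0; first by apply: flat; rewrite eqxx.
  have [->|t1] := eqVneq t 1; first by apply: flat; rewrite eqxx orbT.
  have CLin : Csm Lin t.
    have [It|nIt] := pselect (I t).
      have t01 : 0 < t < 1.
        by move: It; rewrite /= in_itv /= => /andP[a c]; rewrite !lt_neqAle a c t1 eq_sym t0.
      have nI := near_I01 t01.
      apply: (Csm_near (f := L)); last exact: (sw_interior nI (HL t It)).
      by apply: filterS nI => u; rewrite /= in_itv /Lin /= => ->.
    apply: (@Csm_near _ _ _ (fun _ : R => 1 : R)); last exact: Csm_cst.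
    have oI : open (~` I) by apply: closed_openC; exact: itv_closed.
    apply: filterS (open_nbhs_nbhs (conj oI nIt)) => u.
    by rewrite /= in_itv /Lin /= => /negP/negbTE ->.
  by apply: Csm_add => //; apply: Csm_mul => //; apply: Csm_sub => //; apply: Csm_sub => //; exact: Csm_cst.
- move=> t; rewrite /Lt; have Lp := Lin_gt0 t.
  (* At every point [Lt] is a convex combination of two numbers; a local extension is known to be
     positive only where its weight is nonzero. *)
  have conv (x u w : R) : 0 <= x <= 1 -> (x != 0 -> 0 < u) -> 0 < w -> 0 < x * u + (1 - x) * w.
    move=> /andP[x0 x1] Hu w0; have [->|xn] := eqVneq x 0; first by rewrite mul0r subr0 mul1r add0r.
    by rewrite ltr_pwDl // ?mulr_ge0 ?subr_ge0 // ?mulr_gt0 ?Hu // ?lt_neqAle 1?eq_sym ?xn //; exact: ltW.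
  have bb p : 0 <= b p t <= 1 by rewrite bump1_ge0 bump1_le1.
  have pos p : b p t != 0 -> `|t - p| < rho by rewrite ltNge => bn; apply/negP => /b_out E; rewrite E eqxx in bn.
  have [E0|n0] := eqVneq (b 0 t) 0.
    rewrite E0 mul0r add0r subr0; apply: conv => // /pos/Hrho[_ _ /H1[]] //.
  have E1 : b 1 t = 0.
    apply/eqP/negPn/negP => n1; have [x _ _] := Hrho _ (pos _ n0); have [x' _ _] := Hrho _ (pos _ n1).
    by move: x x'; rewrite !ltr_norml => /andP[??] /andP[??]; lra.
  rewrite E1 mul0r addr0 subr0; apply: conv => // /pos/Hrho[_ /H0[]] //.
- move=> t It; rewrite /Lt.
  have E p h rr : (forall t, `|t - p| < rr -> 0 < h t /\ (I t -> h t = L t)) -> (forall x, x < rho -> x < rr) -> b p t * h t = b p t * L t.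
    move=> H Hr; have [Ht|Ht] := ltP `|t - p| rho; last by rewrite b_out // !mul0r.
    by have [_ ->] := H t (Hr _ Ht).
  rewrite (E 0 h0 r0 H0) ?(E 1 h1 r1 H1); [|by move=> x /Hrho[]..].
  have -> : Lin t = L t by rewrite /Lin; move: It; rewrite /= in_itv /= => ->.
  by ring.
Qed.

Lemma is_deriv_in_within_cont (S : set R) (f df : R -> R) :
  (forall t, S t -> is_deriv_in S f t (df t)) -> {within S, continuous f}.
Proof. by move=> H; apply/within_contP => t St; exact: is_deriv_in_lim (H t St). Qed.

(* [mu] is the inverse of a primitive of [Lt]. *)
Lemma arc_length_parameter (Lt : R -> R) : (forall t, Csm Lt t) -> (forall t, 0 < Lt t) ->
  exists (t0 t1 : R) (mu : R -> R), [/\ t0 < t1,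
    set_bij `[t0, t1]%classic I mu &
    forall s, s \in `[t0, t1] -> Csm mu s /\ is_derive s 1 mu (Lt (mu s))^-1].
Proof.
move=> CL L0.
have cL : continuous Lt by move=> t; exact: Csm_cont.
have c2 : 0 < 2 :> R by [].
(* The margin around [0,1] makes the inverse of [N] smooth up to the end-points. *)
have [N _ HN] := primitive cL c2.
have Ncont t : `|t| < 2 -> {for t, continuous N}.
  by move=> Ht; apply: is_derive_cont (HN t Ht).
have inc u w : `|u| < 2 -> `|w| < 2 -> u < w -> N u < N w.
  move=> Hu Hw uw; have sub x : u <= x <= w -> `|x| < 2.
    by move: Hu Hw; rewrite !ltr_norml => /andP[??] /andP[??] /andP[??]; apply/andP; split; lra.
  have [||x xuw E] := @MVT R N Lt u w uw.
  - by move=> x; rewrite in_itv /= => /andP[/ltW a /ltW c]; apply: HN; rewrite sub // a.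
  - apply/within_contP => x; rewrite /= in_itv /= => /sub /Ncont H.
    exact: cvg_trans (@cvg_app _ _ _ _ N (@cvg_within _ _ _ _)) H.
  by rewrite -subr_gt0 E mulr_gt0 // subr_gt0.
(* The default 0 is returned off the range of [N] on ]-2, 2[, which the set [U] below avoids. *)
pose mu s := xget 0 [set t | `|t| < 2 /\ N t = s].
have muN t : `|t| < 2 -> mu (N t) = t.
  move=> Ht; rewrite /mu; case: xgetP => [u _ [Hu E]|/(_ t) []//].
  by have [/(inc _ _ Hu Ht)|/(inc _ _ Ht Hu)|//] := ltgtP u t; rewrite E ltxx.
have h1 : `|-1 : R| < 2 by rewrite normrN normr1 ltr1n.
have h3 : `|3 / 2 : R| < 2 by rewrite ger0_norm; lra.
have pre a b' s : `|a| < 2 -> `|b'| < 2 -> a <= b' -> N a <= s <= N b' -> exists2 t, a <= t <= b' & N t = s.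
  move=> Ha Hb ab /andP[s0 s1]; have [||t tab E] := @IVT R N a b' s ab.
  - apply/within_contP => x; rewrite /= in_itv /= => /andP[xa xb].
    have Hx : `|x| < 2 by move: Ha Hb; rewrite !ltr_norml => /andP[??] /andP[??]; apply/andP; split; lra.
    exact: cvg_trans (@cvg_app _ _ _ _ N (@cvg_within _ _ _ _)) (Ncont x Hx).
  - by rewrite ge_min s0 /= le_max s1 orbT.
  by exists t => //; move: tab; rewrite in_itv.
(* -1 and 3/2 merely enclose [0,1] inside ]-2, 2[; as [N] increases, [U] is an open neighborhood of
   [N 0, N 1]. *)
pose U : set R := [set s | N (-1) < s < N (3 / 2)].
have oU : open U.
  rewrite (_ : U = `](N (-1)), (N (3/2))[%classic); first exact: itv_open.
  by apply/seteqP; split => s /=; rewrite in_itv.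
have UP s : U s -> exists2 t, -1 < t < 3 / 2 & N t = s.
  move=> /andP[s0 s1]; have [||t /andP[t0 t1] E] := pre (-1) (3/2) s h1 h3; first by lra.
    by rewrite !ltW.
  exists t => //; rewrite !lt_neqAle t0 t1 !andbT; apply/andP; split; apply/eqP => Et.
    by rewrite -E -Et ltxx in s0.
  by rewrite -E Et ltxx in s1.
have small (t : R) : -1 < t < 3 / 2 -> `|t| < 2.
  by move=> /andP[a c]; rewrite ltr_norml; apply/andP; split; lra.
have dmu s : U s -> is_derive s 1 mu (Lt (mu s))^-1.
  move=> /UP[t tb <-]; have Ht := small t tb; rewrite muN //.
  have nb : \forall u \near t, `|u| < 2.
    have : nbhs t `]-1, (3/2)[%classic.
      by apply: open_nbhs_nbhs; split; [exact: itv_open|rewrite /= in_itv].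
    by apply: filterS => u /=; rewrite in_itv /= => /small.
  apply: (@is_derive_inverse R N mu (Lt t) t).
  - by apply: filterS nb => u; exact: muN.
  - by apply: filterS nb => u; exact: Ncont.
  - exact: HN.
  - by rewrite gt_eqF.
(* Bootstrapping on the equation mu' = 1 / Lt(mu). *)
have Cmu k : Ck k U mu.
  elim: k => [|k IH]; first by move=> s Us; apply: is_derive_cont (dmu s Us).
  apply: (Ck_R1 oU dmu).
  apply: (@Ck_comp _ _ _ (fdim_R R) _ (fdim_R R) k U setT mu (fun t => (Lt t)^-1)) => //; first exact: openT.
  apply: Csm_Cinf => t _.
  apply: (@Csm_comp _ _ _ (fdim_R R) _ (fdim_R R) Lt (fun x : R => x^-1)) => //.
  by apply: Csm_inv; rewrite gt_eqF.
have n0 : `|0 : R| < 2 by rewrite normr0.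
have n1 : `|1 : R| < 2 by rewrite normr1 ltr1n.
have JU s : s \in `[N 0, N 1] -> U s.
  rewrite in_itv /= => /andP[s0 s1]; apply/andP; split.
    by apply: lt_le_trans s0; apply: inc => //; lra.
  by apply: le_lt_trans s1 _; apply: inc => //; lra.
have Jpre s : s \in `[N 0, N 1] -> exists2 t, I t & N t = s.
  rewrite in_itv /= => H; have [|t Ht E] := pre 0 1 s n0 n1 _ H; first by [].
  by exists t => //; rewrite /= in_itv.
have I2 t : I t -> `|t| < 2.
  by rewrite /= in_itv /= => /andP[a c]; rewrite ltr_norml; apply/andP; split; lra.
exists (N 0), (N 1), mu; split; first by apply: inc.
- split.
  + by move=> s /Jpre[t It <-]; rewrite muN //; exact: I2.
  + move=> s s' /set_mem/Jpre[t It <-] /set_mem/Jpre[t' It' <-].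
    by rewrite !muN; [move=> ->|exact: I2..].
  + move=> t It; exists (N t); last by rewrite muN //; exact: I2.
    move: (It); rewrite /= !in_itv /= => /andP[a c]; have Ht := I2 t It.
    apply/andP; split.
      by move: a; rewrite le_eqVlt => /orP[/eqP <- //|a]; apply/ltW/inc.
    by move: c; rewrite le_eqVlt => /orP[/eqP -> //|c]; apply/ltW/inc.
- move=> s /JU Us; split; last exact: dmu.
  by exists U.
Qed.

Lemma deriv_zero_const (a b : R) (f : R -> R) :
  (forall t, t \in `[a, b] -> is_deriv_in `[a, b]%classic f t 0) ->
  forall u w, u \in `[a, b] -> w \in `[a, b] -> f u = f w.
Proof.
move=> H u w; wlog uw : u w / u < w => [W Hu Hw|Hu Hw].
  by have [/W->//|/W->//|->//] := ltgtP u w.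
have sub x : u <= x <= w -> x \in `[a, b].
  by move: Hu Hw; rewrite !in_itv /= => /andP[??] /andP[??] /andP[??]; apply/andP; split; lra.
have sub' : `[u, w] `<=` `[a, b]%classic by move=> x; rewrite /= in_itv => /sub.
have [||x xuw E] := @MVT R f (fun _ => 0) u w uw.
- move=> x xuw; apply: (@is_deriv_in_interior R `[u, w]%classic).
    by apply: filterS (open_nbhs_nbhs (conj (@itv_open _ _ _ _) xuw)); exact: subset_itv_oo_cc.
  apply: is_deriv_in_sub sub' _; apply: H; apply: sub.
  by move: xuw; rewrite in_itv /= => /andP[/ltW -> /ltW ->].
- apply: (@is_deriv_in_within_cont _ _ (fun _ => 0)) => x xuw.
  by apply: is_deriv_in_sub sub' _; apply: H; apply: sub; rewrite /= in_itv in xuw.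
by move/eqP: E; rewrite mul0r subr_eq0 => /eqP.
Qed.

End OneDim.

(** * Critical points and geodesics *)

Section Critical.
Variables (R : realType) (n : nat) (M : manifold R n) (r : nat) (A : lie_algebroid M r).
Variables (g : riemannian_metric A) (D : connection_op A).
Hypothesis HD : levi_civita g D.
Local Notation I := (`[0:R, 1]%classic).
Local Notation int01 f := (\int[@lebesgue_measure R]_(t in `[0%R, 1%R]) f t).

(** A homotopy starts at [alpha0] only up to equality in the total space; this carries its
    derivatives at eps = 0 over to those of [alpha0]. *)
Lemma covder_tot (J : set R) (PJ : forall t, J t -> ProperFilter (within J t^'))
    (gamma gamma' : R -> M) (alpha s : forall t, A (gamma t)) (alpha' s' : forall t, A (gamma' t)) t : J t ->
  (forall u, J u -> tot (alpha u) = tot (alpha' u)) -> (forall u, J u -> tot (s u) = tot (s' u)) ->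
  is_velocity J gamma' t (anchor (alpha' t)) -> smooth_along_at J t alpha' -> smooth_along_at J t s' ->
  tot (covder D J alpha s t) = tot (covder D J alpha' s' t).
Proof.
move=> Jt Ea Es vel Ha Hs.
have nE (b : forall u, A (gamma u)) (b' : forall u, A (gamma' u)) : (forall u, J u -> tot (b u) = tot (b' u)) ->
    \forall u \near t, J u -> tot (b' u) = tot (b u).
  by move=> E; apply: (@nearW R (nbhs _)) => u Ju; rewrite E.
have Eg u : J u -> gamma u = gamma' u by move=> /Ea /(congr1 (@projT1 _ _)).
have [v Ev] : exists v : A (gamma t), tot v = tot (covder D J alpha' s' t).
  by rewrite (Eg t Jt); exists (covder D J alpha' s' t).
rewrite -Ev; congr tot.
have vel' : is_velocity J gamma t (anchor (alpha t)).
  apply: vel_tot (Ea t Jt) vel; by apply: (@nearW R (nbhs _)) => u; exact: Eg.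
apply: (covder_eq HD PJ Jt vel' (along_eq Jt (nE _ _ Ea) Ha) (along_eq Jt (nE _ _ Es) Hs)).
apply: (@pairs_tot R n M r A g D J t Jt gamma gamma' alpha s alpha' s' v _ _ (Ea t Jt) Ev).
  by apply: (@nearW R (nbhs _)) => u; exact: Es.
exact: (covder_pairs HD Jt vel Ha Hs).
Qed.

Lemma tot_unit_direction (gamma gamma' : R -> M) (alpha : forall t, A (gamma t)) (alpha' : forall t, A (gamma' t)) t :
  tot (alpha t) = tot (alpha' t) -> tot (unit_direction g alpha t) = tot (unit_direction g alpha' t).
Proof.
exact: (congr1 (fun p => tot ((Num.sqrt (g (projT1 p) (projT2 p) (projT2 p)))^-1 *: projT2 p))).
Qed.

Section Path.
Variables (gamma0 : R -> M) (alpha0 : forall t, A (gamma0 t)).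
Hypothesis path0 : A_path 0 1 alpha0.

Let Sal0 t : I t -> smooth_along_at I t alpha0.
Proof. by case: path0 => /smooth_alongE H _; exact: H. Qed.

Let Vel0 t : I t -> is_velocity I gamma0 t (anchor (alpha0 t)).
Proof. by case: path0 => _ H; exact: H. Qed.

(** The test functions are not free: at each interior time only some bump of prescribed smallness,
    along one frame section, is available. This suffices because a nonzero value of [W] has a
    nonzero inner product with some frame section, of constant sign nearby. *)
Lemma fundamental_lemma (W : forall t, A (gamma0 t)) : (forall t, I t -> smooth_along_at I t W) ->
  (forall (T : trivialization r A) (e : 'I_r -> section A) (m : 'I_r) (t0 delta : R), 0 < t0 < 1 ->
    trivs T -> (forall i, smooth_section (e i)) -> (\forall x \near gamma0 t0, is_frame T e x) ->
    0 < delta -> exists chi : R -> R,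
    [/\ forall t, Csm chi t /\ 0 <= chi t, 0 < chi t0, forall t, delta <= `|t - t0| -> chi t = 0 &
        int01 (fun t => chi t * g (gamma0 t) (e m (gamma0 t)) (W t)) = 0]) ->
  forall t, I t -> W t = 0.
Proof.
move=> HW H.
have inner_zero t : 0 < t < 1 -> W t = 0.
  move=> t01; have nI := near_I01 t01; have It := nbhs_singleton nI.
  apply/eqP/negPn/negP => nW.
  have [T [e [tT He Fr]]] := frame_exists A (gamma0 t).
  have [m Km] : exists m, g (gamma0 t) (e m (gamma0 t)) (W t) != 0.
    apply: contrapT => nK.
    have K i : g (gamma0 t) (e i (gamma0 t)) (W t) = 0.
      by apply/eqP/negPn/negP => Ki; apply: nK; exists i.
    move: nW; rewrite -(inner_gt0 g) {1}(frame_expand (W t) (nbhs_singleton Fr)) inner_suml big1 ?ltxx // => i _.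
    by rewrite innerZl K mulr0.
  pose K u := g (gamma0 u) (e m (gamma0 u)) (W u).
  have Ksw u : I u -> smooth_within I u K.
    move=> Iu; apply: (along_inner Iu) (HW u Iu); apply: (along_sec Iu) (He m).
    by have [] := Sal0 Iu.
  (* Normalizes the sign, so that the integrand is nonnegative, and positive at [t]. *)
  pose sg := Num.sg (K t).
  have sgK : 0 < sg * K t by rewrite /sg -normrEsg normr_gt0.
  have N : \forall u \near t, I u -> 0 < sg * K u.
    have C : smooth_within I t (fun u => sg * K u) by apply: sw_mul (Ksw t It); exact/sw_Csm/Csm_cst.
    have P : nbhs (sg * K t) [set x | 0 < x] by apply: open_nbhs_nbhs; split; [exact: open_gt|exact: sgK].
    exact: (sw_near It C P).
  have [delta /= delta_gt0 Hd] := iffLR (nbhs_ballP _ _) N.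
  have [chi [c1 c2 c3 c4]] := H T e m t delta t01 tT He Fr delta_gt0.
  have fC : {within I, continuous (fun u => sg * (chi u * K u))}.
    apply: sw_within_cont => u Iu; apply: sw_mul; first exact/sw_Csm/Csm_cst.
    by apply: sw_mul (Ksw u Iu); apply: sw_Csm; exact: (c1 u).1.
  have : 0 < int01 (fun u => sg * (chi u * K u)).
    apply: (int01_pos fC _ It); last by rewrite mulrCA mulr_gt0.
    move=> u Iu; have [Hu|Hu] := ltP `|u - t| delta.
      rewrite mulrCA mulr_ge0 ?(c1 u).2 // ltW //; apply: Hd => //.
      by rewrite /ball /= distrC.
    by rewrite c3 // mul0r mulr0.
  rewrite int01_Zl ?c4 ?mulr0 ?ltxx //.
  apply: sw_within_cont => u Iu; apply: sw_mul (Ksw u Iu); apply: sw_Csm; exact: (c1 u).1.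
(* The end-points follow by continuity: a nonzero value there would persist at nearby interior
   points. *)
move=> t It; apply/eqP/negPn/negP => nW.
have Ksw : smooth_within I t (fun u => g (gamma0 u) (W u) (W u)) by exact: (along_inner It g (HW t It) (HW t It)).
have K0 : 0 < g (gamma0 t) (W t) (W t) by rewrite inner_gt0.
have N : \forall u \near t, I u -> 0 < g (gamma0 u) (W u) (W u).
  have P : nbhs (g (gamma0 t) (W t) (W t)) [set x | 0 < x] by apply: open_nbhs_nbhs; split; [exact: open_gt|].
  exact: (sw_near It Ksw P).
have N' : \forall u \near t, `|u - t| < 1.
  have := nbhsx_ballx t _ (@ltr01 R); apply: filterS => u; by rewrite /ball /= distrC.
have tE : (t == 0) || (t == 1).
  apply/negPn/negP; rewrite negb_or => /andP[t0 t1]; move: nW; rewrite inner_zero ?eqxx //.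
  by move: It; rewrite /= in_itv /= !lt_neqAle [0 == t]eq_sym t0 t1 => /andP[-> ->].
have PF := proper01 It.
have F : \forall u \near within I t^', False.
  have F' : \forall u \near t, u != t -> I u -> False.
    apply: filterS2 N N' => u Nu Nu' ut Iu.
    have u01 : 0 < u < 1.
      move: tE Iu ut Nu'; rewrite /= in_itv /= => /orP[]/eqP-> /andP[a b] ut; rewrite ltr_norml => /andP[c d]; rewrite !lt_neqAle.
        by rewrite eq_sym ut a /=; apply/andP; split=> //; lra.
      by rewrite ut b andbT; lra.
    by have := Nu Iu; rewrite inner_zero // inner0l ltxx.
  exact: F'.
exact: (filter_not_empty _ F).
Qed.

Lemma homotopy_chi (T : trivialization r A) (e : 'I_r -> section A) (m : 'I_r) (t0 delta : R) : 0 < t0 < 1 ->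
    trivs T -> (forall i, smooth_section (e i)) -> (\forall x \near gamma0 t0, is_frame T e x) ->
    0 < delta -> exists (gamma : R -> R -> M) (alpha : forall eps t, A (gamma eps t)) (chi : R -> R),
  [/\ A_homotopy D alpha0 alpha, A_variation alpha, forall t, tot (alpha 0 t) = tot (alpha0 t),
    transverse (fun eps t => chi t *: e m (gamma eps t)) &
  [/\ forall eps t, I eps -> I t -> Delta D alpha (fun eps t => chi t *: e m (gamma eps t)) eps t = 0,
      forall t, Csm chi t /\ 0 <= chi t, 0 < chi t0, chi 0 = 0 /\ chi 1 = 0 &
      forall t, delta <= `|t - t0| -> chi t = 0]].
Proof.
move=> t01 tT He Fr d0.
have [gamma [alpha [chi [H2' H2 H3 H4 [H5 H6 H7 [c0 c1] H8]]]]] := homotopy_exists HD path0 m t01 tT He Fr d0.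
exists gamma, alpha, chi; split; [|exact: H2'|exact: H2|exact: H4|by split].
split; [exact: H2'|by move=> t _; exact: H2|by move=> eps _; exact: H3|].
exists (fun eps t => chi t *: e m (gamma eps t)); split=> //.
- by move=> eps _; rewrite c0 scale0r.
- by move=> eps _; rewrite c1 scale0r.
Qed.

Let I0 : I 0.
Proof. by rewrite /= in_itv /= lexx ler01. Qed.

Let PI := @proper01 R.

Lemma tot_eq0 x x' (u : A x) (u' : A x') : tot u = tot u' -> (u == 0) = (u' == 0).
Proof. exact: (congr1 (fun p : {x : M & A x : Type} => (projT2 p : A (projT1 p)) == 0)). Qed.

Lemma tot_inner x x' (u : A x) (u' : A x') (b : section A) (k : R) : tot u = tot u' ->
  g x (k *: b x) u = k * g x' (b x') u'.
Proof.
move=> E; have := congr1 (fun p => g (projT1 p) (b (projT1 p)) (projT2 p)) E => /= <-.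
exact: innerZl.
Qed.

Lemma energy_critical_geodesic : h_critical D (A_energy g) alpha0 -> geodesic D 0 1 alpha0.
Proof.
move=> crit; split=> //; apply: fundamental_lemma.
  move=> t It; exact: (covder_sal HD PI It (fun u Iu => Vel0 Iu) (fun u Iu => Sal0 Iu) (fun u Iu => Sal0 Iu)).
move=> T e m t0 delta t01 tT He Fr d0.
have [gamma [alpha [chi [hom var st tr [De c1 c2 [c3 c4] c5]]]]] := homotopy_chi m t01 tT He Fr d0.
exists chi; split=> //.
have := is_deriv_in_unique (PI I0) (crit _ _ hom) (energy_first_variation HD var tr I0).
rewrite c3 c4 !scale0r !inner0l subrr sub0r.
rewrite (int01_eq (g := fun _ => 0) (f := fun t => g _ (Delta _ _ _ _ _) _)); last first.
  by move=> t It; rewrite De // inner0l.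
rewrite int01_cst subr0 => /esym/eqP; rewrite oppr_eq0 => /eqP E; rewrite -[RHS]E.
apply: int01_eq => t It; symmetry.
have E' : tot (covder_t D alpha alpha 0 t) = tot (covder D I alpha0 alpha0 t).
  exact: (covder_tot PI It (fun u _ => st u) (fun u _ => st u) (Vel0 It) (Sal0 It) (Sal0 It)).
exact: (tot_inner (e m) (chi t) E').
Qed.

Hypothesis nz : forall t, I t -> alpha0 t != 0.

Lemma length_critical_dir : h_critical D (A_length g) alpha0 ->
  forall t, I t -> covder D I alpha0 (unit_direction g alpha0) t = 0.
Proof.
move=> crit.
have Salu t : I t -> smooth_along_at I t (unit_direction g alpha0) by move=> It; apply: along_unit_direction; [exact: It|exact: Sal0|exact: nz].
apply: fundamental_lemma.
  move=> t It; exact: (covder_sal HD PI It (fun u Iu => Vel0 Iu) (fun u Iu => Sal0 Iu) Salu).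
move=> T e m t0 delta t01 tT He Fr d0.
have [gamma [alpha [chi [hom var st tr [De c1 c2 [c3 c4] c5]]]]] := homotopy_chi m t01 tT He Fr d0.
exists chi; split=> //.
have nza t : I t -> alpha 0 t != 0.
  by move=> It; rewrite (tot_eq0 (st t)); exact: nz.
have := length_first_variation HD var nza tr (fun t It => De 0 t I0 It).
rewrite c3 c4 !scale0r => /(_ erefl erefl) V.
have := is_deriv_in_unique (PI I0) (crit _ _ hom) V.
move=> /esym/eqP; rewrite oppr_eq0 => /eqP E; rewrite -[RHS]E.
apply: int01_eq => t It; symmetry.
have E' : tot (covder D I (alpha 0) (unit_direction g (alpha 0)) t) = tot (covder D I alpha0 (unit_direction g alpha0) t).
  exact: (covder_tot PI It (fun u _ => st u) (fun u _ => tot_unit_direction (st u)) (Vel0 It) (Sal0 It) (Salu t It)).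
exact: (tot_inner (e m) (chi t) E').
Qed.

Lemma dir_length_critical : (forall t, I t -> covder D I alpha0 (unit_direction g alpha0) t = 0) ->
  h_critical D (A_length g) alpha0.
Proof.
move=> H0 gamma alpha [var st _ [beta [tr De b0 b1]]].
have Salu t : I t -> smooth_along_at I t (unit_direction g alpha0) by move=> It; apply: along_unit_direction; [exact: It|exact: Sal0|exact: nz].
have nza t : I t -> alpha 0 t != 0.
  by move=> It; rewrite (tot_eq0 (st t It)); exact: nz.
have := length_first_variation HD var nza tr (fun t It => De 0 t I0 It) (b0 0 I0) (b1 0 I0).
congr is_deriv_in; rewrite (int01_eq (g := fun _ => 0)) ?int01_cst ?oppr0 // => t It.
have E' : tot (covder D I (alpha 0) (unit_direction g (alpha 0)) t) = tot (covder D I alpha0 (unit_direction g alpha0) t).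
  exact: (covder_tot PI It (fun u Iu => st u Iu) (fun u Iu => tot_unit_direction (st u Iu)) (Vel0 It) (Sal0 It) (Salu t It)).
have -> : covder D I (alpha 0) (unit_direction g (alpha 0)) t = 0.
  by apply/eqP; rewrite (tot_eq0 E') H0.
by rewrite inner0r.
Qed.

Section Reparametrized.
Variables (t0 t1 : R) (mu dmu : R -> R).
Local Notation J := (`[t0, t1]%classic).
Hypothesis cp : change_of_parameter t0 t1 mu dmu.

Let PJ s : J s -> ProperFilter (within J s^').
Proof. by move=> Js; case: cp => lt01 _ _; exact: proper_itv. Qed.

Let muI s : J s -> I (mu s).
Proof. by move=> Js; case: cp => _ [H _ _] _; exact: H. Qed.

Let dmuP s : J s -> is_deriv_in J mu s (dmu s).
Proof. by move=> Js; case: cp => _ _ H; have [] := H s Js. Qed.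

Let swmu s : J s -> smooth_within J s mu.
Proof. by move=> Js; case: cp => _ _ H; have [] := H s Js. Qed.

Let dmu0 s : J s -> dmu s != 0.
Proof. by move=> Js; case: cp => _ _ H; have [] := H s Js. Qed.

Let swdmu s : J s -> smooth_within J s dmu.
Proof. by move=> Js; exact: (sw_deriv_fun Js PJ dmuP (swmu Js)). Qed.

Let nearI (s : R) : \forall u \near s, J u -> I (mu u).
Proof. by apply: (@nearW R (nbhs _)) => u; exact: muI. Qed.

Lemma along_reparam (s : forall t, A (gamma0 t)) : (forall t, I t -> smooth_along_at I t s) ->
  forall u, J u -> smooth_along_at J u (gamma := gamma0 \o mu) (fun u => s (mu u)).
Proof.
move=> Hs u Ju.
exact: (@along_pre R n M r A R R (fdim_R R) I J u mu gamma0 s Ju (muI Ju) (swmu Ju) (nearI u) (Hs _ (muI Ju))).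
Qed.

Lemma path_reparam : A_path t0 t1 (gamma := gamma0 \o mu) (fun u => dmu u *: alpha0 (mu u)).
Proof.
split=> [|u Ju].
  apply/smooth_alongE => u Ju; apply: (along_scale Ju); first exact: swdmu.
  by apply: along_reparam Ju; exact: Sal0.
exact: (velocity_reparam (nearI u) (dmuP Ju) (Vel0 (muI Ju))).
Qed.

Let at_ u := dmu u *: alpha0 (mu u).

Let Sal_at u : J u -> smooth_along_at J u (gamma := gamma0 \o mu) at_.
Proof. by case: path_reparam => /smooth_alongE H _; exact: H. Qed.

Let Vel_at u : J u -> is_velocity J (gamma0 \o mu) u (anchor (at_ u)).
Proof. by case: path_reparam => _ H; exact: H. Qed.

Let Salu t : I t -> smooth_along_at I t (unit_direction g alpha0).
Proof. by move=> It; apply: along_unit_direction; [exact: It|exact: Sal0|exact: nz]. Qed.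

Lemma covder_udir_reparam u : J u ->
  covder D J (gamma := gamma0 \o mu) at_ (fun u => unit_direction g alpha0 (mu u)) u =
  dmu u *: covder D I alpha0 (unit_direction g alpha0) (mu u).
Proof.
move=> Ju; apply: (covder_eq HD PJ Ju (Vel_at Ju) (Sal_at Ju) (along_reparam Salu Ju)).
have P := covder_pairs HD (muI Ju) (Vel0 (muI Ju)) (Sal0 (muI Ju)) (Salu (muI Ju)).
exact: (@pairs_reparam R n M r A g D HD I J mu u (dmu u) gamma0 alpha0 (nearI u) (dmuP Ju) dmu (unit_direction g alpha0) _ erefl P).
Qed.

(* A geodesic has constant speed, so its unit direction is locally a constant
   multiple of it. *)
Lemma geodesic_dir : geodesic D t0 t1 (gamma := gamma0 \o mu) at_ ->
  forall t, I t -> covder D I alpha0 (unit_direction g alpha0) t = 0.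
Proof.
move=> [_ geo] t It.
have [s Js <-] : exists2 s, J s & mu s = t.
  by case: cp => _ [_ _ H] _; have [s Js E] := H t It; exists s.
have Pat u : J u -> pairs g D J (gamma := gamma0 \o mu) at_ at_ (t := u) 0.
  move=> Ju; rewrite -(geo u Ju).
  exact: (covder_pairs HD Ju (Vel_at Ju) (Sal_at Ju) (Sal_at Ju)).
pose q u := g (gamma0 (mu u)) (at_ u) (at_ u).
have dq u : J u -> is_deriv_in J q u 0.
  move=> Ju; have := pairs_inner HD PJ Ju (Vel_at Ju) (Sal_at Ju) (Sal_at Ju) (Pat u Ju) (Pat u Ju).
  by rewrite inner0l inner0r addr0.
have qc u : J u -> q u = q s by move=> Ju; exact: (deriv_zero_const dq Ju Js).
have at0 u : J u -> at_ u != 0 by move=> Ju; rewrite /at_ scaler_eq0 negb_or dmu0 // nz //; exact: muI.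
have q0 : 0 < q s by rewrite inner_gt0 at0.
(* A change of parameter may reverse orientation; the sign of mu' is constant near [s] because mu'
   is continuous and nonzero. *)
pose k := Num.sg (dmu s) / Num.sqrt (q s).
have sgn : \forall u \near s, J u -> Num.sg (dmu u) = Num.sg (dmu s).
  have := swdmu Js; have := dmu0 Js; case: (ltgtP (dmu s) 0) => // Hd _ sw.
    have N : nbhs (dmu s) [set x | x < 0] by apply: open_nbhs_nbhs; split; [exact: open_lt|].
    by apply: filterS (sw_near Js sw N) => u Hu Ju; rewrite (ltr0_sg Hd) (ltr0_sg (Hu Ju)).
  have N : nbhs (dmu s) [set x | 0 < x] by apply: open_nbhs_nbhs; split; [exact: open_gt|].
  by apply: filterS (sw_near Js sw N) => u Hu Ju; rewrite (gtr0_sg Hd) (gtr0_sg (Hu Ju)).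
have E : \forall u \near s, J u -> unit_direction g alpha0 (mu u) = k *: at_ u.
  apply: filterS sgn => u Hu Ju; rewrite /unit_direction /at_ scalerA /k -(qc u Ju) -(Hu Ju).
  congr (_ *: _); rewrite /q /at_ innerZl innerZr mulrA -expr2 sqrtrM ?sqr_ge0 // sqrtr_sqr.
  have n0 : `|dmu u| != 0 by rewrite normr_eq0 dmu0.
  by rewrite mulrAC -normrEsg invfM mulrA mulfV // mul1r.
have P0 : pairs g D J (gamma := gamma0 \o mu) at_ (fun u => unit_direction g alpha0 (mu u)) (t := s) 0.
  move=> c Hc.
  have := pairs_scale (is_deriv_in_cst J k s) (Pat s Js) Hc.
  rewrite scale0r scaler0 addr0 !inner0l !add0r.
  have -> : k *: at_ s = unit_direction g alpha0 (mu s) by rewrite (nbhs_singleton E).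
  apply: is_deriv_in_eq; first by apply: filterS E => u Hu Ju; rewrite Hu.
  by rewrite (nbhs_singleton E).
have := covder_eq HD PJ Js (Vel_at Js) (Sal_at Js) (along_reparam Salu Js) P0.
rewrite covder_udir_reparam // => /eqP; rewrite scaler_eq0 (negbTE (dmu0 Js)) /= => /eqP.
by [].
Qed.

(** With this [dmu] the reparametrized path is the unit direction of [alpha0] pulled back by [mu],
    whose derivative is [dmu] times the one assumed to vanish. *)
Lemma dir_geodesic : (forall t, I t -> covder D I alpha0 (unit_direction g alpha0) t = 0) ->
  (forall u, J u -> dmu u = (Num.sqrt (g (gamma0 (mu u)) (alpha0 (mu u)) (alpha0 (mu u))))^-1) ->
  geodesic D t0 t1 (gamma := gamma0 \o mu) at_.
Proof.
move=> H0 Hd; split=> [|u Ju]; first exact: path_reparam.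
have := covder_udir_reparam Ju; rewrite H0; last exact: muI.
rewrite scaler0 => E.
apply: (covder_eq HD PJ Ju (Vel_at Ju) (Sal_at Ju) (Sal_at Ju)).
have := covder_pairs HD Ju (Vel_at Ju) (Sal_at Ju) (along_reparam Salu Ju).
rewrite E; apply: pairs_tot => //.
by apply: (@nearW R (nbhs _)) => w Jw; rewrite /at_ Hd.
Qed.

End Reparametrized.

Lemma arc_length_geodesic : (forall t, I t -> covder D I alpha0 (unit_direction g alpha0) t = 0) ->
  exists (t0 t1 : R) (mu dmu : R -> R), change_of_parameter t0 t1 mu dmu /\
    geodesic D t0 t1 (gamma := fun t => gamma0 (mu t)) (fun t => dmu t *: alpha0 (mu t)).
Proof.
move=> H0; pose L t := Num.sqrt (g (gamma0 t) (alpha0 t) (alpha0 t)).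
have HL t : I t -> smooth_within I t L.
  move=> It; have Hs := along_inner It g (Sal0 It) (Sal0 It).
  apply: (@sw_compl R R I t It R R (fdim_R R) (fdim_R R) _ (@Num.sqrt R) Hs).
  by apply: Csm_sqrt; rewrite inner_gt0 nz.
have L0 t : I t -> 0 < L t by move=> It; rewrite sqrtr_gt0 inner_gt0 nz.
(* The speed is smooth on [0,1] in the one-sided sense only; a positive extension to the line comes
   before inverting its primitive. *)
have [Lt [CL Lpos LE]] := extend_pos HL L0.
have [t0 [t1 [mu [lt01 bij Hmu]]]] := arc_length_parameter CL Lpos.
have cp : change_of_parameter t0 t1 mu (fun s => (Lt (mu s))^-1).
  split=> // s Js; have [C d] := Hmu s Js; split.
  - exact: sw_Csm.
  - exact: is_derive_in.
  - by rewrite invr_eq0 gt_eqF.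
exists t0, t1, mu, (fun s => (Lt (mu s))^-1); split=> //.
apply: (dir_geodesic cp H0) => u Ju; rewrite LE //.
by case: bij => H _ _; exact: H.
Qed.

End Path.

End Critical.

(** In the last claim the nonvanishing of [alpha0] makes the integrand of the length differentiable
    and the unit direction smooth; in the third claim it follows from unit speed. *)
Theorem proposition3p3 (R : realType) (n : nat) (M : manifold R n) (r : nat)
    (A : lie_algebroid M r) (g : riemannian_metric A) (D : connection_op A)
    (HD : levi_civita g D) :
  [/\ (* 1 *)
      forall (gamma : R -> R -> M)
        (alpha beta : forall eps t : R, A (gamma eps t)),
        A_variation alpha -> transverse beta ->
        forall eps : R, eps \in `[0, 1] ->
        is_deriv_in `[0, 1]%classic
          (fun e => A_energy g (alpha e)) eps
          (g (gamma eps 1) (beta eps 1) (alpha eps 1)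
           - g (gamma eps 0) (beta eps 0) (alpha eps 0)
           - \int[lebesgue_measure]_(t in `[0%R, 1%R])
               g (gamma eps t) (beta eps t) (covder_t D alpha alpha eps t)
           - \int[lebesgue_measure]_(t in `[0%R, 1%R])
               g (gamma eps t) (Delta D alpha beta eps t) (alpha eps t) : R),
      (* 2 *)
      forall m q : M, same_leaf A m q ->
        forall (gamma0 : R -> M) (alpha0 : forall t : R, A (gamma0 t)),
        Omega m q alpha0 -> h_critical D (A_energy g) alpha0 ->
        geodesic D 0 1 alpha0,
      (* 3 *)
      forall (gamma : R -> R -> M) (alpha : forall eps t : R, A (gamma eps t)),
        A_variation alpha ->
        (forall t : R, t \in `[0, 1] ->
           g (gamma 0 t) (alpha 0 t) (alpha 0 t) = 1) ->
        exists2 l : R,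
          is_deriv_in `[0, 1]%classic (fun e => A_energy g (alpha e)) 0 l &
          is_deriv_in `[0, 1]%classic (fun e => A_length g (alpha e)) 0 l
    & (* 4 *)
      forall m q : M, same_leaf A m q ->
        forall (gamma0 : R -> M) (alpha0 : forall t : R, A (gamma0 t)),
        Omega m q alpha0 ->
        (forall t : R, t \in `[0, 1] -> alpha0 t != 0) ->
        (h_critical D (A_length g) alpha0 <->
         exists (t0 t1 : R) (mu dmu : R -> R),
           change_of_parameter t0 t1 mu dmu /\
           geodesic D t0 t1 (gamma := fun t => gamma0 (mu t))
             (fun t => dmu t *: alpha0 (mu t)))].
Proof.
split.
- by move=> gamma alpha beta Ha Hb eps Ie; exact: energy_first_variation.
- by move=> m q _ gamma0 alpha0 [path0 _ _]; exact: energy_critical_geodesic.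
- move=> gamma alpha Ha H1; apply: energy_length_deriv => // t It.
  by rewrite -(inner_gt0 g) H1 // ltr01.
- move=> m q _ gamma0 alpha0 [path0 _ _] nz; split.
    by move=> /(length_critical_dir HD path0 nz); exact: arc_length_geodesic.
  move=> [t0 [t1 [mu [dmu [cp geo]]]]]; apply: (dir_length_critical HD path0 nz).
  exact: (geodesic_dir HD path0 nz cp geo).
Qed.
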